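(* Let $K$ be an algebraically closed field of characteristic $0$, let $X$ be a toric variety over $K$ with torus $T$ and fan $\Sigma$ such that every maximal cone of $\Sigma$ is top-dimensional (of dimension $\dim X$), and let $G$ be a reductive algebraic group over $K$. Then there is an equivalence of categories between the category $\mathfrak{Pbun}_G^T(X)$ of $T$-equivariant principal $G$-bundles on $X$ and the category $\mathfrak{Calg}_G(\Sigma)$ (defined in the context) of compatible $\Sigma$-filtered algebras with $G$-action.
   Context: Toric notation. $\Sigma$ is a fan in a lattice $N$, $T$ is the torus with one-parameter subgroups indexed by $N$, $M=\mathrm{Hom}_{\mathbb Z}(N,\mathbb Z)$ is the character group of $T$, and $|\Sigma(1)|$ is the set of primitive integral generators of the rays of $\Sigma$. For $\sigma\in\Sigma$, $\sigma^\perp=\{u\in M: u|_\sigma=0\}$ and $M_\sigma=M/\sigma^\perp$ (so $M_\sigma=M$ if $\sigma$ is top-dimensional); for $\rho\in\sigma\cap|\Sigma(1)|$ and $[u]\in M_\sigma$ the integer $u(\rho)$ is well defined. $T$-equivariant principal $G$-bundles. A $T$-equivariant principal $G$-bundle on $X$ is an algebraic (right) principal $G$-bundle $E_G\to X$ with an algebraic left $T$-action on $E_G$ lifting the $T$-action on $X$ and commuting with the right $G$-action. Morphisms in $\mathfrak{Pbun}_G^T(X)$ are $T$-equivariant morphisms of principal $G$-bundles over the identity of $X$. $\Sigma$-filtrations. A $\Sigma$-filtration on a $K$-vector space $F$ of countable dimension is a family, indexed by $\rho\in|\Sigma(1)|$, of decreasing filtrations $\cdots\supseteq F^\rho(i)\supseteq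 F^\rho(i+1)\supseteq\cdots$ ($i\in\mathbb Z$) by subspaces, each of which is full: every $v\in F$ lies in $F^\rho(i)$ for some $i$. A $\Sigma$-filtered algebra is a commutative associative $K$-algebra $(A,m)$ with a $\Sigma$-filtration on $A$ such that $m(A^\rho(i)\otimes A^\rho(j))\subseteq A^\rho(i+j)$ for all $\rho,i,j$. Morphisms are algebra homomorphisms mapping $A_1^\rho(i)$ into $A_2^\rho(i)$ for all $\rho,i$. Compatibility. A $\Sigma$-filtered algebra $A$ is compatible if for every $\sigma\in\Sigma$ there is a decomposition $A=\bigoplus_{[u]\in M_\sigma}A^\sigma_{[u]}$ with $A^\rho(i)=\bigoplus_{u(\rho)\ge i}A^\sigma_{[u]}$ for all $\rho\in\sigma\cap|\Sigma(1)|$, $i\in\mathbb Z$, and $m(A^\sigma_{[u]}\otimes A^\sigma_{[v]})\subseteq A^\sigma_{[u]+[v]}$. For a top-dimensional cone $\sigma$, such a decomposition is the same as a $T$-action on $A$ by algebra automorphisms; such an action is called compatible (for $\sigma$). The category $\mathfrak{Calg}_G(\Sigma)$. Objects are compatible $\Sigma$-filtered $K$-algebras $B$ equipped with a $G$-action with respect to which $B$ is $G$-equivariantly isomorphic, as an algebra, to $K[G]$ (with the standard translation action), and such that for every top-dimensional cone of $\Sigma$ there is a compatible action of $T$ on $B$ commuting with the action of $G$. Morphisms are $G$-equivariant isomorphisms of $\Sigma$-filtered $K$-algebras. *)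

(* Defs.v *)
From HB Require Import structures.
From mathcomp Require Import all_boot all_order all_algebra.
From mathcomp Require Import all_classical all_reals topology.

Set Implicit Arguments.
Unset Strict Implicit.
Unset Printing Implicit Defensive.

Import Order.TTheory GRing.Theory Num.Theory.
Local Open Scope classical_set_scope.
Local Open Scope ring_scope.

Record category := Category {
  obj :> Type;
  hom : obj -> obj -> Type;
  idm : forall a, hom a a;
  comp : forall a b c, hom b c -> hom a b -> hom a c;
  comp_idl : forall a b (f : hom a b), comp (idm b) f = f;
  comp_idr : forall a b (f : hom a b), comp f (idm a) = f;
  comp_assoc : forall a b c d (h : hom c d) (g : hom b c) (f : hom a b),
    comp h (comp g f) = comp (comp h g) f }.

Record functor (C D : category) := Functor {
  fobj :> C -> D;
  fmap : forall a b, hom a b -> hom (fobj a) (fobj b);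
  fmap_id : forall a, fmap (idm a) = idm (fobj a);
  fmap_comp : forall a b c (g : hom b c) (f : hom a b),
    fmap (comp g f) = comp (fmap g) (fmap f) }.

Definition functor_id (C : category) : functor C C :=
  @Functor C C id (fun _ _ f => f) (fun _ => erefl) (fun _ _ _ _ _ => erefl).

Lemma functor_comp_id (C D E : category) (G : functor D E) (F : functor C D)
  (a : C) : fmap G (fmap F (idm a)) = idm (G (F a)).
Proof. by rewrite !fmap_id. Qed.

Lemma functor_comp_comp (C D E : category) (G : functor D E) (F : functor C D)
    (a b c : C) (g : hom b c) (f : hom a b) :
  fmap G (fmap F (comp g f)) = comp (fmap G (fmap F g)) (fmap G (fmap F f)).
Proof. by rewrite !fmap_comp. Qed.

Definition functor_comp (C D E : category) (G : functor D E) (F : functor C D)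
    : functor C E :=
  @Functor C E (fun a => G (F a)) (fun a b f => fmap G (fmap F f))
    (functor_comp_id G F) (functor_comp_comp G F).

Definition naturally_isomorphic (C D : category) (F G : functor C D) : Prop :=
  exists (eta : forall a, hom (F a) (G a)) (theta : forall a, hom (G a) (F a)),
    [/\ forall a, comp (eta a) (theta a) = idm (G a),
        forall a, comp (theta a) (eta a) = idm (F a)
      & forall a b (f : hom a b), comp (eta b) (fmap F f) = comp (fmap G f) (eta a)].

Definition equivalent_categories (C D : category) : Prop :=
  exists (F : functor C D) (G : functor D C),
    naturally_isomorphic (functor_comp G F) (functor_id C) /\
    naturally_isomorphic (functor_comp F G) (functor_id D).

(* Varieties are reduced, separated, of finite type, not necessarily
   irreducible.  Over an algebraically closed field they are treated in the
   classical way, as topological spaces (of closed points) with a sheaf of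
   K-valued functions that are locally isomorphic to Zariski closed subsets of
   some K^m. *)

Section Varieties.
Variable K : closedFieldType.

(* [regular U] is only meaningful for U open; the values of f : X -> K outside
   U are irrelevant for [regular U f] as soon as [is_sheaf X] holds. *)
Record space := Space {
  carrier :> topologicalType;
  regular : set carrier -> set (carrier -> K) }.
Arguments regular : clear implicits.

Definition is_sheaf (X : space) : Prop :=
  (forall (U V : set X) f, open U -> open V -> V `<=` U ->
     regular X U f -> regular X V f) /\
  (forall (U : set X) f, open U ->
     (forall x, U x -> exists V g,
        [/\ open V, V x, regular X V g & forall y, U y -> V y -> f y = g y]) ->
     regular X U f).

Definition is_morphism (X Y : space) (f : X -> Y) : Prop :=
  continuous f /\
  forall V g, open V -> regular Y V g -> regular X (f @^-1` V) (g \o f).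

Section Generated.
Variable P : Type.

Inductive alg_gen (S : set (P -> K)) : (P -> K) -> Prop :=
| AlgGen f of S f : alg_gen S f
| AlgCst c : alg_gen S (fun _ => c)
| AlgAdd f g of alg_gen S f & alg_gen S g : alg_gen S (fun p => f p + g p)
| AlgMul f g of alg_gen S f & alg_gen S g : alg_gen S (fun p => f p * g p).

(* A family C of pairs (D, S), with S a set of functions on the chart D,
   generates the Zariski topology with open sets D `&` {h <> 0}, h in K[S],
   and the sheaf of functions that are locally fractions of elements of K[S]. *)
Definition gen_type (C : set (set P * set (P -> K))) : Type := P.

Definition gen_basis (C : set (set P * set (P -> K))) : set (set P) :=
  [set B | exists D S h,
     [/\ C (D, S), alg_gen S h & B = D `&` [set p | h p != 0]]].

HB.instance Definition _ C := gen_eqMixin (gen_type C).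
HB.instance Definition _ C := gen_choiceMixin (gen_type C).
HB.instance Definition _ C :=
  isSubBaseTopological.Build (gen_type C) (gen_basis C) (@id (set P)).

Definition gen_space (C : set (set P * set (P -> K))) : space :=
  @Space (gen_type C) (fun W f => forall p, W p ->
    exists D S g h, [/\ C (D, S), alg_gen S g, alg_gen S h, D p /\ h p != 0
      & forall q, W q -> D q -> h q != 0 -> f q = g q / h q]).

End Generated.

Definition affine_space (m : nat) : space :=
  @gen_space 'rV[K]_m
    [set (setT, [set f | exists i, f = fun x : 'rV[K]_m => x 0 i])].

Definition subspace_of (X : space) (A : set X) : space :=
  @Space (initial_topology (val : A -> X)) (fun W f => forall p, W p ->
    exists V g, [/\ open V, regular X V g, V (val p)
      & forall q, W q -> V (val q) -> f q = g (val q)]).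
Arguments subspace_of X A : clear implicits.

Definition product (X Y : space) : space :=
  @gen_space (X * Y)
    [set c | exists U V, [/\ open U, open V &
       c = (U `*` V, [set f \o fst | f in regular X U] `|`
                     [set g \o snd | g in regular Y V])]].

(* f is an isomorphism of X onto the subspace A of Y, with inverse g *)
Definition is_iso_onto (X Y : space) (A : set Y) (f : X -> Y) : Prop :=
  [/\ is_morphism f, set_bij setT A f
    & exists g : subspace_of Y A -> X,
        is_morphism g /\ forall y, f (g y) = val y].

Definition affine_variety (X : space) : Prop :=
  is_sheaf X /\
  exists m (Z : set (affine_space m)) (f : X -> affine_space m),
    closed Z /\ is_iso_onto Z f.

Definition variety (X : space) : Prop :=
  [/\ is_sheaf X,
      exists m (U : 'I_m -> set X),
        (forall i, open (U i) /\ affine_variety (subspace_of X (U i))) /\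
        (forall x, exists i, U i x)
    & @closed (product X X) [set p | p.1 = p.2]].

Definition regular_at (X : space) (x : X) (f : X -> K) : Prop :=
  exists U, [/\ open U, U x & regular X U f].

(* Flatness of the local ring of X at x over the local ring of Y at f x, by the
   equational criterion: every linear relation is trivial. *)
Definition flat_at (X Y : space) (f : X -> Y) (x : X) : Prop :=
  forall r (a : 'I_r -> Y -> K) (b : 'I_r -> X -> K),
    (forall i, regular_at (f x) (a i)) -> (forall i, regular_at x (b i)) ->
    (\forall p \near x, \sum_i a i (f p) * b i p = 0) ->
  exists s (c : 'I_r -> 'I_s -> Y -> K) (y : 'I_s -> X -> K),
    [/\ forall i j, regular_at (f x) (c i j),
        forall j, regular_at x (y j),
        forall i, \forall p \near x, b i p = \sum_j c i j (f p) * y j p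
      & forall j, \forall q \near f x, \sum_i a i q * c i j q = 0].

Definition flat_morphism (X Y : space) (f : X -> Y) : Prop :=
  forall x, flat_at f x.

Definition affine_morphism (X Y : space) (f : X -> Y) : Prop :=
  forall V, open V -> affine_variety (subspace_of Y V) ->
    affine_variety (subspace_of X (f @^-1` V)).

Record alg_group := AlgGroup {
  grp :> space;
  grp_affine : affine_variety grp;
  gone : grp;
  gmul : grp -> grp -> grp;
  ginv : grp -> grp;
  gmulA : associative gmul;
  gmul1g : left_id gone gmul;
  gmulVg : left_inverse gone ginv gmul;
  gmul_morph : @is_morphism (product grp grp) grp (fun p => gmul p.1 p.2);
  ginv_morph : is_morphism ginv }.
Arguments gone {_}.

Definition coordinate_ring (G : alg_group) : set (G -> K) := regular G setT.

(* right translation by g on K[G] is unipotent: locally, g - 1 is nilpotent *)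
Definition unipotent (G : alg_group) (g : G) : Prop :=
  forall f, coordinate_ring f -> exists k,
    forall x, iter k (fun (h : G -> K) y => h (gmul y g) - h y) f x = 0.

Definition normal_subgroup (G : alg_group) (H : set G) : Prop :=
  [/\ H gone, forall x y, H x -> H y -> H (gmul x y),
      forall x, H x -> H (ginv x)
    & forall g x, H x -> H (gmul (gmul g x) (ginv g))].

(* G has trivial unipotent radical; G need not be connected. *)
Definition reductive (G : alg_group) : Prop :=
  forall H : set G, normal_subgroup H -> closed H -> connected H ->
    (forall x, H x -> unipotent x) -> H = [set gone].

End Varieties.

Arguments regular {K} X U f : rename.
Arguments subspace_of {K} X A.
Arguments gone {K _}.

(* N = Z^n (row vectors) and M = Hom(N, Z) = Z^n (column vectors).  A rational
   cone sigma is represented by the set of lattice points sigma `&` N, which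
   determines it. *)

Section Fans.
Variable n : nat.
Local Notation N := 'rV[int]_n.
Local Notation M := 'cV[int]_n.

Definition pairing (u : M) (v : N) : int := (v *m u) 0 0.

Definition cone_of (s : seq N) : set N :=
  [set v | exists2 k : nat, (0 < k)%N & exists a : 'I_(size s) -> nat,
     v *+ k = \sum_(i < size s) s`_i *+ a i].

Definition strongly_convex_cone (sigma : set N) : Prop :=
  (exists s, sigma = cone_of s) /\
  (forall v, sigma v -> sigma (- v) -> v = 0).

Definition dual_cone (sigma : set N) : set M :=
  [set u | forall v, sigma v -> 0 <= pairing u v].

Definition perp (sigma : set N) : set M :=
  [set u | forall v, sigma v -> pairing u v = 0].

Definition face (tau sigma : set N) : Prop :=
  exists2 u, dual_cone sigma u & tau = sigma `&` [set v | pairing u v = 0].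

Definition is_fan (Sigma : set (set N)) : Prop :=
  [/\ finite_set Sigma, Sigma !=set0,
      forall sigma, Sigma sigma -> strongly_convex_cone sigma,
      forall sigma tau, Sigma sigma -> face tau sigma -> Sigma tau
    & forall sigma tau, Sigma sigma -> Sigma tau ->
        face (sigma `&` tau) sigma /\ face (sigma `&` tau) tau].

Definition top_dimensional (sigma : set N) : Prop :=
  forall v, exists2 k : nat, (0 < k)%N & exists a b,
    [/\ sigma a, sigma b & v *+ k = a - b].

Definition maximal_cone (Sigma : set (set N)) (sigma : set N) : Prop :=
  Sigma sigma /\ forall tau, Sigma tau -> sigma `<=` tau -> tau = sigma.

(* Sigma(1), as a set of generators: if rho generates the monoid of all lattice
   points of a ray then rho is primitive. *)
Definition ray_generators (Sigma : set (set N)) : set N :=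
  [set rho | rho != 0 /\ Sigma [set rho *+ k | k in [set: nat]]].

End Fans.

Section Toric.
Variables (K : closedFieldType) (n : nat).
Local Notation N := 'rV[int]_n.
Local Notation M := 'cV[int]_n.

(* Closed points of Spec K[S], S the semigroup of u in M that are >= 0 on
   sigma: semigroup morphisms S -> (K, * ), extended by 0 outside S. *)
Definition sg_axiom (sigma : set N) (x : M -> K) : Prop :=
  [/\ x 0 = 1,
      forall u v, dual_cone sigma u -> dual_cone sigma v -> x (u + v) = x u * x v
    & forall u, ~ dual_cone sigma u -> x u = 0].

Definition sg_point (sigma : set N) : Type := {x : M -> K | sg_axiom sigma x}.

Definition affine_toric (sigma : set N) : space K :=
  @gen_space K (sg_point sigma)
    [set (setT, [set f | exists2 u, dual_cone sigma u &
                    f = fun x : sg_point sigma => sval x u])].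

(* T = Hom(M, K^* ) *)
Definition torus : space K := affine_toric [set 0].

Definition character (u : M) (t : torus) : K := sval t u.

Lemma dual_cone0 (u : M) : dual_cone [set 0] u.
Proof. by move=> v ->; rewrite /pairing mul0mx mxE. Qed.

Lemma torus_one_axiom : sg_axiom [set 0] (fun _ => 1).
Proof. by split=> // [u v _ _|u /(_ (dual_cone0 u))//]; rewrite mulr1. Qed.

Definition torus_one : torus := exist _ _ torus_one_axiom.

Lemma torus_scale_axiom (sigma : set N) (t : torus) (x : affine_toric sigma) :
  sg_axiom sigma (fun u => character u t * sval x u).
Proof.
have [t0 tM _] := svalP t; have [x0 xM xn] := svalP x; rewrite /character.
split=> [|u v du dv|u /xn ->]; last by rewrite mulr0.
  by rewrite t0 x0 mulr1.
by rewrite tM ?xM //; [rewrite mulrACA|exact: dual_cone0|exact: dual_cone0].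
Qed.

Definition torus_scale (sigma : set N) (t : torus) (x : affine_toric sigma)
  : affine_toric sigma := exist _ _ (torus_scale_axiom t x).

Definition torus_mul (s t : torus) : torus := torus_scale s t.

(* The varieties [affine_toric sigma], sigma in Sigma, glued along common faces:
   these data determine the variety and its torus action up to isomorphism. *)
Record toric_variety (Sigma : set (set N)) := ToricVariety {
  toric_space :> space K;
  toric_is_variety : variety toric_space;
  toric_act : torus -> toric_space -> toric_space;
  toric_chart : forall sigma : Sigma, affine_toric (val sigma) -> toric_space;
  toric_chart_open : forall sigma : Sigma,
    open (range (@toric_chart sigma)) /\
    is_iso_onto (range (@toric_chart sigma)) (@toric_chart sigma);
  toric_cover : forall x, exists sigma : Sigma, range (@toric_chart sigma) x;
  toric_overlap : forall sigma tau kappa : Sigma,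
    val kappa = val sigma `&` val tau ->
    range (@toric_chart sigma) `&` range (@toric_chart tau)
      = range (@toric_chart kappa);
  toric_glue : forall (sigma tau : Sigma) (x : affine_toric (val sigma))
      (y : affine_toric (val tau)),
    val tau `<=` val sigma ->
    (forall u, dual_cone (val sigma) u -> sval x u = sval y u) ->
    toric_chart x = toric_chart y;
  toric_chart_act : forall (sigma : Sigma) t (x : affine_toric (val sigma)),
    toric_act t (toric_chart x) = toric_chart (torus_scale t x) }.

End Toric.

Arguments torus_one {K n}.

Section PrincipalBundles.
Variables (K : closedFieldType) (n : nat) (Sigma : set (set 'rV[int]_n)).
Variables (X : toric_variety K Sigma) (G : alg_group K).

(* Torsors for the flat topology: E -> X is flat, affine and surjective and
   E x G is isomorphic to the fibre product of E with itself over X.  The fibre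
   product is taken with its reduced structure; in characteristic 0 the
   scheme-theoretic one is reduced, since E is reduced and flat over X.  As G
   is smooth, these are the same as etale locally trivial bundles. *)
Record principal_bundle := PrincipalBundle {
  total :> space K;
  total_variety : variety total;
  proj : total -> X;
  ract : total -> G -> total;
  tact : torus K n -> total -> total;
  proj_morph : is_morphism proj;
  proj_surj : forall x, exists e, proj e = x;
  proj_flat : flat_morphism proj;
  proj_affine : affine_morphism proj;
  ract_morph : @is_morphism K (product total G) total (fun p => ract p.1 p.2);
  ract1 : forall e, ract e gone = e;
  ractM : forall e g h, ract e (gmul g h) = ract (ract e g) h;
  proj_ract : forall e g, proj (ract e g) = proj e;
  ract_torsor : @is_iso_onto K (product total G) (product total total)
    [set p | proj p.1 = proj p.2] (fun p => (p.1, ract p.1 p.2));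
  tact_morph : @is_morphism K (product (torus K n) total) total
    (fun p => tact p.1 p.2);
  tact1 : forall e, tact torus_one e = e;
  tactM : forall s t e, tact (torus_mul s t) e = tact s (tact t e);
  proj_tact : forall t e, proj (tact t e) = toric_act t (proj e);
  tact_ract : forall t e g, tact t (ract e g) = ract (tact t e) g }.

Definition bundle_map (E E' : principal_bundle) (f : E -> E') : Prop :=
  [/\ is_morphism f, forall e, proj (f e) = proj e,
      forall e g, f (ract e g) = ract (f e) g
    & forall t e, f (tact t e) = tact t (f e)].

Definition bundle_hom (E E' : principal_bundle) := {f : E -> E' | bundle_map f}.

Lemma bundle_map_id (E : principal_bundle) : bundle_map (@id E).
Proof. by split=> //; split=> // e. Qed.

Lemma bundle_map_comp (E F H : principal_bundle) (g : F -> H) (f : E -> F) :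
  bundle_map g -> bundle_map f -> bundle_map (g \o f).
Proof.
move=> [[cg rg] pg gg tg] [[cf rf] pf gf tf]; split=> [|e|e h|t e] /=.
- split=> [e|V h oV rV]; first by apply: continuous_comp; [apply: cf|apply: cg].
  exact: (rf _ _ (open_comp (fun x _ => cg x) oV) (rg _ _ oV rV)).
- by rewrite pg pf.
- by rewrite gf gg.
- by rewrite tf tg.
Qed.

Definition bundle_id (E : principal_bundle) : bundle_hom E E :=
  exist _ _ (bundle_map_id E).

Definition bundle_comp (E F H : principal_bundle) (g : bundle_hom F H)
    (f : bundle_hom E F) : bundle_hom E H :=
  exist _ _ (bundle_map_comp (svalP g) (svalP f)).

Lemma bundle_comp_idl E F (f : bundle_hom E F) : bundle_comp (bundle_id F) f = f.
Proof. by case: f => f fP; apply: eq_exist. Qed.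

Lemma bundle_comp_idr E F (f : bundle_hom E F) : bundle_comp f (bundle_id E) = f.
Proof. by case: f => f fP; apply: eq_exist. Qed.

Lemma bundle_comp_assoc E F H J (h : bundle_hom H J) (g : bundle_hom F H)
    (f : bundle_hom E F) :
  bundle_comp h (bundle_comp g f) = bundle_comp (bundle_comp h g) f.
Proof. exact: eq_exist. Qed.

Definition Pbun : category :=
  Category bundle_comp_idl bundle_comp_idr bundle_comp_assoc.

End PrincipalBundles.

Section FilteredAlgebras.
Variables (K : closedFieldType) (n : nat) (Sigma : set (set 'rV[int]_n)).
Local Notation N := 'rV[int]_n.
Local Notation M := 'cV[int]_n.

Definition linear_subspace (V : lmodType K) (W : set V) : Prop :=
  W 0 /\ forall k a b, W a -> W b -> W (k *: a + b).

Definition countable_dimension (V : lmodType K) : Prop :=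
  exists e : nat -> V, forall v, exists r (c : 'I_r -> K),
    v = \sum_i c i *: e i.

Record sigma_filtered_algebra := SigmaFilteredAlgebra {
  falg :> comAlgType K;
  falg_countable : countable_dimension falg;
  filt : ray_generators Sigma -> int -> set falg;
  filt_subspace : forall rho i, linear_subspace (filt rho i);
  filt_decr : forall rho i, filt rho (i + 1) `<=` filt rho i;
  filt_full : forall rho v, exists i, filt rho i v;
  filt_mul : forall rho i j a b,
    filt rho i a -> filt rho j b -> filt rho (i + j) (a * b) }.

Definition alg_map (A B : comAlgType K) (f : A -> B) : Prop :=
  linear f /\ monoid_morphism f.

Definition filtered_map (A B : sigma_filtered_algebra) (f : A -> B) : Prop :=
  alg_map f /\ forall rho i a, filt rho i a -> filt rho i (f a).

Definition sum_of (V : lmodType K) (D : M -> set V) (P : set M) : set V :=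
  [set b | exists r (u : 'I_r -> M) (d : 'I_r -> V),
     (forall j, P (u j) /\ D (u j) (d j)) /\ b = \sum_j d j].

(* D is a family indexed by
   M_sigma = M / perp sigma: [D u] only depends on the class of u. *)
Definition compatible_decomposition (B : sigma_filtered_algebra) (sigma : set N)
    (D : M -> set B) : Prop :=
  [/\ (forall u, linear_subspace (D u)) /\
      (forall u v, perp sigma (u - v) -> D u = D v),
      sum_of D setT = setT,
      forall r (u : 'I_r -> M) (d : 'I_r -> B),
        (forall i j, i != j -> ~ perp sigma (u i - u j)) ->
        (forall j, D (u j) (d j)) -> \sum_j d j = 0 -> forall j, d j = 0,
      forall (rho : ray_generators Sigma) (i : int), sigma (val rho) ->
        filt rho i = sum_of D [set u | i <= pairing u (val rho)]
    & forall u v a b, D u a -> D v b -> D (u + v) (a * b)].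

Definition compatible (B : sigma_filtered_algebra) : Prop :=
  forall sigma, Sigma sigma -> exists D : M -> set B,
    compatible_decomposition sigma D.

(* Actions of T by algebra automorphisms, rational by the decomposition into
   weight spaces. *)
Definition compatible_action (B : sigma_filtered_algebra) (sigma : set N)
    (tau : torus K n -> B -> B) : Prop :=
  [/\ forall b, tau torus_one b = b,
      forall s t b, tau (torus_mul s t) b = tau s (tau t b),
      forall t, alg_map (tau t)
    & compatible_decomposition sigma
        (fun u => [set b | forall t, tau t b = character u t *: b])].

Variable G : alg_group K.

Record calg := CalgObject {
  calg_alg :> sigma_filtered_algebra;
  calg_compatible : compatible calg_alg;
  gact : G -> calg_alg -> calg_alg;
  gact1 : forall b, gact gone b = b;
  gactM : forall g h b, gact (gmul g h) b = gact g (gact h b);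
  gact_alg : forall g, alg_map (gact g);
  (* B is G-equivariantly isomorphic to K[G], where (g . f) x = f (x g) *)
  gact_translation : exists phi : calg_alg -> G -> K,
    [/\ forall k a b x, phi (k *: a + b) x = k * phi a x + phi b x,
        forall x, phi 1 x = 1,
        forall a b x, phi (a * b) x = phi a x * phi b x,
        set_bij setT (@coordinate_ring K G) phi
      & forall g b x, phi (gact g b) x = phi b (gmul x g)];
  calg_torus : forall sigma, Sigma sigma -> top_dimensional sigma ->
    exists tau : torus K n -> calg_alg -> calg_alg,
      compatible_action sigma tau /\
      forall t g b, tau t (gact g b) = gact g (tau t b) }.

Definition calg_map (A B : calg) (f : A -> B) : Prop :=
  [/\ filtered_map f, forall g a, f (gact g a) = gact g (f a)
    & exists h : B -> A, [/\ filtered_map h, cancel f h & cancel h f]].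

Definition calg_hom (A B : calg) := {f : A -> B | calg_map f}.

Lemma filtered_map_id (A : sigma_filtered_algebra) : filtered_map (@id A).
Proof. by []. Qed.

Lemma filtered_map_comp (A B C : sigma_filtered_algebra) (g : B -> C)
  (f : A -> B) : filtered_map g -> filtered_map f -> filtered_map (g \o f).
Proof.
move=> [[lg [g1 gM]] Fg] [[lf [f1 fM]] Ff].
split=> [|rho i a Fa]; last exact/Fg/Ff.
split=> [k a b|]; first by rewrite /= lf lg.
by split=> [|a b] /=; rewrite ?f1 ?fM.
Qed.

Lemma calg_map_id (A : calg) : calg_map (@id A).
Proof. by split=> //; exists id. Qed.

Lemma calg_map_comp (A B C : calg) (g : B -> C) (f : A -> B) :
  calg_map g -> calg_map f -> calg_map (g \o f).
Proof.
move=> [Fg gg [g' [Fg' gK g'K]]] [Ff gf [f' [Ff' fK f'K]]].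
split=> [|h a|]; [exact: filtered_map_comp|by rewrite /= gf gg|].
by exists (f' \o g'); split; [exact: filtered_map_comp|exact: can_comp..].
Qed.

Definition calg_id (A : calg) : calg_hom A A := exist _ _ (calg_map_id A).

Definition calg_comp (A B C : calg) (g : calg_hom B C) (f : calg_hom A B)
  : calg_hom A C := exist _ _ (calg_map_comp (svalP g) (svalP f)).

Lemma calg_comp_idl A B (f : calg_hom A B) : calg_comp (calg_id B) f = f.
Proof. by case: f => f fP; apply: eq_exist. Qed.

Lemma calg_comp_idr A B (f : calg_hom A B) : calg_comp f (calg_id A) = f.
Proof. by case: f => f fP; apply: eq_exist. Qed.

Lemma calg_comp_assoc A B C D (h : calg_hom C D) (g : calg_hom B C)
    (f : calg_hom A B) :
  calg_comp h (calg_comp g f) = calg_comp (calg_comp h g) f.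
Proof. exact: eq_exist. Qed.

Definition Calg : category :=
  Category calg_comp_idl calg_comp_idr calg_comp_assoc.

End FilteredAlgebras.

(* Main.v *)
(** Let [e1] be a point of E over the unit of T.  If [sigma] is top-dimensional,
    then over the chart of [sigma] the bundle is equivariantly trivial: there are
    a homomorphism [chi : T -> G] and a section s with s(t) = t e1 chi(t)^-1.
    Indeed, twisting the T-action by the character [chi] of the fibre at the fixed
    point x0, one gets a fixed point e0 over x0; weight vectors x_1, ..., x_d that
    restrict to coordinates of the fibre at e0 generate an ideal J, and by Krull's
    intersection theorem and an Euler derivation argument, where characteristic 0
    is used, K[E] is locally the direct sum of the functions on the base and of
    the intersection of the J + m^N, which gives an equivariant retraction of K[E]
    onto the functions on the base.
    So E amounts to the homomorphisms [chi_sigma], such that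
    [chi_tau(t) chi_sigma(t)^-1] extends over the common face; in terms of the
    T-actions b |-> b(chi_sigma(t)^-1 .) on K[G], this says that they define the
    same filtrations along the common rays.  Intrinsically b has degree >= i along
    rho if t e1 g |-> t^w b(g) is regular over the chart of rho for some w with
    w(rho) = -i. *)
From HB Require Import structures.
Require Import Defs.
From mathcomp Require Import all_boot all_order all_algebra.
From mathcomp Require Import all_classical topology.
From mathcomp Require Import perm finmap zify ring.
Import Defs.

Set Implicit Arguments.
Unset Strict Implicit.
Unset Printing Implicit Defensive.

Import Order.TTheory GRing.Theory Num.Theory.
Local Open Scope classical_set_scope.
Local Open Scope ring_scope.

(** * Krull's intersection theorem *)

(** The retraction is obtained order by order. With [q N = J + m^N], every function is congruent
    modulo [q N] to one pulled back from the base. The twisted torus action splits functions into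
    weight vectors, and each weight occurs at most once on the base, so the approximations of a
    weight vector no longer depend on [N] once the character concerned lies outside [q N]. That such
    an [N] exists is what Krull's theorem and the Euler derivation are for. The obstacle is
    infinitesimal: the torsor condition speaks of points only, whereas the cotangent space at e0 has
    to be spanned by the base and the fibre, which requires the scheme-theoretic fibre over x0 to be
    reduced. This is extracted from flatness: over the open orbit a relation on the fibre product
    amounts to finitely many relations with coefficients on the base, and the equational criterion
    spreads these to e0. As varieties are spaces of points, the algebra is done with sets of
    K-valued functions, and points are recovered as characters of such algebras by the
    Nullstellensatz. *)

Section RelativeIdeals.
Variable R : comPzRingType.
Implicit Types (O I J Q n : set R) (a b c x y : R).

(** The rings to come are subsets of the ring of all functions [P -> K]. Ideals, their products and
    the noetherian property are therefore relative to a subset [O] of the ambient ring. *)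
Definition subring O :=
  [/\ O 1, forall x y, O x -> O y -> O (x - y) & forall x y, O x -> O y -> O (x * y)].

Definition ideal O I :=
  [/\ I `<=` O, I 0, forall x y, I x -> I y -> I (x + y)
    & forall a x, O a -> I x -> I (a * x)].

Definition idl O (S : set R) : set R :=
  [set x | forall I, ideal O I -> S `<=` I -> I x].

Definition noeth O := forall I, ideal O I ->
  exists2 s : seq R, (forall x, x \in s -> I x) & I `<=` idl O [set x | x \in s].

Lemma subringN O x : subring O -> O x -> O (- x).
Proof. by move=> [O1 OB _] Ox; rewrite -sub0r; apply: (OB) => //; rewrite -(subrr 1); apply: OB. Qed.

Lemma subringD O x y : subring O -> O x -> O y -> O (x + y).
Proof. by move=> sO Ox Oy; rewrite -[y]opprK; case: (sO) => _ OB _; apply: (OB) => //; exact: subringN. Qed.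

Lemma subring0 O : subring O -> O 0.
Proof. by move=> [O1 OB _]; rewrite -(subrr 1); apply: OB. Qed.

Lemma subringX O x k : subring O -> O x -> O (x ^+ k).
Proof.
move=> sO Ox; case: (sO) => O1 _ OM.
by elim: k => [|k IH]; rewrite ?expr0 ?exprS //; apply: OM.
Qed.

Lemma subring_ideal O : subring O -> ideal O O.
Proof. by move=> sO; split=> //; [exact: subring0|move=> *; exact: subringD|case: sO]. Qed.

Lemma subset_idl O S : S `<=` idl O S.
Proof. by move=> x Sx I _; apply. Qed.

Lemma idl_ideal O S : subring O -> S `<=` O -> ideal O (idl O S).
Proof.
move=> sO SO; split.
- by move=> x; apply=> //; exact: subring_ideal.
- by move=> I [].
- by move=> x y Hx Hy I iI SI; case: (iI) => _ _ D _; apply: D; [exact: Hx|exact: Hy].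
- by move=> a x Oa Hx I iI SI; case: (iI) => _ _ _; apply=> //; exact: Hx.
Qed.

Lemma idl_sub O S I : ideal O I -> S `<=` I -> idl O S `<=` I.
Proof. by move=> iI SI x; apply. Qed.

Lemma idl_mono O S S' : S `<=` S' -> idl O S `<=` idl O S'.
Proof. by move=> SS x Hx I iI S'I; apply: Hx => // y /SS /S'I. Qed.

Lemma idealB O I x y : subring O -> ideal O I -> I x -> I y -> I (x - y).
Proof.
move=> sO [_ _ D M] Ix Iy; apply: D => //; rewrite -mulN1r; apply: M => //.
by apply: subringN => //; case: sO.
Qed.

Definition idadd I J : set R := [set x | exists2 a, I a & exists2 b, J b & x = a + b].

Lemma idadd_ideal O I J : ideal O I -> ideal O J -> subring O -> ideal O (idadd I J).
Proof.
move=> [IO I0 ID IM] [JO J0 JD JM] sO; split.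
- by move=> _ [a Ia [b Jb ->]]; apply: subringD => //; [exact: IO|exact: JO].
- by exists 0 => //; exists 0 => //; rewrite addr0.
- move=> _ _ [a Ia [b Jb ->]] [a' Ia' [b' Jb' ->]].
  by exists (a + a'); [exact: ID|exists (b + b'); [exact: JD|ring]].
- move=> c _ Oc [a Ia [b Jb ->]].
  by exists (c * a); [exact: IM|exists (c * b); [exact: JM|ring]].
Qed.

Lemma idaddl I J : J 0 -> I `<=` idadd I J.
Proof. by move=> J0 x Ix; exists x => //; exists 0; rewrite ?addr0. Qed.

Lemma idaddr I J : I 0 -> J `<=` idadd I J.
Proof. by move=> I0 x Ix; exists 0 => //; exists x; rewrite ?add0r. Qed.

Definition idmul O I J : set R :=
  idl O [set x | exists2 a, I a & exists2 b, J b & x = a * b].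

Lemma idmul_ideal O I J : ideal O I -> ideal O J -> subring O -> ideal O (idmul O I J).
Proof.
move=> [IO _ _ _] [JO _ _ _] sO; apply: idl_ideal => // _ [a /IO Oa [b /JO Ob ->]].
by case: sO => _ _; apply.
Qed.

Lemma mem_idmul O I J a b : I a -> J b -> idmul O I J (a * b).
Proof. by move=> Ia Jb; apply: subset_idl; exists a => //; exists b. Qed.

Lemma idmul_sub O I J Q : ideal O Q -> (forall a b, I a -> J b -> Q (a * b)) ->
  idmul O I J `<=` Q.
Proof. by move=> iQ H; apply: idl_sub => // _ [a Ia [b Jb ->]]; exact: H. Qed.

Fixpoint idpow O n N : set R := if N is N'.+1 then idmul O n (idpow O n N') else O.

Lemma idpow_ideal O n N : subring O -> ideal O n -> ideal O (idpow O n N).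
Proof.
move=> sO idn; elim: N => [|N IH] /=; first exact: subring_ideal.
exact: idmul_ideal.
Qed.

Lemma idpow_mono O I J N : subring O -> ideal O I -> ideal O J -> I `<=` J ->
  idpow O I N `<=` idpow O J N.
Proof.
move=> sO iI iJ IJ; elim: N => //= N IH; apply: idmul_sub.
  exact: (@idpow_ideal O J N.+1).
by move=> a b /IJ Ja /IH Jb; exact: mem_idmul.
Qed.

Lemma idpow_mul O n N M a b : subring O -> ideal O n ->
  idpow O n N a -> idpow O n M b -> idpow O n (N + M) (a * b).
Proof.
move=> sO idn; elim: N a => [|N IH] a /=.
  by case: (idpow_ideal M sO idn) => _ _ _ H; exact: H.
(* One reduces to generators through the set of all [a] with the required property: it is an ideal,
   and the conjunct [O a] is there because ideals lie in [O]. The same device recurs below. *)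
move=> Ha Hb; suff: idmul O n (idpow O n N) `<=`
    [set a | O a /\ idmul O n (idpow O n (N + M)) (a * b)] by move/(_ _ Ha) => [].
have idNM := idpow_ideal (N + M).+1 sO idn.
have [bO _ _ _] := idpow_ideal M sO idn.
have [NO _ _ _] := idpow_ideal N sO idn.
have [nO _ _ _] := idn.
apply: idmul_sub => [|c d nc nd].
  case: idNM => _ H0 HD HM; split=> [x []//||x y [Ox Hx] [Oy Hy]|c x Oc [Ox Hx]].
  - by split; [exact: subring0|rewrite mul0r].
  - by split; [exact: subringD|rewrite mulrDl; apply: HD].
  - by split; [case: sO => _ _; apply|rewrite -mulrA; apply: HM].
split; first by case: sO => _ _; apply; [exact: nO|exact: NO].
by rewrite -mulrA; apply: mem_idmul => //; apply: IH.
Qed.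

Lemma idpow_le O n N M : subring O -> ideal O n -> (M <= N)%N ->
  idpow O n N `<=` idpow O n M.
Proof.
move=> sO idn; elim: N => [|N IH] //=; first by rewrite leqn0 => /eqP ->.
rewrite leq_eqVlt => /orP[/eqP -> //|/IH H]; apply: subset_trans H.
apply: idmul_sub => [|a b na]; first exact: idpow_ideal.
have [_ _ _ HM] := idpow_ideal N sO idn.
by apply: HM; case: idn => nO _ _ _; exact: nO.
Qed.

End RelativeIdeals.

Section Krull.
Variable R : comPzRingType.
Implicit Types (O I J Q n : set R) (a b c x y : R).
Variable O : set R.
Hypotheses (sO : subring O) (nO : noeth O).

Let OM : forall x y, O x -> O y -> O (x * y). Proof. by case: sO. Qed.
Let O1 : O 1. Proof. by case: sO. Qed.
Lemma noeth_maximal (F : set (set R)) (I0 : set R) :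
  (forall I, F I -> ideal O I) -> F I0 ->
  (forall C : set (set R), C !=set0 -> C `<=` F -> total_on C subset ->
     F (\bigcup_(X in C) X)) ->
  exists2 A, F A & forall B, F B -> A `<=` B -> B `<=` A.
Proof.
move=> Fid FI0 Fch.
(* Adjoining the empty set makes the family closed under the union of the empty chain. A maximal
   element is not empty, since [I0] contains 0. *)
have [|A [FA Amax]] := @Zorn_bigcup R [set A | A = set0 \/ F A].
  move=> C CF Ctot; have [[X [CX FX]]|nC] := pselect (exists X, C X /\ F X); last first.
    left; rewrite predeqE => x; split=> // -[X CX Xx].
    by case: (CF X CX) => [X0|FX]; [rewrite X0 in Xx|case: nC; exists X].
  right; have -> : \bigcup_(X in C) X = \bigcup_(X in C `&` F) X.
    rewrite predeqE => x; split=> -[Y]; last by move=> [CY _] Yx; exists Y.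
    move=> CY Yx; exists Y => //; split=> //.
    by case: (CF Y CY) => // Y0; rewrite Y0 in Yx.
  apply: Fch; [by exists X|by move=> Y []|].
  by move=> Y Z [CY _] [CZ _]; apply: Ctot.
have FA' : F A.
  case: FA => // A0; exfalso; apply: (Amax I0); last by right.
  rewrite A0 properEneq; split=> //.
  by apply/eqP => E; case: (Fid _ FI0) => _; rewrite -E.
exists A => // B FB AB; apply: contrapT => nBA; apply: (Amax B); last by right.
by split.
Qed.

(* Absorbing one generator of [n] at a time. *)
Lemma idpow_sub_of_nilpotent (s : seq R) n Q : ideal O n -> ideal O Q ->
  (forall a, a \in s -> O a /\ exists k, Q (a ^+ k)) ->
  n `<=` idl O (Q `|` [set x | x \in s]) -> exists N, idpow O n N `<=` Q.
Proof.
move=> idn; elim: s Q => [|a s IH] Q iQ Hs Hn.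
  exists 1%N => /=; apply: idmul_sub => // x y nx Oy.
  have [_ _ _ QM] := iQ; rewrite mulrC; apply: QM => //.
  by apply: (Hn x nx Q iQ) => z [|].
have [Oa [k Qak]] := Hs a (mem_head _ _).
pose Q1 := idadd Q [set x | exists2 b, O b & x = b * a].
have iA j : ideal O [set x | exists2 b, O b & x = b * a ^+ j].
  have Oaj : O (a ^+ j) by apply: subringX.
  split; first by move=> _ [b Ob ->]; exact: OM.
  - by exists 0; [exact: subring0|rewrite mul0r].
  - by move=> _ _ [b Ob ->] [c Oc ->]; exists (b + c); [exact: subringD|ring].
  - by move=> c _ Oc [b Ob ->]; exists (c * b); [exact: OM|ring].
have iQ1 : ideal O Q1 by apply: idadd_ideal => //; exact: (iA 1%N).
have [Q0 B0] : Q 0 /\ exists2 b : R, O b & 0 = b * a.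
  by case: iQ => _ ? _ _; split=> //; exists 0; [exact: subring0|rewrite mul0r].
have [|x nx|N HN] := IH Q1 iQ1.
- move=> b bs; have [|Ob [j Qb]] := Hs b; first by rewrite inE bs orbT.
  by split=> //; exists j; apply: idaddl.
- move=> I iI Q1I; apply: (Hn x nx I iI) => z [Qz|/=].
    by apply: Q1I; left; apply: idaddl.
  rewrite inE => /orP[/eqP ->|zs]; apply: Q1I; last by right.
  by left; apply: idaddr => //; exists 1 => //; rewrite mul1r.
have [QO _ QD QM] := iQ.
(* As [n^N] lies in [Q + (a)], each further factor [n^N] gains one factor [a]; after [k] steps
   [a ^+ k] is in [Q]. *)
have step j : idpow O n (j * N) `<=` idadd Q [set x | exists2 b, O b & x = b * a ^+ j].
  elim: j => [|j IHj] x.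
    by rewrite mul0n /= => Ox; apply: idaddr => //; exists x => //; rewrite expr0 mulr1.
  have iT : ideal O (idadd Q [set x | exists2 b, O b & x = b * a ^+ j.+1]).
    by apply: idadd_ideal.
  rewrite mulSn; suff H : forall M, (forall y, idpow O n M y ->
      idadd Q [set x | exists2 b, O b & x = b * a ^+ j] y) ->
      idpow O n (N + M) `<=` idadd Q [set x | exists2 b, O b & x = b * a ^+ j.+1].
    by apply: H => y /IHj.
  move=> M HM z Hz.
  have : idmul O (idpow O n N) (idpow O n M) z.
    elim: (N) z Hz => [|L IHL] z /=.
      by move=> Hz; rewrite -[z]mul1r; apply: mem_idmul.
    apply: idmul_sub; first by apply: (idmul_ideal (idpow_ideal L.+1 sO idn)) => //; exact: idpow_ideal.
    move=> c d nc /IHL.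
    have iL := idmul_ideal (idpow_ideal L.+1 sO idn) (idpow_ideal M sO idn) sO.
    have [nO' _ _ _] := idn.
    move=> Hd; suff: idmul O (idpow O n L) (idpow O n M) `<=`
        [set d | O d /\ idmul O (idpow O n L.+1) (idpow O n M) (c * d)] by case/(_ d Hd).
    apply: idmul_sub.
      case: iL => LO L0 LD LM; split=> [x'|||].
      + by case.
      + by split; [exact: subring0|rewrite mulr0].
      + by move=> u v [Ou Hu] [Ov Hv]; split; [exact: subringD|rewrite mulrDr; exact: LD].
      + by move=> u v Ou [Ov Hv]; split; [exact: OM|rewrite mulrCA; exact: LM].
    move=> u v Hu Hv; split.
      have [LO _ _ _] := idpow_ideal L sO idn; have [MO _ _ _] := idpow_ideal M sO idn.
      by apply: OM; [exact: LO|exact: MO].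
    by rewrite mulrA; apply: mem_idmul => //; apply: mem_idmul.
  move: z {Hz}; apply: idmul_sub => // c d /HN [q Qq [_ [b Ob ->] ->]] /HM [q' Qq' [_ [b' Ob' ->] ->]].
  exists (q * (q' + b' * a ^+ j) + b * a * q').
    apply: QD; first by rewrite mulrC; apply: QM => //; apply: subringD; [|exact: QO|apply: OM => //; apply: subringX].
    by apply: QM => //; exact: OM.
  by exists (b * b' * a ^+ j.+1); [exists (b * b') => //; exact: OM|rewrite exprS; ring].
exists (k * N)%N => x /step [q Qq [_ [b Ob ->] ->]].
by apply: QD => //; exact: QM.
Qed.

(** Induction on the generators. Modulo [Q + (a)] it provides [c1]. Inserting this into the
    hypothesis for [a] gives [c2] in [n] with [(1 - c1 - c2) a] in [Q], so that
    [(1 - c1 - c2) (1 - c1)] carries the whole ideal into [Q]. *)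
Lemma nakayama (s : seq R) n Q : ideal O n -> ideal O Q ->
  (forall a, a \in s -> O a) ->
  idl O (Q `|` [set x | x \in s]) `<=`
     idadd Q (idmul O n (idl O (Q `|` [set x | x \in s]))) ->
  exists2 c, n c & forall x, idl O (Q `|` [set x | x \in s]) x -> Q ((1 - c) * x).
Proof.
move=> idn; elim: s Q => [|a s IH] Q iQ Hs HI.
  exists 0; first by case: idn.
  by move=> x; rewrite subr0 mul1r; apply=> // y [].
have Oa : O a by apply: Hs; exact: mem_head.
pose aO := [set x | exists2 b, O b & x = b * a].
have iA : ideal O aO.
  split; first by move=> _ [b Ob ->]; exact: OM.
  - by exists 0; [exact: subring0|rewrite mul0r].
  - by move=> _ _ [b Ob ->] [c Oc ->]; exists (b + c); [exact: subringD|ring].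
  - by move=> c _ Oc [b Ob ->]; exists (c * b); [exact: OM|ring].
have [[QO Q0 QD QM] [_ A0 _ _]] := (iQ, iA).
have iQ1 : ideal O (idadd Q aO) by apply: idadd_ideal.
have E : idl O (idadd Q aO `|` [set x | x \in s]) = idl O (Q `|` [set x | x \in a :: s]).
  rewrite predeqE => x; split=> Hx I iI SI; apply: (Hx I iI) => z.
  - case=> [[q Qq [_ [b Ob ->] ->]]|zs]; last by apply: SI; right; rewrite /= inE zs orbT.
    case: (iI) => _ _ ID IM; apply: ID; first by apply: SI; left.
    by apply: IM => //; apply: SI; right; exact: mem_head.
  - case=> [Qz|/=]; first by apply: SI; left; apply: idaddl.
    rewrite inE => /orP[/eqP ->|zs]; apply: SI; last by right.
    by left; apply: idaddr => //; exists 1 => //; rewrite mul1r.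
set I := idl O (Q `|` _) in HI E *.
have iI : ideal O I.
  by apply: idl_ideal => // z [/QO //|]; exact: Hs.
have [IO I0 ID IM] := iI.
have [||c1 nc1 Hc1] := IH _ iQ1.
- by move=> b bs; apply: Hs; rewrite inE bs orbT.
- rewrite E => x /HI [q Qq [y Hy ->]]; exists q; first exact: idaddl.
  by exists y.
rewrite E in Hc1.
have Ia : I a by apply: subset_idl; right; exact: mem_head.
have [nO' n0 nD nM] := idn.
have O1c c : n c -> O (1 - c).
  by case: sO => ? OB _ nc; apply: OB => //; exact: nO'.
have [c2 nc2 Hc2] : exists2 c2, n c2 & Q ((1 - c1) * a - c2 * a).
  have [q Qq [y Hy Ea]] := HI a Ia.
  suff [c2 nc2 Hc2] : exists2 c2, n c2 & Q ((1 - c1) * y - c2 * a).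
    exists c2 => //; rewrite {1}Ea mulrDr -addrA; apply: QD => //.
    by apply: QM => //; exact: O1c.
  have iT : ideal O [set y | O y /\ exists2 c2, n c2 & Q ((1 - c1) * y - c2 * a)].
    split=> [z []//|||].
    - by split; [exact: subring0|exists 0 => //; rewrite mulr0 mul0r subrr].
    - move=> u v [Ou [c nc Hc]] [Ov [d nd Hd]]; split; first exact: subringD.
      exists (c + d); first exact: nD.
      have -> : (1 - c1) * (u + v) - (c + d) * a =
        ((1 - c1) * u - c * a) + ((1 - c1) * v - d * a) by ring.
      exact: QD.
    - move=> u v Ou [Ov [c nc Hc]]; split; first exact: OM.
      exists (u * c); first exact: nM.
      have -> : (1 - c1) * (u * v) - u * c * a = u * ((1 - c1) * v - c * a) by ring.
      exact: QM.
  have : [set y | O y /\ exists2 c2, n c2 & Q ((1 - c1) * y - c2 * a)] y.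
    move: y Hy {Ea}; apply: idmul_sub => // u v nu Iv; split.
      by apply: OM; [exact: nO'|exact: IO].
    have [q' Qq' [_ [b Ob ->] Ev]] := Hc1 v Iv.
    exists (b * u); first exact: nM.
    have -> : (1 - c1) * (u * v) - b * u * a = u * ((1 - c1) * v - b * a) by ring.
    by rewrite Ev addrK; apply: QM => //; exact: nO'.
  by case.
exists (1 - (1 - c1 - c2) * (1 - c1)).
  have -> : 1 - (1 - c1 - c2) * (1 - c1) = (1 + 1 - c1 - c2) * c1 + c2 by ring.
  apply: nD => //; apply: nM => //.
  have [O1' OB _] := sO.
  by apply: (OB); [apply: (OB)|]; [exact: subringD|exact: nO'|exact: nO'].
move=> x Ix; rewrite opprB addrCA subrr addr0 -mulrA.
have [q Qq [_ [b Ob ->] ->]] := Hc1 x Ix.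
have -> : (1 - c1 - c2) * (q + b * a) = (1 - c1 - c2) * q + b * ((1 - c1) * a - c2 * a) by ring.
apply: QD; last exact: QM.
apply: QM => //; have [_ OB _] := sO; apply: OB; [exact: O1c|exact: nO'].
Qed.

(* With I the intersection of the Q + n^N, an ideal Q' maximal among those
   meeting I inside Q + n I contains a power of n. *)
Lemma krull_intersection n Q r : ideal O n -> ideal O Q ->
  (forall N, idadd Q (idpow O n N) r) -> exists2 c, n c & Q ((1 - c) * r).
Proof.
move=> idn iQ Hr; pose I := [set x | forall N, idadd Q (idpow O n N) x].
have ij N : ideal O (idadd Q (idpow O n N)).
  by apply: idadd_ideal => //; exact: idpow_ideal.
have iI : ideal O I.
  split=> [x Hx|N|x y Hx Hy N|a x Oa Hx N].
  - by case: (ij 0%N) => H _ _ _; exact: (H _ (Hx 0%N)).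
  - by case: (ij N).
  - by case: (ij N) => _ _ H _; exact: H.
  - by case: (ij N) => _ _ _; apply.
have [[QO Q0 QD QM] [IO I0 ID IM]] := (iQ, iI).
have inI := idmul_ideal idn iI sO.
pose J0 := idadd Q (idmul O n I).
have iJ0 : ideal O J0 by apply: idadd_ideal.
have [_ J00 _ _] := iJ0.
pose F := [set X : set R | [/\ ideal O X, J0 `<=` X & X `&` I `<=` J0]].
have [||C [X0 CX0] CF Ctot|Q' [iQ' JQ' Q'I] Q'max] := @noeth_maximal F J0.
- by move=> X [].
- by split=> // x [].
- split; last by move=> x [[X CX Xx] Ix]; case: (CF X CX) => _ _; apply.
    have [iX0 _ _] := CF _ CX0.
    split=> [x [X CX]|||].
    + by case: (CF X CX) => -[H _ _ _] _ _; exact: H.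
    + by exists X0 => //; case: iX0.
    + move=> x y [X CX Xx] [Y CY Yy].
      case: (Ctot X Y CX CY) => [XY|YX].
        by exists Y => //; case: (CF Y CY) => -[_ _ D _] _ _; apply: D => //; exact: XY.
      by exists X => //; case: (CF X CX) => -[_ _ D _] _ _; apply: D => //; exact: YX.
    + by move=> a x Oa [X CX Xx]; exists X => //; case: (CF X CX) => -[_ _ _ M] _ _; exact: M.
  by move=> x Jx; exists X0 => //; case: (CF X0 CX0) => _ H _; exact: H.
have [Q'O Q'0 Q'D Q'M] := iQ'.
have [nO' n0 nD nM] := idn.
(* The ideals [C k] of multipliers that take [a ^+ k] into [Q'] increase with [k], hence are all
   contained in one of them. For that [k] the ideal [Q' + (a ^+ k)] still meets [I] inside [J0], and
   maximality puts [a ^+ k] in [Q']. *)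
have powQ' a : n a -> exists k, Q' (a ^+ k).
  move=> na; have Oa := nO' a na.
  pose C k := [set x | O x /\ Q' (a ^+ k * x)].
  have Cle k l : (k <= l)%N -> C k `<=` C l.
    move=> kl x [Ox Hx]; split=> //; rewrite -(subnK kl) exprD -mulrA.
    by apply: Q'M => //; exact: subringX.
  have iC : ideal O [set x | exists k, C k x].
    split=> [x [k []]//|||].
    - by exists 0%N; split; [exact: subring0|rewrite mulr0].
    - move=> x y [k Hk] [l Hl]; exists (maxn k l).
      have [Ox Hx] := Cle _ _ (leq_maxl k l) _ Hk; have [Oy Hy] := Cle _ _ (leq_maxr k l) _ Hl.
      by split; [exact: subringD|rewrite mulrDr; apply: Q'D].
    - move=> b x Ob [k [Ox Hx]]; exists k; split; first exact: OM.
      by rewrite mulrCA; apply: Q'M.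
  have [s sC Cs] := nO iC.
  have [k Hk] : exists k, forall x, x \in s -> C k x.
    elim: s sC {Cs} => [|x s IHs] sC; first by exists 0%N.
    have [|k Hk] := IHs; first by move=> y ys; apply: sC; rewrite inE ys orbT.
    have [l Hl] := sC x (mem_head _ _); exists (maxn k l) => y.
    rewrite inE => /orP[/eqP ->|/Hk]; first exact: (Cle l _ (leq_maxr _ _)).
    exact: Cle (leq_maxl _ _) _.
  have Ck x l : C l x -> C k x.
    move=> Hx; apply: (Cs x); [by exists l| |exact: Hk].
    split=> [y []//|||].
    - by split; [exact: subring0|rewrite mulr0].
    - by move=> u v [Ou Hu] [Ov Hv]; split; [exact: subringD|rewrite mulrDr; apply: Q'D].
    - by move=> b u Ob [Ou Hu]; split; [exact: OM|rewrite mulrCA; apply: Q'M].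
  have Oak : O (a ^+ k) by apply: subringX.
  pose aO := [set x | exists2 b, O b & x = b * a ^+ k].
  have iA : ideal O aO.
    split; first by move=> _ [b Ob ->]; exact: OM.
    - by exists 0; [exact: subring0|rewrite mul0r].
    - by move=> _ _ [b Ob ->] [c Oc ->]; exists (b + c); [exact: subringD|ring].
    - by move=> c _ Oc [b Ob ->]; exists (c * b); [exact: OM|ring].
  exists k; apply: (Q'max (idadd Q' aO)).
  - split; first exact: idadd_ideal.
      by move=> x /JQ' Hx; apply: idaddl => //; case: iA.
    move=> _ [[q Qq [_ [b Ob ->] ->]] Iz]; apply: Q'I; split=> //.
    apply: Q'D => //; have [|_ H] := @Ck b k.+1; last by rewrite mulrC.
    split=> //; have -> : a ^+ k.+1 * b = a * (q + b * a ^+ k) - a * q by rewrite exprS; ring.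
    apply: (@idealB _ O) => //; last exact: Q'M.
    by apply: JQ'; apply: idaddr => //; exact: mem_idmul.
  - by apply: idaddl => //; case: iA.
  - by apply: idaddr => //; exists 1 => //; rewrite mul1r.
have [s ns nsub] := nO idn.
have [|x nx|N HN] := @idpow_sub_of_nilpotent s n Q' idn iQ'.
- by move=> a /ns na; split; [exact: nO'|exact: powQ'].
- by apply: (idl_mono (S := [set x | x \in s])) => [y|]; [right|exact: nsub].
(* Since [n^N] lies in [Q'], so does [I]; hence [I] is contained in [Q + n I] and Nakayama's lemma
   applies. *)
have IJ0 : I `<=` J0.
  move=> x Ix; apply: Q'I; split=> //; have [q Qq [y /HN Hy ->]] := Ix N.
  by apply: Q'D => //; apply: JQ'; apply: idaddl => //; case: inI.
have [t It Isub] := nO iI.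
have E : idl O (Q `|` [set x | x \in t]) = I.
  rewrite predeqE => x; split; last first.
    by move/Isub; apply: idl_mono => y; right.
  apply: idl_sub => // y [Qy|]; last exact: It.
  by move=> N'; apply: idaddl => //; case: (idpow_ideal N' sO idn).
have [||c nc Hc] := @nakayama t n Q idn iQ.
- by move=> a /It; exact: IO.
- by rewrite E.
by exists c => //; apply: Hc; rewrite E.
Qed.

End Krull.

(** * Noetherian algebras and the Nullstellensatz *)

Section HilbertBasis.
Variable R : comNzRingType.
Hypothesis nR : noeth [set: R].

(** The ideals [L J d] of coefficients of [X^d] in the elements of [J] of degree at most [d] grow
    with [d], and for [J = I] they are all contained in [L I D] for some [D]. Polynomials that
    realize generators of [L I d] for [d <= D] then generate [I], by lowering the degree. *)
Lemma hilbert_basis : noeth [set: {poly R}].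
Proof.
move=> I iI; have [_ I0 ID IM] := iI.
pose L (J : set {poly R}) d := [set a | exists q, [/\ J q, (size q <= d.+1)%N & q`_d = a]].
have iL J d : ideal setT J -> ideal setT (L J d).
  move=> [_ J0 JD JM]; split=> //; first by exists 0; rewrite size_poly0 coef0.
  - move=> _ _ [p [Jp sp <-]] [q [Jq sq <-]]; exists (p + q); split; [exact: JD| |exact: coefD].
    by rewrite (leq_trans (size_polyD _ _)) // geq_max sp.
  - move=> a _ _ [p [Jp sp <-]]; exists (a%:P * p); split; [exact: JM| |exact: coefCM].
    by rewrite mul_polyC (leq_trans (size_scale_leq _ _)).
have Lmono J d d' : ideal setT J -> (d <= d')%N -> L J d `<=` L J d'.
  move=> [_ _ _ JM] dd _ [p [Jp sp <-]]; exists ('X^(d' - d) * p); split; first exact: JM.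
    have [->|p0] := eqVneq p 0; first by rewrite mulr0 size_poly0.
    rewrite (leq_trans (size_polyMleq _ _)) // size_polyXn; lia.
  by rewrite coefXnM; case: ltnP => [?|_]; [lia|congr (_`_ _); lia].
have Lfin d : exists2 s : seq {poly R}, (forall x, x \in s -> I x) &
    forall J, ideal setT J -> (forall x, x \in s -> J x) -> L I d `<=` L J d.
  have [s sL Ls] := nR (iL I d iI).
  have [t tI ts] : exists2 t : seq {poly R}, (forall x, x \in t -> I x) &
      forall J, (forall x, x \in t -> J x) -> forall a, a \in s -> L J d a.
    elim: s sL {Ls} => [|a s IH] sL; first by exists [::].
    have [|t tI ts] := IH; first by move=> b bs; apply: sL; rewrite inE bs orbT.
    have [p [Ip sp pd]] := sL a (mem_head _ _).
    exists (p :: t); first by move=> x; rewrite inE => /orP[/eqP ->|/tI].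
    move=> J Jt b; rewrite inE => /orP[/eqP ->|bs].
      by exists p; split=> //; apply: Jt; exact: mem_head.
    by apply: ts => // x xt; apply: Jt; rewrite inE xt orbT.
  by exists t => // J iJ Jt a /Ls; apply; [exact: iL|exact: ts].
have iU : ideal setT [set a | exists d, L I d a].
  split=> //; first by exists 0%N; case: (iL I 0%N iI).
  - move=> a b [d Ha] [e Hb]; exists (maxn d e).
    case: (iL I (maxn d e) iI) => _ _ D _.
    by apply: D; [apply: (Lmono I d) => //; exact: leq_maxl|apply: (Lmono I e) => //; exact: leq_maxr].
  - by move=> a b _ [d Hb]; exists d; case: (iL I d iI) => _ _ _; apply.
have [s sL Ls] := nR iU.
have [D HD] : exists D, forall a, a \in s -> L I D a.
  elim: s sL {Ls} => [|a s IH] sL; first by exists 0%N.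
  have [|D HD] := IH; first by move=> b bs; apply: sL; rewrite inE bs orbT.
  have [d Hd] := sL a (mem_head _ _); exists (maxn d D) => b.
  rewrite inE => /orP[/eqP ->|/HD Hb].
    by apply: (Lmono I d) => //; exact: leq_maxl.
  by apply: (Lmono I D) => //; exact: leq_maxr.
have LD d : L I d `<=` L I D.
  by move=> a Ha; apply: (Ls a); [exists d|exact: iL|exact: HD].
have [t tI Ht] : exists2 t : seq {poly R}, (forall x, x \in t -> I x) &
    forall J, ideal setT J -> (forall x, x \in t -> J x) ->
    forall d, (d <= D)%N -> L I d `<=` L J d.
  elim: (D) => [|e [t tI Ht]].
    have [t tI Ht] := Lfin 0%N; exists t => // J iJ Jt d.
    by rewrite leqn0 => /eqP ->; exact: Ht.
  have [t' tI' Ht'] := Lfin e.+1; exists (t ++ t').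
    by move=> x; rewrite mem_cat => /orP[/tI|/tI'].
  move=> J iJ Jt d; rewrite leq_eqVlt => /orP[/eqP ->|de].
    by apply: Ht' => // x xt; apply: Jt; rewrite mem_cat xt orbT.
  by apply: Ht => // x xt; apply: Jt; rewrite mem_cat xt.
exists t => // p Ip J iJ Jt; have [_ J0 JD JM] := iJ.
have iIJ : ideal setT (I `&` J).
  split=> // [x y [Ix Jx] [Iy Jy]|a x _ [Ix Jx]]; first by split; [exact: ID|exact: JD].
  by split; [exact: IM|exact: JM].
have LJ d : L I d `<=` L (I `&` J) d.
  have Ht' x : x \in t -> (I `&` J) x by move=> xt; split; [exact: tI|exact: Jt].
  have [dD|/ltnW Dd] := leqP d D; first exact: Ht.
  by move=> a /LD /(Ht _ iIJ Ht' D (leqnn _)); exact: Lmono.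
elim: {p}(size p) {-2}p (leqnn (size p)) Ip => [|d IH] p.
  by rewrite leqn0 size_poly_eq0 => /eqP -> _.
move=> sp Ip; have [|q [[Iq Jq] sq qd]] := LJ d p`_d; first by exists p.
suff Jpq : J (p - q) by rewrite -(subrK q p); exact: JD.
apply: IH.
  apply/leq_sizeP => i; rewrite leq_eqVlt coefB => /orP[/eqP <-|di].
    by rewrite qd subrr.
  by rewrite !nth_default ?subrr // ?(leq_trans sp) ?(leq_trans sq).
by rewrite -mulN1r; apply: ID => //; exact: IM.
Qed.

End HilbertBasis.

Lemma ex_minimal_nat (Q : nat -> Prop) : (exists n, Q n) ->
  exists n, Q n /\ forall m, (m < n)%N -> ~ Q m.
Proof.
move=> [n Qn]; have E : exists n, `[<Q n>] by exists n; apply/asboolP.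
exists (ex_minn E); case: ex_minnP => m /asboolP Qm mmin; split=> // k km Qk.
by have := mmin k; rewrite leqNgt km => /(_ (asboolT Qk)).
Qed.

Definition prime_ideal (R : comPzRingType) (P : set R) :=
  [/\ ideal setT P, ~ P 1 & forall a b, P (a * b) -> P a \/ P b].

Lemma pseudo_division (R : comNzRingType) (p d : {poly R}) : d != 0 ->
  exists k (q r : {poly R}), [/\ (size r < size d)%N,
    lead_coef d ^+ k *: p = q * d + r & r = (lead_coef d ^+ k)%:P * p - q * d].
Proof.
move=> d0; exists (Pdiv.Ring.rscalp p d), (Pdiv.Ring.rdivp p d), (Pdiv.Ring.rmodp p d).
have E := Pdiv.ComRing.rdivp_eq d p; split=> //.
  by have := Pdiv.CommonRing.ltn_rmodp p d; rewrite d0 => H; exact: H.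
by rewrite mul_polyC E addrC addKr.
Qed.

(** * The Nullstellensatz: adjoining one variable *)

Section NullstellensatzStep.
Variables (R : comNzRingType) (K : closedFieldType).
Variable P : set {poly R}.
Hypothesis primeP : prime_ideal P.

Let p : set R := [set a | P a%:P].
Let iP : ideal setT P. Proof. by case: primeP. Qed.
Let P0 : P 0. Proof. by case: iP. Qed.
Let PD (x y : {poly R}) : P x -> P y -> P (x + y). Proof. by case: iP => _ _ D _; exact: D. Qed.
Let PM (a x : {poly R}) : P x -> P (a * x). Proof. by case: iP => _ _ _ M; exact: M. Qed.
Let PMr (a x : {poly R}) : P x -> P (x * a). Proof. by rewrite mulrC; exact: PM. Qed.
Let PB (x y : {poly R}) : P x -> P y -> P (x - y).
Proof. by move=> Px Py; apply: PD => //; rewrite -mulN1r; exact: PM. Qed.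
Let PMM (a b : {poly R}) : P (a * b) -> P a \/ P b. Proof. by case: primeP => _ _; apply. Qed.

Let pprime a b : p (a * b) -> p a \/ p b.
Proof. by rewrite /p /= polyCM; exact: PMM. Qed.
Let pM a b : p b -> p (a * b). Proof. by rewrite /p /= polyCM; exact: PM. Qed.
Let p0 : p 0. Proof. by rewrite /p /= polyC0. Qed.
Let pD a b : p a -> p b -> p (a + b). Proof. by rewrite /p /= polyCD; exact: PD. Qed.
Let pB a b : p a -> p b -> p (a - b). Proof. by rewrite /p /= polyCB; exact: PB. Qed.
Let pX a k : p (a ^+ k) -> p a.
Proof.
elim: k => [|k IH]; last by rewrite exprS => /pprime[|/IH].
by rewrite expr0 /p /= polyC1; case: primeP.
Qed.
Let iprime : prime_ideal p.
Proof.
split; [split=> //|by rewrite /p /= polyC1; case: primeP|exact: pprime].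
by move=> a x _; exact: pM.
Qed.

Let coefsP (q : {poly R}) : (forall i, p q`_i) -> P q.
Proof.
move=> Hq; rewrite -[q]coefK poly_def; apply: (big_ind P) => // i _.
by rewrite -mul_polyC; apply: PMr; exact: Hq.
Qed.

(** Leading terms with coefficients in [p] are dropped until the leading coefficient is outside [p];
    this changes the polynomial by an element of [P]. *)
Let trim (q : {poly R}) : ~ (forall i, p q`_i) ->
  exists q', [/\ forall i, p (q - q')`_i, ~ p (lead_coef q') & (size q' <= size q)%N].
Proof.
elim: {q}(size q) {-2}q (leqnn (size q)) => [|n IH] q sq Hq.
  by case: Hq => i; rewrite nth_default // (leq_trans sq).
have [pl|npl] := pselect (p (lead_coef q)); last first.
  by exists q; split=> // i; rewrite subrr coef0.
pose q1 := take_poly n q.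
have E i : p (q - q1)`_i.
  rewrite coefB coef_take_poly; case: ltnP => [_|ni]; first by rewrite subrr.
  rewrite subr0; move: ni; rewrite leq_eqVlt => /orP[/eqP <-|ni].
    have [sqn|sqn] := leqP (size q) n; first by rewrite nth_default.
    by have -> : n = (size q).-1 by lia.
  by rewrite nth_default // (leq_trans sq).
have [||q' [H1 H2 H3]] := IH q1; first by rewrite /q1 size_take_poly.
  move=> H; apply: Hq => i; rewrite -(subrK q1 q) coefD; apply: pD => //.
exists q'; split=> // [i|]; first by rewrite -(subrK q1 q) -addrA coefD; apply: pD.
apply: leq_trans H3 _; have [sqn|] := leqP (size q) n.
  by rewrite /q1 take_poly_id.
by move=> /ltnW; apply: leq_trans; rewrite /q1 size_take_poly.
Qed.

Variables (H : set {rmorphism R -> K}) (F : {poly R}).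
Hypothesis nsR : forall P : set R, prime_ideal P -> forall f, ~ P f ->
  exists2 phi, H phi & (forall a, P a -> phi a = 0) /\ phi f != 0.
Hypothesis nPF : ~ P F.

(** If all coefficients of elements of [P] are in [p], take [phi] nonzero at a coefficient of [F]
    and [x] off the roots of the image of [F]. Otherwise let [G] in [P] have least degree among the
    elements with leading coefficient outside [p]. Some multiple of [F] is congruent modulo [P] to
    an element congruent to a constant [c] outside [p]; take [phi] nonzero at [lead_coef G * c] and
    [x] a root of the image of [G]. Pseudo-division by [G] makes [P] vanish there, so [F] does
    not. *)
Lemma nullstellensatz_step : exists2 phi, H phi & exists x,
  (forall q, P q -> (map_poly phi q).[x] = 0) /\ (map_poly phi F).[x] != 0.
Proof.
have mapp0 (phi : {rmorphism R -> K}) (q : {poly R}) : (forall a, p a -> phi a = 0) ->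
    (forall i, p q`_i) -> map_poly phi q = 0.
  by move=> Hphi Hq; apply/polyP => i; rewrite coef_map coef0 /= Hphi.
have [allp|] := pselect (forall G : {poly R}, P G -> forall i, p G`_i).
  have /existsNP[i npi] : ~ forall i, p F`_i by move=> /coefsP.
  have [phi Hphi [phi0 phii]] := nsR iprime npi.
  have : map_poly phi F != 0.
    by apply: contraNneq phii => F0; rewrite -coef_map F0 coef0.
  move=> /closed_nonrootP[x]; rewrite /root => Fx; exists phi => //; exists x; split=> //.
  by move=> q /allp Hq; rewrite mapp0 ?horner0.
move=> /existsNP[G0 /not_implyP[PG0 nG0]].
have [G0' [HG0 lG0 _]] := trim nG0.
have PG0' : P G0' by rewrite -(subKr G0 G0'); apply: PB => //; exact: coefsP.
have [s [[G [PG lG sG]] smin]] := @ex_minimal_nat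
  (fun s => exists G : {poly R}, [/\ P G, ~ p (lead_coef G) & size G = s])
  (ex_intro _ _ (ex_intro _ G0' (And3 PG0' lG0 erefl))).
have Gmin (q : {poly R}) : P q -> (size q < size G)%N -> forall i, p q`_i.
  move=> Pq sq; apply: contrapT => /trim[q' [Hq' lq' sq']].
  apply: (smin (size q')); first by rewrite -sG (leq_ltn_trans sq').
  by exists q'; split=> //; rewrite -(subKr q q'); apply: PB => //; exact: coefsP.
have G_neq0 : G != 0 by apply/eqP => G0'0; apply: lG; rewrite G0'0 lead_coef0.
(* [FP] is the ideal generated by [P] and [F]. An element [r] of least degree in it, outside [P] and
   with leading coefficient outside [p], is constant: dividing [r] by [G], then [G] by [r], one
   compares degrees, as every element of [FP] of smaller degree is in [P]. *)
pose FP (q : {poly R}) := exists h : {poly R}, P (q - h * F).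
have FPB (q q' a b : {poly R}) : FP q -> FP q' -> FP (a * q - b * q').
  move=> [h Hh] [h' Hh']; exists (a * h - b * h').
  have -> : a * q - b * q' - (a * h - b * h') * F = a * (q - h * F) - b * (q' - h' * F) by ring.
  by apply: PB; exact: PM.
have FPP q : P q -> FP q by exists 0; rewrite mul0r subr0.
have ncF : ~ forall i, p F`_i by move=> /coefsP.
have [F' [HF' lF' _]] := trim ncF.
have nPF' : ~ P F' by move=> PF'; apply: nPF; rewrite -(subrK F' F); apply: PD => //; exact: coefsP.
have FPF' : FP F'.
  by exists 1; rewrite mul1r -opprB -mulN1r; apply: PM; exact: coefsP.
have [t [[r [FPr nPr lr sr]] tmin]] := @ex_minimal_nat
  (fun s => exists q : {poly R}, [/\ FP q, ~ P q, ~ p (lead_coef q) & size q = s])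
  (ex_intro _ _ (ex_intro _ F' (And4 FPF' nPF' lF' erefl))).
have rmin (q : {poly R}) : FP q -> (size q < size r)%N -> P q.
  move=> FPq sq; apply: contrapT => nPq.
  have ncq : ~ forall i, p q`_i by move=> /coefsP.
  have [q' [Hq' lq' sq']] := trim ncq.
  apply: (tmin (size q')); first by rewrite -sr (leq_ltn_trans sq').
  exists q'; split=> //; last first.
    by move=> Pq'; apply: nPq; rewrite -(subrK q' q); apply: PD => //; exact: coefsP.
  have -> : q' = 1 * q - 1 * (q - q') by ring.
  by apply: FPB => //; apply: FPP; exact: coefsP.
have r_neq0 : r != 0 by apply/eqP => r0; apply: nPr; rewrite r0.
have sizerG : (size r <= size G)%N.
  rewrite leqNgt; apply/negP => Gr.
  have [k [Q [r' [sr' E Er']]]] := pseudo_division r G_neq0.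
  have Pr' : P r' by apply: rmin; [rewrite Er'; apply: FPB => //; exact: FPP|exact: ltn_trans Gr].
  have : P ((lead_coef G ^+ k)%:P * r).
    by rewrite -(subrK (Q * G) (_ * r)) -Er'; apply: PD => //; exact: PM.
  by case/PMM => // /pX.
have [c cr npc] : exists2 c, r = c%:P & ~ p c.
  have [k [Q [r' [sr' E Er']]]] := pseudo_division G r_neq0.
  have Pr' : P r' by apply: rmin => //; rewrite Er'; apply: FPB => //; exact: FPP.
  have PQ : P Q.
    suff : P (Q * r) by case/PMM.
    have -> : Q * r = (lead_coef r ^+ k)%:P * G - r' by rewrite Er'; ring.
    by apply: PB => //; exact: PM.
  have /trim[Q' [HQ' lQ' sQ']] : ~ forall i, p Q`_i.
    move=> HQ; have : p ((lead_coef r ^+ k) * lead_coef G).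
      rewrite -coefZ E coefD [r'`_ _]nth_default; last by rewrite -ltnS prednK ?size_poly_gt0 // (leq_trans sr').
      rewrite addr0 coefM; apply: (big_ind p) => // i _; rewrite mulrC; exact: pM.
    by case/pprime => // /pX.
  have PQ' : P Q' by rewrite -(subKr Q Q'); apply: PB => //; exact: coefsP.
  have sGQ : (size G <= size Q')%N by rewrite leqNgt; apply/negP => /(Gmin _ PQ'); move=> /(_ (size Q').-1).
  have Q'0 : Q' != 0 by apply/eqP => Q'0; apply: lQ'; rewrite Q'0 lead_coef0.
  suff s1 : (size r <= 1)%N.
    have [c rc] : exists c, r = c%:P by exists r`_0; exact: size1_polyC.
    by exists c => //; move: lr; rewrite rc lead_coefC.
  pose j := ((size Q').-1 + (size r).-1)%N.
  have : ~ p ((lead_coef r ^+ k) * G`_j).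
    rewrite -coefZ E coefD [r'`_ _]nth_default; last first.
      by rewrite /j (leq_trans _ (leq_addl _ _)) // -ltnS prednK ?size_poly_gt0.
    rewrite addr0 -(subrK Q' Q) mulrDl coefD => Hp.
    have : p ((Q' * r)`_j).
      rewrite -[(Q' * r)`_j](addKr ((Q - Q') * r)`_j) addrC; apply: pB => //.
      by rewrite coefM; apply: (big_ind p) => // i _; rewrite mulrC; exact: pM.
    have -> : j = (size Q' + size r).-2 by rewrite /j; move: (size_poly_gt0 Q') (size_poly_gt0 r); rewrite Q'0 r_neq0; lia.
    by rewrite -mul_lead_coef => /pprime[].
  move=> npj; have : ~~ (size G <= j)%N.
    by apply/negP => /(nth_default 0) G0'0; apply: npj; rewrite G0'0 mulr0.
  by rewrite /j; move: (size_poly_gt0 G) (size_poly_gt0 r); rewrite G_neq0 r_neq0; lia.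
have [h Hh] := FPr.
have npgc : ~ p (lead_coef G * c) by case/pprime.
have [phi Hphi [phi0]] := nsR iprime npgc; rewrite rmorphM mulf_eq0 negb_or => /andP[phig phic].
have : size (map_poly phi G) != 1%N.
  rewrite size_map_poly_id0 //; apply/eqP => /eqP/size_poly1P[g g0 Gg].
  by apply: lG; rewrite Gg lead_coefC; rewrite /p /= -Gg.
move=> /closed_rootP[x /rootP Gx].
have Px q : P q -> (map_poly phi q).[x] = 0.
  move=> Pq; have [k [Q [r' [sr' E Er']]]] := pseudo_division q G_neq0.
  have Pr' : P r'.
    by rewrite Er'; apply: PB; exact: PM.
  have E' : (lead_coef G ^+ k)%:P * q = Q * G + r' by rewrite mul_polyC.
  have : map_poly phi ((lead_coef G ^+ k)%:P * q) = map_poly phi Q * map_poly phi G + 0.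
    by rewrite E' -(mapp0 phi r' phi0 (Gmin _ Pr' sr')) rmorphD rmorphM.
  rewrite addr0 rmorphM /= map_polyC /= rmorphXn => /(congr1 (fun f => f.[x])).
  rewrite !hornerM hornerC Gx mulr0.
  by move/eqP; rewrite mulf_eq0 expf_eq0 (negbTE phig) andbF => /eqP.
exists phi => //; exists x; split=> //.
have := Px _ Hh; rewrite rmorphB rmorphM cr /= map_polyC hornerD hornerN hornerM hornerC.
by move/eqP; apply: contraTneq => ->; rewrite mulr0 subr0.
Qed.

End NullstellensatzStep.

Lemma exists_prime_ideal (R : comPzRingType) (I : set R) : ideal setT I -> ~ I 1 ->
  exists2 P, prime_ideal P & I `<=` P.
Proof.
move=> iI nI1; have sT : subring [set: R] by [].
pose F := [set X : set R | [/\ ideal setT X, I `<=` X & ~ X 1]].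
have [||C [X0 CX0] CF Ctot|P [iP IP nP1] Pmax] := @noeth_maximal R setT F I.
- by move=> X [].
- by split=> // x.
- split; last by move=> [X CX X1]; case: (CF X CX).
    have [iX0 _ _] := CF _ CX0; split=> //; first by exists X0 => //; case: iX0.
    + move=> x y [X CX Xx] [Y CY Yy].
      case: (Ctot X Y CX CY) => [XY|YX].
        by exists Y => //; case: (CF Y CY) => -[_ _ D _] _ _; apply: D => //; exact: XY.
      by exists X => //; case: (CF X CX) => -[_ _ D _] _ _; apply: D => //; exact: YX.
    + by move=> a x Oa [X CX Xx]; exists X => //; case: (CF X CX) => -[_ _ _ M] _ _; exact: M.
  by move=> x Ix; exists X0 => //; case: (CF X0 CX0) => _ H _; exact: H.
have [_ P0 PD PM] := iP.
exists P => //; split=> // a b Pab.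
have main c : ~ P c -> exists x y, P x /\ 1 = x + y * c.
  move=> nPc; apply: contrapT => H.
  have iA : ideal setT [set x : R | exists2 b, [set: R] b & x = b * c].
    split=> //; first by exists 0; rewrite ?mul0r.
    - by move=> _ _ [x _ ->] [y _ ->]; exists (x + y); rewrite ?mulrDl.
    - by move=> x _ _ [y _ ->]; exists (x * y); rewrite ?mulrA.
  have [_ A0 _ _] := iA.
  apply: nPc; apply: (Pmax (idadd P [set x | exists2 b, [set: R] b & x = b * c])).
  - split; first exact: idadd_ideal.
      by move=> x /IP Px; exact: idaddl.
    by move=> [x Px [_ [y _ ->] E]]; apply: H; exists x, y.
  - exact: idaddl.
  - by apply: idaddr => //; exists 1; rewrite ?mul1r.
have [Pa|/main[x [y [Px E]]]] := pselect (P a); first by left.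
have [Pb|/main[x' [y' [Px' E']]]] := pselect (P b); first by right.
exfalso; apply: nP1; rewrite -(mul1r 1) {1}E E'.
have -> : (x + y * a) * (x' + y' * b) = x' * x + (y' * b) * x + (y * a) * x' + (y * y') * (a * b) by ring.
by do 3 (apply: (PD); last exact: PM); exact: PM.
Qed.

(** * Polynomials in several variables *)

Section IteratedPolynomials.
Variable K : closedFieldType.

(** Variables are adjoined one at a time, so that Hilbert's theorem and the Nullstellensatz follow
    by induction on their number. *)
Fixpoint ipoly m : comNzRingType := if m is m'.+1 then ({poly ipoly m'} : comNzRingType) else K.

Fixpoint ipoint m : Type := if m is m'.+1 then (ipoint m' * K)%type else unit.

Fixpoint ieval m : ipoint m -> {rmorphism ipoly m -> K} :=
  match m with
  | 0 => fun _ => idfun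
  | m'.+1 => fun x => (horner_eval x.2 \o map_poly (ieval x.1))%FUN
  end.

Lemma noeth_ipoly m : noeth [set: ipoly m].
Proof.
elim: m => [|m IH]; last exact: hilbert_basis.
move=> I [_ I0 ID IM]; have [H|] := pselect (forall x, I x -> x = 0).
  by exists [::] => // x /H ->; move=> J [].
move=> /existsNP[x /not_implyP[Ix /eqP x0]]; exists [:: x] => [y|y _ J [_ _ _ JM] HJ].
  by rewrite inE => /eqP ->.
rewrite -[y](divfK x0); apply: JM => //; apply: HJ; exact: mem_head.
Qed.

Lemma ipoly_nullstellensatz m (P : set (ipoly m)) f : prime_ideal P -> ~ P f ->
  exists x : ipoint m, (forall p, P p -> ieval x p = 0) /\ ieval x f != 0.
Proof.
elim: m P f => [|m IH] P f pP nPf /=.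
  have [[_ P0 _ PM] nP1 _] := pP; exists tt; split.
    move=> p Pp; apply/eqP/negP => /negP p0; apply: nP1.
    by rewrite -(mulVf (p0 : (p : K) != 0)); exact: PM.
  by apply/eqP => f0; apply: nPf; rewrite -[f]/(f : K) /= f0.
have [|phi [x _ <-] [t [Ht1 Ht2]]] := @nullstellensatz_step _ K P pP (range (@ieval m)) f _ nPf.
  by move=> Q pQ g nQg; have [x [Hx1 Hx2]] := IH Q g pQ nQg; exists (ieval x); [exists x|].
by exists (x, t).
Qed.

Variable P : Type.

Fixpoint mkpoint m (y : nat -> P -> K) (p : P) : ipoint m :=
  if m is m'.+1 then (mkpoint m' y p, y m' p) else tt.

Definition ievalf m (y : nat -> P -> K) (q : ipoly m) : P -> K := fun p => ieval (mkpoint m y p) q.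

Lemma ievalf_alg m y (q : ipoly m) S : (forall i, (i < m)%N -> S (y i)) -> alg_gen S (ievalf y q).
Proof.
elim: m q => [|m IH] q HS; first exact: AlgCst.
have IHm q' : alg_gen S (ievalf y (q' : ipoly m)) by apply: IH => i im; apply: HS; lia.
rewrite /ipoly /= in q *; elim/poly_ind: q => [|q c IHq].
  have -> : ievalf (m := m.+1) y 0 = fun=> 0 by apply/funext => p; rewrite /ievalf rmorph0.
  exact: AlgCst.
rewrite /ievalf /= /horner_eval.
have -> : (fun p : P => (map_poly (ieval (mkpoint m y p)) (q * 'X + c%:P)).[y m p]) =
    (fun p => ievalf (m := m.+1) y q p * y m p + ievalf y c p).
  apply/funext => p; rewrite rmorphD rmorphM /= map_polyX map_polyC /=.
  by rewrite hornerD hornerM hornerX hornerC.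
by apply: AlgAdd => //; apply: AlgMul => //; apply: AlgGen; apply: HS.
Qed.

Lemma alg_ievalf m y (f : P -> K) :
  alg_gen [set g | exists2 i, (i < m)%N & g = y i] f -> exists q : ipoly m, f = ievalf y q.
Proof.
have gen i : (i < m)%N -> exists q : ipoly m, y i = ievalf y q.
  elim: m => // m IH; rewrite ltnS leq_eqVlt => /orP[/eqP ->|/IH[q ->]].
    by exists 'X; apply/funext => p; rewrite /ievalf /= /horner_eval map_polyX hornerX.
  by exists q%:P; apply/funext => p; rewrite /ievalf /= /horner_eval map_polyC hornerC.
elim=> {f} [_ [i im ->]|c|f g _ [q ->] _ [r ->]|f g _ [q ->] _ [r ->]].
- exact: gen.
- elim: m {gen} => [|m [q Hq]]; first by exists c.
  by exists q%:P; rewrite Hq; apply/funext => p; rewrite /ievalf /= /horner_eval map_polyC hornerC.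
- by exists (q + r); apply/funext => p; rewrite /ievalf rmorphD.
- by exists (q * r); apply/funext => p; rewrite /ievalf rmorphM.
Qed.

End IteratedPolynomials.

Section AlgGen.
Variables (K : closedFieldType) (P : Type).
Implicit Types (S O : set (P -> K)) (f g : P -> K).

Lemma subring_alg_gen S : subring (alg_gen S).
Proof.
split=> [|f g Hf Hg|f g]; [exact: AlgCst| |exact: AlgMul].
have -> : f - g = (fun p => f p + (fun p => (fun=> -1) p * g p) p).
  by apply/funext => p; rewrite mulN1r.
by apply: AlgAdd => //; apply: AlgMul => //; exact: AlgCst.
Qed.

Lemma alg_gen_sub S S' : S `<=` alg_gen S' -> alg_gen S `<=` alg_gen S'.
Proof.
move=> SS' f; elim=> {f} [f /SS'//|c|f g _ Hf _ Hg|f g _ Hf _ Hg].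
- exact: AlgCst.
- exact: AlgAdd.
- exact: AlgMul.
Qed.

(** A homomorphism of algebras from [O] to [K]. It is a function on all of [P -> K], so the laws are
    only required on [O]. *)
Definition alg_char O (phi : (P -> K) -> K) :=
  [/\ forall c, phi (fun=> c) = c,
      forall f g, O f -> O g -> phi (f + g) = phi f + phi g
    & forall f g, O f -> O g -> phi (f * g) = phi f * phi g].

Variables (m : nat) (y : 'I_m -> P -> K).
Let O := alg_gen (range y).

Let y' (i : nat) : P -> K := if insub i is Some j then y j else 0.

Let rangeE : range y = [set g | exists2 i, (i < m)%N & g = y' i].
Proof.
rewrite predeqE => f; split=> [[i _ <-]|[i im ->]].
  by exists i => //; rewrite /y' valK.
by rewrite /y' insubT; exists (Ordinal im).
Qed.

Let OE f : O f <-> exists q : ipoly K m, f = ievalf y' q.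
Proof.
rewrite /O rangeE; split; first exact: alg_ievalf.
by move=> [q ->]; apply: ievalf_alg => i im; exists i.
Qed.

Let pull (I : set (P -> K)) : set (ipoly K m) := [set q | I (ievalf y' q)].

Let ievalfD q r : ievalf y' (q + r) = ievalf y' q + ievalf (m := m) y' r.
Proof. by apply/funext => p; rewrite /ievalf rmorphD. Qed.
Let ievalfM q r : ievalf y' (q * r) = ievalf y' q * ievalf (m := m) y' r.
Proof. by apply/funext => p; rewrite /ievalf rmorphM. Qed.

Let pull_ideal I : ideal O I -> ideal setT (pull I).
Proof.
move=> [IO I0 ID IM]; split=> //.
- rewrite /pull /=; have -> // : ievalf y' (0 : ipoly K m) = 0.
  by apply/funext => p; rewrite /ievalf rmorph0.
- by move=> q r; rewrite /pull /= ievalfD; exact: ID.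
- by move=> q r _; rewrite /pull /= ievalfM; apply: IM; apply/OE; exists q.
Qed.

Lemma noeth_alg_gen : noeth (alg_gen (range y)).
Proof.
move=> I iI; have [s sI Hs] := noeth_ipoly (pull_ideal iI).
exists [seq ievalf y' q | q <- s]; first by move=> _ /mapP[q /sI Iq ->].
move=> f If J iJ HJ; case: (iI) => IO _ _ _.
have [q Ef] := (OE f).1 (IO f If); rewrite Ef.
suff : pull J q by [].
apply: (Hs q); [by rewrite /pull /= -Ef|exact: pull_ideal|].
by move=> r rs; apply: HJ => /=; apply: map_f.
Qed.

(** Pulled back to a polynomial ring, the ideal lies in a prime, which has a zero. The relations
    between the [y i] are in the pullback, so evaluation at this zero factors through the algebra of
    functions. *)
Lemma alg_gen_nullstellensatz (I : set (P -> K)) : ideal (alg_gen (range y)) I -> ~ I 1 ->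
  exists phi, alg_char (alg_gen (range y)) phi /\ forall f, I f -> phi f = 0.
Proof.
move=> iI nI1; have [|Q pQ IQ] := exists_prime_ideal (pull_ideal iI).
  rewrite /pull /=; have -> // : ievalf y' (1 : ipoly K m) = 1.
  by apply/funext => p; rewrite /ievalf rmorph1.
have nQ1 : ~ Q 1 by case: pQ.
have [x [Qx _]] := ipoly_nullstellensatz pQ nQ1.
have [IO I0 _ _] := iI.
have wd q r : ievalf y' q = ievalf y' r -> ieval x q = ieval x r :> K.
  move=> E; apply/eqP; rewrite -subr_eq0 -rmorphB; apply/eqP/Qx/IQ; rewrite /pull /=.
  have -> // : ievalf y' (q - r) = 0.
  by apply/funext => p; move/(congr1 (@^~ p)): E; rewrite /ievalf rmorphB => ->; rewrite subrr.
pose phi f : K := if pselect (exists q : ipoly K m, f = ievalf y' q) is left H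
  then ieval x (projT1 (cid H)) else 0.
have phiE q : phi (ievalf y' q) = ieval x q.
  rewrite /phi; case: pselect => [H|[]]; last by exists q.
  by apply: wd; rewrite -(projT2 (cid H)).
exists phi; split; last first.
  by move=> f If; have [q Ef] := (OE f).1 (IO f If); rewrite Ef phiE; apply/Qx/IQ; rewrite /pull /= -Ef.
split=> [c|f g /OE[q ->] /OE[r ->]|f g /OE[q ->] /OE[r ->]].
- have [q Hq] : exists q : ipoly K m, (forall z, ieval z q = c).
    elim: (m) => [|k [q Hq]]; first by exists c.
    by exists q%:P => z /=; rewrite /horner_eval map_polyC hornerC /= Hq.
  have -> : (fun=> c) = ievalf y' q by apply/funext => p; rewrite /ievalf Hq.
  by rewrite phiE Hq.
- by rewrite -ievalfD !phiE rmorphD.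
- by rewrite -ievalfM !phiE rmorphM.
Qed.

End AlgGen.

(** * Regular functions and affine coordinates *)

Lemma open_local (T : topologicalType) (W : set T) :
  (forall p, W p -> exists V, [/\ open V, V p & V `<=` W]) -> open W.
Proof.
move=> H; rewrite openE => p /H[V [oV Vp VW]].
by apply: (filterS VW); exact: open_nbhs_nbhs.
Qed.

Section Spaces.
Variable K : closedFieldType.
Implicit Types X Y : space K.

(** Formulated for an arbitrary subset, so that open sets, closed sets and fibre products are
    handled without forming subspaces. On an open set it agrees with [regular], by the sheaf
    property. *)
Definition reg_on X (Z : set X) (f : X -> K) := forall p, Z p ->
  exists V g, [/\ open V, V p, regular X V g & forall q, Z q -> V q -> f q = g q].

(** [is_sheaf] only concerns restriction and gluing. This adds that the regular functions form
    K-algebras, with open nonvanishing loci and regular inverses there; it holds for all spaces in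
    use, see [gen_ringed] and [ringed_variety]. *)
Record ringed X : Prop := Ringed {
  ringed_sheaf : is_sheaf X;
  ringed_cst : forall U c, open U -> regular X U (fun=> c);
  ringed_add : forall U f g, open U -> regular X U f -> regular X U g ->
    regular X U (fun x => f x + g x);
  ringed_mul : forall U f g, open U -> regular X U f -> regular X U g ->
    regular X U (fun x => f x * g x);
  ringed_inv : forall U f, open U -> regular X U f ->
    open (U `&` [set x | f x != 0]) /\
    regular X (U `&` [set x | f x != 0]) (fun x => (f x)^-1) }.

(** Continuity and regularity of pullbacks, both relative to [Z]; for [Z = setT] this is
    [is_morphism], by [morph_onT]. *)
Definition morph_on X (Z : set X) Y (f : X -> Y) := forall V, open V ->
  (forall p, Z p -> V (f p) -> exists W, [/\ open W, W p & forall q, Z q -> W q -> V (f q)]) /\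
  (forall g, regular Y V g -> reg_on (Z `&` f @^-1` V) (g \o f)).

Lemma reg_on_sub X (Z Z' : set X) f : Z' `<=` Z -> reg_on Z f -> reg_on Z' f.
Proof.
move=> ZZ H p /ZZ/H[V [g [oV Vp rg E]]]; exists V, g; split=> // q /ZZ; exact: E.
Qed.

Lemma reg_on_ext X (Z : set X) f g : (forall p, Z p -> f p = g p) -> reg_on Z f -> reg_on Z g.
Proof.
move=> fg H p Zp; have [V [h [oV Vp rh E]]] := H p Zp.
by exists V, h; split=> // q Zq Vq; rewrite -fg // E.
Qed.

Lemma regular_reg_on X (U : set X) f : open U -> regular X U f -> reg_on U f.
Proof. by move=> oU rf p Up; exists U, f. Qed.

Lemma reg_on_regular X (U : set X) f : is_sheaf X -> open U -> reg_on U f -> regular X U f.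
Proof.
by move=> [_ sX] oU H; apply: sX.
Qed.

Lemma reg_on_local X (Z : set X) f : is_sheaf X ->
  (forall p, Z p -> exists V, [/\ open V, V p & reg_on (Z `&` V) f]) -> reg_on Z f.
Proof.
move=> [sX _] H p Zp; have [V [oV Vp HV]] := H p Zp.
have [W [g [oW Wp rg E]]] := HV p (conj Zp Vp).
exists (W `&` V), g; split=> //; first exact: openI.
  by apply: (sX W) => //; exact: openI.
by move=> q Zq [Wq Vq]; apply: E.
Qed.

Section RingOps.
Variable X : space K.
Hypothesis rX : ringed X.
Let sX := ringed_sheaf rX.

Lemma reg_on_combine (Z : set X) f g (op : K -> K -> K) :
  (forall U a b, open U -> regular X U a -> regular X U b -> regular X U (fun x => op (a x) (b x))) ->
  reg_on Z f -> reg_on Z g -> reg_on Z (fun x => op (f x) (g x)).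
Proof.
move=> Hop Hf Hg p Zp.
have [V [a [oV Vp ra Ea]]] := Hf p Zp; have [W [b [oW Wp rb Eb]]] := Hg p Zp.
have oVW := openI oV oW.
exists (V `&` W), (fun x => op (a x) (b x)); split=> //.
  by apply: Hop => //; [apply: sX.1 ra|apply: sX.1 rb].
by move=> q Zq [Vq Wq]; rewrite Ea ?Eb.
Qed.

Lemma reg_on_add (Z : set X) f g : reg_on Z f -> reg_on Z g -> reg_on Z (fun x => f x + g x).
Proof. by apply: (reg_on_combine (op := +%R)) => U a b; exact: ringed_add. Qed.

Lemma reg_on_mul (Z : set X) f g : reg_on Z f -> reg_on Z g -> reg_on Z (fun x => f x * g x).
Proof. by apply: (reg_on_combine (op := *%R)) => U a b; exact: ringed_mul. Qed.

Lemma reg_on_cst (Z : set X) c : reg_on Z (fun=> c).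
Proof. by move=> p Zp; exists setT, (fun=> c); split=> //; [exact: openT|apply: ringed_cst => //; exact: openT]. Qed.

Lemma reg_on_nz (Z : set X) f p : reg_on Z f -> Z p -> f p != 0 ->
  exists V, [/\ open V, V p & forall q, Z q -> V q -> f q != 0].
Proof.
move=> Hf Zp fp; have [V [g [oV Vp rg E]]] := Hf p Zp.
have [oW _] := ringed_inv rX oV rg.
by exists (V `&` [set x | g x != 0]); split=> [//|/=|q Zq [Vq gq]]; rewrite -?E // E.
Qed.

Lemma reg_on_inv (Z : set X) f : reg_on Z f -> reg_on (Z `&` [set x | f x != 0]) (fun x => (f x)^-1).
Proof.
move=> Hf p [Zp /= fp]; have [V [g [oV Vp rg E]]] := Hf p Zp.
have [oW rW] := ringed_inv rX oV rg.
exists (V `&` [set x | g x != 0]), (fun x => (g x)^-1).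
by split=> [//|/=|//|q [Zq _] [Vq gq]]; rewrite -?E // E.
Qed.

Lemma reg_on_alg (Z : set X) (S : set (X -> K)) f :
  (forall g, S g -> reg_on Z g) -> alg_gen S f -> reg_on Z f.
Proof.
move=> HS; elim=> {f} [f /HS//|c|f g _ Hf _ Hg|f g _ Hf _ Hg].
- exact: reg_on_cst.
- exact: reg_on_add.
- exact: reg_on_mul.
Qed.

Lemma regular_open_nz (U : set X) f : open U -> regular X U f -> open (U `&` [set x | f x != 0]).
Proof. by move=> oU rf; case: (ringed_inv rX oU rf). Qed.

End RingOps.

Lemma morph_on_sub X (Z Z' : set X) Y (f : X -> Y) : Z' `<=` Z -> morph_on Z f -> morph_on Z' f.
Proof.
move=> ZZ H V oV; have [H1 H2] := H V oV; split=> [p /ZZ Zp Vp|g rg].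
  by have [W [oW Wp HW]] := H1 p Zp Vp; exists W; split=> // q /ZZ; exact: HW.
by apply: reg_on_sub (H2 g rg) => q [/ZZ].
Qed.

Lemma morph_on_ext X (Z : set X) Y (f g : X -> Y) :
  (forall p, Z p -> f p = g p) -> morph_on Z f -> morph_on Z g.
Proof.
move=> E H V oV; have [H1 H2] := H V oV; split=> [p Zp|h rh].
  rewrite -E // => Vp; have [W [oW Wp HW]] := H1 p Zp Vp.
  by exists W; split=> // q Zq Wq; rewrite -E //; exact: HW.
apply: (@reg_on_ext _ _ (h \o f)) => [p [Zp _]|]; first by rewrite /= E.
by apply: reg_on_sub (H2 h rh) => q [Zq /=]; rewrite -E.
Qed.

Lemma morph_on_reg X (Z : set X) Y (Z' : set Y) (f : X -> Y) g : is_sheaf X ->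
  morph_on Z f -> (forall p, Z p -> Z' (f p)) -> reg_on Z' g -> reg_on Z (g \o f).
Proof.
move=> sX Hf ZZ Hg p Zp; have [V [h [oV Vp rh E]]] := Hg _ (ZZ _ Zp).
have [H1 H2] := Hf V oV; have [W [oW Wp HW]] := H1 p Zp Vp.
have [W' [k [oW' W'p rk Ek]]] := H2 h rh p (conj Zp Vp).
exists (W `&` W'), k; split=> //; first exact: openI.
  by apply: sX.1 rk => //; exact: openI.
move=> q Zq [Wq W'q] /=; rewrite -Ek //; last by split=> //; exact: HW.
by apply: E; [exact: ZZ|exact: HW].
Qed.

Lemma morph_on_comp X (Z : set X) Y (Z' : set Y) (T : space K) (f : X -> Y) (g : Y -> T) : is_sheaf X ->
  morph_on Z f -> (forall p, Z p -> Z' (f p)) -> morph_on Z' g -> morph_on Z (g \o f).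
Proof.
move=> sX Hf ZZ Hg V oV; have [H1 H2] := Hg V oV; split=> [p Zp Vp|h rh].
  have [W [oW Wp HW]] := H1 (f p) (ZZ _ Zp) Vp.
  have [W' [oW' W'p HW']] := (Hf W oW).1 p Zp Wp.
  by exists W'; split=> // q Zq W'q; apply: HW; [exact: ZZ|exact: HW'].
have Hf' : morph_on (Z `&` (g \o f) @^-1` V) f by apply: morph_on_sub Hf => q [].
apply: (@morph_on_reg _ _ _ (Z' `&` g @^-1` V) f (h \o g)) => //; last exact: H2.
by move=> p [Zp Vp]; split=> //; exact: ZZ.
Qed.

Lemma morph_on_local X (Z : set X) Y (f : X -> Y) : is_sheaf X ->
  (forall p, Z p -> exists W, [/\ open W, W p & morph_on (Z `&` W) f]) -> morph_on Z f.
Proof.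
move=> sX H V oV; split=> [p Zp Vp|g rg].
  have [W [oW Wp HW]] := H p Zp; have [W' [oW' W'p HW']] := (HW V oV).1 p (conj Zp Wp) Vp.
  by exists (W `&` W'); split=> [||q Zq [Wq W'q]]; [exact: openI| |exact: HW'].
apply: reg_on_local => // p [Zp Vp]; have [W [oW Wp HW]] := H p Zp.
exists W; split=> //; apply: reg_on_sub ((HW V oV).2 g rg).
by move=> q [[Zq Vq] Wq].
Qed.

Lemma morph_on_id X (Z : set X) : morph_on Z (@id X).
Proof.
move=> V oV; split=> [p Zp Vp|g rg p [Zp Vp]]; first by exists V.
by exists V, g.
Qed.

Lemma morph_onT X Y (f : X -> Y) : is_sheaf X -> morph_on setT f <-> is_morphism f.
Proof.
move=> sX; split=> [H|[cf rf] V oV].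
  split.
    apply/continuousP => V oV; apply: open_local => p Vp.
    have [W [oW Wp HW]] := (H V oV).1 p I Vp.
    by exists W; split=> // q Wq; apply: HW.
  move=> V g oV rg; have [H1 H2] := H V oV; apply: reg_on_regular => //.
    apply: open_local => p Vp; have [W [oW Wp HW]] := H1 p I Vp.
    by exists W; split=> // q Wq; apply: HW.
  by apply: reg_on_sub (H2 g rg) => q; split.
have oV' : open (f @^-1` V) by move/continuousP: cf; apply.
split=> [p _ Vp|g rg]; first by exists (f @^-1` V).
apply: reg_on_sub (regular_reg_on oV' (rf V g oV rg)); exact: subIsetr.
Qed.

Lemma morph_onTW X Y (f : X -> Y) Z : is_sheaf X -> is_morphism f -> morph_on Z f.
Proof. by move=> sX /(morph_onT _ sX); apply: morph_on_sub. Qed.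

Section GenSpace.
Variables (P : Type) (C : set (set P * set (P -> K))).

(** This is what makes the principal sets of the charts a basis of the topology: around a common
    point two charts admit a third inside both, whose algebra contains the restrictions of theirs,
    so that fractions from different charts can be compared. *)
Definition directed :=
  (forall p : P, exists D S, C (D, S) /\ D p) /\
  (forall D S D' S' p, C (D, S) -> C (D', S') -> D p -> D' p -> exists D'' S'',
    [/\ C (D'', S''), D'' p, D'' `<=` D `&` D',
        forall f, S f -> exists2 g, alg_gen S'' g & forall q, D'' q -> f q = g q
      & forall f, S' f -> exists2 g, alg_gen S'' g & forall q, D'' q -> f q = g q]).

Lemma alg_gen_refine S S'' (D : set P) :
  (forall f, S f -> exists2 g, alg_gen S'' g & forall q, D q -> f q = g q) ->
  forall f : P -> K, alg_gen S f -> exists2 g, alg_gen S'' g & forall q, D q -> f q = g q.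
Proof.
move=> HS f; elim=> {f} [f /HS//|c|f g _ [f' Hf' Ef] _ [g' Hg' Eg]|f g _ [f' Hf' Ef] _ [g' Hg' Eg]].
- by exists (fun=> c) => //; exact: AlgCst.
- exists (fun x => f' x + g' x); first exact: AlgAdd.
  by move=> q Dq; rewrite Ef ?Eg.
- exists (fun x => f' x * g' x); first exact: AlgMul.
  by move=> q Dq; rewrite Ef ?Eg.
Qed.

Lemma gen_basic_open D S h : C (D, S) -> alg_gen S h ->
  @open (gen_type C) (D `&` [set p | h p != 0]).
Proof.
move=> CDS Sh; exists [set D `&` [set p | h p != 0]]; last by rewrite bigcup_set1.
by move=> _ ->; apply: (@finI_from1 _ _ (gen_basis C) (@id (set P))); exists D, S, h.
Qed.

Hypothesis dC : directed.

Lemma gen_base (W : set (gen_type C)) p : open W -> W p -> exists D S h,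
  [/\ C (D, S), alg_gen S h, D p, h p != 0 & forall q, D q -> h q != 0 -> W q].
Proof.
case=> D' D'fin <- [B D'B Bp]; have [F FB EB] := D'fin B D'B.
suff [D [S [h [H1 H2 H3 H4 H5]]]] : exists D S h, [/\ C (D, S), alg_gen S h, D p, h p != 0
    & forall q, D q -> h q != 0 -> B q].
  by exists D, S, h; split=> // q Dq hq; exists B => //; exact: H5.
have main : forall s : seq (set P), (forall A, A \in s -> gen_basis C A) -> (forall A, A \in s -> A p) ->
  exists D S h, [/\ C (D, S), alg_gen S h, D p, h p != 0
    & forall q, D q -> h q != 0 -> forall A, A \in s -> A q]; last first.
  have [|A AF|D [S [h [H1 H2 H3 H4 H5]]]] := main (finmap.enum_fset F).
  - by move=> A AF; exact: (set_mem (FB A AF)).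
  - by move: Bp; rewrite -EB => /(_ A AF).
  - exists D, S, h; split=> // q Dq hq; rewrite -EB => A AF; exact: (H5 q Dq hq A AF).
elim=> [|A s IH] {}FB {}Bp.
  have [D [S [CDS Dp]]] := dC.1 p; exists D, S, (fun=> 1).
  by split=> //; [exact: AlgCst|exact: oner_neq0].
have [||D [S [h [H1 H2 H3 H4 H5]]]] := IH.
- by move=> A' A's; apply: FB; rewrite inE A's orbT.
- by move=> A' A's; apply: Bp; rewrite inE A's orbT.
have [DA [SA [hA [CA HA EA]]]] := FB A (mem_head _ _).
have : A p by apply: Bp; exact: mem_head.
rewrite EA => -[/= DAp hAp].
have [D2 [S2 [C2 D2p sD2 ref1 ref2]]] := dC.2 _ _ _ _ _ H1 CA H3 DAp.
have [h' Hh' Eh'] := alg_gen_refine ref1 H2.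
have [hA' HhA' EhA'] := alg_gen_refine ref2 HA.
exists D2, S2, (fun q => h' q * hA' q); split=> //; first exact: AlgMul.
  by rewrite -Eh' // -EhA' // mulf_neq0.
move=> q D2q; rewrite mulf_eq0 negb_or => /andP[h'q hA'q].
have [Dq DAq] := sD2 q D2q.
move=> A'; rewrite inE => /orP[/eqP A'A|A's].
  by rewrite A'A; split=> //=; rewrite EhA'.
by apply: (H5 q Dq) A's; rewrite Eh'.
Qed.

(* Replacing [g / h] by [g k / (h k)] lets one shrink the domain of a fraction. *)
Lemma gen_regular_at (W : set (gen_type C)) f p : open W -> W p ->
  (exists V g, [/\ open V, V p, regular (gen_space C) V g & forall q, W q -> V q -> f q = g q]) <->
  exists D S g h, [/\ C (D, S), alg_gen S g, alg_gen S h, D p /\ h p != 0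
      & forall q, D q -> h q != 0 -> W q /\ f q = g q / h q].
Proof.
move=> oW Wp; split=> [[V [k [oV Vp rk E]]]|[D [S [g [h [CDS Sg Sh [Dp hp] E]]]]]]; last first.
  exists (D `&` [set p | h p != 0]), (fun q => g q / h q); split=> //.
  - exact: gen_basic_open Sh.
  - by move=> r [Dr hr]; exists D, S, g, h.
  - by move=> q Wq [Dq hq]; case: (E q Dq hq).
have [D [S [g [h [CDS Sg Sh [Dp hp] Ek]]]]] := rk p Vp.
have [D1 [S1 [h1 [C1 Sh1 D1p h1p H1]]]] := gen_base (openI oW oV) (conj Wp Vp).
have [D2 [S2 [C2 D2p sD2 ref1 ref2]]] := dC.2 _ _ _ _ _ CDS C1 Dp D1p.
have [g' Sg' Eg'] := alg_gen_refine ref1 Sg; have [h' Sh' Eh'] := alg_gen_refine ref1 Sh.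
have [h1' Sh1' Eh1'] := alg_gen_refine ref2 Sh1.
exists D2, S2, (fun q => g' q * h1' q), (fun q => h' q * h1' q).
split=> //; [exact: AlgMul|exact: AlgMul|by rewrite -Eh' // -Eh1' // mulf_neq0|].
move=> q D2q; rewrite mulf_eq0 negb_or => /andP[h'q h1'q].
have [Dq D1q] := sD2 q D2q.
have [|Wq Vq] := H1 q D1q; first by rewrite Eh1'.
by split=> //; rewrite -mulf_div divff // mulr1 E // Ek ?Eh' // Eg'.
Qed.

Lemma gen_ringed : ringed (gen_space C).
Proof.
have sh : is_sheaf (gen_space C).
  split=> [U V f oU oV VU rf p Vp|U f oU H p Up].
    have [D [S [g [h [CDS Sg Sh [Dp hp] E]]]]] := rf p (VU _ Vp).
    by exists D, S, g, h; split=> // q /VU; exact: E.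
  have [D [S [g [h [CDS Sg Sh [Dp hp] E]]]]] := (gen_regular_at f oU Up).1 (H p Up).
  by exists D, S, g, h; split=> // q Uq Dq hq; case: (E q Dq hq).
have at_ U f p : open U -> regular (gen_space C) U f -> U p ->
    exists D S g h, [/\ C (D, S), alg_gen S g, alg_gen S h, D p /\ h p != 0
      & forall q, D q -> h q != 0 -> U q /\ f q = g q / h q].
  by move=> oU rf Up; apply: (gen_regular_at f oU Up).1; exists U, f.
(* [num] is the numerator of [op (a / b) (c / d)] over [b * d], so that sums and products are
   treated at once. *)
have comb (op : K -> K -> K) (num : K -> K -> K -> K -> K) U f g : open U ->
    (forall a b c d, b != 0 -> d != 0 -> op (a / b) (c / d) = num a b c d / (b * d)) ->
    (forall S (a b c d : P -> K), alg_gen S a -> alg_gen S b -> alg_gen S c -> alg_gen S d ->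
      alg_gen S (fun x => num (a x) (b x) (c x) (d x))) ->
    regular (gen_space C) U f -> regular (gen_space C) U g ->
    regular (gen_space C) U (fun x => op (f x) (g x)).
  move=> oU Hop Hnum rf rg p Up.
  have [D [S [a [b [CDS Sa Sb [Dp bp] E]]]]] := at_ U f p oU rf Up.
  have [D' [S' [c [d [CDS' Sc Sd [D'p dp] E']]]]] := at_ U g p oU rg Up.
  have [D2 [S2 [C2 D2p sD2 ref1 ref2]]] := dC.2 _ _ _ _ _ CDS CDS' Dp D'p.
  have [a' Sa' Ea'] := alg_gen_refine ref1 Sa; have [b' Sb' Eb'] := alg_gen_refine ref1 Sb.
  have [c' Sc' Ec'] := alg_gen_refine ref2 Sc; have [d' Sd' Ed'] := alg_gen_refine ref2 Sd.
  exists D2, S2, (fun x => num (a' x) (b' x) (c' x) (d' x)), (fun x => b' x * d' x).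
  split=> //; [exact: Hnum|exact: AlgMul|by rewrite -Eb' // -Ed' // mulf_neq0|].
  move=> q Uq D2q; rewrite mulf_eq0 negb_or => /andP[b'q d'q].
  have [Dq D'q] := sD2 q D2q.
  rewrite (E q Dq _).2 ?Eb' // (E' q D'q _).2 ?Ed' // Ea' // Ec' //.
  by rewrite Hop.
split=> //.
- move=> U c oU p Up; have [D [S [CDS Dp]]] := dC.1 p.
  exists D, S, (fun=> c), (fun=> 1); split=> //; try exact: AlgCst.
    by split=> //; exact: oner_neq0.
  by move=> q _ _ _; rewrite divr1.
- move=> U f g oU; apply: (comb +%R (fun a b c d => a * d + c * b)) => //.
    by move=> a b c d b0 d0; rewrite addf_div.
  by move=> S a b c d Sa Sb Sc Sd; apply: AlgAdd; exact: AlgMul.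
- move=> U f g oU; apply: (comb *%R (fun a b c d => a * c)) => //.
    by move=> a b c d b0 d0; rewrite mulf_div.
  by move=> S a b c d Sa Sb Sc Sd; exact: AlgMul.
- move=> U f oU rf.
  have oUf : open ((U : set (gen_space C)) `&` [set x | f x != 0]).
    apply: open_local => p [Up /= fp].
    have [D [S [a [b [CDS Sa Sb [Dp bp] E]]]]] := at_ U f p oU rf Up.
    have Ep := (E p Dp bp).2.
    exists (D `&` [set q | a q * b q != 0]); split.
    + by apply: gen_basic_open CDS _; exact: AlgMul.
    + split=> //=; rewrite mulf_neq0 //; apply: contraNneq fp => a0.
      by rewrite Ep a0 mul0r.
    + move=> q [Dq /=]; rewrite mulf_eq0 negb_or => /andP[aq bq].
      by have [Uq /= ->] := E q Dq bq; split=> //=; rewrite mulf_neq0 ?invr_eq0.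
  split=> // p [Up /= fp].
  have [D [S [a [b [CDS Sa Sb [Dp bp] E]]]]] := at_ U f p oU rf Up.
  have ap : a p != 0 by apply: contraNneq fp => a0; rewrite (E p Dp bp).2 a0 mul0r.
  exists D, S, (fun x => b x * b x), (fun x => a x * b x).
  split=> //; [exact: AlgMul|exact: AlgMul|by rewrite mulf_neq0|].
  move=> q [Uq fq] Dq; rewrite mulf_eq0 negb_or => /andP[aq bq].
  by rewrite (E q Dq bq).2 invf_div -mulf_div divff // mulr1.
Qed.

Lemma morph_on_gen X (Z : set X) (f : X -> gen_space C) : ringed X ->
  (forall D S p, C (D, S) -> Z p -> D (f p) ->
     exists W, [/\ open W, W p, forall q, Z q -> W q -> D (f q)
       & forall g, S g -> reg_on (Z `&` W) (g \o f)]) -> morph_on Z f.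
Proof.
move=> rX H.
have key D S p : C (D, S) -> Z p -> D (f p) -> exists W, [/\ open W, W p, forall q, Z q -> W q -> D (f q)
       & forall g, alg_gen S g -> reg_on (Z `&` W) (g \o f)].
  move=> CDS Zp Dp; have [W [oW Wp HW HS]] := H D S p CDS Zp Dp; exists W; split=> // g.
  elim=> {g} [g /HS//|c|g h _ Hg _ Hh|g h _ Hg _ Hh].
  - exact: reg_on_cst.
  - exact: (reg_on_add rX Hg Hh).
  - exact: (reg_on_mul rX Hg Hh).
move=> V oV; split=> [p Zp Vp|g rg].
  have [D [S [h [CDS Sh Dp hp HV]]]] := gen_base oV Vp.
  have [W [oW Wp HW HS]] := key D S p CDS Zp Dp.
  have [W' [oW' W'p HW']] := reg_on_nz rX (HS h Sh) (conj Zp Wp) hp.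
  exists (W `&` W'); split=> // [|q Zq [Wq W'q]]; first exact: openI.
  by apply: HV; [exact: HW|exact: HW'].
apply: reg_on_local (ringed_sheaf rX) _ => p [Zp Vp].
have [D [S [a [b [CDS Sa Sb [Dp bp] E]]]]] : exists D S a b, [/\ C (D, S), alg_gen S a, alg_gen S b,
    D (f p) /\ b (f p) != 0 & forall q, D q -> b q != 0 -> V q /\ g q = a q / b q].
  by apply: (gen_regular_at g oV Vp).1; exists V, g.
have [W [oW Wp HW HS]] := key D S p CDS Zp Dp.
have [W' [oW' W'p HW']] := reg_on_nz rX (HS b Sb) (conj Zp Wp) bp.
exists (W `&` W'); split=> //; first exact: openI.
have Hb := reg_on_inv rX (HS b Sb).
have Ha : reg_on (Z `&` W `&` [set x | (b \o f) x != 0]) (a \o f).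
  by apply: reg_on_sub (HS a Sa); exact: subIsetl.
have Hab := reg_on_mul rX Ha Hb.
apply: (@reg_on_ext _ _ (fun x => (a \o f) x * ((b \o f) x)^-1)).
  move=> q [[Zq Vq] [Wq W'q]] /=.
  by rewrite (E (f q) _ _).2 //; [exact: HW|exact: HW'].
apply: reg_on_sub Hab => q [[Zq Vq] [Wq W'q]]; split=> //.
exact: HW'.
Qed.

End GenSpace.

End Spaces.

(** * Products and subspaces *)

Section Products.
Variable K : closedFieldType.
Implicit Types X Y T : space K.

Lemma directed1 (P : Type) (S : set (P -> K)) : directed [set (setT, S)].
Proof.
split=> [p|D S1 D' S2 p]; first by exists setT, S.
move=> -[-> ->] [-> ->] _ _; exists setT, S.
by split=> // f Sf; exists f => //; exact: AlgGen.
Qed.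

Lemma directed_product X Y : is_sheaf X -> is_sheaf Y ->
  directed [set c : set (X * Y) * set (X * Y -> K) | exists U V, [/\ open U, open V &
       c = (U `*` V, [set f \o fst | f in regular X U] `|` [set g \o snd | g in regular Y V])]].
Proof.
move=> sX sY; split=> [p|D S D' S' p].
  exists (setT `*` setT), ([set f \o fst | f in regular X setT] `|` [set g \o snd | g in regular Y setT]).
  by split=> //; exists setT, setT; split=> //; exact: openT.
move=> [U [V [oU oV [-> ->]]]] [U' [V' [oU' oV' [-> ->]]]] /= [Up Vp] [Up' Vp'].
have [oUU oVV] := (openI oU oU', openI oV oV').
exists ((U `&` U') `*` (V `&` V')), ([set f \o fst | f in regular X (U `&` U')] `|` [set g \o snd | g in regular Y (V `&` V')]).
split.
- by exists (U `&` U'), (V `&` V').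
- by [].
- by move=> q /= [[? ?] [? ?]].
- move=> f [[g rg <-]|[g rg <-]]; [exists (g \o fst)|exists (g \o snd)] => //.
  + by apply: AlgGen; left; exists g => //; apply: sX.1 rg.
  + by apply: AlgGen; right; exists g => //; apply: sY.1 rg.
- move=> f [[g rg <-]|[g rg <-]]; [exists (g \o fst)|exists (g \o snd)] => //.
  + by apply: AlgGen; left; exists g => //; apply: sX.1 rg => // q [].
  + by apply: AlgGen; right; exists g => //; apply: sY.1 rg => // q [].
Qed.

Lemma ringed_product X Y : is_sheaf X -> is_sheaf Y -> ringed (product X Y).
Proof. by move=> sX sY; apply: gen_ringed; exact: directed_product. Qed.

Lemma ringed_affine_space m : ringed (affine_space K m).
Proof. exact: gen_ringed (directed1 _). Qed.

Lemma ringed_affine_toric n (sigma : set 'rV[int]_n) : ringed (affine_toric K sigma).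
Proof. exact: gen_ringed (directed1 _). Qed.

Lemma product_open X Y (U : set X) (V : set Y) : open U -> open V ->
  @open (product X Y) (U `*` V).
Proof.
move=> oU oV.
have -> : U `*` V = (U `*` V) `&` [set p : X * Y | (fun=> 1 : K) p != 0].
  by rewrite predeqE => p; split=> [[? ?]|[//]]; split=> //=; exact: oner_neq0.
apply: (gen_basic_open (S := [set f \o fst | f in regular X U] `|` [set g \o snd | g in regular Y V])).
  by exists U, V.
exact: AlgCst.
Qed.

Lemma morph_on_fst X Y (Z : set (product X Y)) : ringed X -> ringed Y -> @morph_on _ (product X Y) Z X fst.
Proof.
move=> rX rY V oV; have oW := product_open oV (@openT Y).
split=> [p Zp Vp|g rg p [Zp Vp]]; first by exists (V `*` setT); split=> // q _ [].
exists (V `*` setT), (g \o fst); split=> // q Wq.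
exists (V `*` setT), ([set f \o fst | f in regular X V] `|` [set g \o snd | g in regular Y setT]),
  (g \o fst), (fun=> 1); split=> //.
- by exists V, setT; split=> //; exact: openT.
- by apply: AlgGen; left; exists g.
- exact: AlgCst.
- by split=> //; exact: oner_neq0.
- by move=> r _ _ _; rewrite divr1.
Qed.

Lemma morph_on_snd X Y (Z : set (product X Y)) : ringed X -> ringed Y -> @morph_on _ (product X Y) Z Y snd.
Proof.
move=> rX rY V oV; have oW := product_open (@openT X) oV.
split=> [p Zp Vp|g rg p [Zp Vp]]; first by exists (setT `*` V); split=> // q _ [].
exists (setT `*` V), (g \o snd); split=> // q Wq.
exists (setT `*` V), ([set f \o fst | f in regular X setT] `|` [set g \o snd | g in regular Y V]),
  (g \o snd), (fun=> 1); split=> //.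
- by exists setT, V; split=> //; exact: openT.
- by apply: AlgGen; right; exists g.
- exact: AlgCst.
- by split=> //; exact: oner_neq0.
- by move=> r _ _ _; rewrite divr1.
Qed.

Lemma morph_on_pair T X Y (Z : set T) (f : T -> X) (g : T -> Y) : ringed T -> is_sheaf X -> is_sheaf Y ->
  morph_on Z f -> morph_on Z g -> @morph_on _ T Z (product X Y) (fun t => (f t, g t)).
Proof.
move=> rT sX sY Hf Hg; apply: (morph_on_gen (directed_product sX sY)) => // D S p.
move=> [U [V [oU oV [-> ->]]]] Zp /= [Up Vp].
have [Hf1 Hf2] := Hf U oU; have [Hg1 Hg2] := Hg V oV.
have [W [oW Wp HW]] := Hf1 p Zp Up; have [W' [oW' W'p HW']] := Hg1 p Zp Vp.
exists (W `&` W'); split=> //; first exact: openI.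
  by move=> q Zq [Wq W'q]; split; [exact: HW|exact: HW'].
move=> h [[k rk <-]|[k rk <-]].
  by apply: reg_on_sub (Hf2 k rk) => q [Zq [Wq _]]; split=> //; exact: HW.
by apply: reg_on_sub (Hg2 k rk) => q [Zq [_ Wq]]; split=> //; exact: HW'.
Qed.

Lemma sub_sheaf X (A : set X) : is_sheaf X -> is_sheaf (subspace_of X A).
Proof.
move=> sX; split=> [U V f oU oV VU rf p Vp|U f oU H p Up].
  have [W [g [oW rg Wp E]]] := rf p (VU _ Vp).
  by exists W, g; split=> // q /VU; exact: E.
have [V [g [[V0 oV0 EV] Vp rg E]]] := H p Up.
have [W [k [oW rk Wp Ek]]] := rg p Vp; rewrite -EV /= in Vp E Ek.
have oWV := openI oW oV0; exists (W `&` V0), k; split=> //.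
  by apply: sX.1 rk => // q [].
by move=> q Uq [Wq Vq]; rewrite E // Ek.
Qed.

Lemma morph_on_val X (A : set X) Z : @morph_on _ (subspace_of X A) Z X val.
Proof.
move=> V oV; have oV' : @open (subspace_of X A) (val @^-1` V) by exists V.
split=> [p Zp Vp|g rg p [Zp Vp]]; first by exists (val @^-1` V).
exists (val @^-1` V), (g \o val); split=> // q Vq.
by exists V, g.
Qed.

Lemma morph_on_of_sub X (A : set X) Y (f : X -> Y) : is_sheaf X ->
  @is_morphism _ (subspace_of X A) Y (f \o val) -> morph_on A f.
Proof.
move=> sX /(morph_onT _ (sub_sheaf A sX)) H V oV; have [H1 H2] := H V oV; split=> [p Ap Vp|g rg p [Ap Vp]].
  have [W' [[W oW <-] Wp HW]] := H1 (SigSub (mem_set Ap)) I Vp.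
  exists W; split=> // q Aq Wq; exact: (HW (SigSub (mem_set Aq)) I).
have [W' [k [[W oW <-] Wp rk Ek]]] := H2 g rg (SigSub (mem_set Ap)) (conj I Vp).
have [W2 [k2 [oW2 rk2 W2p Ek2]]] := rk _ Wp.
exists (W `&` W2), k2; split=> //; [exact: openI| |].
  by apply: sX.1 rk2 => //; exact: openI.
move=> q [Aq Vq] [Wq W2q].
have -> : (g \o f) q = k (SigSub (mem_set Aq)) by apply: (Ek (SigSub (mem_set Aq))).
exact: (Ek2 (SigSub (mem_set Aq))).
Qed.

Lemma morph_to_sub X (A : set X) T (f : T -> X) (h : T -> subspace_of X A) (Z : set T) : is_sheaf X ->
  is_sheaf T -> (forall t, Z t -> val (h t) = f t) -> morph_on Z f -> morph_on Z h.
Proof.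
move=> sX sT E H V [V0 oV0 <-]; have [H1 H2] := H V0 oV0; split=> [p Zp Vp|g rg p [Zp Vp]].
  have [|W [oW Wp HW]] := H1 p Zp; first by rewrite -E.
  by exists W; split=> // q Zq Wq; rewrite /= E //; exact: HW.
have [W [k [oW rk Wp Ek]]] := rg _ Vp; rewrite /= E // in Wp.
have [W1 [oW1 W1p HW1]] := (H W oW).1 p Zp Wp.
have [W2 [k2 [oW2 W2p rk2 Ek2]]] := (H W oW).2 k rk p (conj Zp Wp).
exists (W1 `&` W2), k2; split=> //; first exact: openI.
  by apply: sT.1 rk2 => //; exact: openI.
move=> q [Zq Vq] [W1q W2q]; have Wq := HW1 q Zq W1q.
by rewrite /= Ek //= ?E // -Ek2.
Qed.

End Products.

(** * Coordinates on affine subsets *)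

Section Coords.
Variable K : closedFieldType.
Implicit Types X Y T : space K.

(* Intrinsic description of an affine subset: the [y i] are coordinates of a
   closed embedding into affine space; [coords_pt] says that the image is closed. *)
Record coords X (Z : set X) m (y : 'I_m -> X -> K) : Prop := Coords {
  coords_reg : forall i, reg_on Z (y i);
  coords_base : forall V p, open V -> Z p -> V p ->
    exists h, [/\ alg_gen (range y) h, h p != 0 & forall q, Z q -> h q != 0 -> V q];
  coords_frac : forall V f p, open V -> regular X V f -> Z p -> V p -> exists g h,
    [/\ alg_gen (range y) g, alg_gen (range y) h, h p != 0
      & forall q, Z q -> V q -> h q != 0 -> f q = g q / h q];
  coords_pt : forall phi, alg_char (alg_gen (range y)) phi ->
    (forall f, alg_gen (range y) f -> (forall p, Z p -> f p = 0) -> phi f = 0) ->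
    exists2 p, Z p & forall f, alg_gen (range y) f -> phi f = f p;
  coords_inj : forall p q, Z p -> Z q -> (forall i, y i p = y i q) -> p = q }.

Lemma fun_addE P (f g : P -> K) p : (f + g) p = f p + g p. Proof. by []. Qed.
Lemma fun_mulE P (f g : P -> K) p : (f * g) p = f p * g p. Proof. by []. Qed.

Lemma alg_char0 P (S : set (P -> K)) phi : alg_char (alg_gen S) phi -> phi 0 = 0.
Proof. by case=> H _ _; exact: H. Qed.

Lemma alg_char_eq P (Z : set P) (S : set (P -> K)) phi f g : alg_char (alg_gen S) phi ->
  (forall f, alg_gen S f -> (forall p, Z p -> f p = 0) -> phi f = 0) ->
  alg_gen S f -> alg_gen S g -> (forall p, Z p -> f p = g p) -> phi f = phi g.
Proof.
move=> [phic phiD phiM] phi0 Sf Sg E; have SN : alg_gen S ((fun=> -1) * g).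
  by apply: AlgMul => //; exact: AlgCst.
have : phi (f + (fun=> -1) * g) = 0.
  by apply: phi0 => [|p Zp]; [exact: AlgAdd|rewrite fun_addE fun_mulE E // mulN1r subrr].
rewrite phiD // phiM //; last exact: AlgCst.
by rewrite phic mulN1r => /subr0_eq.
Qed.

Lemma alg_gen_range P m (y : 'I_m -> P -> K) i : alg_gen (range y) (y i).
Proof. by apply: AlgGen; exists i. Qed.

Lemma alg_gen_eq P m (y : 'I_m -> P -> K) f p q : alg_gen (range y) f ->
  (forall i, y i p = y i q) -> f p = f q.
Proof.
move=> Hf H; elim: Hf => {f} [_ [i _ <-]//|//|f g _ -> _ ->//|f g _ -> _ -> //].
Qed.

Lemma coords_sep X (Z : set X) m (y : 'I_m -> X -> K) p q : coords Z y -> Z p -> Z q ->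
  (forall f, alg_gen (range y) f -> f p = f q) -> p = q.
Proof. by move=> cy Zp Zq H; apply: (coords_inj cy) => // i; apply: H; exact: alg_gen_range. Qed.

Lemma coords_alg_reg X (Z : set X) m (y : 'I_m -> X -> K) f : ringed X -> coords Z y ->
  alg_gen (range y) f -> reg_on Z f.
Proof. by move=> rX cy; apply: reg_on_alg => // _ [i _ <-]; exact: (coords_reg cy). Qed.

(* If two functions [g / h] agree with [f] only where some [k] does not vanish,
   [g h k^2 / h^2 k^2] agrees with it everywhere in the sense of cross products. *)
Lemma coords_reg_frac X (Z U : set X) m (y : 'I_m -> X -> K) f p : coords Z y -> open U ->
  reg_on (Z `&` U) f -> Z p -> U p -> exists g h,
  [/\ alg_gen (range y) g, alg_gen (range y) h, h p != 0
      & forall q, Z q -> h q != 0 -> U q /\ f q = g q / h q].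
Proof.
move=> cy oU Hf Zp Up; have [V [k [oV Vp rk Ek]]] := Hf p (conj Zp Up).
have [g [h [Hg Hh hp E]]] := coords_frac cy oV rk Zp Vp.
have [l [Hl lp HV]] := coords_base cy (openI oU oV) Zp (conj Up Vp).
exists (fun q => g q * l q), (fun q => h q * l q).
split; [exact: AlgMul|exact: AlgMul|exact: mulf_neq0|].
move=> q Zq; rewrite mulf_eq0 negb_or => /andP[hq lq]; have [Uq Vq] := HV q Zq lq.
by split=> //; rewrite -mulf_div divff // mulr1 Ek // E.
Qed.

(** The denominators [h], those with [h f] in the algebra, form an ideal. If it were proper it would
    have a zero, a point of [Z]; near it [f] is a fraction [g / h], and [h * h] is a denominator
    that does not vanish there. The square makes the identity hold also where [h] vanishes. *)
Lemma coords_reg_alg X (Z : set X) m (y : 'I_m -> X -> K) f : coords Z y ->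
  reg_on Z f -> exists2 g, alg_gen (range y) g & forall q, Z q -> f q = g q.
Proof.
move=> cy Hf; set O := alg_gen (range y).
pose I := [set h | O h /\ exists2 g, O g & forall q, Z q -> h q * f q = g q].
have iI : ideal O I.
  split=> [h []//|||].
  - split; first exact: AlgCst.
    by exists 0; [exact: AlgCst|move=> q _; rewrite mul0r].
  - move=> h h' [Oh [g Og E]] [Oh' [g' Og' E']]; split; first exact: AlgAdd.
    by exists (g + g'); [exact: AlgAdd|move=> q Zq; rewrite !fun_addE mulrDl E ?E'].
  - move=> a h Oa [Oh [g Og E]]; split; first exact: AlgMul.
    by exists (a * g); [exact: AlgMul|move=> q Zq; rewrite !fun_mulE -mulrA E].
have [[_ [g Og E]]|nI1] := pselect (I 1).
  by exists g => // q Zq; rewrite -E // mul1r.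
have [phi [Hphi phi0]] := alg_gen_nullstellensatz iI nI1.
have [p Zp Ep] : exists2 p, Z p & forall f, O f -> phi f = f p.
  apply: (coords_pt cy) => // g Og g0; apply: phi0; split=> //.
  by exists 0; [exact: AlgCst|move=> q Zq; rewrite g0 // mul0r].
have Hf' : reg_on (Z `&` setT) f by rewrite setIT.
have [g [h [Og Oh hp E]]] := coords_reg_frac cy (@openT X) Hf' Zp Logic.I.
have : I (h * h).
  split; first exact: AlgMul.
  exists (g * h); first exact: AlgMul.
  move=> q Zq; have [hq|hq] := eqVneq (h q) 0; first by rewrite !fun_mulE hq !mul0r mulr0.
  by rewrite !fun_mulE (E q Zq hq).2; field.
move=> /phi0; rewrite Ep; last exact: AlgMul.
by move=> /eqP; rewrite mulf_eq0 orbb (negbTE hp).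
Qed.

(** The ideal generated by [S] has no zero on [Z], hence contains 1 by the Nullstellensatz. *)
Lemma coords_partition X (Z : set X) m (y : 'I_m -> X -> K) (S : set (X -> K)) : coords Z y ->
  S `<=` alg_gen (range y) -> (forall p, Z p -> exists2 h, S h & h p != 0) ->
  exists r (h k : 'I_r -> X -> K), [/\ forall i, S (h i), forall i, alg_gen (range y) (k i)
    & forall q, Z q -> \sum_i k i q * h i q = 1].
Proof.
move=> cy SO HS; set O := alg_gen (range y).
pose I := [set f | O f /\ exists r (h k : 'I_r -> X -> K), [/\ forall i, S (h i), forall i, O (k i)
    & forall q, Z q -> \sum_i k i q * h i q = f q]].
have iI : ideal O I.
  split=> [h []//|||].
  - split; first exact: AlgCst.
    by exists 0%N, (fun=> 0), (fun=> 0); split=> [[]//|[]//|q _]; rewrite big_ord0.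
  - move=> f f' [Of [r [h [k [Sh Ok E]]]]] [Of' [r' [h' [k' [Sh' Ok' E']]]]].
    split; first exact: AlgAdd.
    exists (r + r')%N, (fun i => match fintype.split i with inl j => h j | inr j => h' j end),
      (fun i => match fintype.split i with inl j => k j | inr j => k' j end); split.
    + by move=> i; case: fintype.split.
    + by move=> i; case: fintype.split.
    + move=> q Zq; rewrite fun_addE big_split_ord /= -E // -E' //; congr (_ + _); apply: eq_bigr => i _.
        by rewrite -[lshift _ _]/(unsplit (inl i)) unsplitK.
      by rewrite -[rshift _ _]/(unsplit (inr i)) unsplitK.
  - move=> a f Oa [Of [r [h [k [Sh Ok E]]]]]; split; first exact: AlgMul.
    exists r, h, (fun i => a * k i); split=> // [i|q Zq]; first exact: (AlgMul Oa (Ok i)).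
    by rewrite fun_mulE -E // mulr_sumr; apply: eq_bigr => i _; rewrite mulrA.
have [[_ [r [h [k [Sh Ok E]]]]]|nI1] := pselect (I 1); first by exists r, h, k.
have [phi [Hphi phi0]] := alg_gen_nullstellensatz iI nI1.
have [p Zp Ep] : exists2 p, Z p & forall f, O f -> phi f = f p.
  apply: (coords_pt cy) => // g Og g0; apply: phi0; split=> //.
  by exists 0%N, (fun=> 0), (fun=> 0); split=> [[]//|[]//|q Zq]; rewrite big_ord0 g0.
have [h Sh hp] := HS p Zp; have : I h.
  split; first exact: SO.
  by exists 1%N, (fun=> h), (fun=> 1); split=> // [i|q _]; [exact: AlgCst|rewrite big_ord1 mul1r].
by move=> /phi0; rewrite Ep; [move/eqP; rewrite (negbTE hp)|exact: SO].
Qed.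

Lemma alg_gen_comp P Q (f : P -> Q) (S : set (Q -> K)) (S' : set (P -> K)) h :
  (forall g, S g -> alg_gen S' (g \o f)) -> alg_gen S h -> alg_gen S' (h \o f).
Proof.
move=> H; elim=> {h} [h /H//|c|g h _ Hg _ Hh|g h _ Hg _ Hh]; [exact: AlgCst| |].
- exact: (AlgAdd Hg Hh).
- exact: (AlgMul Hg Hh).
Qed.

Lemma alg_gen_precomp P Q (f : P -> Q) m (y : 'I_m -> Q -> K) h :
  alg_gen (range (fun i => y i \o f)) h -> exists2 g, alg_gen (range y) g & h = g \o f.
Proof.
elim=> {h} [_ [i _ <-]|c|_ _ _ [g Hg ->] _ [h Hh ->]|_ _ _ [g Hg ->] _ [h Hh ->]].
- by exists (y i) => //; exact: alg_gen_range.
- by exists (fun=> c) => //; exact: AlgCst.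
- by exists (fun p => g p + h p) => //; exact: AlgAdd.
- by exists (fun p => g p * h p) => //; exact: AlgMul.
Qed.

Lemma alg_gen_postcomp P Q (f : P -> Q) m (y : 'I_m -> Q -> K) g :
  alg_gen (range y) g -> alg_gen (range (fun i => y i \o f)) (g \o f).
Proof. by apply: alg_gen_comp => _ [i _ <-]; exact: (alg_gen_range (fun i => y i \o f)). Qed.

Lemma coords_transport X (Z : set X) m (y : 'I_m -> X -> K) T (Z' : set T) (f : T -> X) :
  ringed X -> ringed T -> coords Z y -> morph_on Z' f -> (forall p, Z' p -> Z (f p)) ->
  (forall q, Z q -> exists2 p, Z' p & f p = q) ->
  (forall p q, Z' p -> Z' q -> f p = f q -> p = q) ->
  (forall V phi p, open V -> regular T V phi -> Z' p -> V p -> exists W psi,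
    [/\ open W, W (f p), regular X W psi & forall q, Z' q -> W (f q) -> V q /\ phi q = psi (f q)]) ->
  coords Z' (fun i => y i \o f).
Proof.
move=> rX rT cy Hf ZZ surj inj H; split.
- by move=> i; apply: morph_on_reg Hf ZZ (coords_reg cy i); exact: ringed_sheaf.
- move=> V p oV Zp Vp; have [W [psi [oW Wp rpsi E]]] := H V _ p oV (ringed_cst rT 0 oV) Zp Vp.
  have [h [Oh hp HW]] := coords_base cy oW (ZZ p Zp) Wp.
  exists (h \o f); split=> //; first exact: alg_gen_postcomp.
  by move=> q Zq hq; apply: (E q Zq _).1; apply: HW => //; exact: ZZ.
- move=> V phi p oV rphi Zp Vp; have [W [psi [oW Wp rpsi E]]] := H V phi p oV rphi Zp Vp.
  have rW := regular_reg_on oW rpsi.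
  have rW' : reg_on (Z `&` W) psi by apply: reg_on_sub rW; exact: subIsetr.
  have [g [h [Og Oh hp E']]] := coords_reg_frac cy oW rW' (ZZ p Zp) Wp.
  exists (g \o f), (h \o f); split=> //; try exact: alg_gen_postcomp.
  move=> q Zq Vq hq; have [Wq Eq] := E' (f q) (ZZ q Zq) hq.
  by rewrite (E q Zq Wq).2.
- move=> phi [phic phiD phiM] phi0.
  have [| |p Zp Ep] := coords_pt cy (phi := fun g => phi (g \o f)).
  + split=> [c|g h Og Oh|g h Og Oh]; first exact: phic.
      by rewrite -phiD //; exact: alg_gen_postcomp.
    by rewrite -phiM //; exact: alg_gen_postcomp.
  + move=> g Og g0; apply: phi0 => [|q /ZZ Zq]; [exact: alg_gen_postcomp|exact: g0].
  have [q Zq fq] := surj p Zp; exists q => // _ /alg_gen_precomp[g Og ->].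
  by rewrite Ep //= fq.
- by move=> p q Zp Zq E; apply: inj => //; apply: (coords_inj cy); [exact: ZZ|exact: ZZ|exact: E].
Qed.

(* The last hypothesis of [coords_transport] in the presence of an inverse morphism. *)
Lemma transport_inverse X (Z : set X) T (Z' : set T) (f : T -> X) (g : X -> T) : ringed X ->
  (forall p, Z' p -> Z (f p)) -> (forall p, Z' p -> g (f p) = p) -> morph_on Z g ->
  forall V phi p, open V -> regular T V phi -> Z' p -> V p -> exists W psi,
    [/\ open W, W (f p), regular X W psi & forall q, Z' q -> W (f q) -> V q /\ phi q = psi (f q)].
Proof.
move=> rX ZZ gf Hg V phi p oV rphi Zp Vp; have [H1 H2] := Hg V oV.
have [|W [oW Wp HW]] := H1 (f p) (ZZ p Zp); first by rewrite gf.
have [|W' [psi [oW' W'p rpsi E]]] := H2 phi rphi (f p).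
  by split; [exact: ZZ|rewrite /= gf].
exists (W `&` W'), psi; split=> //; first exact: openI.
  by apply: (ringed_sheaf rX).1 rpsi => //; exact: openI.
move=> q Zq [Wq W'q]; have Vq : V q by rewrite -[q]gf //; apply: HW => //; exact: ZZ.
split=> //; have := E (f q); rewrite /= gf //; apply=> //.
by split=> //; exact: ZZ.
Qed.

Lemma coords_closed X (Z C : set X) m (y : 'I_m -> X -> K) : ringed X -> coords Z y -> closed C ->
  coords (Z `&` C) y.
Proof.
move=> rX cy cC; split.
- by move=> i; apply: reg_on_sub (coords_reg cy i); exact: subIsetl.
- move=> V p oV [Zp _] Vp; have [h [Oh hp HV]] := coords_base cy oV Zp Vp.
  by exists h; split=> // q [Zq _]; exact: HV.
- move=> V f p oV rf [Zp _] Vp; have [g [h [Og Oh hp E]]] := coords_frac cy oV rf Zp Vp.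
  by exists g, h; split=> // q [Zq _]; exact: E.
- move=> phi Hphi phi0; have [|p Zp Ep] := coords_pt cy Hphi.
    by move=> f Of f0; apply: phi0 => // q [Zq _]; exact: f0.
  exists p => //; split=> //; apply: contrapT => nCp.
  have oC : open (~` C) by exact: closed_openC.
  have [h [Oh hp HC]] := coords_base cy oC Zp nCp.
  move/eqP: hp; apply; rewrite -Ep //; apply: phi0 => // q [Zq Cq].
  by apply/eqP/negP => /negP hq; exact: (HC q Zq hq).
- by move=> p q [Zp _] [Zq _]; exact: (coords_inj cy).
Qed.

Definition snoc_fun P m (y : 'I_m -> P -> K) (h : P -> K) (i : 'I_m.+1) : P -> K :=
  if unlift ord_max i is Some j then y j else h.

Lemma alg_gen_snoc P m (y : 'I_m -> P -> K) h : alg_gen (range y) `<=` alg_gen (range (snoc_fun y h)).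
Proof.
apply: alg_gen_sub => _ [i _ <-]; apply: AlgGen; exists (lift ord_max i) => //.
by rewrite /snoc_fun liftK.
Qed.

Lemma alg_gen_snoc_last P m (y : 'I_m -> P -> K) h : alg_gen (range (snoc_fun y h)) h.
Proof. by apply: AlgGen; exists ord_max => //; rewrite /snoc_fun unlift_none. Qed.

Lemma alg_gen_exp P (S : set (P -> K)) f N : alg_gen S f -> alg_gen S (fun p => f p ^+ N).
Proof.
move=> Sf; elim: N => [|N IH].
  have -> : (fun p => f p ^+ 0) = fun=> 1 by apply/funext => p; rewrite expr0.
  exact: AlgCst.
have -> : (fun p => f p ^+ N.+1) = fun p => f p * f p ^+ N by apply/funext => p; rewrite exprS.
exact: AlgMul.
Qed.

Lemma alg_gen_snoc_inv P m (y : 'I_m -> P -> K) h f : alg_gen (range y) h ->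
  alg_gen (range (snoc_fun y (fun p => (h p)^-1))) f ->
  exists N g, alg_gen (range y) g /\ forall p, h p != 0 -> f p = g p / h p ^+ N.
Proof.
move=> Oh; elim=> {f} [_ [i _ <-]|c|f f' _ [N [g [Og E]]] _ [N' [g' [Og' E']]]
    |f f' _ [N [g [Og E]]] _ [N' [g' [Og' E']]]].
- rewrite /snoc_fun; case: unliftP => [j _|_].
    by exists 0%N, (y j); split=> [|p _]; [exact: alg_gen_range|rewrite expr0 divr1].
  by exists 1%N, (fun=> 1); split=> [|p _]; [exact: AlgCst|rewrite expr1 mul1r].
- by exists 0%N, (fun=> c); split=> [|p _]; [exact: AlgCst|rewrite expr0 divr1].
- exists (N + N')%N, (fun p => g p * h p ^+ N' + g' p * h p ^+ N); split.
    by apply: AlgAdd; apply: AlgMul => //; exact: alg_gen_exp.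
  by move=> p hp; rewrite E ?E' // exprD addf_div ?expf_neq0.
- exists (N + N')%N, (fun p => g p * g' p); split; first exact: AlgMul.
  by move=> p hp; rewrite E ?E' // exprD mulf_div.
Qed.

(** Rabinowitsch's trick: with [1 / h] as a further coordinate, a character takes a nonzero value at
    [h], so the point that it defines lies in the principal open set. *)
Lemma coords_principal X (Z : set X) m (y : 'I_m -> X -> K) h : ringed X -> coords Z y ->
  alg_gen (range y) h -> coords (Z `&` [set p | h p != 0]) (snoc_fun y (fun p => (h p)^-1)).
Proof.
move=> rX cy Oh; set y' := snoc_fun _ _.
have O'h : alg_gen (range y') h by apply: alg_gen_snoc.
have O'h' : alg_gen (range y') (fun p => (h p)^-1) by exact: alg_gen_snoc_last.
have Rh := coords_alg_reg rX cy Oh.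
split.
- move=> i; rewrite /y' /snoc_fun; case: unliftP => [j _|_]; last exact: reg_on_inv.
  by apply: reg_on_sub (coords_reg cy j); exact: subIsetl.
- move=> V p oV [Zp hp] Vp; have [k [Ok kp HV]] := coords_base cy oV Zp Vp.
  by exists k; split=> [||q [Zq _]]; [exact: alg_gen_snoc| |exact: HV].
- move=> V f p oV rf [Zp _] Vp; have [g [k [Og Ok kp E]]] := coords_frac cy oV rf Zp Vp.
  by exists g, k; split=> [||//|q [Zq _]]; [exact: alg_gen_snoc..|exact: E].
- move=> phi Hphi phi0; have [phic phiD phiM] := Hphi.
  have [| |p Zp Ep] := coords_pt cy (phi := phi).
  + by split=> [//|f g Of Og|f g Of Og]; [apply: phiD|apply: phiM]; exact: alg_gen_snoc.
  + by move=> f Of f0; apply: phi0 => [|q [Zq _]]; [exact: alg_gen_snoc|exact: f0].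
  have hV : phi (h * (fun p => (h p)^-1)) = 1.
    rewrite -[RHS](phic 1); apply: (alg_char_eq Hphi phi0); [exact: AlgMul|exact: AlgCst|].
    by move=> q [_ hq]; rewrite fun_mulE mulfV.
  have hp : h p != 0.
    apply/eqP => h0; move: hV; rewrite phiM // Ep // h0 mul0r => /eqP.
    by rewrite eq_sym oner_eq0.
  exists p => // f; elim=> {f} [_ [i _ <-]|c|f g Of Hf Og Hg|f g Of Hf Og Hg].
  + rewrite /y' /snoc_fun; case: unliftP => [j _|_]; first by rewrite Ep //; exact: alg_gen_range.
    by apply: (mulfI hp); rewrite mulfV // -hV phiM // (Ep h Oh).
  + exact: phic.
  + by rewrite phiD // Hf Hg.
  + by rewrite phiM // Hf Hg.
- by move=> p q [Zp _] [Zq _] E; apply: (coords_inj cy) => // i; have := E (lift ord_max i); rewrite /y' /snoc_fun liftK.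
Qed.

End Coords.

Section CoordsConstructions.
Variable K : closedFieldType.
Implicit Types X Y T : space K.

Definition pair_fun P Q m n (y : 'I_m -> P -> K) (z : 'I_n -> Q -> K) (i : 'I_(m + n)) : P * Q -> K :=
  match fintype.split i with inl j => y j \o fst | inr j => z j \o snd end.

Section PairFun.
Variables (P Q : Type) (m n : nat) (y : 'I_m -> P -> K) (z : 'I_n -> Q -> K).

Lemma alg_gen_pair1 f : alg_gen (range y) f -> alg_gen (range (pair_fun y z)) (f \o fst).
Proof.
apply: alg_gen_comp => _ [i _ <-]; apply: AlgGen; exists (lshift n i) => //.
by rewrite /pair_fun -[lshift _ _]/(unsplit (inl i)) unsplitK.
Qed.

Lemma alg_gen_pair2 f : alg_gen (range z) f -> alg_gen (range (pair_fun y z)) (f \o snd).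
Proof.
apply: alg_gen_comp => _ [i _ <-]; apply: AlgGen; exists (rshift m i) => //.
by rewrite /pair_fun -[rshift _ _]/(unsplit (inr i)) unsplitK.
Qed.

Lemma alg_gen_pair_ind (R : set (P * Q -> K)) :
  (forall f, alg_gen (range y) f -> R (f \o fst)) -> (forall f, alg_gen (range z) f -> R (f \o snd)) ->
  (forall f g, R f -> R g -> R (fun p => f p + g p)) ->
  (forall f g, alg_gen (range (pair_fun y z)) f -> alg_gen (range (pair_fun y z)) g ->
     R f -> R g -> R (fun p => f p * g p)) ->
  forall f, alg_gen (range (pair_fun y z)) f -> R f.
Proof.
move=> H1 H2 HD HM f; elim=> {f} [_ [i _ <-]|c|f g _ Hf _ Hg|f g Of Hf Og Hg].
- rewrite /pair_fun; case: fintype.split => j; [apply: H1|apply: H2]; exact: alg_gen_range.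
- by apply: (H1 (fun=> c)); exact: AlgCst.
- exact: HD.
- exact: HM.
Qed.

Lemma alg_gen_pair_sum f : alg_gen (range (pair_fun y z)) f ->
  exists r (a : 'I_r -> P -> K) (b : 'I_r -> Q -> K), [/\ forall i, alg_gen (range y) (a i),
    forall i, alg_gen (range z) (b i) & forall p q, f (p, q) = \sum_i a i p * b i q].
Proof.
move: f; apply: alg_gen_pair_ind.
- move=> f Of; exists 1%N, (fun=> f), (fun _ _ => 1); split=> // [i|p q]; first exact: AlgCst.
  by rewrite big_ord1 mulr1.
- move=> f Of; exists 1%N, (fun _ _ => 1), (fun=> f); split=> // [i|p q]; first exact: AlgCst.
  by rewrite big_ord1 mul1r.
- move=> f g [r [a [b [Oa Ob E]]]] [r' [a' [b' [Oa' Ob' E']]]].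
  exists (r + r')%N, (fun i => match fintype.split i with inl j => a j | inr j => a' j end),
    (fun i => match fintype.split i with inl j => b j | inr j => b' j end); split.
  + by move=> i; case: fintype.split.
  + by move=> i; case: fintype.split.
  + move=> p q; rewrite big_split_ord E E'; congr (_ + _); apply: eq_bigr => i _.
      by rewrite -[lshift _ _]/(unsplit (inl i)) unsplitK.
    by rewrite -[rshift _ _]/(unsplit (inr i)) unsplitK.
- move=> f g _ _ [r [a [b [Oa Ob E]]]] [r' [a' [b' [Oa' Ob' E']]]].
  exists #|{: 'I_r * 'I_r'}|, (fun i p => a (enum_val i).1 p * a' (enum_val i).2 p),
    (fun i p => b (enum_val i).1 p * b' (enum_val i).2 p); split.
  + by move=> i; exact: AlgMul.
  + by move=> i; exact: AlgMul.
  + move=> p q; rewrite E E' big_distrlr /= pair_big /=.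
    rewrite [RHS](reindex (enum_rank (T := {: 'I_r * 'I_r'}))) /=; last first.
      by apply: onW_bij; exact: enum_rank_bij.
    by apply: eq_bigr => -[i j] _; rewrite enum_rankK /= mulrACA.
Qed.

End PairFun.

Lemma coords_prod X (Z : set X) m (y : 'I_m -> X -> K) Y (Z' : set Y) n (z : 'I_n -> Y -> K) :
  ringed X -> ringed Y -> coords Z y -> coords Z' z -> @coords _ (product X Y) (Z `*` Z') _ (pair_fun y z).
Proof.
move=> rX rY cy cz; have [sX sY] := (ringed_sheaf rX, ringed_sheaf rY).
have rXY := ringed_product sX sY; set O := alg_gen (range (pair_fun y z)).
have box (U : set X) (V : set Y) p : open U -> open V -> (Z `*` Z') p -> U p.1 -> V p.2 ->
    exists l, [/\ O l, l p != 0 & forall q, (Z `*` Z') q -> l q != 0 -> (U `*` V) q].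
  move=> oU oV [Zp Zp'] Up Vp.
  have [l [Ol lp HU]] := coords_base cy oU Zp Up; have [l' [Ol' lp' HV]] := coords_base cz oV Zp' Vp.
  exists (fun q => (l \o fst) q * (l' \o snd) q).
  split; [apply: AlgMul; [exact: alg_gen_pair1|exact: alg_gen_pair2]|exact: mulf_neq0|].
  move=> q [Zq Zq'] /=; rewrite mulf_eq0 negb_or => /andP[lq l'q].
  by split; [exact: HU|exact: HV].
have key (U : set X) (V : set Y) p f : open U -> open V -> (Z `*` Z') p -> U p.1 -> V p.2 ->
    alg_gen ([set f \o fst | f in regular X U] `|` [set g \o snd | g in regular Y V]) f ->
    exists g h, [/\ O g, O h, h p != 0 & forall q, (Z `*` Z') q -> h q != 0 -> f q = g q / h q].
  move=> oU oV [Zp Zp'] Up Vp.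
  elim=> {f} [_ [[f rf <-]|[f rf <-]]|c|f g _ [a [b [Oa Ob bp E]]] _ [a' [b' [Oa' Ob' b'p E']]]
     |f g _ [a [b [Oa Ob bp E]]] _ [a' [b' [Oa' Ob' b'p E']]]].
  - have rf' : reg_on (Z `&` U) f by apply: reg_on_sub (regular_reg_on oU rf); exact: subIsetr.
    have [g [h [Og Oh hp E]]] := coords_reg_frac cy oU rf' Zp Up.
    exists (g \o fst), (h \o fst); split=> //; try exact: alg_gen_pair1.
    by move=> q [Zq _] hq; case: (E q.1 Zq hq).
  - have rf' : reg_on (Z' `&` V) f by apply: reg_on_sub (regular_reg_on oV rf); exact: subIsetr.
    have [g [h [Og Oh hp E]]] := coords_reg_frac cz oV rf' Zp' Vp.
    exists (g \o snd), (h \o snd); split=> //; try exact: alg_gen_pair2.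
    by move=> q [_ Zq] hq; case: (E q.2 Zq hq).
  - exists (fun=> c), (fun=> 1); split; try exact: AlgCst; first exact: oner_neq0.
    by move=> q _ _; rewrite divr1.
  - exists (fun q => a q * b' q + a' q * b q), (fun q => b q * b' q).
    split; [by apply: AlgAdd; exact: AlgMul|exact: AlgMul|exact: mulf_neq0|].
    move=> q Zq; rewrite mulf_eq0 negb_or => /andP[bq b'q].
    by rewrite E // E' // addf_div.
  - exists (fun q => a q * a' q), (fun q => b q * b' q).
    split; [exact: AlgMul|exact: AlgMul|exact: mulf_neq0|].
    move=> q Zq; rewrite mulf_eq0 negb_or => /andP[bq b'q].
    by rewrite E // E' // mulf_div.
split.
- move=> i; rewrite /pair_fun; case: fintype.split => j.
    by apply: morph_on_reg (morph_on_fst _ rX rY) _ (coords_reg cy j); [exact: ringed_sheaf|move=> p []].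
  by apply: morph_on_reg (morph_on_snd _ rX rY) _ (coords_reg cz j); [exact: ringed_sheaf|move=> p []].
- move=> V p oV Zp Vp.
  have [D [S [h [[U [W [oU oW [-> ES]]]] Sh [Up Wp] hp HV]]]] := gen_base (directed_product sX sY) oV Vp.
  rewrite {}ES in Sh; have [g [k [Og Ok kp E]]] := key U W p h oU oW Zp Up Wp Sh.
  have [l [Ol lp HD]] := box U W p oU oW Zp Up Wp.
  exists (fun q => g q * (k q * l q)); split; first by do 2 apply: AlgMul => //.
    rewrite !mulf_neq0 //; apply: contraNneq hp => g0; by rewrite E // g0 mul0r.
  move=> q Zq; rewrite !mulf_eq0 !negb_or => /andP[gq /andP[kq lq]].
  by apply: HV; [exact: HD|rewrite E // mulf_neq0 ?invr_eq0].
- move=> V f p oV rf Zp Vp.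
  have [D [S [a [b [[U [W [oU oW [-> ES]]]] Sa Sb [[Up Wp] bp] Ef]]]]] := rf p Vp.
  rewrite {}ES in Sa Sb.
  have [g [k [Og Ok kp E]]] := key U W p a oU oW Zp Up Wp Sa.
  have [g' [k' [Og' Ok' k'p E']]] := key U W p b oU oW Zp Up Wp Sb.
  have [l [Ol lp HD]] := box U W p oU oW Zp Up Wp.
  exists (fun q => (g q * k' q) * (k' q * l q)), (fun q => (g' q * k q) * (k' q * l q)); split.
  + by apply: AlgMul; apply: AlgMul.
  + by apply: AlgMul; apply: AlgMul.
  + by rewrite !mulf_neq0 //; apply: contraNneq bp => g0; rewrite E' // g0 mul0r.
  move=> q Zq Vq; rewrite !mulf_eq0 !negb_or => /andP[/andP[g'q kq] /andP[k'q lq]].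
  have Dq := HD q Zq lq; rewrite Ef // ?E' // ?E ?mulf_neq0 ?invr_eq0 //.
  by field; rewrite g'q kq k'q lq.
- move=> phi [phic phiD phiM] phi0.
  have [| |p Zp Ep] := coords_pt cy (phi := fun f => phi (f \o fst)).
  + split=> [c|f g Of Og|f g Of Og]; first exact: phic.
      by rewrite -phiD //; exact: alg_gen_pair1.
    by rewrite -phiM //; exact: alg_gen_pair1.
  + by move=> f Of f0; apply: phi0 => [|q [Zq _]]; [exact: alg_gen_pair1|exact: f0].
  have [| |q Zq Eq] := coords_pt cz (phi := fun f => phi (f \o snd)).
  + split=> [c|f g Of Og|f g Of Og]; first exact: phic.
      by rewrite -phiD //; exact: alg_gen_pair2.
    by rewrite -phiM //; exact: alg_gen_pair2.
  + by move=> f Of f0; apply: phi0 => [|t [_ Zt]]; [exact: alg_gen_pair2|exact: f0].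
  exists (p, q) => // f; elim=> {f} [_ [i _ <-]|c|f g Of Hf Og Hg|f g Of Hf Og Hg].
  + rewrite /pair_fun; case: fintype.split => j; [rewrite Ep|rewrite Eq] => //; exact: alg_gen_range.
  + exact: phic.
  + by rewrite phiD // Hf Hg.
  + by rewrite phiM // Hf Hg.
- move=> [p p'] [q q'] [/= Zp Zp'] [/= Zq Zq'] E; congr (_, _).
    apply: (coords_inj cy) => // i; have := E (lshift n i).
    by rewrite /pair_fun -[lshift _ _]/(unsplit (inl i)) unsplitK.
  apply: (coords_inj cz) => // i; have := E (rshift m i).
  by rewrite /pair_fun -[rshift _ _]/(unsplit (inr i)) unsplitK.
Qed.

(** A character of the algebra generated by [w] is nonzero at some [h i], because these generate the
    unit ideal. It extends to the localization at [h i], which contains the coordinates of that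
    piece, and so is a point of the piece. The remaining properties are local and follow by clearing
    powers of [h i]. *)
Lemma coords_glue X (Z : set X) M (w : 'I_M -> X -> K) r (h k : 'I_r -> X -> K) : ringed X ->
  (forall i, reg_on Z (w i)) ->
  (forall i, alg_gen (range w) (h i)) -> (forall i, alg_gen (range w) (k i)) ->
  (forall q, Z q -> \sum_i k i q * h i q = 1) ->
  (forall i, exists m (y : 'I_m -> X -> K), coords (Z `&` [set q | h i q != 0]) y /\
     forall j, exists N g, alg_gen (range w) g /\ forall q, Z q -> h i q != 0 -> y j q = g q / h i q ^+ N) ->
  coords Z w.
Proof.
move=> rX Rw Oh Ok hk1 Hloc; set O := alg_gen (range w).
have cover q : Z q -> exists i, h i q != 0.
  move=> Zq; apply: contrapT => H; have := hk1 q Zq; rewrite big1 => [/esym/eqP|i _].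
    by rewrite oner_eq0.
  by have [->|hi] := eqVneq (h i q) 0; [rewrite mulr0|case: H; exists i].
have loc i : exists m (y : 'I_m -> X -> K), coords (Z `&` [set q | h i q != 0]) y /\
    forall f, alg_gen (range y) f -> exists N g, O g /\ forall q, Z q -> h i q != 0 -> f q = g q / h i q ^+ N.
  have [m [y [cy Hy]]] := Hloc i; exists m, y; split=> // f.
  elim=> {f} [_ [j _ <-]|c|f f' _ [N [g [Og E]]] _ [N' [g' [Og' E']]]|f f' _ [N [g [Og E]]] _ [N' [g' [Og' E']]]].
  - exact: Hy.
  - by exists 0%N, (fun=> c); split=> [|q _ _]; [exact: AlgCst|rewrite expr0 divr1].
  - exists (N + N')%N, (fun p => g p * h i p ^+ N' + g' p * h i p ^+ N); split.
      by apply: AlgAdd; apply: AlgMul => //; apply: alg_gen_exp; exact: Oh.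
    by move=> p Zp hp; rewrite E ?E' // exprD addf_div ?expf_neq0.
  - exists (N + N')%N, (fun p => g p * g' p); split; first exact: AlgMul.
    by move=> p Zp hp; rewrite E ?E' // exprD mulf_div.
split=> //.
- move=> V p oV Zp Vp; have [i hi] := cover p Zp; have [m [y [cy Hy]]] := loc i.
  have [f [Of fp HV]] := coords_base cy oV (conj Zp hi) Vp.
  have [N [g [Og E]]] := Hy f Of; exists (fun q => g q * h i q).
  split; first exact: AlgMul.
    by rewrite mulf_neq0 //; apply: contraNneq fp => g0; rewrite E // g0 mul0r.
  move=> q Zq; rewrite mulf_eq0 negb_or => /andP[gq hq]; apply: HV => //.
  by rewrite E // mulf_neq0 // invr_eq0 expf_neq0.
- move=> V f p oV rf Zp Vp; have [i hi] := cover p Zp; have [m [y [cy Hy]]] := loc i.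
  have [a [b [Oa Ob bp E]]] := coords_frac cy oV rf (conj Zp hi) Vp.
  have [N [g [Og Eg]]] := Hy a Oa; have [N' [g' [Og' Eg']]] := Hy b Ob.
  exists (fun q => g q * h i q ^+ N' * h i q), (fun q => g' q * h i q ^+ N * h i q); split.
  + by do 2 (apply: AlgMul => //); apply: alg_gen_exp.
  + by do 2 (apply: AlgMul => //); apply: alg_gen_exp.
  + by rewrite !mulf_neq0 ?expf_neq0 //; apply: contraNneq bp => g0; rewrite Eg' // g0 mul0r.
  move=> q Zq Vq; rewrite !mulf_eq0 !negb_or => /andP[/andP[g'q hNq] hq].
  rewrite E // ?Eg' // ?Eg // ?mulf_neq0 ?invr_eq0 ?expf_neq0 //.
  have hN'q : h i q ^+ N' != 0 by rewrite expf_neq0.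
  move: hNq hN'q; move: (h i q ^+ N) (h i q ^+ N') => A B A0 B0.
  by field; rewrite g'q hq A0 B0.
- move=> phi Hphi phi0; have [phic phiD phiM] := Hphi.
  have [i hi] : exists i, phi (h i) != 0.
    apply: contrapT => H.
    have main (s : seq 'I_r) : O (fun q => \sum_(i <- s) k i q * h i q) /\
        phi (fun q => \sum_(i <- s) k i q * h i q) = 0.
      elim: s => [|j s [IH1 IH2]].
        have -> : (fun q : X => \sum_(i <- [::]) k i q * h i q) = fun=> 0.
          by apply/funext => q; rewrite big_nil.
        by split; [exact: AlgCst|exact: phic].
      have -> : (fun q => \sum_(i <- j :: s) k i q * h i q) =
          k j * h j + (fun q => \sum_(i <- s) k i q * h i q).
        by apply/funext => q; rewrite big_cons.
      have Okh : O (k j * h j) by exact: (AlgMul (Ok j) (Oh j)).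
      split; first exact: AlgAdd.
      rewrite phiD // IH2 addr0 phiM //; have [->|hj] := eqVneq (phi (h j)) 0; first by rewrite mulr0.
      by case: H; exists j.
    have [Os] := main (index_enum 'I_r); apply/eqP.
    suff -> : phi (fun q => \sum_i k i q * h i q) = 1 by exact: oner_neq0.
    rewrite -[RHS](phic 1); apply: (alg_char_eq Hphi phi0) => //; exact: AlgCst.
  have [m [y [cy Hy]]] := loc i.
  have phiX N : phi (fun q => h i q ^+ N) = phi (h i) ^+ N.
    elim: N => [|N IH].
      by rewrite expr0 -[RHS]phic; congr (phi _); apply/funext => q; rewrite expr0.
    rewrite exprS -IH -phiM //; last exact: alg_gen_exp.
    by congr (phi _); apply/funext => q; rewrite exprS.
  pose Q (f : X -> K) N g := O g /\ forall q, Z q -> h i q != 0 -> f q = g q / h i q ^+ N.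
  have wd f N g N' g' : Q f N g -> Q f N' g' -> phi g / phi (h i) ^+ N = phi g' / phi (h i) ^+ N'.
    move=> [Og E] [Og' E'].
    have OX L : O (fun q => h i q ^+ L) by apply: alg_gen_exp; exact: Oh.
    have OXN := OX N; have OXN' := OX N'.
    apply/eqP; rewrite eqr_div ?expf_neq0 // -!phiX -!phiM //.
    have OM a b : O a -> O b -> O (a * b) by exact: AlgMul.
    have Ohi := Oh i.
    have O1 := OM _ _ Og (OX N'); have O2 := OM _ _ Og' (OX N).
    (* The identity between numerators is only known where [h i] does not vanish; one more factor
       [h i] makes it hold on [Z]. *)
    apply/eqP/(mulfI hi); rewrite -!phiM //.
    apply: (alg_char_eq Hphi phi0); [exact: OM|exact: OM|].
    move=> q Zq; rewrite !fun_mulE; have [->|hq] := eqVneq (h i q) 0; first by rewrite !mul0r.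
    congr (_ * _); apply/eqP; rewrite -eqr_div ?expf_neq0 //; apply/eqP.
    by rewrite -E // -E'.
  (* The extension of [phi] to the functions of the form [g / h i ^+ N], which is independent of the
     form chosen by [wd]; elsewhere the value 0 is arbitrary. *)
  pose phi' f := if pselect (exists Ng, Q f Ng.1 Ng.2) is left H
    then phi (projT1 (cid H)).2 / phi (h i) ^+ (projT1 (cid H)).1 else 0.
  have phi'E f N g : Q f N g -> phi' f = phi g / phi (h i) ^+ N.
    move=> Qf; rewrite /phi'; case: pselect => [H|[]]; last by exists (N, g).
    exact: wd (projT2 (cid H)) Qf.
  have [| |p [Zp hp] Ep] := coords_pt cy (phi := phi').
  - split=> [c|f f' Of Of'|f f' Of Of'].
    + rewrite (phi'E _ 0%N (fun=> c)) ?phic ?expr0 ?divr1 //.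
      by split=> [|q _ _]; [exact: AlgCst|rewrite expr0 divr1].
    + have [N [g [Og E]]] := Hy f Of; have [N' [g' [Og' E']]] := Hy f' Of'.
      have OX L : O (fun q => h i q ^+ L) by apply: alg_gen_exp; exact: Oh.
      have OXN := OX N; have OXN' := OX N'.
      have OM a b : O a -> O b -> O (a * b) by exact: AlgMul.
      rewrite (phi'E f N g) // (phi'E f' N' g') //.
      rewrite (phi'E _ (N + N')%N (g * (fun q => h i q ^+ N') + g' * (fun q => h i q ^+ N))).
        rewrite phiD; [|exact: OM|exact: OM]; rewrite !phiM // !phiX.
        by rewrite addf_div ?expf_neq0 // exprD.
      split; first by apply: AlgAdd; exact: OM.
      by move=> q Zq hq; rewrite !fun_addE !fun_mulE E // E' // addf_div ?expf_neq0 // exprD.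
    + have [N [g [Og E]]] := Hy f Of; have [N' [g' [Og' E']]] := Hy f' Of'.
      rewrite (phi'E f N g) // (phi'E f' N' g') // (phi'E _ (N + N')%N (g * g')).
        by rewrite phiM // mulf_div exprD.
      split; first exact: AlgMul.
      by move=> q Zq hq; rewrite !fun_mulE E // E' // mulf_div exprD.
  - move=> f Of f0; rewrite (phi'E f 0%N (fun=> 0)) ?phic ?mul0r //.
    by split=> [|q Zq hq]; [exact: AlgCst|rewrite mul0r f0].
  exists p => // g Og.
  have Rg : reg_on Z g by apply: reg_on_alg Og => // _ [j _ <-].
  have [f Of Ef] := coords_reg_alg cy (reg_on_sub (@subIsetl _ _ _) Rg).
  rewrite (Ef p (conj Zp hp)) -Ep // (phi'E f 0%N g) ?expr0 ?divr1 //.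
  by split=> // q Zq hq; rewrite expr0 divr1 Ef.
- move=> p q Zp Zq E; have [i hi] := cover p Zp; have [m [y [cy Hy]]] := loc i.
  have EO g : O g -> g p = g q by move=> Og; exact: alg_gen_eq Og E.
  have hq : h i q != 0 by rewrite -(EO (h i)) //; exact: Oh.
  apply: (coords_inj cy) => // j; have [N [g [Og Eg]]] := Hy (y j) (alg_gen_range y j).
  by rewrite !Eg // (EO g Og) (EO (h i) (Oh i)).
Qed.
End CoordsConstructions.

(** * Affine varieties and coordinates *)

Section AffineVarieties.
Variable K : closedFieldType.
Implicit Types X Y T : space K.

Lemma ringed_sub X (A : set X) : ringed X -> ringed (subspace_of X A).
Proof.
move=> rX; have sX := ringed_sheaf rX.
have comb (op : K -> K -> K) U f g :
    (forall U a b, open U -> regular X U a -> regular X U b -> regular X U (fun x => op (a x) (b x))) ->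
    regular (subspace_of X A) U f -> regular (subspace_of X A) U g ->
    regular (subspace_of X A) U (fun x => op (f x) (g x)).
  move=> Hop rf rg p Up; have [V [a [oV ra Vp Ea]]] := rf p Up.
  have [W [b [oW rb Wp Eb]]] := rg p Up; have oVW := openI oV oW.
  exists (V `&` W), (fun x => op (a x) (b x)); split=> //.
    by apply: Hop => //; [apply: sX.1 ra|apply: sX.1 rb].
  by move=> q Uq [Vq Wq]; rewrite Ea ?Eb.
split.
- exact: sub_sheaf.
- move=> U c oU p Up; exists setT, (fun=> c); split=> //; first exact: openT.
  by apply: ringed_cst => //; exact: openT.
- by move=> U f g oU; apply: (comb +%R) => *; exact: ringed_add.
- by move=> U f g oU; apply: (comb *%R) => *; exact: ringed_mul.
- move=> U f oU rf; split.
    apply: open_local => p [Up fp]; have [V [a [oV ra Vp Ea]]] := rf p Up.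
    have [U0 oU0 EU] := oU; have oW := regular_open_nz rX oV ra; rewrite -EU in Up rf Ea *.
    exists (val @^-1` (U0 `&` (V `&` [set x | a x != 0]))); split.
    + by exists (U0 `&` (V `&` [set x | a x != 0])) => //; exact: openI.
    + by split=> //; split=> //=; rewrite -Ea.
    + by move=> q [Uq [Vq aq]]; split=> //=; rewrite Ea.
  move=> p [Up fp]; have [V [a [oV ra Vp Ea]]] := rf p Up.
  have [oW rW] := ringed_inv rX oV ra.
  exists (V `&` [set x | a x != 0]), (fun x => (a x)^-1); split=> //.
    by split=> //=; rewrite -Ea.
  by move=> q [Uq fq] [Vq aq]; rewrite Ea.
Qed.

Lemma coords_affine_space m :
  @coords K (affine_space K m) setT m (fun i (x : 'rV[K]_m) => x 0 i).
Proof.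
have rA := ringed_affine_space K m.
have ES : [set f | exists i, f = fun x : 'rV[K]_m => x 0 i] = range (fun i (x : 'rV[K]_m) => x 0 i).
  by rewrite predeqE => f; split=> [[i ->]|[i _ <-]]; exists i.
pose O := alg_gen (range (fun i (x : 'rV[K]_m) => x 0 i)).
split.
- move=> i; apply: regular_reg_on; first exact: openT.
  move=> p _; exists setT, [set f | exists i, f = fun x : 'rV[K]_m => x 0 i], (fun x : 'rV[K]_m => x 0 i), (fun=> 1).
  split=> //; [by apply: AlgGen; exists i|exact: AlgCst|by split=> //; exact: oner_neq0|].
  by move=> q _ _ _; rewrite divr1.
- move=> V p oV _ Vp; have [D [S [h [[ED ES'] Sh Dp hp HV]]]] := gen_base (directed1 _) oV Vp.
  exists h; split=> //; first by rewrite /O -ES -ES'.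
  by move=> q _ hq; apply: HV => //; rewrite ED.
- move=> V f p oV rf _ Vp; have [D [S [g [h [[ED ES'] Sg Sh [Dp hp] E]]]]] := rf p Vp.
  exists g, h; split=> //; try by rewrite /O -ES -ES'.
  by move=> q _ Vq hq; apply: E => //; rewrite ED.
- move=> phi [phic phiD phiM] phi0; exists (\row_i phi (fun x : 'rV[K]_m => x 0 i)) => // f.
  elim=> {f} [_ [i _ <-]|c|f g Of Hf Og Hg|f g Of Hf Og Hg].
  + by rewrite mxE.
  + exact: phic.
  + by rewrite phiD // Hf Hg.
  + by rewrite phiM // Hf Hg.
- by move=> p q _ _ E; apply/rowP => i; exact: E.
Qed.

Lemma affine_coordsT T : ringed T -> affine_variety T ->
  exists m (y : 'I_m -> T -> K), coords setT y.
Proof.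
move=> rT [sT [m [C [f [cC [mf [fC finj fsurj] [g [mg fg]]]]]]]].
have rA := ringed_affine_space K m; have sA := ringed_sheaf rA.
have cA := coords_closed rA (coords_affine_space m) cC; rewrite setTI in cA.
have mg' : morph_on setT g by apply/morph_onT => //; apply: sub_sheaf.
have gval p (Cfp : C (f p)) : g (SigSub (mem_set Cfp)) = p.
  by apply: finj; rewrite ?in_setT // fg.
exists m, (fun i => (fun x : 'rV[K]_m => x 0 i) \o f).
apply: (coords_transport rA rT cA).
- exact/morph_onT.
- by move=> p _; exact: fC.
- by move=> q /fsurj[p _ <-]; exists p.
- by move=> p q _ _ E; apply: finj; rewrite ?in_setT.
- move=> V phi p oV rphi _ Vp; have Cfp : C (f p) by exact: fC.
  have [H1 H2] := mg' V oV.
  have [|W1 [[W oW <-] Wp HW]] := H1 (SigSub (mem_set Cfp)) Logic.I; first by rewrite gval.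
  have [|W2 [k [[W' oW' <-] W'p rk Ek]]] := H2 phi rphi (SigSub (mem_set Cfp)).
    by split=> //; rewrite /= gval.
  have [W3 [psi [oW3 rpsi W3p E3]]] := rk _ W'p.
  exists (W `&` W' `&` W3), psi; split=> //.
  + by do 2 (apply: openI => //).
  + by apply: sA.1 rpsi => //; do 2 (apply: openI => //).
  + move=> q _ [[Wq W'q] W3q]; have Cfq : C (f q) by exact: fC.
    have Vq : V q by rewrite -[q](gval q Cfq); apply: HW.
    split=> //; rewrite -(E3 (SigSub (mem_set Cfq))) // -Ek //=; first by rewrite gval.
    by split=> //=; rewrite gval.
Qed.

Lemma affine_coords X (Z : set X) : ringed X -> affine_variety (subspace_of X Z) ->
  exists m (y : 'I_m -> X -> K), coords Z y.
Proof.
move=> rX aT; have rT := ringed_sub Z rX; have [m [yT cT]] := affine_coordsT rT aT.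
(* An inverse of [val] defined on all of [X] needs a default point, so the empty subset is treated
   apart; there a character would satisfy [1 = 0]. *)
have [[t0]|nT] := pselect (inhabited (subspace_of X Z)); last first.
  exists 0%N, (fun i _ => 0).
  have nZ p : Z p -> False by move=> Zp; apply: nT; constructor; exact: (SigSub (mem_set Zp)).
  split=> [[]//|V p _ /nZ//|V h p _ _ /nZ//|phi Hphi phi0|p q /nZ //].
  exfalso; have /eqP := phi0 (fun=> 1) (AlgCst _ _) (fun p Zp => False_ind _ (nZ p Zp)).
  by case: Hphi => -> _ _; apply/negP; exact: oner_neq0.
pose h x : subspace_of X Z := if pselect (Z x) is left Zx then SigSub (mem_set Zx) else t0.
have valh x : Z x -> val (h x) = x by rewrite /h; case: pselect.
have hval t : h (val t) = t by apply/val_inj; rewrite valh //; exact: set_mem (valP t).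
exists m, (fun i => yT i \o h).
apply: (coords_transport rT rX cT).
- by apply: (morph_to_sub (f := id)) => //; [exact: ringed_sheaf..|exact: morph_on_id].
- by [].
- by move=> t _; exists (val t); [exact: set_mem (valP t)|].
- by move=> p q Zp Zq E; rewrite -(valh p Zp) E valh.
- exact: (@transport_inverse _ (subspace_of X Z) setT X Z h val rT (fun _ _ => Logic.I) valh (morph_on_val _)).
Qed.

Lemma coords_affine X (Z : set X) m (y : 'I_m -> X -> K) : ringed X -> coords Z y ->
  affine_variety (subspace_of X Z).
Proof.
move=> rX cy; have sX := ringed_sheaf rX; have rT := ringed_sub Z rX.
split; first exact: sub_sheaf.
pose F (x : X) : affine_space K m := \row_i y i x.
have yF i : y i = (fun x : 'rV[K]_m => x 0 i) \o F by apply/funext => x; rewrite /= mxE.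
pose f (t : subspace_of X Z) := F (val t).
have Zval (t : subspace_of X Z) : Z (val t) by exact: set_mem (valP t).
have cA := coords_affine_space m; have rA := ringed_affine_space K m; have sA := ringed_sheaf rA.
have alg_F h : alg_gen (range y) h -> exists2 g,
    alg_gen (range (fun i (x : 'rV[K]_m) => x 0 i)) g & h = g \o F.
  move=> Hh; apply: (alg_gen_precomp (y := fun i (x : 'rV[K]_m) => x 0 i)).
  by have -> : (fun i => (fun x : 'rV[K]_m => x 0 i) \o F) = y by apply/funext => i; rewrite -yF.
have F_alg g : alg_gen (range (fun i (x : 'rV[K]_m) => x 0 i)) g -> alg_gen (range y) (g \o F).
  by apply: alg_gen_comp => _ [i _ <-]; rewrite -yF; exact: alg_gen_range.
have mF : morph_on Z F.
  apply: (morph_on_gen (directed1 _)) => // D S p [-> ->] Zp _; exists setT.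
  split=> //; first exact: openT.
  by move=> g [i ->]; rewrite setIT -yF; exact: (coords_reg cy).
have oD g : alg_gen (range (fun i (x : 'rV[K]_m) => x 0 i)) g ->
    @open (affine_space K m) (setT `&` [set x | g x != 0]).
  move=> Og; apply: (regular_open_nz rA); first exact: openT.
  by apply: (reg_on_regular sA); [exact: openT|exact: (coords_alg_reg rA cA)].
(* If every polynomial that vanishes on the image vanishes at [z], then evaluation at [z] is a
   well-defined character of the algebra generated by the [y i], and [coords_pt] shows that [z] is
   in the image. *)
have cC : closed (range f).
  rewrite -[range f]setCK; apply: open_closedC; apply: open_local => z nz.
  pose O := alg_gen (range (fun i (x : 'rV[K]_m) => x 0 i)).
  suff [g [Og gz g0]] : exists g, [/\ O g, g z != 0 & forall t, g (f t) = 0].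
    exists (setT `&` [set x | g x != 0]); split=> //.
      exact: oD.
    by move=> q [_ /= gq] [t _ ft]; move/eqP: gq; rewrite -ft.
  apply: contrapT => H; apply: nz.
  have wd g g' : O g -> O g' -> (forall p, Z p -> g (F p) = g' (F p)) -> g z = g' z.
    move=> Og Og' E; apply/eqP/negP => /negP ne; apply: H.
    exists (fun x => g x + (-1) * g' x); split.
    + by apply: AlgAdd => //; apply: AlgMul => //; exact: AlgCst.
    + by rewrite mulN1r subr_eq0.
    + by move=> t; rewrite /f E // mulN1r subrr.
  pose phi h := if pselect (exists2 g, O g & h = g \o F) is left E then projT1 (cid2 E) z else 0.
  have phiE g : O g -> phi (g \o F) = g z.
    move=> Og; rewrite /phi; case: pselect => [E|[]]; last by exists g.
    case: (cid2 E) => g' Og' /= Eg; apply: wd => // p Zp.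
    by have := congr1 (@^~ p) Eg.
  have [| |p Zp Ep] := coords_pt cy (phi := phi).
  - split=> [c|h h' /alg_F[g Og ->] /alg_F[g' Og' ->]|h h' /alg_F[g Og ->] /alg_F[g' Og' ->]].
    + by rewrite (phiE (fun=> c)) //; exact: AlgCst.
    + by rewrite (phiE (fun x => g x + g' x)) ?phiE //; exact: AlgAdd.
    + by rewrite (phiE (fun x => g x * g' x)) ?phiE //; exact: AlgMul.
  - move=> h /alg_F[g Og ->] g0; rewrite phiE //.
    by rewrite (wd g (fun=> 0)) //; exact: AlgCst.
  exists (SigSub (mem_set Zp)) => //; apply/rowP => i.
  have Oi : O (fun x : 'rV[K]_m => x 0 i) by apply: AlgGen; exists i.
  rewrite -(phiE _ Oi) -yF Ep; last exact: alg_gen_range.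
  by rewrite yF.
exists m, (range f), f; split=> //; split.
- apply/morph_onT; first exact: sub_sheaf.
  by apply: (morph_on_comp (Z' := Z) _ _ _ mF) => //; [exact: sub_sheaf|exact: morph_on_val].
- split=> [t _|s t _ _ E|_ [t _ <-]]; [by exists t| |by exists t].
  apply/val_inj/(coords_inj cy) => // i; rewrite !yF.
  by move/rowP/(_ i): E.
- have gP (c : subspace_of (affine_space K m) (range f)) : exists t, f t = val c.
    by have [t _ ft] := set_mem (valP c); exists t.
  pose g c := projT1 (cid (gP c)); have fg c : f (g c) = val c := projT2 (cid (gP c)).
  exists g; split=> //; apply/morph_onT; first exact: sub_sheaf.
  apply: (morph_to_sub (f := fun c => val (g c))) => //; first exact: sub_sheaf.
  move=> V oV; split=> [c _ Vc|phi rphi c [_ Vc]].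
    have [h [Oh hp HV]] := coords_base cy oV (Zval _) Vc.
    have [h0 Oh0 Eh] := alg_F h Oh.
    have R0 := oD _ Oh0.
    exists (val @^-1` (setT `&` [set x | h0 x != 0])); split.
    + by exists (setT `&` [set x | h0 x != 0]).
    + by split=> //=; rewrite -fg; move: hp; rewrite Eh.
    + by move=> c' _ [_ /= hc']; apply: HV; [exact: Zval|rewrite Eh /= -[F _]/(f _) fg].
  have rphi' : reg_on (Z `&` V) phi by apply: reg_on_sub (regular_reg_on oV rphi); exact: subIsetr.
  have [a [b [Oa Ob bp E]]] := coords_reg_frac cy oV rphi' (Zval _) Vc.
  have [a0 Oa0 Ea] := alg_F a Oa; have [b0 Ob0 Eb] := alg_F b Ob.
  have Ra0 : @reg_on K (affine_space K m) setT a0 := coords_alg_reg rA cA Oa0.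
  have Rb0 : @reg_on K (affine_space K m) setT b0 := coords_alg_reg rA cA Ob0.
  have Rb := reg_on_inv rA Rb0.
  have Ra : @reg_on K (affine_space K m) (setT `&` [set x | b0 x != 0]) a0.
    by apply: reg_on_sub Ra0.
  have Rab := reg_on_mul rA Ra Rb.
  have oDb := oD _ Ob0.
  exists (val @^-1` (setT `&` [set x | b0 x != 0])), ((fun x => a0 x * (b0 x)^-1) \o val); split.
  + by exists (setT `&` [set x | b0 x != 0]).
  + by split=> //=; rewrite -fg; move: bp; rewrite Eb.
  + move=> c' Hc'; exists (setT `&` [set x | b0 x != 0]), (fun x => a0 x * (b0 x)^-1).
    by split=> //; exact: reg_on_regular Rab.
  + move=> c' [_ Vc'] [_ /= bc']; rewrite -fg in bc' *.
    by rewrite /= (E _ (Zval _) _).2 ?Ea ?Eb.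
Qed.

End AffineVarieties.

Section Varieties.
Variable K : closedFieldType.
Implicit Types X Y T : space K.

Lemma ringed_iso T (A : space K) (f : T -> A) (g : A -> T) : is_sheaf T -> ringed A ->
  is_morphism f -> is_morphism g -> cancel f g -> ringed T.
Proof.
move=> sT rA [cf rf] [cg rg] fg.
have E (U : set T) : f @^-1` (g @^-1` U) = U by rewrite predeqE => t /=; rewrite fg.
have oP (U : set T) : open U -> open (g @^-1` U) by move=> oU; move/continuousP: cg; apply.
have oQ (U : set A) : open U -> open (f @^-1` U) by move=> oU; move/continuousP: cf; apply.
have pull (U : set T) phi psi : open U -> regular A (g @^-1` U) psi ->
    (forall t, phi t = psi (f t)) -> regular T U phi.
  move=> oU /(rf _ _ (oP U oU)); rewrite E => H Ephi.
  by have -> : phi = psi \o f by apply/funext.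
split=> //.
- by move=> U c oU; apply: (pull U _ (fun=> c)) => //; apply: ringed_cst => //; exact: oP.
- move=> U a b oU ra rb; apply: (pull U _ (fun x => (a \o g) x + (b \o g) x)) => //.
    by apply: ringed_add => //; [exact: oP|exact: rg|exact: rg].
  by move=> t; rewrite /= fg.
- move=> U a b oU ra rb; apply: (pull U _ (fun x => (a \o g) x * (b \o g) x)) => //.
    by apply: ringed_mul => //; [exact: oP|exact: rg|exact: rg].
  by move=> t; rewrite /= fg.
- move=> U a oU ra; have [oV rV] := ringed_inv rA (oP U oU) (rg _ _ oU ra).
  have EU : U `&` [set x | a x != 0] = f @^-1` (g @^-1` U `&` [set x | (a \o g) x != 0]).
    by rewrite predeqE => t /=; rewrite fg.
  have oW : open (U `&` [set x | a x != 0]) by rewrite EU; exact: oQ.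
  split=> //; apply: (pull _ _ (fun x => ((a \o g) x)^-1)) => // t; by rewrite /= fg.
Qed.

Lemma ringed_affine T : affine_variety T -> ringed T.
Proof.
move=> [sT [m [C [f [cC [mf [fC finj fsurj] [g [mg fg]]]]]]]].
have rA := ringed_affine_space K m; have rS := ringed_sub C rA.
pose f' t : subspace_of (affine_space K m) C := SigSub (mem_set (fC t Logic.I)).
apply: (@ringed_iso T (subspace_of (affine_space K m) C) f' g) => //.
  apply/morph_onT => //; apply: (morph_to_sub (f := f)) => //; [exact: ringed_sheaf|].
  exact/morph_onT.
by move=> t; apply: finj; rewrite ?in_setT // fg.
Qed.

Lemma ringed_cover X (I : Type) (U : I -> set X) : is_sheaf X -> (forall i, open (U i)) ->
  (forall x, exists i, U i x) -> (forall i, ringed (subspace_of X (U i))) -> ringed X.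
Proof.
move=> sX oU cov rU.
have down i (V : set X) f : open V -> regular X V f ->
    regular (subspace_of X (U i)) (val @^-1` V) (f \o val).
  by move=> oV rf t Vt; exists V, f; split.
have oval i (V : set X) : open V -> @open (subspace_of X (U i)) (val @^-1` V) by exists V.
have up (V : set X) f : open V -> (forall i, exists2 g, regular (subspace_of X (U i)) (val @^-1` V) g &
     forall t, V (val t) -> f (val t) = g t) -> regular X V f.
  move=> oV H; apply: sX.2 => // x Vx; have [i Ux] := cov x.
  have [g rg Eg] := H i; have [W [k [oW rk Wx Ek]]] := rg (SigSub (mem_set Ux)) Vx.
  have oWU := openI oW (oU i).
  exists (W `&` U i), k; split=> //; first by apply: sX.1 rk.
  move=> y Vy [Wy Uy]; have := Eg (SigSub (mem_set Uy)) Vy => /= ->.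
  exact: (Ek (SigSub (mem_set Uy))).
split=> //.
- by move=> V c oV; apply: up => // i; exists (fun=> c) => //; apply: ringed_cst => //; exact: oval.
- move=> V f g oV rf rg; apply: up => // i; exists (fun t => (f \o val) t + (g \o val) t) => //.
  by apply: ringed_add => //; [exact: oval|exact: down|exact: down].
- move=> V f g oV rf rg; apply: up => // i; exists (fun t => (f \o val) t * (g \o val) t) => //.
  by apply: ringed_mul => //; [exact: oval|exact: down|exact: down].
- move=> V f oV rf; have oW : open (V `&` [set x | f x != 0]).
    apply: open_local => x [Vx fx]; have [i Ux] := cov x.
    have [[W oW EW] _] := ringed_inv (rU i) (oval i V oV) (down i V f oV rf).
    exists (W `&` U i); split; first exact: openI.
      split=> //; suff : (val @^-1` W) (SigSub (mem_set Ux) : subspace_of X (U i)) by [].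
      by rewrite EW.
    move=> y [Wy Uy]; have : (val @^-1` W) (SigSub (mem_set Uy) : subspace_of X (U i)) by [].
    by rewrite EW.
  split=> //; apply: up => // i; exists (fun t => ((f \o val) t)^-1) => //.
  by have [_] := ringed_inv (rU i) (oval i V oV) (down i V f oV rf).
Qed.

Lemma ringed_variety X : variety X -> ringed X.
Proof.
move=> [sX [m [U [HU cov]]] _]; apply: (@ringed_cover X 'I_m U) => // i; first by case: (HU i).
by apply: ringed_affine; case: (HU i).
Qed.

Lemma coords_variety X r (U : 'I_r -> set X) : ringed X ->
  (forall i, open (U i) /\ exists m (y : 'I_m -> X -> K), coords (U i) y) ->
  (forall x, exists i, U i x) -> @closed (product X X) [set p | p.1 = p.2] -> variety X.
Proof.
move=> rX HU cov cl; split=> //; first exact: ringed_sheaf.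
exists r, U; split=> // i; have [oU [m [y cy]]] := HU i; split=> //.
exact: coords_affine cy.
Qed.

Lemma coords_alg_open X (U : set X) m (y : 'I_m -> X -> K) f : ringed X -> open U ->
  coords U y -> alg_gen (range y) f -> open (U `&` [set x | f x != 0]).
Proof.
move=> rX oU cy Of; apply: regular_open_nz => //.
by apply: reg_on_regular => //; [exact: ringed_sheaf|exact: coords_alg_reg cy Of].
Qed.

Lemma morph_on_coords T (Z : set T) X (U : set X) m (y : 'I_m -> X -> K) (f : T -> X) :
  ringed T -> ringed X -> coords U y -> (forall p, Z p -> U (f p)) ->
  (forall i, reg_on Z (y i \o f)) -> morph_on Z f.
Proof.
move=> rT rX cy ZU H.
have Ralg g : alg_gen (range y) g -> reg_on Z (g \o f).
  move=> Og; apply: (@reg_on_alg _ _ rT _ (range (fun i => y i \o f))).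
    by move=> _ [i _ <-]; exact: H.
  exact: alg_gen_postcomp.
move=> V oV; split=> [p Zp Vp|g rg].
  have [h [Oh hp HV]] := coords_base cy oV (ZU p Zp) Vp.
  have [W [oW Wp HW]] := reg_on_nz rT (Ralg h Oh) Zp hp.
  by exists W; split=> // q Zq Wq; apply: HV; [exact: ZU|exact: HW].
apply: reg_on_local => [|p [Zp Vp]]; first exact: ringed_sheaf.
have [a [b [Oa Ob bp E]]] := coords_frac cy oV rg (ZU p Zp) Vp.
have [W [oW Wp HW]] := reg_on_nz rT (Ralg b Ob) Zp bp.
exists W; split=> //.
have Rb := reg_on_inv rT (Ralg b Ob).
have Ra : reg_on (Z `&` [set x | (b \o f) x != 0]) (a \o f).
  by apply: reg_on_sub (Ralg a Oa); exact: subIsetl.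
apply: (@reg_on_ext _ _ _ (fun x => (a \o f) x * ((b \o f) x)^-1)); last first.
  by apply: reg_on_sub (reg_on_mul rT Ra Rb) => q [[Zq Vq] Wq]; split=> //; exact: HW.
by move=> q [[Zq Vq] Wq] /=; rewrite E //; [exact: ZU|exact: HW].
Qed.

Lemma morph_on_alg T (Z : set T) X (U : set X) m (y : 'I_m -> X -> K) (f : T -> X) g :
  ringed T -> coords U y -> (forall p, Z p -> U (f p)) -> morph_on Z f -> reg_on U g -> reg_on Z (g \o f).
Proof. by move=> rT cy ZU Hf Hg; apply: morph_on_reg Hf ZU Hg; exact: ringed_sheaf. Qed.

Lemma coords_point_of_char X (U : set X) m (y : 'I_m -> X -> K) (phi : (X -> K) -> K) :
  coords U y -> alg_char (alg_gen (range y)) phi ->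
  (forall f, alg_gen (range y) f -> (forall p, U p -> f p = 0) -> phi f = 0) ->
  {p | U p /\ forall f, alg_gen (range y) f -> phi f = f p}.
Proof. by move=> cy H1 H2; apply: cid; have [p Up E] := coords_pt cy H1 H2; exists p. Qed.

End Varieties.

(** * Cones and fans *)

Section Cones.
Variable n : nat.
Local Notation N := 'rV[int]_n.
Local Notation M := 'cV[int]_n.
Implicit Types (u e : M) (v w c d : N) (s : seq N) (sigma tau : set N).

Lemma pairingDl u u' v : pairing (u + u') v = pairing u v + pairing u' v.
Proof. by rewrite /pairing mulmxDr mxE. Qed.
Lemma pairingDr u v v' : pairing u (v + v') = pairing u v + pairing u v'.
Proof. by rewrite /pairing mulmxDl mxE. Qed.
Lemma pairingZl k u v : pairing (k *: u) v = k * pairing u v.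
Proof. by rewrite /pairing -scalemxAr mxE. Qed.
Lemma pairingZr k u v : pairing u (k *: v) = k * pairing u v.
Proof. by rewrite /pairing -scalemxAl mxE. Qed.
Lemma pairing0l v : pairing (0 : M) v = 0. Proof. by rewrite /pairing mulmx0 mxE. Qed.
Lemma pairing0r u : pairing u (0 : N) = 0. Proof. by rewrite /pairing mul0mx mxE. Qed.
Lemma pairingNl u v : pairing (- u) v = - pairing u v.
Proof. by rewrite -scaleN1r pairingZl mulN1r. Qed.
Lemma pairingNr u v : pairing u (- v) = - pairing u v.
Proof. by rewrite -scaleN1r pairingZr mulN1r. Qed.
Lemma pairingBl u u' v : pairing (u - u') v = pairing u v - pairing u' v.
Proof. by rewrite pairingDl pairingNl. Qed.
Lemma pairingMn u v k : pairing u (v *+ k) = k%:Z * pairing u v.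
Proof. by rewrite -scaler_nat pairingZr natz. Qed.
Lemma pairing_sumr u (I : Type) (r : seq I) (F : I -> N) :
  pairing u (\sum_(i <- r) F i) = \sum_(i <- r) pairing u (F i).
Proof.
elim: r => [|i r IH]; first by rewrite !big_nil pairing0r.
by rewrite !big_cons pairingDr IH.
Qed.

Lemma pairing_ext v v' : (forall u, pairing u v = pairing u v') -> v = v'.
Proof.
move=> H; apply/rowP => i; have := H (delta_mx i 0).
have E w : pairing (delta_mx i 0) w = w 0 i; last by rewrite !E.
rewrite /pairing mxE (bigD1 i) //= big1 ?addr0 => [|j ji].
  by rewrite mxE !eqxx mulr1.
by rewrite mxE (negbTE ji) mulr0.
Qed.

Lemma pairing_extl u u' : (forall v, pairing u v = pairing u' v) -> u = u'.
Proof.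
move=> H; apply/colP => i; have := H (delta_mx 0 i).
have E u0 : pairing u0 (delta_mx 0 i) = u0 i 0; last by rewrite !E.
rewrite /pairing mxE (bigD1 i) //= big1 ?addr0 => [|j ji].
  by rewrite mxE !eqxx mul1r.
by rewrite mxE (negbTE ji) mul0r.
Qed.

Inductive nspan s : N -> Prop :=
| Nspan0 : nspan s 0
| NspanS v c : v \in s -> nspan s c -> nspan s (v + c).

Lemma nspanD s v c : nspan s v -> nspan s c -> nspan s (v + c).
Proof.
move=> Hv Hc; elim: Hv => [|w d ws _ IH]; first by rewrite add0r.
by rewrite -addrA; apply: NspanS.
Qed.

Lemma nspanMn s v k : nspan s v -> nspan s (v *+ k).
Proof.
move=> Hv; elim: k => [|k IH]; first by rewrite mulr0n; exact: Nspan0.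
by rewrite mulrS; exact: nspanD.
Qed.

Lemma nspan_mem s v : v \in s -> nspan s v.
Proof. by move=> vs; rewrite -[v]addr0; apply: NspanS => //; exact: Nspan0. Qed.

Lemma nspan_sub s s' v : {subset s <= s'} -> nspan s v -> nspan s' v.
Proof.
by move=> ss; elim=> [|w d /ss ws _ IH]; [exact: Nspan0|exact: NspanS].
Qed.

Lemma nspan_ge0 s v u : nspan s v -> (forall w, w \in s -> 0 <= pairing u w) -> 0 <= pairing u v.
Proof.
move=> Hv H; elim: Hv => [|w d ws _ IH]; first by rewrite pairing0r.
by rewrite pairingDr addr_ge0 // H.
Qed.

Lemma large_multiple s u e : (forall v, v \in s -> 0 < pairing u v) ->
  exists k : nat, forall v, v \in s -> 0 < pairing (k%:Z *: u + e) v.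
Proof.
move=> H; exists (\sum_(v <- s) `|pairing e v|.+1)%N => v vs.
rewrite pairingDl pairingZl (big_rem v vs) /=.
have := H v vs; move: (\sum_(_ <- _) _)%N => k; move: (pairing e v) (pairing u v) => a b b0.
nia.
Qed.

(* Gordan's alternative, by induction on the vectors: eliminate the first one
   by passing to the functionals that vanish on it. *)
Lemma gordan_alternative s (W : set M) : W 0 -> (forall u u', W u -> W u' -> W (u + u')) ->
  (forall (k : int) u, W u -> W (k *: u)) ->
  (exists2 u, W u & forall v, v \in s -> 0 < pairing u v) \/
  (exists v c, [/\ v \in s, nspan s c & forall u, W u -> pairing u (v + c) = 0]).
Proof.
elim: s W => [|v s IH] W W0 WD WZ; first by left; exists 0.
have sub : {subset s <= v :: s} by move=> x xs; rewrite inE xs orbT.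
have [Wv|] := pselect (forall u, W u -> pairing u v = 0).
  right; exists v, 0; split=> [||u Wu]; [exact: mem_head|exact: Nspan0|by rewrite addr0 Wv].
move=> /existsNP[e0 /not_implyP[We0 /eqP e0v]].
have [e We ev] : exists2 e, W e & 0 < pairing e v.
  have [?|?] := ltrP 0 (pairing e0 v); first by exists e0.
  by exists ((-1) *: e0); [exact: WZ|rewrite pairingZl; lia].
pose W' := [set u | W u /\ pairing u v = 0].
have [||k u [Wu uv]|[u' [Wu' u'v] Hu']|] := IH W'.
- by split=> //; rewrite pairing0l.
- by move=> u u' [Wu uv] [Wu' uv']; split; [exact: WD|rewrite pairingDl uv uv'].
- by split; [exact: WZ|rewrite pairingZl uv mulr0].
- have [k Hk] := large_multiple e Hu'; left; exists (k%:Z *: u' + e).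
    by apply: WD => //; exact: WZ.
  move=> w; rewrite inE => /orP[/eqP ->|/Hk //].
  by rewrite pairingDl pairingZl u'v mulr0 add0r.
move=> [w [c [ws Hc Hd]]]; have [d dE] : exists d, d = w + c by exists (w + c).
rewrite -dE in Hd.
(* Correcting [u] by a multiple of [e] gives a functional that vanishes on the first vector [v]. As
   such functionals kill [d], on [W] the vector [d] is the multiple [pairing e d / pairing e v] of
   [v]; the sign of the factor decides between the two alternatives. *)
have Hprop u : W u -> pairing e v * pairing u d = pairing e d * pairing u v.
  move=> Wu; have : W' (pairing e v *: u + (- pairing u v) *: e).
    split; first by apply: WD; exact: WZ.
    by rewrite pairingDl !pairingZl; ring.
  by move=> /Hd; rewrite pairingDl !pairingZl; lia.
have [q0|q0] := lerP (pairing e d) 0.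
  (* The relation is [pairing e v * d - pairing e d * v = 0] with [d = w + c]; one copy of [w] is
     the vector singled out in the conclusion, whence the predecessor. *)
  right; exists w, (w *+ `|pairing e v|.-1 + c *+ `|pairing e v| + v *+ `|pairing e d|).
  split=> [||u Wu]; first by rewrite inE ws orbT.
    apply: nspanD; last by apply/nspanMn/nspan_mem; exact: mem_head.
    apply: nspanD; apply: nspanMn; first by apply: nspan_mem; rewrite inE ws orbT.
    exact: nspan_sub Hc.
  have Eud : pairing u d = pairing u w + pairing u c by rewrite dE pairingDr.
  rewrite !pairingDr !pairingMn.
  have -> : (`|pairing e v|.-1)%:Z = pairing e v - 1 by lia.
  have -> : `|pairing e v|%N%:Z = pairing e v by lia.
  have -> : `|pairing e d|%N%:Z = - pairing e d by lia.
  have := Hprop u Wu; rewrite Eud => H.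
  by transitivity (pairing e v * (pairing u w + pairing u c) - pairing e d * pairing u v); [ring|rewrite H subrr].
have [[u Wu Hu]|[w' [c' [ws' Hc' Hd']]]] := IH W W0 WD WZ; last first.
  by right; exists w', c'; split=> //; [exact: sub|exact: nspan_sub Hc'].
left; exists u => // x; rewrite inE => /orP[/eqP ->|/Hu //].
have ud : 0 < pairing u d.
  rewrite dE pairingDr ltr_pwDl ?Hu //; apply: nspan_ge0 Hc _ => y /Hu; exact: ltW.
have := Hprop u Wu; move: (pairing e v) (pairing u d) (pairing e d) (pairing u v) ev ud q0 => A B C D; nia.
Qed.

Lemma cone_mem s v : v \in s -> cone_of s v.
Proof.
move=> vs; exists 1%N => //; exists (fun i => (i == index v s :> nat) : nat).
have iv : (index v s < size s)%N by rewrite index_mem.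
rewrite mulr1n (bigD1 (Ordinal iv)) //= eqxx mulr1n nth_index // big1 ?addr0 // => j.
by rewrite -val_eqE /= => /negbTE ->; rewrite mulr0n.
Qed.

Lemma cone_sat s v k : (0 < k)%N -> cone_of s (v *+ k) -> cone_of s v.
Proof. by move=> k0 [j j0 [a E]]; exists (k * j)%N; [rewrite muln_gt0 k0|exists a; rewrite mulrnA]. Qed.

Lemma cone0 s : cone_of s 0.
Proof. by exists 1%N => //; exists (fun=> 0%N); rewrite big1 // mul0rn. Qed.

Lemma coneD s v w : cone_of s v -> cone_of s w -> cone_of s (v + w).
Proof.
move=> [k k0 [a Ea]] [l l0 [b Eb]]; exists (k * l)%N; first by rewrite muln_gt0 k0.
exists (fun i => a i * l + b i * k)%N; rewrite mulrnDl mulrnA Ea [(k * l)%N]mulnC mulrnA Eb.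
by rewrite -!sumrMnl -big_split /=; apply: eq_bigr => i _; rewrite mulrnDr !mulrnA.
Qed.

Lemma nspan_cone s v : nspan s v -> cone_of s v.
Proof. by elim=> [|w d ws _ IH]; [exact: cone0|apply: coneD => //; exact: cone_mem]. Qed.

Lemma dual_coneP s u : dual_cone (cone_of s) u <-> forall v, v \in s -> 0 <= pairing u v.
Proof.
split=> [H v vs|H v [k k0 [a E]]]; first by apply: H; exact: cone_mem.
suff : 0 <= pairing u (v *+ k) by rewrite pairingMn; nia.
by rewrite E pairing_sumr sumr_ge0 // => i _; rewrite pairingMn mulr_ge0 // H // mem_nth.
Qed.

Lemma positive_on_cone s u : (forall v, v \in s -> v != 0 -> 0 < pairing u v) ->
  forall v, cone_of s v -> v != 0 -> 0 < pairing u v.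
Proof.
move=> H v [k k0 [a E]] v0.
have ge0 (i : 'I_(size s)) : 0 <= pairing u (s`_i *+ a i) :> int.
  rewrite pairingMn mulr_ge0 //; have [->|si] := eqVneq s`_i 0; first by rewrite pairing0r.
  by rewrite ltW // H // mem_nth.
have Epair : k%:Z * pairing u v = \sum_(i < size s) pairing u (s`_i *+ a i).
  by rewrite -pairingMn E pairing_sumr.
have : 0 <= \sum_(i < size s) pairing u (s`_i *+ a i) :> int by apply: sumr_ge0 => i _; exact: ge0.
rewrite le_eqVlt => /orP[/eqP Z0|]; last by rewrite -Epair; nia.
exfalso; move/eqP: v0; apply; apply/eqP; have : v *+ k == 0.
  rewrite E; apply/eqP; apply: big1 => i _.
  have /eqP := esym Z0; rewrite psumr_eq0 => [/allP/(_ i (mem_index_enum _))/=|j _]; last exact: ge0.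
  rewrite pairingMn mulf_eq0 => /orP[/eqP ai0|]; first by have -> : a i = 0%N by lia.
  move=> /eqP P0; have [->|si] := eqVneq s`_i 0; first by rewrite mul0rn.
  by have := H _ (mem_nth 0 (ltn_ord i)) si; rewrite P0.
move=> /eqP vk; apply/eqP/pairing_ext => u'; have := congr1 (pairing u') vk.
by rewrite pairingMn !pairing0r; nia.
Qed.

(** By Gordan's alternative, the only obstruction is a nonzero generator whose negative is in the
    cone too. *)
Lemma strictly_positive sigma : strongly_convex_cone sigma ->
  exists u, forall v, sigma v -> v != 0 -> 0 < pairing u v.
Proof.
move=> [[s ->] sc]; pose s' := [seq v <- s | v != 0].
have s's : {subset s' <= s} by move=> v; rewrite mem_filter => /andP[].
have [//|//|//|[u _ Hu]|[v [c [vs Hc H]]]] := @gordan_alternative s' setT.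
  by exists u; apply: positive_on_cone => v vs v0; apply: Hu; rewrite mem_filter v0.
exfalso; have cv : c = - v.
  by apply: pairing_ext => u; have := H u Logic.I; rewrite pairingDr pairingNr; lia.
have := sc v; rewrite -cv => H0; move: (vs); rewrite mem_filter => /andP[/eqP v0 _]; apply: v0.
by apply: H0; [apply/cone_mem/s's|apply/nspan_cone/(nspan_sub s's)].
Qed.

End Cones.

Lemma count_lt (T : eqType) (a b : pred T) (L : seq T) x : (forall k, a k -> b k) ->
  x \in L -> b x -> ~~ a x -> (count a L < count b L)%N.
Proof.
move=> ab; elim: L => // y L IH; rewrite inE => /orP[/eqP <-|xL] bx ax /=.
  by rewrite bx (negbTE ax) add0n add1n ltnS sub_count.
by have := IH xL bx ax; case: (boolP (a y)) => [/ab ->|_]; lia.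
Qed.

Section Fan.
Variable n : nat.
Local Notation N := 'rV[int]_n.
Local Notation M := 'cV[int]_n.
Variable Sigma : set (set N).
Hypothesis fanS : is_fan Sigma.
Implicit Types (sigma tau : set N) (u : M) (v : N).

Lemma fan_zero : Sigma [set 0].
Proof.
have [_ [sigma Ss] sc fa _] := fanS; have [u Hu] := strictly_positive (sc _ Ss).
apply: (fa sigma) => //; have s0 : sigma 0 by case: (sc _ Ss) => -[s ->] _; exact: cone0.
exists u => [v sv|].
  by have [->|v0] := eqVneq v 0; [rewrite pairing0r|rewrite ltW // Hu].
rewrite predeqE => v; split=> [->|[sv /= uv]]; first by split=> //=; rewrite pairing0r.
by apply/eqP/negP => /negP v0; have := Hu v sv v0; rewrite uv.
Qed.

Lemma fan_inter sigma tau : Sigma sigma -> Sigma tau -> Sigma (sigma `&` tau).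
Proof. by move=> Ss St; have [_ _ _ fa int] := fanS; apply: (fa sigma) => //; case: (int _ _ Ss St). Qed.

Lemma fan_contains0 sigma : Sigma sigma -> sigma 0.
Proof. by move=> Ss; have [_ _ sc _ _] := fanS; case: (sc _ Ss) => -[s ->] _; exact: cone0. Qed.

Lemma fan_minimal (Q : set (set N)) sigma : Sigma sigma -> Q sigma ->
  exists tau, [/\ Sigma tau, tau `<=` sigma, Q tau
    & forall kappa, Sigma kappa -> kappa `<=` tau -> Q kappa -> kappa = tau].
Proof.
have [/finite_seqP[L EL] _ _ _ _] := fanS => Ss Qs.
pose below tau := count (fun kappa => `[<kappa `<=` tau>]) L.
have [m [[tau [St ts Qt mt]] mmin]] := @ex_minimal_nat
  (fun m => exists tau, [/\ Sigma tau, tau `<=` sigma, Q tau & below tau = m])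
  (ex_intro _ _ (ex_intro _ sigma (And4 Ss (fun x => id) Qs erefl))).
exists tau; split=> // kappa Sk kt Qk; apply: contrapT => ne.
apply: (mmin (below kappa)); last by exists kappa; split=> // x /kt /ts.
rewrite -mt /below; have tL : tau \in L by move: St; rewrite EL.
apply: (count_lt _ tL) => [k /asboolP kk||]; [by apply/asboolP => x /kk /kt|exact/asboolP|].
by apply/asboolPn => tk; apply: ne; rewrite eqEsubset.
Qed.

Lemma fan_maximal sigma : Sigma sigma -> exists2 tau, maximal_cone Sigma tau & sigma `<=` tau.
Proof.
have [/finite_seqP[L EL] _ _ _ _] := fanS => Ss.
pose above tau := count (fun kappa => `[<tau `<=` kappa>]) L.
have [m [[tau [St ts mt]] mmin]] := @ex_minimal_nat
  (fun m => exists tau, [/\ Sigma tau, sigma `<=` tau & above tau = m])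
  (ex_intro _ _ (ex_intro _ sigma (And3 Ss (fun x => id) erefl))).
exists tau => //; split=> // kappa Sk tk; apply: contrapT => ne.
apply: (mmin (above kappa)); last by exists kappa; split=> // x /ts /tk.
rewrite -mt /above; have tL : tau \in L by move: St; rewrite EL.
apply: (count_lt _ tL) => [k /asboolP kk||]; [by apply/asboolP => x /tk /kk|exact/asboolP|].
by apply/asboolPn => kt; apply: ne; rewrite eqEsubset.
Qed.

(* On a cone minimal among those where [u] takes a negative value, all linear
   forms are proportional, so that cone is a ray. *)
Lemma dual_cone_rays sigma u : Sigma sigma ->
  (forall rho, ray_generators Sigma rho -> sigma rho -> 0 <= pairing u rho) -> dual_cone sigma u.
Proof.
move=> Ss Hu; apply: contrapT => nu.
have [tau [St ts nut tmin]] := fan_minimal (Q := fun tau => ~ dual_cone tau u) Ss nu.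
have [_ _ sc fa _] := fanS; have [[s Es] _] := sc _ St.
have [w0 Hw0] := strictly_positive (sc _ St).
have [v0 [v0s uv0]] : exists v0, v0 \in s /\ pairing u v0 < 0.
  apply: contrapT => H; apply: nut; rewrite Es; apply/dual_coneP => v vs; rewrite leNgt.
  by apply/negP => uv; apply: H; exists v.
(* Let [v1] minimize the slope [u / w] among the generators. Then [w(v1) u - u(v1) w] is nonnegative
   on [tau] and cuts out a face that contains [v1], on which [u] is negative. By minimality of [tau]
   this face is [tau]. *)
have key w : (forall v, tau v -> v != 0 -> 0 < pairing w v) ->
    exists a b : int, [/\ a < 0, 0 < b & forall v, tau v -> b * pairing u v = a * pairing w v].
  move=> Hw; pose q v : rat := (pairing u v)%:~R / (pairing w v)%:~R.
  have [v1 [v1s v1n0 v1min]] : exists v1, [/\ v1 \in s, v1 != 0 & forall v, v \in s -> v != 0 -> q v1 <= q v].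
    have v0n0 : v0 != 0 by apply: contraTneq uv0 => ->; rewrite pairing0r.
    elim: (s) (v0) v0s v0n0 => // x s' IH y ys yn0.
    have [[z [zs' zn0]]|H] := pselect (exists z, z \in s' /\ z != 0).
      have [v1 [v1s v1n0 v1m]] := IH z zs' zn0.
      have [->|xn0] := eqVneq x 0.
        exists v1; split=> // [|v]; first by rewrite inE v1s orbT.
        by rewrite inE => /orP[/eqP ->|/v1m]; rewrite ?eqxx.
      have [le|/ltW le] := lerP (q v1) (q x).
        exists v1; split=> // [|v]; first by rewrite inE v1s orbT.
        by rewrite inE => /orP[/eqP ->|/v1m].
      exists x; split=> // [|v]; first exact: mem_head.
      by rewrite inE => /orP[/eqP ->//|vs vn0]; apply: le_trans le _; exact: v1m.
    have xy : y = x.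
      by move: ys; rewrite inE => /orP[/eqP //|ys]; case: H; exists y.
    exists y; split=> // v; rewrite xy inE => /orP[/eqP -> //|vs vn0].
    by case: H; exists v.
  have tv v : v \in s -> tau v by move=> vs; rewrite Es; exact: cone_mem.
  have wv1 := Hw v1 (tv _ v1s) v1n0.
  have minw v : v \in s -> pairing u v1 * pairing w v <= pairing u v * pairing w v1.
    move=> vs; have [->|vn0] := eqVneq v 0; first by rewrite !pairing0r mulr0 mul0r.
    have wv := Hw v (tv _ vs) vn0.
    have := v1min v vs vn0; rewrite /q ler_pdivrMr ?ltr0z // mulrAC ler_pdivlMr ?ltr0z //.
    by rewrite -!intrM ler_int.
  have uv1 : pairing u v1 < 0.
    have v0n0 : v0 != 0 by apply: contraTneq uv0 => ->; rewrite pairing0r.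
    have := minw v0 v0s; have := Hw v0 (tv _ v0s) v0n0.
    by move: uv0 wv1; move: (pairing u v1) (pairing w v0) (pairing u v0) (pairing w v1); nia.
  exists (pairing u v1), (pairing w v1); split=> // v tauv.
  pose u' := pairing w v1 *: u + (- pairing u v1) *: w.
  have du' : dual_cone tau u'.
    rewrite Es; apply/dual_coneP => x xs; rewrite pairingDl !pairingZl.
    by have := minw x xs; lia.
  have Sf := fa _ (tau `&` [set v | pairing u' v = 0]) St (ex_intro2 _ _ u' du' erefl).
  have Ef : tau `&` [set v | pairing u' v = 0] = tau.
    apply: tmin => // H; have : 0 <= pairing u v1; last by lia.
    by apply: H; split; [exact: tv|rewrite /u' /= pairingDl !pairingZl; lia].
  by move: tauv; rewrite -Ef => -[_ /=]; rewrite /u' pairingDl !pairingZl; lia.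
(* An arbitrary form [e] becomes positive after adding a multiple of [w0]. Applying [key] to [w0]
   and to this sum shows that [e] is proportional to [w0] on [tau]. *)
have prop e v v' : tau v -> tau v' -> pairing e v * pairing w0 v' = pairing e v' * pairing w0 v.
  have [a [b [a0 b0 Eab]]] := key w0 Hw0.
  pose s' := [seq v <- s | v != 0].
  have [x xs'|k Hk] := @large_multiple n s' w0 e.
    move: xs'; rewrite mem_filter => /andP[x_n0 xs]; apply: Hw0 => //.
    by rewrite Es; exact: cone_mem.
  have [|a' [b' [a'0 b'0 Eab']]] := key (k%:Z *: w0 + e).
    rewrite Es; apply: positive_on_cone => x xs x_n0; apply: Hk; by rewrite mem_filter x_n0.
  move=> tv tv'; have := Eab v tv; have := Eab v' tv'; have := Eab' v tv; have := Eab' v' tv'.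
  rewrite !pairingDl !pairingZl.
  move: (pairing u v) (pairing u v') (pairing w0 v) (pairing w0 v') (pairing e v) (pairing e v') => A B C D E F H1 H2 H3 H4.
  have H5 : a' * b * (k%:Z * C + E) = a * b' * C.
    by rewrite -mulrA [b * _]mulrC mulrA -H2; transitivity (b' * (b * A)); [ring|rewrite H4; ring].
  have H6 : a' * b * (k%:Z * D + F) = a * b' * D.
    by rewrite -mulrA [b * _]mulrC mulrA -H1; transitivity (b' * (b * B)); [ring|rewrite H3; ring].
  have H7 : a' * b * (E * D - F * C) = 0.
    transitivity (a' * b * (k%:Z * C + E) * D - a' * b * (k%:Z * D + F) * C); first by ring.
    by rewrite H5 H6; ring.
  have ab : a' * b != 0 by rewrite mulf_neq0 //; lia.
  by move/eqP: H7; rewrite mulf_eq0 (negbTE ab) /= subr_eq0 => /eqP.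
have v0n0 : v0 != 0 by apply: contraTneq uv0 => ->; rewrite pairing0r.
have tv0 : tau v0 by rewrite Es; exact: cone_mem.
(* A nonzero lattice point of [tau] at which [w0] is least generates [tau]: by division with
   remainder [v - rho *+ k] is a point of [tau] with a smaller value, hence it is zero. *)
have [m [[rho [tr rn0 mr]] rmin]] := @ex_minimal_nat
  (fun m => exists rho, [/\ tau rho, rho != 0 & `|pairing w0 rho|%N = m])
  (ex_intro _ _ (ex_intro _ v0 (And3 tv0 v0n0 erefl))).
have wr := Hw0 rho tr rn0.
have Eray v : tau v -> exists k : nat, v = rho *+ k.
  move=> tv; have [->|vn0] := eqVneq v 0; first by exists 0%N.
  have wv := Hw0 v tv vn0.
  pose k := (`|pairing w0 v| %/ `|pairing w0 rho|)%N; pose r := (`|pairing w0 v| %% `|pairing w0 rho|)%N.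
  have Ekr : pairing w0 v = k%:Z * pairing w0 rho + r%:Z.
    have := divn_eq `|pairing w0 v| `|pairing w0 rho|; rewrite -/k -/r; lia.
  have rlt : (r < `|pairing w0 rho|)%N by rewrite /r ltn_mod; lia.
  have Ev : (v - rho *+ k) *+ `|pairing w0 rho| = rho *+ r.
    apply: pairing_ext => e; rewrite !pairingMn pairingDr pairingNr pairingMn.
    have := prop e v rho tv tr; rewrite Ekr; have -> : `|pairing w0 rho|%N%:Z = pairing w0 rho by lia.
    by move=> H; rewrite mulrDr mulrC H; ring.
  have tvk : tau (v - rho *+ k).
    rewrite Es; apply: (@cone_sat _ _ _ `|pairing w0 rho|); first by lia.
    rewrite Ev; elim: (r) => [|j IH]; first by rewrite mulr0n; exact: cone0.
    by rewrite mulrS; apply: coneD => //; rewrite -Es.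
  exists k; apply/eqP; rewrite -subr_eq0; apply/negP => /negP vkn0.
  apply: (rmin r); first by rewrite -mr.
  exists (v - rho *+ k); split=> //.
  have := congr1 (pairing w0) Ev; rewrite !pairingMn; have := Hw0 _ tvk vkn0; nia.
have rayr : ray_generators Sigma rho.
  split=> //; have -> // : [set rho *+ k | k in [set: nat]] = tau.
  rewrite predeqE => v; split=> [[k _ <-]|/Eray[k ->]]; last by exists k.
  rewrite Es; elim: k => [|j IH]; first by rewrite mulr0n; exact: cone0.
  by rewrite mulrS; apply: coneD => //; rewrite -Es.
have := Hu rho rayr (ts _ tr); have [a [b [a0 b0 Eab]]] := key w0 Hw0.
by have := Eab rho tr; nia.
Qed.

End Fan.

(** * Toric charts *)

Section Dickson.

Definition ledv d (a b : nat -> nat) := forall i, (i < d)%N -> (a i <= b i)%N.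

(** Every element lies above one of [s] in the first [d] coordinates, and also in the last one if
    that is at least [m], a bound for the last coordinates of [s]. For each of the finitely many
    smaller values of the last coordinate, the induction hypothesis is applied once more. *)
Lemma dickson d (A : set (nat -> nat)) :
  exists s : seq (nat -> nat), (forall f, f \in s -> A f) /\
    forall a, A a -> exists2 f, f \in s & ledv d f a.
Proof.
elim: d A => [|d IH] A.
  have [[a Aa]|nA] := pselect (exists a, A a); last first.
    by exists [::]; split=> // a Aa; case: nA; exists a.
  by exists [:: a]; split=> [f|b _]; [rewrite inE => /eqP ->|exists a => //; exact: mem_head].
have [s [sA Hs]] := IH A.
pose m := (\sum_(f <- s) f d)%N.
have [t [tA Ht]] : exists t : seq (nat -> nat), (forall f, f \in t -> A f) /\
    forall a, A a -> (a d < m)%N -> exists2 f, f \in t & ledv d.+1 f a.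
  elim: (m) => [|k [t [tA Ht]]]; first by exists [::].
  have [t' [tA' Ht']] := IH [set a | A a /\ a d = k].
  exists (t ++ t'); split=> [f|a Aa]; first by rewrite mem_cat => /orP[/tA|/tA'[]].
  rewrite ltnS leq_eqVlt => /orP[/eqP ak|/(Ht a Aa)[f ft fa]]; last first.
    by exists f => //; rewrite mem_cat ft.
  have [f ft fa] := Ht' a (conj Aa ak); exists f; first by rewrite mem_cat ft orbT.
  move=> i; rewrite ltnS leq_eqVlt => /orP[/eqP ->|/fa //].
  by have [_ ->] := tA' f ft; rewrite ak.
exists (s ++ t); split=> [f|a Aa]; first by rewrite mem_cat => /orP[/sA|/tA].
have [am|ma] := ltnP (a d) m.
  by have [f ft fa] := Ht a Aa am; exists f => //; rewrite mem_cat ft orbT.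
have [f fs fa] := Hs a Aa; exists f; first by rewrite mem_cat fs.
move=> i; rewrite ltnS leq_eqVlt => /orP[/eqP ->|/fa //].
by apply: leq_trans ma; rewrite /m (big_rem f fs) /=; exact: leq_addr.
Qed.

(** The nonzero elements lie above finitely many of them; such an element is subtracted, and one
    continues by induction on the sum of the coordinates. *)
Lemma dickson_generators d (A : set (nat -> nat)) :
  (forall a b, A a -> A b -> ledv d a b -> A (fun i => b i - a i)%N) ->
  exists s : seq (nat -> nat), (forall f, f \in s -> A f) /\
    forall a, A a -> exists t : seq (nat -> nat), {subset t <= s} /\
      forall i, (i < d)%N -> a i = (\sum_(f <- t) f i)%N.
Proof.
move=> HA; pose A' := [set a | A a /\ exists2 i, (i < d)%N & (0 < a i)%N].
have [s [sA Hs]] := dickson d A'; exists s; split=> [f /sA[]//|a].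
pose wt (a : nat -> nat) := (\sum_(i < d) a i)%N.
elim: {a}(wt a) {-2}a (leqnn (wt a)) => [|k IH] a wa Aa.
  exists [::]; split=> // i id; rewrite big_nil; apply/eqP; rewrite -leqn0.
  by rewrite (leq_trans _ wa) // /wt (bigD1 (Ordinal id)) //= leq_addr.
have [pos|zero] := pselect (exists2 i, (i < d)%N & (0 < a i)%N); last first.
  exists [::]; split=> // i id; rewrite big_nil; apply/eqP; rewrite -leqn0 leqNgt.
  by apply/negP => ai; apply: zero; exists i.
have [f fs fa] := Hs a (conj Aa pos); have [Af [j jd fj]] := sA f fs.
have [||t [ts Ht]] := IH (fun i => a i - f i)%N.
- rewrite -ltnS; apply: leq_trans wa; rewrite /wt.
  have E (b : nat -> nat) : (\sum_(i < d) b i = b j + \sum_(i < d | i != Ordinal jd) b i)%N.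
    by rewrite (bigD1 (Ordinal jd)).
  have h1 : (a j - f j < a j)%N by have := fa j jd; lia.
  have h2 : (\sum_(i < d | i != Ordinal jd) (a i - f i) <= \sum_(i < d | i != Ordinal jd) a i)%N.
    by apply: leq_sum => i _; exact: leq_subr.
  by rewrite (E a) (E (fun i => a i - f i)%N) /= -addSn leq_add.
- exact: HA.
exists (f :: t); split=> [x|i id]; first by rewrite inE => /orP[/eqP -> //|/ts].
by rewrite big_cons -Ht //; have := fa i id; lia.
Qed.

End Dickson.

Section Gordan.
Variable n : nat.
Local Notation N := 'rV[int]_n.
Local Notation M := 'cV[int]_n.

(* A lattice point of the dual cone is encoded by its positive and negative
   parts followed by its values on the generators of the cone. *)
Lemma dual_cone_generators (s : seq N) : exists t : seq M,
  (forall u, u \in t -> dual_cone (cone_of s) u) /\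
  forall u, dual_cone (cone_of s) u -> exists2 t' : seq M, {subset t' <= t} & u = \sum_(w <- t') w.
Proof.
pose dec (a : nat -> nat) : M := \col_i ((a i)%:Z - (a (n + i)%N)%:Z).
pose A := [set a : nat -> nat | forall i, (i < size s)%N -> pairing (dec a) s`_i = (a (n + n + i)%N)%:Z].
pose d := (n + n + size s)%N.
have decE a b : ledv d b a -> dec (fun i => a i - b i)%N = dec a - dec b.
  move=> ab; apply/colP => i; rewrite !mxE.
  by have := ab i; have := ab (n + i)%N; rewrite /d; have := ltn_ord i; lia.
have [|S [SA HS]] := @dickson_generators d A.
  move=> a b Aa Ab ab i si; rewrite decE // pairingBl Aa // Ab //.
  by have := ab (n + n + i)%N; rewrite /d; lia.
exists [seq dec a | a <- S]; split.
  move=> _ /mapP[a /SA Aa ->]; apply/dual_coneP => v vs.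
  by rewrite -(nth_index 0 vs) Aa // index_mem.
move=> u du; pose a (i : nat) : nat :=
  if insub i is Some j then `|Num.max (u (j : 'I_n) ord0) (0 : int)|%N
  else if insub (i - n)%N is Some j then `|Num.max (- u (j : 'I_n) ord0) (0 : int)|%N
  else `|pairing u s`_(i - (n + n))|%N.
have deca : dec a = u.
  apply/colP => i; rewrite mxE /a valK insubF; last by rewrite ltnNge leq_addr.
  rewrite addKn valK -[u i _]/(u i ord0) /Order.max; move: (u i ord0) => z.
  by case: ifP; case: ifP; lia.
have Aa : A a.
  move=> i si; rewrite deca /a !insubF; [|lia|lia].
  by rewrite addKn gez0_abs //; apply: du; exact/cone_mem/mem_nth.
have [t [tS Ht]] := HS a Aa; exists [seq dec b | b <- t].
  by move=> _ /mapP[b /tS bS ->]; exact: map_f.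
apply/colP => i; rewrite -{1}deca big_map summxE mxE.
have i1 : (i < d)%N by rewrite /d; have := ltn_ord i; lia.
have i2 : (n + i < d)%N by rewrite /d; have := ltn_ord i; lia.
rewrite (Ht i) // (Ht (n + i)%N) // !(big_morph Posz PoszD erefl) -sumrB.
by apply: eq_bigr => b _; rewrite mxE.
Qed.

End Gordan.

Section AffineToric.
Variables (K : closedFieldType) (n : nat).
Local Notation N := 'rV[int]_n.
Local Notation M := 'cV[int]_n.
Implicit Types (sigma : set N) (u w : M).

Lemma dual_coneD sigma u w : dual_cone sigma u -> dual_cone sigma w -> dual_cone sigma (u + w).
Proof. by move=> du dw v sv; rewrite pairingDl addr_ge0 ?du ?dw. Qed.

Lemma dual_cone_0 sigma : dual_cone sigma 0.
Proof. by move=> v _; rewrite pairing0l. Qed.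

Definition tchar sigma (u : M) (x : affine_toric K sigma) : K := sval x u.

Lemma tchar0 sigma (x : affine_toric K sigma) : tchar 0 x = 1.
Proof. by case: (svalP x). Qed.

Lemma tcharD sigma u w (x : affine_toric K sigma) : dual_cone sigma u -> dual_cone sigma w ->
  tchar (u + w) x = tchar u x * tchar w x.
Proof. by move=> du dw; case: (svalP x) => _ H _; exact: H. Qed.

Lemma sg_point_inj sigma (x y : sg_point K sigma) : sval x = sval y -> x = y.
Proof. by case: x y => x xP [y yP] /= E; apply: eq_exist. Qed.

Lemma tchar_ext sigma (x y : affine_toric K sigma) :
  (forall u, dual_cone sigma u -> tchar u x = tchar u y) -> x = y.
Proof.
move=> H; apply: sg_point_inj; apply/funext => u.
have [/H //|nu] := pselect (dual_cone sigma u).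
by case: (svalP x) => _ _ ->//; case: (svalP y) => _ _ ->.
Qed.

Lemma coords_affine_toric (s : seq N) : exists m (u : 'I_m -> M),
  (forall i, dual_cone (cone_of s) (u i)) /\
  @coords K (affine_toric K (cone_of s)) setT m (fun i => @tchar _ (u i)).
Proof.
set sigma := cone_of s; have [t [td Ht]] := dual_cone_generators s.
pose y (i : 'I_(size t)) : affine_toric K sigma -> K := @tchar sigma t`_i.
exists (size t), (fun i : 'I_(size t) => t`_i); split=> [i|]; first by apply: td; exact: mem_nth.
have rA := ringed_affine_toric K sigma; have sA := ringed_sheaf rA.
pose S := [set f | exists2 u, dual_cone sigma u & f = fun x : sg_point K sigma => sval x u].
have Sy : S `<=` alg_gen (range y).
  move=> _ [u du ->]; have [t' t't ->] := Ht u du.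
  suff [_ H] : dual_cone sigma (\sum_(w <- t') w) /\
    alg_gen (range y) (@tchar sigma (\sum_(w <- t') w)) by exact: H.
  elim: t' t't => [|w t' IH] t't.
    rewrite big_nil; split; first exact: dual_cone_0.
    have -> : @tchar sigma 0 = fun=> 1 by apply/funext => x; rewrite tchar0.
    exact: AlgCst.
  have [|dw aw] := IH; first by move=> x xt'; apply: t't; rewrite inE xt' orbT.
  have wt : w \in t by apply: t't; exact: mem_head.
  have dw' : dual_cone sigma w by exact: td.
  rewrite big_cons; split; first exact: dual_coneD.
  have -> : @tchar sigma (w + \sum_(w <- t') w) = fun x => tchar w x * tchar (\sum_(w <- t') w) x.
    by apply/funext => x; rewrite tcharD.
  apply: AlgMul => //; apply: AlgGen; have it : (index w t < size t)%N by rewrite index_mem.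
  by exists (Ordinal it) => //; rewrite /y /= nth_index.
have OS f : alg_gen S f -> alg_gen (range y) f by move=> Sf; exact: (alg_gen_sub Sy).
split.
- move=> i; apply: regular_reg_on; first exact: openT.
  move=> p _; exists setT, S, (y i), (fun=> 1); split=> //.
  + by apply: AlgGen; exists t`_i => //; apply: td; exact: mem_nth.
  + exact: AlgCst.
  + by split=> //; exact: oner_neq0.
  + by move=> q _ _ _; rewrite divr1.
- move=> V p oV _ Vp; have [D [S' [h [[ED ES'] Sh Dp hp HV]]]] := gen_base (directed1 _) oV Vp.
  exists h; split=> //; first by apply: OS; rewrite /S -ES'.
  by move=> q _ hq; apply: HV => //; rewrite ED.
- move=> V f p oV rf _ Vp; have [D [S' [g [h [[ED ES'] Sg Sh [Dp hp] E]]]]] := rf p Vp.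
  exists g, h; split=> //; try by apply: OS; rewrite /S -ES'.
  by move=> q _ Vq hq; apply: E => //; rewrite ED.
- move=> phi [phic phiD phiM] phi0.
  have Oc u : dual_cone sigma u -> alg_gen (range y) (@tchar sigma u).
    by move=> du; apply: Sy; exists u.
  pose x u : K := if pselect (dual_cone sigma u) is left _ then phi (@tchar sigma u) else 0.
  have xE u : dual_cone sigma u -> x u = phi (@tchar sigma u) by rewrite /x; case: pselect.
  have xP : sg_axiom sigma x.
    split=> [|u v du dv|u nu].
    + rewrite xE; last exact: dual_cone_0.
      by rewrite -[RHS]phic; congr (phi _); apply/funext => p; rewrite tchar0.
    + rewrite !xE //; last exact: dual_coneD.
      rewrite -phiM; [|exact: Oc|exact: Oc].
      by congr (phi _); apply/funext => p; rewrite tcharD.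
    + by rewrite /x; case: pselect.
  exists (exist _ x xP) => // f; elim=> {f} [_ [i _ <-]|c|f g Of Hf Og Hg|f g Of Hf Og Hg].
  + by rewrite /y [RHS]/tchar /= xE //; apply: td; exact: mem_nth.
  + exact: phic.
  + by rewrite phiD // Hf Hg.
  + by rewrite phiM // Hf Hg.
- move=> p q _ _ E; apply: tchar_ext => u du.
  apply: (alg_gen_eq (y := y)); last exact: E.
  by apply: Sy; exists u.
Qed.

Lemma alg_gen_chars sigma (P : Type) (ch : M -> P -> K) (S : set (P -> K)) f :
  (forall g, S g -> exists2 u, dual_cone sigma u & g = ch u) ->
  (forall p, ch 0 p = 1) ->
  (forall u w p, dual_cone sigma u -> dual_cone sigma w -> ch (u + w) p = ch u p * ch w p) ->
  alg_gen S f -> exists r (c : 'I_r -> K) (u : 'I_r -> M),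
    (forall i, dual_cone sigma (u i)) /\ forall p, f p = \sum_i c i * ch (u i) p.
Proof.
move=> HS ch0 chD; elim=> {f} [f /HS[u du ->]|c|f g _ [r [c [u [du E]]]] _ [r' [c' [u' [du' E']]]]
   |f g _ [r [c [u [du E]]]] _ [r' [c' [u' [du' E']]]]].
- by exists 1%N, (fun=> 1), (fun=> u); split=> // p; rewrite big_ord1 mul1r.
- exists 1%N, (fun=> c), (fun=> 0); split=> [_|p]; first exact: dual_cone_0.
  by rewrite big_ord1 ch0 mulr1.
- exists (r + r')%N, (fun i => match fintype.split i with inl j => c j | inr j => c' j end),
    (fun i => match fintype.split i with inl j => u j | inr j => u' j end); split.
    by move=> i; case: fintype.split.
  move=> p; rewrite big_split_ord E E'; congr (_ + _); apply: eq_bigr => i _.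
    by rewrite -[lshift _ _]/(unsplit (inl i)) unsplitK.
  by rewrite -[rshift _ _]/(unsplit (inr i)) unsplitK.
- exists #|{: 'I_r * 'I_r'}|, (fun i => c (enum_val i).1 * c' (enum_val i).2),
    (fun i => u (enum_val i).1 + u' (enum_val i).2); split.
    by move=> i; exact: dual_coneD.
  move=> p; rewrite E E' big_distrlr /= pair_big /=.
  rewrite [RHS](reindex (enum_rank (T := {: 'I_r * 'I_r'}))) /=; last first.
    by apply: onW_bij; exact: enum_rank_bij.
  by apply: eq_bigr => -[i j] _; rewrite enum_rankK /= chD // mulrACA.
Qed.

End AffineToric.

(** * Characters of the torus and weight components *)

Section Characters.
Variables (K : closedFieldType) (n : nat).
Hypothesis hK : [pchar K] =i pred0.
Local Notation M := 'cV[int]_n.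
Local Notation T := (torus K n).
Implicit Types (t : T) (u w : M).

Lemma natr_inj_char0 : forall k : nat, (k%:R == 0 :> K) = (k == 0)%N.
Proof. by apply/pcharf0P. Qed.

Lemma char0E t : character 0 t = 1. Proof. exact: tchar0. Qed.

Lemma charD u w t : character (u + w) t = character u t * character w t.
Proof. by apply: tcharD; exact: dual_cone0. Qed.

Lemma char_neq0 u t : character u t != 0.
Proof.
apply/eqP => u0; have := charD u (- u) t; rewrite subrr char0E u0 mul0r => /eqP.
by rewrite oner_eq0.
Qed.

Lemma charN u t : character (- u) t = (character u t)^-1.
Proof.
by apply: (mulfI (char_neq0 u t)); rewrite -charD subrr char0E mulfV ?char_neq0.
Qed.

Lemma charB u w t : character (u - w) t = character u t / character w t.
Proof. by rewrite charD charN. Qed.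

Lemma char_mul u s t : character u (torus_mul s t) = character u s * character u t.
Proof. by []. Qed.

Lemma char_one u : character u (@torus_one K n) = 1. Proof. by []. Qed.

Lemma torus_ext s t : (forall u, character u s = character u t) -> s = t.
Proof. by move=> H; apply: tchar_ext => u _; exact: H. Qed.

Lemma torus_mulC s t : torus_mul s t = torus_mul t s.
Proof. by apply: torus_ext => u; rewrite !char_mul mulrC. Qed.

Lemma torus_mul1 t : torus_mul t torus_one = t.
Proof. by apply: torus_ext => u; rewrite char_mul char_one mulr1. Qed.

Lemma torus_inv_axiom t : @sg_axiom K n [set 0] (fun u => (character u t)^-1).
Proof.
split=> [|u w _ _|u /(_ (@dual_cone0 n u)) //]; first by rewrite char0E invr1.
by rewrite charD invfM.
Qed.

Definition torus_inv t : T := exist _ _ (torus_inv_axiom t).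

Lemma char_inv u t : character u (torus_inv t) = (character u t)^-1. Proof. by []. Qed.

Lemma torus_mulV t : torus_mul t (torus_inv t) = torus_one.
Proof. by apply: torus_ext => u; rewrite char_mul char_inv char_one mulfV ?char_neq0. Qed.

(* The number 2 has infinite order in characteristic 0. *)
Lemma char_separate u w : u != w -> exists t, character u t != character w t.
Proof.
move=> uw; have [i ui] : exists i, u i 0 != w i 0.
  apply: contrapT => H; case/eqP: uw; apply/colP => i; apply/eqP/negP => /negP ui.
  by apply: H; exists i.
have two0 : 2 != 0 :> K by rewrite natr_inj_char0.
have ax : @sg_axiom K n [set 0] (fun u => 2 ^ (u i 0)).
  split=> [|a b _ _|a /(_ (@dual_cone0 n a)) //]; first by rewrite mxE expr0z.
  by rewrite mxE expfzDr.
exists (exist _ _ ax : T); rewrite /character /=.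
have key (a : int) : 2 ^ a = 1 :> K -> a = 0.
  have H k : 2 ^+ k = 1 :> K -> k = 0%N.
    move=> /eqP; rewrite -subr_eq0 -natrX -(natrB _ (expn_gt0 2 k)) natr_inj_char0 subn_eq0.
    by case: k => // k; rewrite leqNgt -{1}(expn0 2) ltn_exp2l.
  by case: a => k; [move/H => ->|rewrite NegzE -exprnN => /eqP; rewrite invr_eq1 => /eqP/H].
apply/eqP => E; case/eqP: ui; apply/eqP; rewrite -subr_eq0; apply/eqP/key.
by rewrite expfzDr // E -expfzDr // subrr expr0z.
Qed.

Definition fun_subspace (P : Type) (Q : set (P -> K)) :=
  [/\ Q 0, forall f g, Q f -> Q g -> Q (f + g) & forall c f, Q f -> Q ((fun=> c) * f)].

(** Dedekind's argument. Translating by [t0] and subtracting the multiple by [character w0 t0]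
    removes the term of weight [w0] and multiplies the one of weight [w] by a constant, which is
    nonzero if [t0] separates [w] from [w0]. *)
Lemma weights_in_subspace_uniq (P : Type) (Q : set (P -> K)) (ws : seq M) (g : M -> P -> K) :
  fun_subspace Q -> uniq ws ->
  (forall t, Q (\sum_(w <- ws) (fun=> character w t) * g w)) -> forall w, w \in ws -> Q (g w).
Proof.
move=> [Q0 QD QZ]; elim: ws g => // w0 ws IH g /andP[w0n uws] H.
have Hws w : w \in ws -> Q (g w).
  move=> wws; have w0w : w != w0 by apply: contraNneq w0n => <-.
  have [t0 Ht0] := char_separate w0w.
  have /(QZ (character w t0 - character w0 t0)^-1) : Q ((fun=> character w t0 - character w0 t0) * g w).
    apply: (IH (fun w => (fun=> character w t0 - character w0 t0) * g w)) => // t.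
    have := QD _ _ (H (torus_mul t t0)) (QZ (- character w0 t0) _ (H t)).
    congr Q; rewrite !big_cons mulrDr addrACA mulrA.
    apply/funext => p; rewrite !(fun_addE, fun_mulE, fct_sumE) char_mul.
    rewrite [X in X + _ = _](_ : _ = 0) ?add0r; last by ring.
    rewrite mulr_sumr -big_split /=; apply: eq_bigr => x _.
    by rewrite !(fun_addE, fun_mulE) /= -[sval t0 x]/(character x t0); ring.
  congr Q; apply/funext => p; rewrite !fun_mulE mulrA mulVf ?mul1r //.
  by rewrite subr_eq0.
move=> w; rewrite inE => /orP[/eqP ->|/Hws //].
have H1 := H torus_one; rewrite big_cons in H1.
have Hs : Q (\sum_(w <- ws) (fun=> character w torus_one) * g w).
  rewrite big_seq; apply: (big_ind Q) => // x xs.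
  by apply: QZ; exact: Hws.
have := QD _ _ H1 (QZ (-1) _ Hs); congr Q; apply/funext => p.
by rewrite !(fun_addE, fun_mulE) char_one; ring.
Qed.

Lemma sum_by_weight (I : finType) (u : I -> M) (c : I -> K) (F : M -> K) :
  \sum_i c i * F (u i) = \sum_(w <- undup (codom u)) (\sum_(i | u i == w) c i) * F w.
Proof.
rewrite (eq_bigr (fun i => \sum_(w <- undup (codom u) | u i == w) c i * F w)); last first.
  move=> i _; rewrite (eq_bigl (fun w => w == u i)) => [|x]; last by rewrite eq_sym.
  by rewrite -big_filter filter_pred1_uniq ?undup_uniq ?big_seq1 ?mem_undup ?codom_f.
by rewrite (exchange_big_dep xpredT) //=; apply: eq_bigr => w _; rewrite mulr_suml.
Qed.

Lemma weights_in_subspace (P : Type) (Q : set (P -> K)) r (u : 'I_r -> M) (f : 'I_r -> P -> K) :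
  fun_subspace Q -> (forall t, Q (fun p => \sum_i character (u i) t * f i p)) ->
  forall w, Q (fun p => \sum_(i | u i == w) f i p).
Proof.
move=> sQ H w; have [Q0 _ _] := sQ.
have [wu|wnu] := boolP (w \in undup (codom u)); last first.
  congr Q: Q0; apply/funext => p; rewrite big_pred0 // => i.
  by apply/eqP => E; move: wnu; rewrite mem_undup -E codom_f.
pose g w p := \sum_(i | u i == w) f i p.
apply: (@weights_in_subspace_uniq _ Q (undup (codom u)) g sQ (undup_uniq _) _ w wu) => t.
congr Q: (H t); apply/funext => p; rewrite fct_sumE.
rewrite [RHS](eq_bigr (fun w => \sum_(i | u i == w) character w t * f i p)); last first.
  by move=> x _; rewrite fun_mulE /g mulr_sumr.
rewrite (exchange_big_dep xpredT) //=; apply: eq_bigr => i _.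
rewrite (eq_bigl (fun w => w == u i)) => [|x]; last by rewrite eq_sym.
by rewrite -big_filter filter_pred1_uniq ?undup_uniq ?big_seq1 ?mem_undup ?codom_f.
Qed.

End Characters.

(** * The charts of a toric variety and its open orbit *)

Section ToricCharts.
Variables (K : closedFieldType) (n : nat).
Hypothesis hK : [pchar K] =i pred0.
Local Notation N := 'rV[int]_n.
Local Notation M := 'cV[int]_n.
Local Notation T := (torus K n).
Variable Sigma : set (set N).
Hypothesis fanS : is_fan Sigma.
Variable X : toric_variety K Sigma.
Implicit Types (t : T) (u w : M) (sigma tau : Sigma) (x : X).

Let rX : ringed X := ringed_variety (toric_is_variety X).
Let sX := ringed_sheaf rX.
Let rT : ringed T := ringed_affine_toric K [set 0].

Local Notation chart s := (@toric_chart K n Sigma X s).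

Definition fcone (s : set N) (Ss : Sigma s) : Sigma := SigSub (mem_set Ss).

Lemma fcone_mem sigma : Sigma (val sigma). Proof. exact: set_mem (valP sigma). Qed.

Definition cone0F : Sigma := fcone (fan_zero fanS).
Definition coneI sigma tau : Sigma := fcone (fan_inter fanS (fcone_mem sigma) (fcone_mem tau)).

Definition tU sigma : set X := range (chart sigma).

Lemma tU_open sigma : open (tU sigma).
Proof. by case: (toric_chart_open X sigma). Qed.

Lemma toric_chart_inj sigma : injective (chart sigma).
Proof.
have [_ [_ [_ inj _] _]] := toric_chart_open X sigma.
by move=> p q; apply: inj; rewrite in_setT.
Qed.

Lemma one_point_axiom (s : set N) : @sg_axiom K n s (fun u => if `[<dual_cone s u>] then 1 else 0).
Proof.
split=> [|u w du dw|u nu]; last by rewrite asboolF.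
  by rewrite asboolT //; exact: dual_cone_0.
by rewrite !asboolT ?mulr1 //; exact: dual_coneD.
Qed.

Definition tinv sigma x : affine_toric K (val sigma) :=
  if pselect (tU sigma x) is left Ux then projT1 (cid2 Ux)
  else exist _ _ (one_point_axiom (val sigma)).

Lemma tinvK sigma x : tU sigma x -> chart sigma (tinv sigma x) = x.
Proof. by rewrite /tinv; case: pselect => // Ux _; case: (cid2 Ux). Qed.

Lemma tchartK sigma p : tinv sigma (chart _ p) = p.
Proof. by apply: toric_chart_inj; rewrite tinvK //; exists p. Qed.

Lemma morph_tchart sigma : @morph_on _ (affine_toric K (val sigma)) setT X (chart sigma).
Proof.
have [_ [m _ _]] := toric_chart_open X sigma.
by apply/morph_onT => //; exact: ringed_sheaf (ringed_affine_toric _ _).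
Qed.

Lemma morph_tinv sigma : morph_on (tU sigma) (tinv sigma).
Proof.
have [_ [_ _ [g [mg Eg]]]] := toric_chart_open X sigma.
apply: morph_on_of_sub => //; have -> // : tinv sigma \o val = g.
by apply/funext => y; rewrite /= -Eg tchartK.
Qed.

Definition xchar sigma u x : K := tchar u (tinv sigma x).

Lemma xchar0 sigma x : xchar sigma 0 x = 1. Proof. exact: tchar0. Qed.

Lemma xcharD sigma u w x : dual_cone (val sigma) u -> dual_cone (val sigma) w ->
  xchar sigma (u + w) x = xchar sigma u x * xchar sigma w x.
Proof. exact: tcharD. Qed.

Lemma coords_tU sigma : exists m (u : 'I_m -> M), (forall i, dual_cone (val sigma) (u i)) /\
  coords (tU sigma) (fun i => xchar sigma (u i)).
Proof.
have [_ _ sc _ _] := fanS; have [[s Es] _] := sc _ (fcone_mem sigma).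
have [m [u [du cA]]] := coords_affine_toric K s; rewrite -Es in du cA.
exists m, u; split=> //; have rA := ringed_affine_toric K (val sigma).
apply: (coords_transport rA rX cA (morph_tinv (sigma := sigma))) => //.
- by move=> q _; exists (chart _ q); [exists q|exact: tchartK].
- by move=> p q Up Uq E; rewrite -(tinvK Up) E tinvK.
- apply: (@transport_inverse _ (affine_toric K (val sigma)) setT X (tU sigma) (tinv sigma)
    (chart sigma)) => //.
    by move=> p; exact: tinvK.
  exact: morph_tchart.
Qed.

Lemma reg_xchar sigma u : dual_cone (val sigma) u -> reg_on (tU sigma) (xchar sigma u).
Proof.
move=> du; apply: (morph_on_reg (Z' := setT) sX (morph_tinv (sigma := sigma))) => //.
apply: regular_reg_on; first exact: openT.
move=> p _; exists setT, [set f | exists2 u, dual_cone (val sigma) u &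
  f = fun x : sg_point K (val sigma) => sval x u], (tchar u), (fun=> 1).
split=> //; [by apply: AlgGen; exists u|exact: AlgCst|by split=> //; exact: oner_neq0|].
by move=> q _ _ _; rewrite divr1.
Qed.

Lemma reg_tU sigma f : reg_on (tU sigma) f -> exists r (c : 'I_r -> K) (u : 'I_r -> M),
  (forall i, dual_cone (val sigma) (u i)) /\
  forall x, tU sigma x -> f x = \sum_i c i * xchar sigma (u i) x.
Proof.
move=> Rf; have [m [u [du cU]]] := coords_tU sigma.
have [g Og Eg] := coords_reg_alg cU Rf.
have [| | |r [c [w [dw E]]]] := @alg_gen_chars K n (val sigma) X (xchar sigma) _ g _ _ _ Og.
- by move=> _ [i _ <-]; exists (u i).
- exact: xchar0.
- by move=> *; exact: xcharD.
by exists r, c, w; split=> // x Ux; rewrite Eg.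
Qed.

Lemma xchar_point sigma x y : tU sigma x -> tU sigma y ->
  (forall u, dual_cone (val sigma) u -> xchar sigma u x = xchar sigma u y) -> x = y.
Proof.
by move=> Ux Uy H; rewrite -(tinvK Ux) -(tinvK Uy); congr (chart _); exact: tchar_ext.
Qed.

Lemma restrict_axiom (s s' : set N) (p : sg_point K s') : s' `<=` s ->
  @sg_axiom K n s (fun u => if `[<dual_cone s u>] then sval p u else 0).
Proof.
move=> ss; have [p0 pD _] := svalP p.
have sub u : dual_cone s u -> dual_cone s' u by move=> du v /ss; exact: du.
split=> [|u w du dw|u nu]; last by rewrite asboolF.
  by rewrite asboolT //; exact: dual_cone_0.
by have duw := dual_coneD du dw; rewrite !asboolT //; apply: pD; exact: sub.
Qed.

Lemma tU_sub sigma tau : val tau `<=` val sigma -> tU tau `<=` tU sigma /\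
  forall u x, tU tau x -> dual_cone (val sigma) u -> xchar sigma u x = xchar tau u x.
Proof.
move=> ts.
have key (p : affine_toric K (val tau)) : chart _ (exist _ _ (restrict_axiom p ts) : affine_toric K (val sigma))
   = chart _ p.
  by apply: toric_glue => // u du /=; rewrite asboolT.
split=> [_ [p _ <-]|u _ [p _ <-] du]; first by rewrite -key; exists (exist _ _ (restrict_axiom p ts)).
by rewrite /xchar tchartK -key tchartK /tchar /= asboolT.
Qed.

Lemma tU_inter sigma tau : tU sigma `&` tU tau = tU (coneI sigma tau).
Proof. exact: toric_overlap. Qed.

Definition xorb t : X := chart cone0F t.

Lemma cone0F_sub sigma : val cone0F `<=` val sigma.
Proof. by move=> _ ->; exact: (fan_contains0 fanS (fcone_mem sigma)). Qed.

Lemma xorb_tU sigma t : tU sigma (xorb t).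
Proof. by have [H _] := tU_sub (@cone0F_sub sigma); apply: H; exists t. Qed.

Lemma xchar_xorb sigma u t : dual_cone (val sigma) u -> xchar sigma u (xorb t) = character u t.
Proof.
move=> du; have [_ ->] := tU_sub (@cone0F_sub sigma) => //; last by exists t.
by rewrite /xchar tchartK.
Qed.

Lemma tU_act sigma t x : tU sigma x -> tU sigma (toric_act t x).
Proof. by move=> [p _ <-]; rewrite toric_chart_act; exists (torus_scale t p). Qed.

Lemma xchar_act sigma u t x : tU sigma x ->
  xchar sigma u (toric_act t x) = character u t * xchar sigma u x.
Proof. by move=> [p _ <-]; rewrite toric_chart_act /xchar !tchartK. Qed.

Lemma act_xorb s t : toric_act s (xorb t) = xorb (torus_mul s t).
Proof. exact: toric_chart_act. Qed.

Lemma xorb_one_act t : xorb t = toric_act t (xorb torus_one).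
Proof. by rewrite act_xorb torus_mul1. Qed.

(* Linear independence of characters makes the open orbit dense. *)
Lemma char_combination_zero r (c : 'I_r -> K) (u : 'I_r -> M) :
  (forall t, \sum_i c i * character (u i) t = 0) -> forall F : M -> K, \sum_i c i * F (u i) = 0.
Proof.
move=> H F; pose Q : set (unit -> K) := [set 0].
have sQ : fun_subspace Q.
  by split=> // [f g -> ->|a f ->]; [rewrite addr0|rewrite mulr0].
have H' t : Q (fun p => \sum_i character (u i) t * (fun _ : unit => c i) p).
  by apply/funext => p; rewrite -[RHS](H t); apply: eq_bigr => i _; rewrite mulrC.
have key w : \sum_(i | u i == w) c i = 0.
  by have := weights_in_subspace hK sQ H' w; move/(congr1 (@^~ tt)).
by rewrite sum_by_weight big1 // => w _; rewrite key mul0r.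
Qed.

Lemma reg_tU_zero sigma f : reg_on (tU sigma) f -> (forall t, f (xorb t) = 0) ->
  forall x, tU sigma x -> f x = 0.
Proof.
move=> /reg_tU[r [c [u [du E]]]] H x Ux; rewrite E //.
apply: (char_combination_zero (c := c) (u := u) _ (fun u => xchar sigma u x)) => t.
transitivity (f (xorb t)); last exact: H.
rewrite E; last exact: xorb_tU.
by apply: eq_bigr => i _; rewrite xchar_xorb.
Qed.

Lemma reg_tU_eq sigma f g : reg_on (tU sigma) f -> reg_on (tU sigma) g ->
  (forall t, f (xorb t) = g (xorb t)) -> forall x, tU sigma x -> f x = g x.
Proof.
move=> Rf Rg H x Ux; apply/eqP; rewrite -subr_eq0; apply/eqP.
have R : reg_on (tU sigma) (fun x => f x + (-1) * g x).
  by apply: reg_on_add => //; apply: reg_on_mul => //; exact: reg_on_cst.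
have := reg_tU_zero R _ Ux; rewrite mulN1r; apply=> t.
by rewrite H mulN1r subrr.
Qed.

Lemma reg_character (Z : set T) u : @reg_on _ T Z (character u).
Proof.
apply: (@reg_on_sub _ T setT) => //; apply: regular_reg_on; first exact: openT.
move=> p _; exists setT, [set f | exists2 u, dual_cone [set 0] u &
  f = fun x : sg_point K [set 0] => sval x u], (tchar u), (fun=> 1).
split=> //; [by apply: AlgGen; exists u => //; exact: dual_cone0|exact: AlgCst|by split=> //; exact: oner_neq0|].
by move=> q _ _ _; rewrite divr1.
Qed.

Lemma morph_act sigma : @morph_on _ (product T X) (setT `*` tU sigma) X
  (fun p => toric_act p.1 p.2).
Proof.
have rP : ringed (product T X) by apply: ringed_product => //; exact: ringed_sheaf.
have [m [u [du cU]]] := coords_tU sigma.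
apply: (morph_on_coords rP rX cU) => [[t x] [_ Ux]|i]; first exact: tU_act.
have R1 : @reg_on _ (product T X) (setT `*` tU sigma) (character (u i) \o fst).
  apply: (morph_on_reg (Z' := setT) _ (morph_on_fst _ rT rX)) => //; first exact: ringed_sheaf.
  exact: reg_character.
have R2 : @reg_on _ (product T X) (setT `*` tU sigma) (xchar sigma (u i) \o snd).
  apply: (morph_on_reg (Z' := tU sigma) _ (morph_on_snd _ rT rX)).
  - exact: ringed_sheaf.
  - by move=> p [].
  - exact: reg_xchar.
by apply: reg_on_ext (reg_on_mul rP R1 R2) => -[t x] [_ Ux] /=; rewrite xchar_act.
Qed.

Lemma coords_torus : exists m (u : 'I_m -> M),
  @coords K T setT m (fun i => character (u i)).
Proof.
have [m [u [_ cA]]] := coords_affine_toric K ([::] : seq N).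
have E0 : cone_of [::] = [set 0 : N].
  rewrite predeqE => v; split=> [[k k0 [a]]|->]; last exact: cone0.
  rewrite big_ord0 => vk; apply: pairing_ext => u'; have := congr1 (pairing u') vk.
  by rewrite pairingMn !pairing0r; nia.
by rewrite E0 in cA; exists m, u.
Qed.

Lemma alg_gen_torus_chars m (u : 'I_m -> M) (f : T -> K) : alg_gen (range (fun i => @character K n (u i))) f ->
  exists r (c : 'I_r -> K) (w : 'I_r -> M), forall t, f t = \sum_i c i * character (w i) t.
Proof.
move=> Of; have [| | |r [c [w [_ E]]]] := @alg_gen_chars K n [set 0] T (@character K n) _ f _ _ _ Of.
- by move=> _ [i _ <-]; exists (u i) => //; exact: dual_cone0.
- exact: char0E.
- by move=> *; exact: charD.
by exists r, c, w.
Qed.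

End ToricCharts.

(** * The equivariant retraction *)

Section AlgebraicSection.
Variables (K : closedFieldType) (n : nat).
Hypothesis hK : [pchar K] =i pred0.
Local Notation M := 'cV[int]_n.
Local Notation T := (torus K n).
Variables (P : Type) (l : nat) (z : 'I_l -> P -> K) (e0 : P).
Let O := alg_gen (range z).
Let sO : subring O := subring_alg_gen _.
Let OM f g : O f -> O g -> O (f * g). Proof. exact: AlgMul. Qed.
Let OD f g : O f -> O g -> O (f + g). Proof. exact: AlgAdd. Qed.
Let OC c : O (fun=> c). Proof. exact: AlgCst. Qed.
Let O1 : O 1. Proof. exact: AlgCst. Qed.
Definition point_ideal (S : set (P -> K)) (e : P) := [set f | S f /\ f e = 0].
Let m := point_ideal O e0.

Variable theta : T -> P -> P.
Hypothesis theta_rat : forall r, O r -> exists k (u : 'I_k -> M) (f : 'I_k -> P -> K),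
  (forall i, O (f i)) /\ forall t p, r (theta t p) = \sum_i character (u i) t * f i p.
Hypothesis theta_e0 : forall t, theta t e0 = e0.
Hypothesis theta_one : forall p, theta torus_one p = p.
Hypothesis theta_mul : forall s t p, theta (torus_mul s t) p = theta s (theta t p).

Variables (S : set M) (alpha : M -> P -> K).
Hypothesis S0 : S 0.
Hypothesis SD : forall u w, S u -> S w -> S (u + w).
Hypothesis alphaO : forall u, S u -> O (alpha u).
Hypothesis alpha0 : alpha 0 = 1.
Hypothesis alphaD : forall u w, S u -> S w -> alpha (u + w) = alpha u * alpha w.
Hypothesis alpha_theta : forall u t p, S u -> alpha u (theta t p) = character u t * alpha u p.

(** The functions that come from the base: [S] will be the dual cone of [sigma] and [alpha u] the
    pullback of the character [u] to the bundle. *)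
Definition char_span : set (P -> K) := [set a | exists k (c : 'I_k -> K) (u : 'I_k -> M),
  (forall i, S (u i)) /\ forall p, a p = \sum_i c i * alpha (u i) p].
Let A := char_span.

Variables (d : nat) (x : 'I_d -> P -> K) (w : 'I_d -> M).
Hypothesis xO : forall i, O (x i).
Hypothesis x_e0 : forall i, x i e0 = 0.
Hypothesis x_theta : forall i t p, x i (theta t p) = character (w i) t * x i p.
Let X := idl O (range x).

(** An Euler derivation transverse to the section sought: it kills the functions from the base,
    takes values in the ideal of the [x i], and multiplies each [x i] by one function that does not
    vanish at [e0]. *)
Variables (Eul : (P -> K) -> P -> K) (Delta : P -> K).
Hypothesis EulO : forall r, O r -> X (Eul r).
Hypothesis EulD : forall r r', O r -> O r' -> Eul (r + r') = Eul r + Eul r'.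
Hypothesis EulM : forall r r', O r -> O r' -> Eul (r * r') = r * Eul r' + r' * Eul r.
Hypothesis Eulx : forall i, Eul (x i) = Delta * x i.
Hypothesis Eula : forall u, S u -> Eul (alpha u) = 0.
Hypothesis DeltaO : O Delta.
Hypothesis Delta_e0 : Delta e0 != 0.

(** Modulo [m^2] the maximal ideal is spanned by the [x i] and by functions from the base: the
    cotangent space at [e0] is generated by the fibre and the base. *)
Hypothesis tangent : forall r, O r -> r e0 = 0 -> exists a,
  [/\ A a, a e0 = 0 & idadd X (idpow O m 2) (r - a)].
Hypothesis alpha_regular : forall u s, S u -> O s -> s * alpha u = 0 -> s e0 = 0.

Let im : ideal O m.
Proof.
split=> [f []//|||]; first by split; [exact: OC|].
- by move=> f g [Of f0] [Og g0]; split; [exact: OD|rewrite fun_addE f0 g0 addr0].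
- by move=> f g Of [Og g0]; split; [exact: OM|rewrite fun_mulE g0 mulr0].
Qed.
Let iX : ideal O X. Proof. by apply: idl_ideal => // _ [i _ <-]. Qed.
Let XO f : X f -> O f. Proof. by case: iX => H _ _ _; exact: H. Qed.
Let Xm : X `<=` m.
Proof. by apply: idl_sub => // _ [i _ <-]; split. Qed.
Let ip N : ideal O (idpow O m N). Proof. exact: idpow_ideal. Qed.
Let iXN N : ideal O (idpow O X N). Proof. exact: idpow_ideal. Qed.
Let q N := idadd X (idpow O m N).
Let iq N : ideal O (q N). Proof. exact: idadd_ideal. Qed.

Let AO a : A a -> O a.
Proof.
move=> [k [c [u [Su E]]]]; have -> : a = \sum_i (fun=> c i) * alpha (u i).
  by apply/funext => p; rewrite E fct_sumE; apply: eq_bigr => i _.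
apply: (big_ind O) => // [|i _]; first exact: OC.
by apply: OM => //; exact: alphaO.
Qed.

Let AD a b : A a -> A b -> A (a + b).
Proof.
move=> [k [c [u [Su E]]]] [k' [c' [u' [Su' E']]]].
exists (k + k')%N, (fun i => match fintype.split i with inl j => c j | inr j => c' j end),
  (fun i => match fintype.split i with inl j => u j | inr j => u' j end); split.
  by move=> i; case: fintype.split.
move=> p; rewrite big_split_ord fun_addE E E'; congr (_ + _); apply: eq_bigr => i _.
  by rewrite -[lshift _ _]/(unsplit (inl i)) unsplitK.
by rewrite -[rshift _ _]/(unsplit (inr i)) unsplitK.
Qed.

Let Aalpha c u : S u -> A ((fun=> c) * alpha u).
Proof. by move=> Su; exists 1%N, (fun=> c), (fun=> u); split=> // p; rewrite big_ord1. Qed.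

Let A0 : A 0.
Proof. by exists 0%N, (fun=> 0), (fun=> 0); split=> [[]//|p]; rewrite big_ord0. Qed.

Let AC c : A (fun=> c).
Proof. by have := Aalpha c S0; rewrite alpha0 mulr1. Qed.

Let AM a b : A a -> A b -> A (a * b).
Proof.
move=> [k [c [u [Su E]]]] [k' [c' [u' [Su' E']]]].
have -> : a * b = \sum_i \sum_j (fun=> c i * c' j) * alpha (u i + u' j).
  apply/funext => p; rewrite fun_mulE E E' fct_sumE mulr_suml; apply: eq_bigr => i _.
  rewrite fct_sumE mulr_sumr; apply: eq_bigr => j _.
  by rewrite alphaD // !fun_mulE mulrACA.
by apply: (big_ind A) => // i _; apply: (big_ind A) => // j _; apply: Aalpha; exact: SD.
Qed.

Let AB a b : A a -> A b -> A (a - b).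
Proof.
move=> Aa Ab; apply: AD => //; rewrite -mulN1r; apply: AM => //.
have -> : -1 = (fun=> -1 : K) :> (P -> K) by [].
exact: AC.
Qed.

Let qM N f g : O f -> q N g -> q N (f * g).
Proof. by case: (iq N) => _ _ _; apply. Qed.
Let qD N f g : q N f -> q N g -> q N (f + g).
Proof. by case: (iq N) => _ _ H _; exact: H. Qed.
Let qB N f g : q N f -> q N g -> q N (f - g).
Proof. exact: (idealB sO (iq N)). Qed.

Let unit_mod s : O s -> s e0 != 0 -> exists2 c, m c & s = (fun=> s e0) * (1 - c).
Proof.
move=> Os s0; exists (1 - (fun=> (s e0)^-1) * s).
  split; last by rewrite fun_addE /= -[(- _) e0]/(- (_ e0)) fun_mulE mulVf // subrr.
  by case: sO => ? OB _; apply: (OB) => //; apply: OM.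
by rewrite subKr; apply/funext => p; rewrite !fun_mulE mulrA mulfV ?mul1r.
Qed.

Let Eul0 : Eul 0 = 0.
Proof.
have H : Eul (0 + 0) = Eul 0 + Eul 0 by apply: EulD; exact: (OC 0).
by apply: (addrI (Eul 0)); rewrite addr0 -H addr0.
Qed.

(* On X^N the derivation [Eul] is multiplication by N Delta modulo X^(N+1). *)
Let euler N y : idpow O X N y ->
  idpow O X N.+1 (Eul y - (fun=> N%:R) * Delta * y).
Proof.
elim: N y => [|N IH] y.
  move=> Oy; have -> : (fun=> 0%:R) * Delta * y = 0.
    by apply/funext => p; rewrite !fun_mulE !mul0r.
  by rewrite subr0 /= -[Eul y]mulr1; apply: mem_idmul => //; exact: EulO.
have [SO S0' SD' SM] := iXN N.+2.
have OX N' f : idpow O X N' f -> O f by case: (iXN N') => H _ _ _; exact: H.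
have ONc c : O ((fun=> c) * Delta) by apply: OM.
have iT : ideal O [set y | idpow O X N.+1 y /\ idpow O X N.+2 (Eul y - (fun=> N.+1%:R) * Delta * y)].
  have [S1O S10 S1D S1M] := iXN N.+1.
  split=> [f [/OX]//|||].
  - by split=> //; rewrite Eul0 mulr0 subr0.
  - move=> f g [Xf Hf] [Xg Hg]; split; first exact: S1D.
    have [Of Og] := (OX _ _ Xf, OX _ _ Xg); rewrite EulD // mulrDr opprD addrACA.
    exact: SD'.
  - move=> f g Of [Xg Hg]; split; first exact: S1M.
    have Og := OX _ _ Xg; rewrite EulM //.
    have -> : f * Eul g + g * Eul f - (fun=> N.+1%:R) * Delta * (f * g) =
        f * (Eul g - (fun=> N.+1%:R) * Delta * g) + Eul f * g by ring.
    by apply: SD'; [exact: SM|apply: mem_idmul => //; exact: EulO].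
move=> Hy; suff : [set y | idpow O X N.+1 y /\ idpow O X N.+2 (Eul y - (fun=> N.+1%:R) * Delta * y)] y by case.
move: y Hy; apply: idmul_sub => // a b Xa Hb.
have Hb' := IH b Hb; have Ob := OX _ _ Hb.
have iT' : ideal O [set a | X a /\ idpow O X 2 (Eul a - Delta * a)].
  have [X2O X20 X2D X2M] := iXN 2; have [_ X00 XD XM] := iX.
  split=> [f [/XO]//|||].
  - by split=> //; rewrite Eul0 mulr0 subr0.
  - move=> f g [Xf Hf] [Xg Hg]; split; first exact: XD.
    have [Of Og] := (XO Xf, XO Xg); rewrite EulD // mulrDr opprD addrACA; exact: X2D.
  - move=> f g Of [Xg Hg]; split; first exact: XM.
    have Og := XO Xg; rewrite EulM //.
    have -> : f * Eul g + g * Eul f - Delta * (f * g) = f * (Eul g - Delta * g) + Eul f * g by ring.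
    apply: X2D; first exact: X2M.
    have := @idpow_mul _ O X 1 1 (Eul f) g sO iX.
    have E1 f' : X f' -> idpow O X 1 f'.
      by move=> Xf'; rewrite -[f']mulr1; apply: mem_idmul.
    by apply; apply: E1 => //; exact: EulO.
have [_ Ha] : X a /\ idpow O X 2 (Eul a - Delta * a).
  suff : X `<=` [set a | X a /\ idpow O X 2 (Eul a - Delta * a)] by apply.
  apply: idl_sub => // _ [i _ <-]; split; first by apply: subset_idl; exists i.
  by rewrite Eulx subrr; case: (iXN 2).
have Oa := XO Xa; split; first exact: mem_idmul.
rewrite EulM //.
have -> : a * Eul b + b * Eul a - (fun=> N.+1%:R) * Delta * (a * b) =
   a * (Eul b - (fun=> N%:R) * Delta * b) + (Eul a - Delta * a) * b.
  have -> : (fun=> N.+1%:R) = (fun=> N%:R) + 1 :> (P -> K).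
    by apply/funext => p; rewrite fun_addE -natr1.
  by ring.
apply: SD'; first exact: mem_idmul.
by have := @idpow_mul _ O X 2 N _ _ sO iX Ha Hb; rewrite add2n.
Qed.

(** By the Euler formula for [s * alpha u], the function [N.+1 Delta s alpha_u] is congruent to
    [alpha_u Eul(s)] modulo [X^(N+2)]. After multiplication by [s] the latter is in [X^(N+2)] as
    well, because [Eul s] is in [X]. In characteristic 0 the factor [N.+1 Delta s^2] does not vanish
    at [e0]. *)
Let alpha_pow N u s : S u -> O s -> s e0 != 0 -> idpow O X N.+1 (s * alpha u) ->
  exists s', [/\ O s', s' e0 != 0 & idpow O X N.+2 (s' * alpha u)].
Proof.
move=> Su Os s0 Hs; have Oa := alphaO Su; have [SO S0' SD' SM] := iXN N.+2.
exists (s * ((fun=> N.+1%:R) * Delta * s)); split.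
- by apply: OM => //; apply: OM => //; apply: OM.
- by rewrite !fun_mulE !mulf_neq0 // (natr_inj_char0 hK).
have := euler Hs; rewrite EulM // Eula // mulr0 add0r => H.
have H1 : idpow O X N.+2 (s * alpha u * Eul s).
  by rewrite mulrC; apply: mem_idmul => //; exact: EulO.
have -> : s * ((fun=> N.+1%:R) * Delta * s) * alpha u =
    s * alpha u * Eul s - s * (alpha u * Eul s - (fun=> N.+1%:R) * Delta * (s * alpha u)) by ring.
by apply: (idealB sO (iXN N.+2)) => //; exact: SM.
Qed.

(** Otherwise Krull's theorem puts [s * alpha u] in [X] for some [s] with [s e0 <> 0], and
    [alpha_pow] puts such multiples in every power of [X]. As [s] is a unit modulo powers of [m],
    the function [alpha u] is in all powers of [m]. Krull's theorem with [Q = 0] then makes a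
    function that is 1 at [e0] annihilate it, against [alpha_regular]. *)
Lemma alpha_not_in u : S u -> exists N, ~ q N (alpha u).
Proof.
move=> Su; apply: contrapT => H; have Oa := alphaO Su.
have nO : noeth O by exact: noeth_alg_gen.
have Hq N : q N (alpha u) by apply: contrapT => Hn; apply: H; exists N.
have [c [Oc c0] Hc] := krull_intersection sO nO im iX Hq.
have pow N : exists s, [/\ O s, s e0 != 0 & idpow O X N.+1 (s * alpha u)].
  elim: N => [|N [s [Os s0 Hs]]]; last exact: alpha_pow Hs.
  exists (1 - c); split.
  - by case: sO => ? OB _; apply: (OB).
  - by rewrite fun_addE -[(- c) e0]/(- (c e0)) c0 subr0 oner_neq0.
  - by rewrite -[_ * _]mulr1; apply: mem_idmul.
have mN N : idpow O m N (alpha u).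
  have [s [Os s0 /(idpow_mono sO iX im Xm) Hs]] := pow N.
  have {}Hs : idpow O m N (s * alpha u) by apply: (idpow_le sO im _ Hs).
  have [c' mc' Es] := unit_mod Os s0; have [pO p0 pD pM] := ip N.
  have {}Hs : idpow O m N ((1 - c') * alpha u).
    have -> : (1 - c') * alpha u = (fun=> (s e0)^-1) * (s * alpha u).
      by rewrite {2}Es; apply/funext => p; rewrite !fun_mulE !mulrA mulVf // mul1r.
    exact: pM.
  suff : forall k, (k <= N)%N -> idpow O m k (alpha u) by apply.
  elim=> [//|k IH] kN; have [_ _ kD _] := ip k.+1.
  have -> : alpha u = (1 - c') * alpha u + c' * alpha u by ring.
  by apply: kD; [exact: (idpow_le sO im kN Hs)|apply: mem_idmul => //; apply: IH; exact: ltnW].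
have [||c' [Oc' c'0] Hc'] := krull_intersection (n := m) (Q := [set 0]) (r := alpha u) sO nO im.
- by split=> [f ->|//|f g -> ->|f g _ ->]; [exact: OC|rewrite addr0|rewrite mulr0].
- by move=> N; exists 0 => //; exists (alpha u); rewrite ?add0r.
have /(alpha_regular Su) : O (1 - c') by case: sO => ? OB _; apply: (OB).
by move=> /(_ Hc') /eqP; rewrite fun_addE -[(- c') e0]/(- (c' e0)) c'0 subr0 oner_eq0.
Qed.

(** By [tangent], [m] is contained in [A + q 2]. Multiplying, [m^k] is contained in [A + q (k+1)]
    for all [k], and the error is corrected one order at a time. *)
Lemma approximate N r : O r -> exists a, A a /\ q N (r - a).
Proof.
move=> Or; suff [a Aa [ra0 Hq]] : exists2 a, A a & (r - a) e0 = 0 /\ q N.+1 (r - a).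
  exists a; split=> //; case: Hq => f Xf [g Hg ->]; exists f => //; exists g => //.
  exact: (idpow_le sO im (leqnSn N) Hg).
elim: N => [|N [a Aa [ra0 [f Xf [g Hg E]]]]].
  exists (fun=> r e0); first exact: AC.
  split; first by rewrite fun_addE -[(- _) e0]/(- (r e0)) subrr.
  apply: idaddr; first by case: iX.
  rewrite -[_ - _]mulr1; apply: mem_idmul => //.
  split; last by rewrite fun_addE -[(- _) e0]/(- (r e0)) subrr.
  by case: sO => ? OB _; apply: (OB).
have step k h : idpow O m k h -> exists2 b, A b & (k = 0%N \/ b e0 = 0) /\ q k.+1 (h - b).
  elim: k h {Hg E Xf} => [|k IHk] h.
    move=> Oh; exists (fun=> h e0); first exact: AC.
    split; first by left.
    apply: idaddr; first by case: iX.
    rewrite -[_ - _]mulr1; apply: mem_idmul => //.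
    split; last by rewrite fun_addE -[(- _) e0]/(- (h e0)) subrr.
    by case: sO => ? OB _; apply: (OB).
  move=> Hh; have pO k' f' : idpow O m k' f' -> O f' by case: (ip k') => H _ _ _; exact: H.
  have iT : ideal O [set h | idpow O m k.+1 h /\ exists2 b, A b & b e0 = 0 /\ q k.+2 (h - b)].
    have [pO' p0 pD pM] := ip k.+1; split=> [f' [/pO]//|||].
    - split=> //; exists 0; first exact: A0.
      by split=> //; rewrite subr0; case: (iq k.+2).
    - move=> f1 f2 [H1 [b1 Ab1 [b10 Hb1]]] [H2 [b2 Ab2 [b20 Hb2]]]; split; first exact: pD.
      exists (b1 + b2); first exact: AD.
      by split; [rewrite fun_addE b10 b20 addr0|rewrite opprD addrACA; exact: qD].
    - move=> f1 f2 Of1 [H2 [b2 Ab2 [b20 Hb2]]]; split; first exact: pM.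
      exists ((fun=> f1 e0) * b2); first by apply: AM => //; exact: AC.
      split; first by rewrite fun_mulE b20 mulr0.
      have -> : f1 * f2 - (fun=> f1 e0) * b2 = (fun=> f1 e0) * (f2 - b2) + (f1 - (fun=> f1 e0)) * f2 by ring.
      apply: qD; first exact: qM.
      apply: idaddr; first by case: iX.
      apply: mem_idmul => //; split; last by rewrite fun_addE -[(- _) e0]/(- (f1 e0)) subrr.
      by case: sO => ? OB _; apply: (OB).
  suff : [set h | idpow O m k.+1 h /\ exists2 b, A b & b e0 = 0 /\ q k.+2 (h - b)] h.
    by case=> _ [b Ab [b0 Hb]]; exists b => //; split=> //; right.
  move: h Hh; apply: idmul_sub => // u v [Ou u0] Hv; split; first by apply: mem_idmul.
  have [b Ab [b0 Hb]] := IHk v Hv; have [a1 [Aa1 a10 Ha1]] := tangent Ou u0.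
  exists (a1 * b); first exact: AM.
  split; first by rewrite fun_mulE a10 mul0r.
  have ma1 : m a1 := conj (AO Aa1) a10.
  have Ov := pO _ _ Hv; have Ob := AO Ab.
  have -> : u * v - a1 * b = (u - a1) * v + a1 * (v - b) by ring.
  apply: qD.
    case: Ha1 => g1 Xg1 [g2 Hg2 ->]; rewrite mulrDl; apply: qD.
      apply: idaddl; first by case: (ip k.+2).
      by rewrite mulrC; case: iX => _ _ _ XM; exact: XM.
    apply: idaddr; first by case: iX.
    by have := @idpow_mul _ O m 2 k _ _ sO im Hg2 Hv; rewrite add2n.
  case: Hb => g1 Xg1 [g2 Hg2 ->]; rewrite mulrDr; apply: qD.
    apply: idaddl; first by case: (ip k.+2).
    by case: iX => _ _ _ XM; apply: XM => //; exact: AO.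
  by apply: idaddr; [case: iX|apply: mem_idmul].
have [b Ab [[//|b0] Hb]] := step N.+1 g Hg; exists (a + b); first exact: AD.
have -> : r - (a + b) = f + (g - b).
  by rewrite opprD addrA E -addrA.
split; last by apply: qD => //; apply: idaddl => //; case: (ip N.+2).
have [_ f0] := Xm Xf; rewrite fun_addE f0 add0r fun_addE -[(- b) e0]/(- (b e0)) b0 subr0.
have [_ _ _ _] := ip N.+1; have : m g by have := idpow_le sO im (isT : (1 <= N.+1)%N) Hg; apply: idmul_sub => // u v mu Ov; rewrite mulrC; case: im => _ _ _; apply.
by case.
Qed.

Let theta_O f t : O f -> O (f \o theta t).
Proof.
move=> /theta_rat[k [u [g [Og E]]]].
have -> : f \o theta t = \sum_i (fun=> character (u i) t) * g i.
  by apply/funext => p; rewrite /= E fct_sumE.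
by apply: (big_ind O) => // [|i _]; [exact: OC|exact: OM].
Qed.

Let stable J t : ideal O J -> ideal O [set f | O f /\ J (f \o theta t)].
Proof.
move=> [JO J0 JD JM]; split=> [f []//|||].
- by split=> //; exact: OC.
- by move=> f g [Of Jf] [Og Jg]; split; [exact: OD|exact: (JD _ _ Jf Jg)].
- by move=> f g Of [Og Jg]; split; [exact: OM|exact: (JM _ _ (theta_O t Of) Jg)].
Qed.

Let X_theta t f : X f -> X (f \o theta t).
Proof.
move=> Xf; suff [] : [set f | O f /\ X (f \o theta t)] f by [].
move: f Xf; apply: idl_sub => [|_ [i _ <-]]; first exact: stable.
split=> //; have -> : x i \o theta t = (fun=> character (w i) t) * x i.
  by apply/funext => p; rewrite /= x_theta.
by case: iX => _ _ _; apply => //; apply: subset_idl; exists i.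
Qed.

Let m_theta t N f : idpow O m N f -> idpow O m N (f \o theta t).
Proof.
elim: N f => [|N IH] f; first exact: theta_O.
move=> Hf; suff [] : [set f | O f /\ idpow O m N.+1 (f \o theta t)] f by [].
move: f Hf; apply: idmul_sub => [|a b [Oa a0] Hb]; first exact: stable.
have Ob : O b by case: (ip N) => H _ _ _; exact: H.
split; first exact: OM.
have -> : (a * b) \o theta t = (a \o theta t) * (b \o theta t) by [].
by apply: mem_idmul; [split; [exact: theta_O|rewrite /= theta_e0]|exact: IH].
Qed.

Let q_theta t N f : q N f -> q N (f \o theta t).
Proof.
by move=> [a Xa [b Hb ->]]; exists (a \o theta t); [exact: X_theta|exists (b \o theta t); [exact: m_theta|]].
Qed.

Let q_subspace N : fun_subspace (q N).
Proof.
by split; [case: (iq N)|case: (iq N) => _ _ H _; exact: H|move=> c f Hf; exact: qM].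
Qed.

Let q_le N N' f : (N' <= N)%N -> q N f -> q N' f.
Proof.
by move=> le [a Xa [b Hb ->]]; exists a => //; exists b => //; exact: (idpow_le sO im le).
Qed.

Let q_scalar N c u : q N ((fun=> c) * alpha u) -> ~ q N (alpha u) -> c = 0.
Proof.
move=> H nq; apply/eqP/negP => /negP c0; apply: nq.
have -> : alpha u = (fun=> c^-1) * ((fun=> c) * alpha u).
  by apply/funext => p; rewrite !fun_mulE mulrA mulVf // mul1r.
exact: qM.
Qed.

(** Expanding [r] at [theta s (theta t p)] in two ways and comparing characters of [s] shows that
    the sum of the coefficients of a given character is a weight vector; at [s = 1] these sums add
    up to [r]. *)
Lemma weight_decomposition r : O r -> exists k (u : 'I_k -> M) (f : 'I_k -> P -> K),
  [/\ forall i, O (f i), forall i t p, f i (theta t p) = character (u i) t * f i p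
    & forall p, r p = \sum_i f i p].
Proof.
move=> Or; have [k [u [f [Of E]]]] := theta_rat Or.
pose ws := undup (codom u); pose g w p := \sum_(i | u i == w) f i p.
exists (size ws), (fun j => nth 0 ws j), (fun j => g (nth 0 ws j)); split.
- move=> j; have -> : g (nth 0 ws j) = \sum_(i | u i == nth 0 ws j) f i.
    by apply/funext => p; rewrite fct_sumE.
  by apply: (big_ind O) => //; exact: OC.
- move=> j t p; pose h i p := f i (theta t p) - character (u i) t * f i p.
  have sQ : @fun_subspace K P [set 0].
    by split=> // [f1 f2 -> ->|c f1 ->]; [rewrite addr0|rewrite mulr0].
  have H s : [set (0 : P -> K)] (fun p => \sum_i character (u i) s * h i p).
    apply/funext => p'; rewrite /h; under eq_bigr do rewrite mulrBr mulrA.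
    rewrite sumrB -E -theta_mul E -sumrB big1 // => i _.
    by rewrite char_mul subrr.
  have := weights_in_subspace hK sQ H (nth 0 ws j); move/(congr1 (@^~ p)).
  rewrite /h sumrB => /eqP; rewrite subr_eq0 => /eqP E'; rewrite /g E' mulr_sumr.
  by apply: eq_bigr => i /eqP ->.
- move=> p; rewrite -(theta_one p) E theta_one.
  under eq_bigr do rewrite char_one.
  rewrite (eq_bigr (fun i => f i p * 1)) => [|i _]; last by rewrite mul1r mulr1.
  rewrite (sum_by_weight u (fun i => f i p) (fun=> 1)) -/ws (big_nth 0) big_mkord.
  by apply: eq_bigr => j _; rewrite mulr1.
Qed.

(** As [q N] is stable under [theta], it contains the weight components of its elements; hence the
    approximation of a weight vector may be replaced by its part of the same weight, a multiple of
    one [alpha w']. *)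
Let weight_component N f w' : O f -> (forall t p, f (theta t p) = character w' t * f p) ->
  exists c, (S w' \/ c = 0) /\ q N (f - (fun=> c) * alpha w').
Proof.
move=> Of fw; have [a [[k [c [u [Su E]]]] Ha]] := approximate N Of.
exists (\sum_(i | u i == w') c i); split.
  have [Sw|nS] := pselect (S w'); [by left|right; rewrite big_pred0 // => i].
  by apply/eqP => ui; apply: nS; rewrite -ui.
pose u' (i : 'I_k.+1) := if unlift ord0 i is Some j then u j else w'.
pose f' (i : 'I_k.+1) p := if unlift ord0 i is Some j then - (c j * alpha (u j) p) else f p.
have H t : q N (fun p => \sum_i character (u' i) t * f' i p).
  congr (q N) : (q_theta t Ha); apply/funext => p /=.
  rewrite fun_addE -[(- a) _]/(- (a _)) fw E big_ord_recl /u' /f' unlift_none; congr (_ + _).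
  rewrite -sumrN; apply: eq_bigr => i _; rewrite liftK alpha_theta //; ring.
have := weights_in_subspace hK (q_subspace N) H w'; congr (q N); apply/funext => p.
rewrite fun_addE -[(- _) p]/(- (_ p)) fun_mulE.
rewrite big_mkcond big_ord_recl /u' /f' unlift_none eqxx; congr (_ + _).
rewrite mulr_suml -sumrN [RHS]big_mkcond /=; apply: eq_bigr => i _; rewrite liftK.
by case: eqP => // ->.
Qed.

(** A weight vector is approximated to every order by multiples of one character. Once [alpha] is
    outside [q N0], the scalar is determined modulo [q N0], so it is the same for all larger [N]. *)
Lemma limit_exists r : O r -> exists a, A a /\ forall N, q N (r - a).
Proof.
move=> Or; have [k [u [f [Of fw E]]]] := weight_decomposition Or.
have key i : exists a, A a /\ forall N, q N (f i - a).
  have [Sw|nS] := pselect (S (u i)); last first.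
    exists 0; split=> // N; have [c [[//|c0]]] := weight_component N (Of i) (fw i).
    rewrite c0; have -> // : (fun=> 0) * alpha (u i) = 0 by apply/funext => p; rewrite fun_mulE mul0r.
  have [N0 HN0] := alpha_not_in Sw.
  have [c [_ Hc]] := weight_component N0 (Of i) (fw i).
  exists ((fun=> c) * alpha (u i)); split; first exact: Aalpha.
  move=> N; have [le|/ltnW le] := leqP N N0; first exact: (q_le le).
  have [c' [_ Hc']] := weight_component N (Of i) (fw i).
  suff -> : c = c' by [].
  apply/eqP; rewrite -subr_eq0; apply/eqP/(q_scalar (N := N0) (u := u i)) => //.
  have := qB (q_le le Hc') Hc; congr (q N0); apply/funext => p.
  by rewrite !(fun_addE, fun_mulE) -![(- _) p]/(- (_ p)) !(fun_addE, fun_mulE) -![(- _) p]/(- (_ p)) !fun_mulE; ring.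
have [a Ha] := choice key.
exists (\sum_i a i); split.
  by apply: (big_ind A) => // i _; case: (Ha i).
move=> N; have -> : r - \sum_i a i = \sum_i (f i - a i).
  by rewrite sumrB; congr (_ - _); apply/funext => p; rewrite E fct_sumE.
by apply: (big_ind (q N)) => [|f1 f2|i _]; [case: (iq N)|exact: qD|case: (Ha i)].
Qed.

Lemma limit_unique a : A a -> (forall N, q N a) -> a = 0.
Proof.
move=> [k [c [u [Su E]]]] H.
have key w' : S w' -> \sum_(i | u i == w') c i = 0.
  move=> Sw; have [N HN] := alpha_not_in Sw; apply: (q_scalar (N := N) (u := w')) => //.
  have H' t : q N (fun p => \sum_i character (u i) t * (c i * alpha (u i) p)).
    congr (q N) : (q_theta t (H N)); apply/funext => p /=; rewrite E; apply: eq_bigr => i _.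
    by rewrite alpha_theta // mulrCA.
  have := weights_in_subspace hK (q_subspace N) H' w'; congr (q N); apply/funext => p.
  by rewrite fun_mulE mulr_suml; apply: eq_bigr => i /eqP ->.
apply/funext => p; rewrite E (sum_by_weight u c (fun w => alpha w p)) big1_seq // => w' /andP[_].
by rewrite mem_undup => /codomP[i ->]; rewrite key ?mul0r.
Qed.

(** [s r] is the only function from the base congruent to [r] modulo every [q N]. Since the [q N]
    are ideals stable under [theta], uniqueness gives all the properties. *)
Theorem equivariant_retraction : exists s : (P -> K) -> P -> K,
  [/\ forall r, O r -> char_span (s r), forall a, char_span a -> s a = a,
      forall r r', O r -> O r' -> s (r + r') = s r + s r',
      forall r r', O r -> O r' -> s (r * r') = s r * s r'
    & forall r t, O r -> s (r \o theta t) = s r \o theta t].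
Proof.
pose s r := if pselect (O r) is left Or then projT1 (cid (limit_exists Or)) else 0.
have sP r : O r -> A (s r) /\ forall N, q N (r - s r).
  by move=> Or; rewrite /s; case: pselect => // Or'; case: (cid _).
have sE r a : O r -> A a -> (forall N, q N (r - a)) -> s r = a.
  move=> Or Aa Ha; have [As Hs] := sP r Or.
  apply/eqP; rewrite -subr_eq0; apply/eqP/limit_unique => [|N]; first exact: AB.
  have -> : s r - a = (r - a) - (r - s r) by ring.
  exact: qB.
exists s; split=> [r Or|a Aa|r r' Or Or'|r r' Or Or'|r t Or].
- by case: (sP r Or).
- by apply: sE => // [|N]; [exact: AO|rewrite subrr; case: (iq N)].
- have [[As Hs] [As' Hs']] := (sP r Or, sP r' Or').
  apply: sE => [||N]; [exact: OD|exact: AD|].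
  by rewrite opprD addrACA; exact: qD.
- have [[As Hs] [As' Hs']] := (sP r Or, sP r' Or').
  apply: sE => [||N]; [exact: OM|exact: AM|].
  have -> : r * r' - s r * s r' = r * (r' - s r') + s r' * (r - s r) by ring.
  by apply: qD; apply: qM => //; exact: AO.
- have [As Hs] := sP r Or; apply: sE => [||N]; first exact: theta_O.
    have [k [c [u [Su E]]]] := As; exists k, (fun i => c i * character (u i) t), u; split=> // p.
    by rewrite /= E; apply: eq_bigr => i _; rewrite alpha_theta // mulrA.
  exact: (q_theta t (Hs N)).
Qed.

End AlgebraicSection.

(** * Algebraic groups *)

Section AlgebraicGroups.
Variables (K : closedFieldType) (G : alg_group K).
Implicit Types (g h : G) (f b : G -> K).
Local Notation KG := (@coordinate_ring K G).

Lemma gmulKg g h : gmul (ginv g) (gmul g h) = h.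
Proof. by rewrite gmulA gmulVg gmul1g. Qed.

Lemma gmulgV g : gmul g (ginv g) = gone.
Proof.
set a := gmul g _; have aa : gmul a a = a by rewrite /a -gmulA gmulKg.
by rewrite -(gmulKg a a) aa gmulVg.
Qed.

Lemma gmulg1 g : gmul g gone = g.
Proof. by rewrite -(gmulVg g) gmulA gmulgV gmul1g. Qed.

Lemma gmulVKg g h : gmul g (gmul (ginv g) h) = h.
Proof. by rewrite gmulA gmulgV gmul1g. Qed.

Lemma gmulgK g h : gmul (gmul h g) (ginv g) = h.
Proof. by rewrite -gmulA gmulgV gmulg1. Qed.

Lemma gmulgVK g h : gmul (gmul h (ginv g)) g = h.
Proof. by rewrite -gmulA gmulVg gmulg1. Qed.

Lemma gmulgI g h k : gmul g h = gmul g k -> h = k.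
Proof. by move=> e; rewrite -(gmulKg g h) e gmulKg. Qed.

Lemma ginvK g : ginv (ginv g) = g.
Proof. by apply: (@gmulgI (ginv g)); rewrite gmulgV gmulVg. Qed.

Lemma ginvM g h : ginv (gmul g h) = gmul (ginv h) (ginv g).
Proof. by apply: (@gmulgI (gmul g h)); rewrite gmulgV -gmulA (gmulA h) gmulgV gmul1g gmulgV. Qed.

Lemma ginv1 : ginv (@gone K G) = gone.
Proof. by rewrite -[LHS]gmul1g gmulgV. Qed.

Lemma ringed_group : ringed G.
Proof. exact: ringed_affine (grp_affine G). Qed.

Let rG := ringed_group.
Let sG := ringed_sheaf rG.

Lemma group_coords : exists m (y : 'I_m -> G -> K), coords setT y.
Proof. exact: affine_coordsT rG (grp_affine G). Qed.

Lemma coordinate_ringP f : KG f <-> reg_on setT f.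
Proof.
split; first exact: (regular_reg_on openT).
exact: (reg_on_regular sG openT).
Qed.

Lemma coordinate_ringE m (y : 'I_m -> G -> K) : coords setT y -> KG = alg_gen (range y).
Proof.
move=> cy; apply/seteqP; split=> f.
  move=> /coordinate_ringP /(coords_reg_alg cy)[g Ag fg].
  by have -> : f = g by apply/funext => x; apply: fg.
by move=> Af; apply/coordinate_ringP; apply: coords_alg_reg cy Af.
Qed.

Lemma coordinate_ring_alg : alg_gen KG = KG.
Proof.
apply/seteqP; split=> f; last exact: AlgGen.
by move=> Af; apply/coordinate_ringP; apply: (reg_on_alg rG _ Af) => g /coordinate_ringP.
Qed.

Lemma subring_coordinate_ring : subring KG.
Proof. by rewrite -coordinate_ring_alg; exact: subring_alg_gen. Qed.

Lemma coordinate_ring_cst c : KG (fun=> c).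
Proof. by rewrite -coordinate_ring_alg; apply: AlgCst. Qed.

Lemma coordinate_ringD f b : KG f -> KG b -> KG (f + b).
Proof. by move=> Kf Kb; apply: (subringD subring_coordinate_ring). Qed.

Lemma coordinate_ringM f b : KG f -> KG b -> KG (f * b).
Proof. by have [_ _ H] := subring_coordinate_ring; apply: H. Qed.

Lemma morph_gmul (T : space K) (Z : set T) (f g : T -> G) : ringed T -> morph_on Z f -> morph_on Z g ->
  morph_on Z (fun t => gmul (f t) (g t)).
Proof.
move=> rT mf mg; have sT := ringed_sheaf rT.
have m2 := morph_on_pair rT sG sG mf mg.
apply: (@morph_on_comp _ T Z (product G G) setT G _ (fun p => gmul p.1 p.2) sT m2) => //.
exact: (morph_onTW _ (ringed_sheaf (ringed_product sG sG)) (gmul_morph G)).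
Qed.

Lemma morph_ginv (T : space K) (Z : set T) (f : T -> G) : ringed T -> morph_on Z f ->
  morph_on Z (fun t => ginv (f t)).
Proof.
move=> rT mf; apply: (@morph_on_comp _ T Z G setT G f (@ginv K G) (ringed_sheaf rT) mf) => //.
exact: (morph_onTW _ sG (ginv_morph G)).
Qed.

Lemma morph_cst (T X : space K) (Z : set T) (c : X) : ringed T -> morph_on Z (fun=> c).
Proof.
move=> rT V oV; split=> [p Zp Vc|g rg]; first by exists setT; split=> //; apply: openT.
exact: (reg_on_cst rT).
Qed.

Lemma coordinate_ring_lmul c b : KG b -> KG (fun g => b (gmul c g)).
Proof.
move=> /coordinate_ringP rb; apply/coordinate_ringP.
apply: (@morph_on_reg _ G setT G setT (fun g => gmul c g) b sG) => //.
by apply: morph_gmul => //; [apply: morph_cst|apply: morph_on_id].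
Qed.

Lemma coordinate_ring_rmul c b : KG b -> KG (fun g => b (gmul g c)).
Proof.
move=> /coordinate_ringP rb; apply/coordinate_ringP.
apply: (@morph_on_reg _ G setT G setT (fun g => gmul g c) b sG) => //.
by apply: morph_gmul => //; [apply: morph_on_id|apply: morph_cst].
Qed.

Lemma coordinate_ring_comul b : KG b -> exists r (a a' : 'I_r -> G -> K),
  [/\ forall i, KG (a i), forall i, KG (a' i)
    & forall g h, b (gmul g h) = \sum_i a i g * a' i h].
Proof.
have [m [y cy]] := group_coords; have Ey := coordinate_ringE cy; move=> Kb.
have c2 := coords_prod rG rG cy cy.
have /(coords_reg_alg c2)[F AF EF] : @reg_on _ (product G G) (setT `*` setT)
    (fun p => b (gmul p.1 p.2)).
  have sGG := ringed_sheaf (ringed_product sG sG).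
  apply: (@morph_on_reg _ (product G G) _ G setT (fun p => gmul p.1 p.2) b sGG) => //.
    exact: (morph_onTW _ sGG (gmul_morph G)).
  exact/coordinate_ringP.
have [r [a [a' [Aa Aa' E]]]] := alg_gen_pair_sum AF.
by exists r, a, a'; split=> [i|i|g h]; rewrite ?Ey // -E -(EF (g, h)).
Qed.

Lemma coordinate_ring_sep g h : (forall b, KG b -> b g = b h) -> g = h.
Proof.
have [m [y cy]] := group_coords => E; apply: (coords_sep cy) => // f Af.
by apply: E; rewrite (coordinate_ringE cy).
Qed.

Lemma coordinate_ring_point phi : alg_char KG phi -> {g | forall b, KG b -> phi b = b g}.
Proof.
move=> ch; apply: cid; have [m [y cy]] := group_coords.
rewrite (coordinate_ringE cy) in ch *.
have [|g [_ H]] := coords_point_of_char cy ch; last by exists g.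
move=> f Af f0; have -> : f = 0 by apply/funext => p; apply: f0.
exact: alg_char0 ch.
Qed.

(** The character [b |-> phi b 1] is evaluation at a point [c]; applied to right translates of [b]
    it gives [phi b g = b (c g)]. In this way torus actions and isomorphisms of algebras become left
    translations. *)
Lemma coordinate_ring_endo (phi : (G -> K) -> G -> K) : (forall c, phi (fun=> c) = fun=> c) ->
  (forall a b, KG a -> KG b -> phi (a + b) = phi a + phi b) ->
  (forall a b, KG a -> KG b -> phi (a * b) = phi a * phi b) ->
  (forall b h, KG b -> phi (fun g => b (gmul g h)) = fun g => phi b (gmul g h)) ->
  {c | forall b, KG b -> phi b = fun g => b (gmul c g)}.
Proof.
move=> phiC phiD phiM phiR.
have [|c E] := @coordinate_ring_point (fun b => phi b gone).
  by split=> [c|a b Ka Kb|a b Ka Kb]; rewrite ?phiC ?phiD ?phiM.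
exists c => b Kb; apply/funext => g.
have := E _ (coordinate_ring_rmul g Kb); rewrite phiR //.
by rewrite gmul1g.
Qed.

Lemma morph_on_group (T : space K) (Z : set T) (f : T -> G) : ringed T ->
  (forall b, KG b -> reg_on Z (b \o f)) -> morph_on Z f.
Proof.
move=> rT H; have [m [y cy]] := group_coords.
apply: (morph_on_coords rT rG cy) => // i; apply: H.
by rewrite (coordinate_ringE cy); apply: alg_gen_range.
Qed.

Lemma morph_on_group_reg (T : space K) (Z : set T) (f : T -> G) b : ringed T -> morph_on Z f -> KG b ->
  reg_on Z (b \o f).
Proof.
move=> rT mf /coordinate_ringP rb.
exact: (@morph_on_reg _ T Z G setT f b (ringed_sheaf rT)).
Qed.

End AlgebraicGroups.

(** * Extension of maps from the torus to a group *)

Section Extension.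
Variables (K : closedFieldType) (n : nat).
Hypothesis hK : [pchar K] =i pred0.
Variable Sigma : set (set 'rV[int]_n).
Hypothesis fanS : is_fan Sigma.
Variable X : toric_variety K Sigma.
Variable G : alg_group K.
Implicit Types (sigma : Sigma).
Local Notation KG := (@coordinate_ring K G).
Local Notation xorb := (xorb fanS X).
Let rX : ringed X := ringed_variety (toric_is_variety X).

(** Since the open orbit is dense, the extensions of the functions [b \o gamma] are unique, hence
    depend on [b] through a homomorphism of algebras. Their values at a point of the chart form a
    character of the coordinate ring, that is, an element of the group. *)
Lemma torus_to_group_extend sigma (gamma : torus K n -> G) :
  (forall b, KG b -> exists F : X -> K, reg_on (tU sigma) F /\ forall t, F (xorb t) = b (gamma t)) ->
  exists gbar : X -> G, morph_on (tU sigma) gbar /\ forall t, gbar (xorb t) = gamma t.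
Proof.
move=> H.
pose F (b : G -> K) : X -> K := if pselect (KG b) is left Kb then projT1 (cid (H b Kb)) else 0.
have FP b : KG b -> reg_on (tU sigma) (F b) /\ forall t, F b (xorb t) = b (gamma t).
  by rewrite /F; case: pselect => // Kb _; case: cid.
have FE b f : KG b -> reg_on (tU sigma) f -> (forall t, f (xorb t) = b (gamma t)) ->
    forall x, tU sigma x -> F b x = f x.
  move=> Kb rf Ef x Ux; have [rFb EFb] := FP b Kb.
  by apply: (reg_tU_eq hK rFb rf) => // t; rewrite EFb Ef.
have ch x : tU sigma x -> alg_char KG (fun b => F b x).
  move=> Ux; split=> [c|a b Ka Kb|a b Ka Kb].
  - by apply: (FE _ (fun=> c)) => //; [apply: coordinate_ring_cst|apply: (reg_on_cst rX)].
  - have [ra Ea] := FP a Ka; have [rb Eb] := FP b Kb.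
    apply: (FE _ (fun x => F a x + F b x)) => //; first exact: coordinate_ringD.
      exact: (reg_on_add rX).
    by move=> t; rewrite Ea Eb.
  have [ra Ea] := FP a Ka; have [rb Eb] := FP b Kb.
  apply: (FE _ (fun x => F a x * F b x)) => //; first exact: coordinate_ringM.
    exact: (reg_on_mul rX).
  by move=> t; rewrite Ea Eb.
pose gbar x : G := if pselect (tU sigma x) is left Ux
  then projT1 (coordinate_ring_point (ch x Ux)) else gone.
have gE x b : tU sigma x -> KG b -> b (gbar x) = F b x.
  by move=> Ux Kb; rewrite /gbar; case: pselect => // Ux'; case: coordinate_ring_point => g /= ->.
exists gbar; split.
  apply: (morph_on_group rX) => b Kb; have [rb _] := FP b Kb.
  by apply: reg_on_ext rb => x Ux; rewrite /= gE.
move=> t; apply: coordinate_ring_sep => b Kb.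
by rewrite gE //; [case: (FP b Kb)|apply: xorb_tU].
Qed.

Lemma morph_to_group_unique sigma (f g : X -> G) : morph_on (tU sigma) f -> morph_on (tU sigma) g ->
  (forall t, f (xorb t) = g (xorb t)) -> forall x, tU sigma x -> f x = g x.
Proof.
move=> mf mg E x Ux; apply: coordinate_ring_sep => b Kb.
rewrite -[b (f x)]/((b \o f) x) -[b (g x)]/((b \o g) x).
apply: (reg_tU_eq hK (morph_on_group_reg rX mf Kb) (morph_on_group_reg rX mg Kb) _ Ux) => t.
by rewrite /= E.
Qed.

End Extension.

(** * Flatness and reducedness *)

Section CommonDenominators.
Variables (K : closedFieldType) (X : space K) (Z : set X) (m : nat) (y : 'I_m -> X -> K).
Hypotheses (rX : ringed X) (cy : coords Z y).

Lemma alg_gen_prod (P : Type) (S : set (P -> K)) (I : Type) (s : seq I) (Q : pred I) (F : I -> P -> K) :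
  (forall i, Q i -> alg_gen S (F i)) -> alg_gen S (fun p => \prod_(i <- s | Q i) F i p).
Proof.
move=> H; elim: s => [|i s IH].
  rewrite (_ : (fun _ => _) = fun=> 1); first exact: AlgCst.
  by apply/funext => p; rewrite big_nil.
case Qi : (Q i).
  rewrite (_ : (fun _ => _) = fun p => F i p * \prod_(i <- s | Q i) F i p).
    exact: (AlgMul (H i Qi) IH).
  by apply/funext => p; rewrite big_cons Qi.
rewrite (_ : (fun _ => _) = fun p => \prod_(i <- s | Q i) F i p) //.
by apply/funext => p; rewrite big_cons Qi.
Qed.

Lemma alg_gen_sum (P : Type) (S : set (P -> K)) (I : Type) (s : seq I) (Q : pred I) (F : I -> P -> K) :
  (forall i, Q i -> alg_gen S (F i)) -> alg_gen S (fun p => \sum_(i <- s | Q i) F i p).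
Proof.
move=> H; elim: s => [|i s IH].
  rewrite (_ : (fun _ => _) = fun=> 0); first exact: AlgCst.
  by apply/funext => p; rewrite big_nil.
case Qi : (Q i).
  rewrite (_ : (fun _ => _) = fun p => F i p + \sum_(i <- s | Q i) F i p).
    exact: (AlgAdd (H i Qi) IH).
  by apply/funext => p; rewrite big_cons Qi.
rewrite (_ : (fun _ => _) = fun p => \sum_(i <- s | Q i) F i p) //.
by apply/funext => p; rewrite big_cons Qi.
Qed.

Lemma coords_near p (Q : set X) : Z p -> (\forall q \near p, Q q) ->
  exists h, [/\ alg_gen (range y) h, h p != 0 & forall q, Z q -> h q != 0 -> Q q].
Proof.
move=> Zp nQ; have : nbhs p Q by []. rewrite nbhsE => -[V [oV Vp] VQ].
by have [h [Ah hp hV]] := coords_base cy oV Zp Vp; exists h; split=> // q Zq /(hV q Zq) /VQ.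
Qed.

Lemma coords_common_denominator p (I : finType) (F : I -> X -> K) : Z p ->
  (forall i, regular_at p (F i)) ->
  exists (h : X -> K) (g : I -> X -> K), [/\ alg_gen (range y) h, h p != 0, forall i, alg_gen (range y) (g i)
    & forall i q, Z q -> h q != 0 -> h q * F i q = g i q].
Proof.
move=> Zp RF.
have /choice[gh H] : forall i, exists gh : (X -> K) * (X -> K), [/\ alg_gen (range y) gh.1,
    alg_gen (range y) gh.2, gh.2 p != 0 & forall q, Z q -> gh.2 q != 0 -> F i q = gh.1 q / gh.2 q].
  move=> i; have [V [oV Vp rV]] := RF i.
  have r2 : reg_on (Z `&` V) (F i) by apply: reg_on_sub (regular_reg_on oV rV) => q [].
  have [g [h [Ag Ah hp E]]] := coords_reg_frac cy oV r2 Zp Vp.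
  by exists (g, h); split=> // q Zq hq; case: (E q Zq hq).
exists (fun q => \prod_i (gh i).2 q), (fun i q => (gh i).1 q * \prod_(j | j != i) (gh j).2 q).
split.
- by apply: alg_gen_prod => i _; case: (H i).
- by apply/prodf_neq0 => i _; case: (H i).
- move=> i; have [A1 _ _ _] := H i; apply: (AlgMul A1).
  by apply: alg_gen_prod => j _; case: (H j).
move=> i q Zq /prodf_neq0 nz; have [_ _ _ E] := H i.
have hi := nz i isT.
by rewrite (bigD1 i) //= E //; field.
Qed.

End CommonDenominators.

Section FlatLocal.
Variables (K : closedFieldType) (E X : space K) (f : E -> X).
Hypotheses (rE : ringed E) (rX : ringed X) (mf : is_morphism f).
Variables (U : set X) (m : nat) (y : 'I_m -> X -> K) (l : nat) (z : 'I_l -> E -> K).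
Hypotheses (oU : open U) (cy : coords U y) (cz : coords (f @^-1` U) z).
Variable e0 : E.
Hypotheses (Ue0 : U (f e0)) (flatf : flat_at f e0).
Local Notation Z := (f @^-1` U).

Let oZ : open Z.
Proof. by apply: open_comp => // e _; case: mf => c _; apply: c. Qed.

Let reg_at (Y : space K) (V : set Y) (h : Y -> K) p : is_sheaf Y -> open V -> V p -> reg_on V h -> regular_at p h.
Proof. by move=> sY oV Vp /(reg_on_regular sY oV) rh; exists V. Qed.

Let pull h : reg_on U h -> reg_on Z (h \o f).
Proof.
move=> rh; have sE := ringed_sheaf rE.
by apply: (@morph_on_reg _ E Z X U f h sE) => //; apply: morph_onTW.
Qed.

(** The germs provided by [flat_at] become functions on the two affine charts by clearing
    denominators; the price is the factor [s], which does not vanish at [e0]. *)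
Lemma flat_relation r (a : 'I_r -> X -> K) (b : 'I_r -> E -> K) :
  (forall i, reg_on U (a i)) -> (forall i, reg_on Z (b i)) ->
  (forall p, Z p -> \sum_i a i (f p) * b i p = 0) ->
  exists s k (c : 'I_r -> 'I_k -> X -> K) (x : 'I_k -> E -> K),
    [/\ reg_on Z s /\ s e0 != 0, forall i j, reg_on U (c i j), forall j, reg_on Z (x j),
        forall i p, Z p -> s p * b i p = \sum_j c i j (f p) * x j p
      & forall j q, U q -> \sum_i a i q * c i j q = 0].
Proof.
move=> ra rb rel; have sE := ringed_sheaf rE; have sX := ringed_sheaf rX.
have [|||k [c [x [rc rx Eb Ea]]]] := flatf (a := a) (b := b).
- by move=> i; apply: (reg_at sX oU Ue0).
- by move=> i; apply: (reg_at sE oZ Ue0).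
- by apply: filterS (open_nbhs_nbhs (conj oZ (Ue0 : Z e0))) => p; apply: rel.
have [d [g [Ad d0 Ag Eg]]] := coords_common_denominator cy (F := fun ij : 'I_r * 'I_k => c ij.1 ij.2)
  Ue0 (fun ij => rc ij.1 ij.2).
have [e [xi [Ae e0n Axi Exi]]] := coords_common_denominator cz (F := x) Ue0 rx.
have [d' [Ad' d'0 Ed']] := coords_near cy Ue0 (filter_forall _ Ea).
have [s' [As' s'0 Es']] := coords_near cz Ue0 (filter_forall _ Eb).
have R := coords_alg_reg rX cy; have RE := coords_alg_reg rE cz.
(* [d] and [e] clear the denominators of the [c i j] and of the [x j]. The second factors [d] and
   [e], and the factors [s'] and [d'], make the identities hold also at the points where those
   functions vanish. *)
exists (fun p => s' p * e p * d (f p) * d (f p) * d' (f p) * e p), k,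
  (fun i j q => d' q * d q * g (i, j) q), (fun j p => s' p * e p * xi j p).
split.
- split; last by rewrite !mulf_neq0.
  by do !apply: (reg_on_mul rE); first [exact: RE|exact: (pull (R _ _))].
- by move=> i j; do !apply: (reg_on_mul rX); apply: R.
- by move=> j; do !apply: (reg_on_mul rE); apply: RE.
- move=> i p Zp.
  have [s'p|s'p] := eqVneq (s' p) 0.
    by rewrite s'p !(mul0r, mulr0) big1 // => j _; rewrite !(mul0r, mulr0).
  have [ep|ep] := eqVneq (e p) 0.
    by rewrite ep !(mul0r, mulr0) big1 // => j _; rewrite !(mul0r, mulr0).
  have [dp|dp] := eqVneq (d (f p)) 0.
    by rewrite dp !(mul0r, mulr0) big1 // => j _; rewrite !(mul0r, mulr0).
  rewrite (Es' p Zp s'p i) mulr_sumr; apply: eq_bigr => j _.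
  by rewrite -(Eg (i, j) _ Zp dp) /= -(Exi j p Zp ep); ring.
move=> j q Uq.
have [d'q|d'q] := eqVneq (d' q) 0.
  by rewrite big1 // => i _; rewrite d'q !(mulr0, mul0r).
have [dq|dq] := eqVneq (d q) 0.
  by rewrite big1 // => i _; rewrite dq !(mulr0, mul0r).
transitivity (d' q * d q * d q * \sum_i a i q * c i j q).
  rewrite mulr_sumr; apply: eq_bigr => i _.
  by rewrite -(Eg (i, j) _ Uq dq) /=; ring.
by rewrite (Ed' q Uq d'q j) mulr0.
Qed.

(** Relations are trivialized one after another: the next one, rewritten in terms of the [x j]
    already found, is a single relation between these. *)
Lemma flat_system N r (a : nat -> 'I_r -> X -> K) (b : 'I_r -> E -> K) :
  (forall n i, reg_on U (a n i)) -> (forall i, reg_on Z (b i)) ->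
  (forall n p, (n < N)%N -> Z p -> \sum_i a n i (f p) * b i p = 0) ->
  exists s k (c : 'I_r -> 'I_k -> X -> K) (x : 'I_k -> E -> K),
    [/\ reg_on Z s /\ s e0 != 0, forall i j, reg_on U (c i j), forall j, reg_on Z (x j),
        forall i p, Z p -> s p * b i p = \sum_j c i j (f p) * x j p
      & forall n j q, (n < N)%N -> U q -> \sum_i a n i q * c i j q = 0].
Proof.
move=> ra rb; elim: N => [|N IH] rel.
  exists (fun=> 1), r, (fun i j _ => (i == j)%:R), b; split=> //.
  - by split; [apply: (reg_on_cst rE)|apply: oner_neq0].
  - by move=> i j; apply: (reg_on_cst rX).
  move=> i p _; rewrite mul1r (bigD1 i) //= eqxx mul1r big1 ?addr0 // => j ji.
  by rewrite eq_sym (negPf ji) mul0r.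
have [|s [k [c [x [[rs s0] rc rx Eb Ea]]]]] := IH.
  by move=> n p nN; apply: rel; apply: ltnW.
have [|||s' [k' [c' [x' [[rs' s'0] rc' rx' Ex Ea']]]]] := @flat_relation k
  (fun j q => \sum_i a N i q * c i j q) x.
- move=> j; apply: (reg_on_alg rX (S := [set h | reg_on U h])) => //.
  by apply: alg_gen_sum => i _; apply: AlgMul; apply: AlgGen; [apply: ra|apply: rc].
- exact: rx.
- move=> p Zp.
  transitivity (s p * \sum_i a N i (f p) * b i p); last by rewrite rel // mulr0.
  rewrite mulr_sumr; under eq_bigr do rewrite mulr_suml.
  rewrite exchange_big /=; apply: eq_bigr => i _.
  rewrite mulrCA Eb // mulr_sumr; apply: eq_bigr => j _; ring.
exists (fun p => s' p * s p), k', (fun i j' q => \sum_j c i j q * c' j j' q), x'; split=> //.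
- by split; [apply: (reg_on_mul rE)|apply: mulf_neq0].
- move=> i j'; apply: (reg_on_alg rX (S := [set h | reg_on U h])) => //.
  by apply: alg_gen_sum => j _; apply: AlgMul; apply: AlgGen; [apply: rc|apply: rc'].
- move=> i p Zp; rewrite -mulrA Eb // mulr_sumr.
  under [RHS]eq_bigr do rewrite mulr_suml.
  rewrite exchange_big /=; apply: eq_bigr => j _.
  rewrite mulrCA Ex // mulr_sumr; apply: eq_bigr => j' _; ring.
move=> n j' q nN Uq.
transitivity (\sum_j (\sum_i a n i q * c i j q) * c' j j' q).
  under eq_bigr do rewrite mulr_sumr.
  under [RHS]eq_bigr do rewrite mulr_suml.
  rewrite exchange_big /=; apply: eq_bigr => j _; apply: eq_bigr => i _; ring.
move: nN; rewrite ltnS leq_eqVlt => /orP[/eqP ->|nN]; first exact: Ea'.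
by rewrite big1 // => j _; rewrite Ea // mul0r.
Qed.

End FlatLocal.

(** * Characters that vanish off the open orbit *)

Section OpenOrbit.
Variables (K : closedFieldType) (n : nat).
Hypothesis hK : [pchar K] =i pred0.
Local Notation N := 'rV[int]_n.
Local Notation M := 'cV[int]_n.
Variable Sigma : set (set N).
Hypothesis fanS : is_fan Sigma.
Variable X : toric_variety K Sigma.
Implicit Types (sigma : Sigma) (u w : M) (x : X).
Local Notation xorb := (xorb fanS X).

Definition positive_on (s : set N) u := forall c : N, s c -> c != 0 -> 0 < pairing u c.

Lemma positive_on_dual (s : set N) u : positive_on s u -> dual_cone s u.
Proof.
move=> pu c sc; have [->|c0] := eqVneq c 0; first by rewrite pairing0r.
exact/ltW/pu.
Qed.

(** A strictly positive functional is taken often enough to absorb finitely many weights. Its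
    character turns the corresponding Laurent polynomials into functions on the chart that vanish
    off the open orbit. *)
Lemma positive_shift sigma (ws : seq M) :
  exists v, positive_on (val sigma) v /\ forall u, u \in ws -> positive_on (val sigma) (v + u).
Proof.
have [_ _ scS _ _] := fanS; have scs := scS _ (fcone_mem sigma).
have [[s sE] _] := scs; have [v0 pv0] := strictly_positive scs.
pose s' := [seq c <- s | c != 0].
have ps' u : (forall c, c \in s' -> 0 < pairing u c) -> positive_on (val sigma) u.
  move=> pu c; rewrite sE; apply: positive_on_cone => {}c cs c0.
  by apply: pu; rewrite mem_filter c0.
have p0 c : c \in s' -> 0 < pairing v0 c.
  by rewrite mem_filter => /andP[c0 cs]; apply: pv0 => //; rewrite sE; apply: cone_mem.
have scale k : 0 <= k -> forall u, (forall c, c \in s' -> 0 < pairing u c) ->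
    forall c, c \in s' -> 0 < pairing (k *: v0 + u) c.
  move=> k0 u pu c cs; rewrite pairingDl pairingZl ltr_wpDl ?pu //.
  by rewrite mulr_ge0 // ltW // p0.
have [k pk] : exists k : nat, forall u, u \in ws -> forall c, c \in s' -> 0 < pairing (k%:Z *: v0 + u) c.
  elim: ws => [|u ws [k IH]]; first by exists 0%N.
  have [k' Hk'] := large_multiple u p0; exists (k + k')%N => u'; rewrite inE => /orP[/eqP ->|u'ws].
    by rewrite PoszD scalerDl -addrA; apply: scale.
  by rewrite PoszD scalerDl addrAC addrC; apply: scale => // c cs; apply: IH.
exists ((k%:Z + 1) *: v0); split.
  by apply: ps' => c cs; rewrite pairingZl mulr_gt0 ?p0 //; lia.
move=> u uw; apply: ps'; rewrite scalerDl scale1r -addrA addrCA -{1}[v0]scale1r.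
by apply: scale => //; apply: pk.
Qed.

Lemma xchar_mulrn sigma v x k : dual_cone (val sigma) v ->
  xchar sigma (k%:Z *: v) x = xchar sigma v x ^+ k.
Proof.
move=> dv; have dk j : dual_cone (val sigma) (j%:Z *: v).
  by move=> c sc; rewrite pairingZl mulr_ge0 // dv.
elim: k => [|k IH]; first by rewrite scale0r xchar0.
by rewrite intS scalerDl scale1r xcharD // IH exprS.
Qed.

(** Every [u] becomes an element of the dual cone after adding a multiple of [v], so a point of the
    chart at which [v] is nonzero extends to a homomorphism on all of [M], a point of the torus. *)
Lemma open_orbit sigma v x : tU sigma x -> positive_on (val sigma) v -> xchar sigma v x != 0 ->
  exists t, x = xorb t.
Proof.
move=> Ux pv nz; have dv := positive_on_dual pv.
have [_ _ scS _ _] := fanS; have [[s sE] _] := scS _ (fcone_mem sigma).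
have ex u : exists k : nat, dual_cone (val sigma) (k%:Z *: v + u).
  pose s' := [seq c <- s | c != 0].
  have [c|k Hk] := @large_multiple _ s' v u.
    by rewrite mem_filter => /andP[c0 cs]; apply: pv => //; rewrite sE; apply: cone_mem.
  exists k; rewrite sE; apply/dual_coneP => c cs; have [->|c0] := eqVneq c 0.
    by rewrite pairing0r.
  by apply/ltW/Hk; rewrite mem_filter c0.
pose t u := let k := projT1 (cid (ex u)) in xchar sigma (k%:Z *: v + u) x / xchar sigma v x ^+ k.
have dk j : dual_cone (val sigma) (j%:Z *: v).
  by move=> c sc; rewrite pairingZl mulr_ge0 // dv.
have tE u k : dual_cone (val sigma) (k%:Z *: v + u) ->
    t u = xchar sigma (k%:Z *: v + u) x / xchar sigma v x ^+ k.
  rewrite /t; case: cid => j /= dj dku.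
  apply/eqP; rewrite eqr_div ?expf_neq0 // -!xchar_mulrn // -!xcharD //.
  by apply/eqP; congr (xchar sigma _ x); rewrite addrAC [RHS]addrAC (addrC (j%:Z *: v)).
have tP : @sg_axiom K n [set 0] t.
  split=> [|u w _ _|u /(_ (dual_cone0 u))//].
    by rewrite (tE 0 0%N) ?scale0r ?addr0 ?xchar0 ?divr1 //; apply: dual_cone_0.
  have [[j dj] [k dk']] := (ex u, ex w).
  have E : (j + k)%:Z *: v + (u + w) = (j%:Z *: v + u) + (k%:Z *: v + w).
    by rewrite PoszD scalerDl addrACA.
  rewrite (tE u j) // (tE w k) // (tE _ (j + k)%N); last by rewrite E; apply: dual_coneD.
  by rewrite E xcharD // exprD invfM mulrACA.
exists (exist _ t tP); apply: (xchar_point Ux (xorb_tU fanS X sigma _)) => u du.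
rewrite xchar_xorb // /character /= (tE u 0%N) ?scale0r ?add0r //.
by rewrite divr1.
Qed.

End OpenOrbit.

Lemma In_nth (T : Type) (x0 : T) (s : seq T) j : (j < size s)%N -> List.In (nth x0 s j) s.
Proof. by elim: s j => [|a s IH] [|j] //= Hj; [left|right; apply: IH]. Qed.

(* Finitely many points detect all the linear relations between given functions. *)
Lemma spanning_points (K : fieldType) (Q : Type) (A : set Q) (I : finType) (F : I -> Q -> K) :
  exists r (e : 'I_r -> Q), (forall l, A (e l)) /\
    exists mu : 'I_r -> I -> K, forall q, A q ->
      forall i, F i q = \sum_l (\sum_j mu l j * F j q) * F i (e l).
Proof.
pose v q : 'rV[K]_#|I| := \row_j F (enum_val j) q.
(* Among the spans of value vectors [v q] at finitely many points of [A], one of maximal dimension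
   contains all value vectors, and its coordinate functionals provide [mu]. *)
pose D k := `[< exists2 s : seq Q, (forall q, List.In q s -> A q) & \dim <<map v s>>%VS = k >].
have D0 : exists k, D k by exists 0%N; apply/asboolP; exists [::] => //=; rewrite span_nil dimv0.
have Db k : D k -> (k <= #|I|)%N.
  move=> /asboolP[s _ <-]; apply: leq_trans (dimvS (subvf _)) _.
  by rewrite dimvf /dim /= mul1n.
have [k /asboolP[s sA sk] kmax] := ex_maxnP D0 Db.
have inA l : A (tnth (in_tuple s) l).
  by apply: sA; rewrite (tnth_nth (tnth (in_tuple s) l)); apply: In_nth.
pose t := map_tuple v (in_tuple s).
exists (size s), (tnth (in_tuple s)); split=> //.
exists (fun l j => coord t l (delta_mx 0 (enum_rank j))) => q Aq i.
have vq : v q \in <<map v s>>%VS.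
  have sub : (<<map v s>> <= <<map v (q :: s)>>)%VS.
    by apply: sub_span => c cs; rewrite /= inE cs orbT.
  have dim : (\dim <<map v (q :: s)>>%VS <= \dim <<map v s>>%VS)%N.
    by rewrite sk; apply: kmax; apply/asboolP; exists (q :: s) => // q' [<-|/sA].
  have /eqP -> : (<<map v s>> == <<map v (q :: s)>>)%VS by rewrite eqEdim sub.
  by apply: memv_span; rewrite /= inE eqxx.
have := coord_span (X := t) vq => /(congr1 (fun x : 'rV_#|I| => x 0 (enum_rank i))).
rewrite mxE enum_rankK => ->; rewrite summxE; apply: eq_bigr => l _.
rewrite mxE -tnth_nth tnth_map mxE enum_rankK; congr (_ * _).
rewrite {1}(row_sum_delta (v q)) linear_sum (reindex enum_rank) /=; last first.
  by exists enum_val => j _; rewrite ?enum_rankK ?enum_valK.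
by apply: eq_bigr => j _; rewrite linearZ /= mxE enum_rankK mulrC.
Qed.

Section SeparationOfVariables.
Variables (K : closedFieldType).

Lemma reg_on_prod_sum (X Y : space K) (Z : set X) m (y : 'I_m -> X -> K) (Z' : set Y) k (z : 'I_k -> Y -> K)
    (F : X * Y -> K) : ringed X -> ringed Y -> coords Z y -> coords Z' z ->
  @reg_on _ (product X Y) (Z `*` Z') F ->
  exists r (a : 'I_r -> X -> K) (b : 'I_r -> Y -> K), [/\ forall i, alg_gen (range y) (a i),
    forall i, alg_gen (range z) (b i) & forall p q, Z p -> Z' q -> F (p, q) = \sum_i a i p * b i q].
Proof.
move=> rX rY cy cz /(coords_reg_alg (coords_prod rX rY cy cz))[g Ag E].
have [r [a [b [Aa Ab Eg]]]] := alg_gen_pair_sum Ag.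
by exists r, a, b; split=> // p q Zp Zq; rewrite E.
Qed.

Lemma sum_characters (M P Q : Type) (ch : M -> P -> K) (D : set M) (A : set P) (S : set (Q -> K)) s
    (a : 'I_s -> P -> K) (b : 'I_s -> Q -> K) :
  (forall i, exists r (c : 'I_r -> K) (u : 'I_r -> M), (forall j, D (u j)) /\
     forall p, A p -> a i p = \sum_j c j * ch (u j) p) ->
  (forall i, alg_gen S (b i)) ->
  exists r (u : 'I_r -> M) (f : 'I_r -> Q -> K), [/\ forall i, D (u i), forall i, alg_gen S (f i)
    & forall p q, A p -> \sum_i a i p * b i q = \sum_i ch (u i) p * f i q].
Proof.
move=> H Ab.
have {H} /choice[L HL] : forall i, exists L : seq (K * M), (forall x, List.In x L -> D x.2) /\
    forall p, A p -> a i p = \sum_(x <- L) x.1 * ch x.2 p.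
  move=> i; have [r [c [u [Du Ea]]]] := H i.
  exists [seq (c j, u j) | j <- enum 'I_r]; split=> [x|p Ap].
    by elim: (enum _) => //= j J IH [<- /=|/IH //]; apply: Du.
  by rewrite big_map big_enum Ea //; apply: eq_big.
pose LL := flatten [seq [seq (y.2, (fun e => y.1 * b i e) : Q -> K) | y <- L i] | i <- enum 'I_s].
have LLP : forall x, List.In x LL -> D x.1 /\ alg_gen S x.2.
  rewrite /LL; elim: (enum _) => //= i I IH x /List.in_app_iff[]; last exact: IH.
  elim: (L i) (HL i).1 => //= y L' IHL DL [<-|]; last by apply: IHL => z zL; apply: DL; right.
  by split; [apply: DL; left|apply: (AlgMul (AlgCst _ _) (Ab i))].
have {LLP} LLP j : D (tnth (in_tuple LL) j).1 /\ alg_gen S (tnth (in_tuple LL) j).2.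
  by apply: LLP; rewrite (tnth_nth (tnth (in_tuple LL) j)); apply: In_nth.
exists (size LL), (fun i => (tnth (in_tuple LL) i).1), (fun i => (tnth (in_tuple LL) i).2).
split=> [i|i|p q Ap]; [by case: (LLP i)..|].
rewrite -(big_tuple _ _ (in_tuple LL) xpredT (fun y => ch y.1 p * y.2 q)) /=.
rewrite big_flatten big_map big_enum; apply: eq_big => // i _.
rewrite (HL i).2 // mulr_suml big_map; apply: eq_bigr => y _ /=.
by rewrite [y.1 * _]mulrC mulrA.
Qed.

Lemma reg_on_torus_prod n (Y : space K) (Z : set Y) m (z : 'I_m -> Y -> K) (F : torus K n * Y -> K) :
  ringed Y -> coords Z z -> @reg_on _ (product (torus K n) Y) (setT `*` Z) F ->
  exists k (u : 'I_k -> 'cV[int]_n) (f : 'I_k -> Y -> K), (forall i, alg_gen (range z) (f i)) /\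
    forall t p, Z p -> F (t, p) = \sum_i character (u i) t * f i p.
Proof.
move=> rY cz rF; have [q [v cT]] := coords_torus K n.
have [s [a [b [Aa Ab Eab]]]] := reg_on_prod_sum (ringed_affine_toric K [set 0]) rY cT cz rF.
have [|k [u [f [_ Af Ef]]]] := sum_characters (ch := @character K n) (D := setT) (A := setT) (a := a) _ Ab.
  by move=> i; have [k [c [w Ew]]] := alg_gen_torus_chars (Aa i); exists k, c, w.
by exists k, u, f; split=> // t p Zp; rewrite Eab // Ef.
Qed.

Lemma reg_on_chart_prod n (Sigma : set (set 'rV[int]_n)) (fanS : is_fan Sigma) (X : toric_variety K Sigma)
    (sigma : Sigma) (Y : space K) (Z : set Y) m (z : 'I_m -> Y -> K) (F : X * Y -> K) :
  ringed Y -> coords Z z -> @reg_on _ (product X Y) (tU sigma `*` Z) F ->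
  exists k (u : 'I_k -> 'cV[int]_n) (f : 'I_k -> Y -> K), [/\ forall i, dual_cone (val sigma) (u i),
    forall i, alg_gen (range z) (f i)
    & forall x p, tU sigma x -> Z p -> F (x, p) = \sum_i xchar sigma (u i) x * f i p].
Proof.
move=> rY cz rF; have rX := ringed_variety (toric_is_variety X).
have [q [v [_ cU]]] := coords_tU fanS X sigma.
have [s [a [b [Aa Ab Eab]]]] := reg_on_prod_sum rX rY cU cz rF.
have [|k [u [f [du Af Ef]]]] := sum_characters (ch := @xchar K n Sigma X sigma)
  (D := dual_cone (val sigma)) (A := tU sigma) (a := a) _ Ab.
  by move=> i; exact: (reg_tU fanS (coords_alg_reg rX cU (Aa i))).
by exists k, u, f; split=> // x p Ux Zp; rewrite Eab // Ef.
Qed.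

End SeparationOfVariables.

(** * Functions on the total space of a bundle *)

Section Bundle.
Variables (K : closedFieldType) (n : nat).
Hypothesis hK : [pchar K] =i pred0.
Local Notation N := 'rV[int]_n.
Local Notation M := 'cV[int]_n.
Local Notation T := (torus K n).
Variable Sigma : set (set N).
Hypothesis fanS : is_fan Sigma.
Variable X : toric_variety K Sigma.
Variable G : alg_group K.
Variable E : principal_bundle X G.
Implicit Types (sigma : Sigma) (t : T) (u w : M) (x : X) (e : E) (g : G).
Local Notation xorb := (xorb fanS X).
Local Notation KG := (@coordinate_ring K G).

Lemma ringed_toric : ringed X. Proof. exact: ringed_variety (toric_is_variety X). Qed.
Lemma ringed_total : ringed E. Proof. exact: ringed_variety (total_variety E). Qed.
Lemma ringed_torus : ringed T. Proof. exact: ringed_affine_toric. Qed.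

Let rX := ringed_toric.
Let rE := ringed_total.
Let rT := ringed_torus.
Let rG := ringed_group G.
Let sX := ringed_sheaf rX.
Let sE := ringed_sheaf rE.
Let sT := ringed_sheaf rT.
Let sG := ringed_sheaf rG.

Definition over sigma : set E := @proj _ _ _ _ _ E @^-1` tU sigma.

Lemma over_open sigma : open (over sigma).
Proof.
apply: open_comp => [e _|]; last exact: tU_open.
by have [c _] := proj_morph E; apply: c.
Qed.

Lemma coords_over sigma : exists l (z : 'I_l -> E -> K), coords (over sigma) z.
Proof.
have [m [u [_ cU]]] := coords_tU fanS X sigma.
exact: (affine_coords rE (@proj_affine _ _ _ _ _ E _ (tU_open X sigma) (coords_affine rX cU))).
Qed.

Lemma morph_proj (Z : set E) : morph_on Z (@proj _ _ _ _ _ E).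
Proof. exact: morph_onTW sE (proj_morph E). Qed.

Lemma reg_proj sigma f : reg_on (tU sigma) f -> reg_on (over sigma) (f \o @proj _ _ _ _ _ E).
Proof.
move=> rf; apply: (@morph_on_reg _ E (over sigma) X (tU sigma) _ f sE) => //.
exact: morph_proj.
Qed.

Lemma over_ract sigma e g : over sigma e -> over sigma (ract e g).
Proof. by rewrite /over /= proj_ract. Qed.

Lemma over_tact sigma t e : over sigma e -> over sigma (tact t e).
Proof. by rewrite /over /= proj_tact => ?; apply: tU_act. Qed.

Lemma ract_inj e : injective (ract e).
Proof.
move=> g h eq; have [_ [_ inj _] _] := ract_torsor E.
have := inj (e, g) (e, h); rewrite !in_setE /= eq => H.
by case: (H Logic.I Logic.I erefl).
Qed.

Lemma ractV e g : ract (ract e g) (ginv g) = e.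
Proof. by rewrite -ractM gmulgV ract1. Qed.

Lemma ractVV e g : ract (ract e (ginv g)) g = e.
Proof. by rewrite -ractM gmulVg ract1. Qed.

Lemma bundle_division : exists d : E -> E -> G,
  (forall e e', proj e = proj e' -> ract e (d e e') = e') /\
  @morph_on _ (product E E) [set p | proj p.1 = proj p.2] G (fun p => d p.1 p.2).
Proof.
pose D := [set p : product E E | proj p.1 = proj p.2].
have [_ [_ _ surj] [h [mh hK']]] := ract_torsor E.
pose d e e' : G := if pselect (proj e = proj e') is left H
  then (h (SigSub (mem_set (H : D (e, e'))))).2 else gone.
have rEE := ringed_product sE sE; have sEE := ringed_sheaf rEE.
have rEG := ringed_product sE sG.
exists d; split.
  move=> e e' H; rewrite /d; case: pselect => // H'.
  have := hK' (SigSub (mem_set (H' : D (e, e')))) => /= -[e1].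
  by rewrite {1}e1.
apply: (morph_on_of_sub sEE).
have mh2 : @morph_on _ (subspace_of (product E E) D) setT G (snd \o h).
  apply: (@morph_on_comp _ _ setT (product E G) setT G h snd) => //; first exact: sub_sheaf.
    exact/morph_onT/mh/sub_sheaf.
  exact: morph_on_snd.
have sS : is_sheaf (subspace_of (product E E) D) by apply: sub_sheaf.
apply/(morph_onT _ sS); apply: morph_on_ext mh2 => p _ /=.
rewrite /d; case: pselect => [H|]; last by case; have := valP p; rewrite in_setE.
by congr (h _).2; apply: val_inj => /=; apply: surjective_pairing.
Qed.

Lemma reg_over_rational sigma (act : T -> E -> E) r :
  @morph_on _ (product T E) (setT `*` over sigma) E (fun p => act p.1 p.2) ->
  (forall t e, over sigma e -> over sigma (act t e)) ->
  reg_on (over sigma) r -> exists k (u : 'I_k -> M) (f : 'I_k -> E -> K),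
  (forall i, reg_on (over sigma) (f i)) /\
  forall t e, over sigma e -> r (act t e) = \sum_i character (u i) t * f i e.
Proof.
move=> mact sact rr; have [l [z cz]] := coords_over sigma.
have rTE := ringed_product sT sE; have sTE := ringed_sheaf rTE.
have rF : @reg_on _ (product T E) (setT `*` over sigma) (fun p => r (act p.1 p.2)).
  apply: (@morph_on_reg _ (product T E) _ E (over sigma) (fun p => act p.1 p.2) r sTE) => //.
  by move=> [t e] /= [_ He]; apply: sact.
have [k [u [f [Af Ef]]]] := reg_on_torus_prod rE cz rF.
exists k, u, f; split=> [i|t e He]; first exact: coords_alg_reg cz (Af i).
exact: Ef.
Qed.

Lemma reg_over_tact sigma r : reg_on (over sigma) r -> exists k (u : 'I_k -> M) (f : 'I_k -> E -> K),
  (forall i, reg_on (over sigma) (f i)) /\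
  forall t e, over sigma e -> r (tact t e) = \sum_i character (u i) t * f i e.
Proof.
apply: reg_over_rational => [|t e]; last exact: over_tact.
exact: (morph_onTW _ (ringed_sheaf (ringed_product sT sE)) (tact_morph E)).
Qed.

Lemma reg_over_ract sigma r : reg_on (over sigma) r -> exists k (f : 'I_k -> E -> K) (h : 'I_k -> G -> K),
  [/\ forall i, reg_on (over sigma) (f i), forall i, KG (h i)
    & forall e g, over sigma e -> r (ract e g) = \sum_i f i e * h i g].
Proof.
move=> rr; have [l [z cz]] := coords_over sigma; have [m [y cG]] := group_coords G.
have rEG := ringed_product sE sG; have sEG := ringed_sheaf rEG.
have rF : @reg_on _ (product E G) (over sigma `*` setT) (fun p => r (ract p.1 p.2)).
  apply: (@morph_on_reg _ (product E G) _ E (over sigma) (fun p => ract p.1 p.2) r sEG) => //.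
    exact: (morph_onTW _ sEG (ract_morph E)).
  by move=> [e g] /= [He _]; apply: over_ract.
have [s [a [b [Aa Ab Eab]]]] := reg_on_prod_sum rE rG cz cG rF.
exists s, a, b; split=> [i|i|e g He].
- exact: coords_alg_reg cz (Aa i).
- by rewrite (coordinate_ringE cG).
exact: Eab.
Qed.

(** The fibre product is closed in the product of the total space with itself, because the diagonal
    of the base is closed. So [b] of the division map is the restriction of a polynomial in the
    coordinates of both factors, whose variables separate. *)
Lemma reg_division sigma d b : KG b ->
  @morph_on _ (product E E) [set p | proj p.1 = proj p.2] G (fun p => d p.1 p.2) ->
  exists r (p q : 'I_r -> E -> K), [/\ forall i, reg_on (over sigma) (p i),
    forall i, reg_on (over sigma) (q i) &
    forall e e', over sigma e -> proj e = proj e' -> b (d e e') = \sum_i p i e * q i e'].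
Proof.
move=> Kb md; have [l [z cz]] := coords_over sigma.
have rEE := ringed_product sE sE; have sEE := ringed_sheaf rEE.
have rXX := ringed_product sX sX.
pose D := [set p : product E E | proj p.1 = proj p.2].
have cD : closed D.
  have [_ _ cl] := toric_is_variety X.
  apply: (@closed_comp (product E E) (product X X) (fun p => (proj p.1, proj p.2))) cl => p _.
  have : @is_morphism K (product E E) (product X X) (fun p => (proj p.1, proj p.2)).
    apply/morph_onT => //; apply: (@morph_on_pair _ (product E E)) => //.
      apply: (@morph_on_comp _ (product E E) setT E setT X fst) => //; first exact: morph_on_fst.
      exact: morph_proj.
    apply: (@morph_on_comp _ (product E E) setT E setT X snd) => //; first exact: morph_on_snd.
    exact: morph_proj.
  by case=> c _; apply: c.
have cc := coords_closed rEE (coords_prod rE rE cz cz) cD.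
have rb : @reg_on _ (product E E) ((over sigma `*` over sigma) `&` D) (fun p => b (d p.1 p.2)).
  apply: (@morph_on_reg _ (product E E) _ G setT (fun p => d p.1 p.2) b sEE) => //.
    by apply: morph_on_sub md => p [].
  exact/coordinate_ringP.
have [F AF EF] := coords_reg_alg cc rb.
have [r [p [q [Ap Aq Epq]]]] := alg_gen_pair_sum AF.
exists r, p, q; split=> [i|i|e e' He H].
- exact: coords_alg_reg cz (Ap i).
- exact: coords_alg_reg cz (Aq i).
by rewrite -Epq -(EF (e, e')) //; split=> //; split=> //=; rewrite /over /= -H.
Qed.

End Bundle.

(** * Reducedness of the fibres *)

Section Reducedness.
Variables (K : closedFieldType) (n : nat).
Hypothesis hK : [pchar K] =i pred0.
Local Notation N := 'rV[int]_n.
Local Notation M := 'cV[int]_n.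
Local Notation T := (torus K n).
Variable Sigma : set (set N).
Hypothesis fanS : is_fan Sigma.
Variable X : toric_variety K Sigma.
Variable G : alg_group K.
Variable E : principal_bundle X G.
Implicit Types (sigma : Sigma) (t : T) (u w : M) (x : X) (e : E) (g : G).
Local Notation xorb := (xorb fanS X).
Local Notation KG := (@coordinate_ring K G).
Let rX := ringed_toric X.
Let rE := ringed_total E.
Local Notation over := (over (E := E)).

(* Flatness forbids functions supported over the boundary. *)
Lemma zero_over_orbit sigma h e0 : reg_on (over sigma) h -> over sigma e0 ->
  (forall e t, proj e = xorb t -> h e = 0) -> h e0 = 0.
Proof.
move=> rh He0 h0; have [v [pv _]] := positive_shift fanS sigma [::].
have dv := positive_on_dual pv.
have [m [u [_ cU]]] := coords_tU fanS X sigma; have [l [z cz]] := coords_over fanS E sigma.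
have [||p Zp|s [k [c [x [[rs s0] rc rx Eb Ea]]]]] := @flat_relation K E X _ rE rX (proj_morph E)
    _ _ _ _ _ (tU_open X sigma) cU cz e0 He0 (@proj_flat _ _ _ _ _ E e0) 1 (fun=> xchar sigma v) (fun=> h).
- by move=> _; apply: reg_xchar.
- by [].
- rewrite big_ord1; have [->|nz] := eqVneq (xchar sigma v (proj p)) 0; first by rewrite mul0r.
  have [t Et] := open_orbit fanS Zp pv nz.
  by rewrite (h0 _ _ Et) mulr0.
have c0 j q : tU sigma q -> c 0 j q = 0.
  apply: (reg_tU_zero hK (fanS := fanS)) => // t.
  have := Ea j _ (xorb_tU fanS X sigma t); rewrite big_ord1 xchar_xorb // => /eqP.
  by rewrite mulf_eq0 (negPf (char_neq0 _ _)) => /eqP.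
have := Eb 0 e0 He0; rewrite big1 => [/eqP|j _]; last by rewrite c0 ?mul0r.
by rewrite mulf_eq0 (negPf s0) => /eqP.
Qed.

Lemma eq_over_orbit sigma f h : reg_on (over sigma) f -> reg_on (over sigma) h ->
  (forall e t, proj e = xorb t -> f e = h e) -> forall e, over sigma e -> f e = h e.
Proof.
move=> rf rh eq e He; apply/eqP; rewrite -subr_eq0; apply/eqP.
rewrite -[- h e]mulN1r.
apply: (@zero_over_orbit sigma (fun e => f e + -1 * h e)) => //.
  by apply: (reg_on_add rE) => //; apply: (reg_on_mul rE) => //; apply: (reg_on_cst rE).
by move=> e' t /eq ->; rewrite mulN1r subrr.
Qed.

(* Over the open orbit, e = t e' with e' in one fibre, which turns the relation
   into finitely many relations with coefficients in K[M]. *)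
Lemma fibre_product_relation sigma e0 r (p q : 'I_r -> E -> K) : over sigma e0 ->
  (forall i, reg_on (over sigma) (p i)) -> (forall i, reg_on (over sigma) (q i)) ->
  (forall e e', over sigma e -> proj e = proj e' -> \sum_i p i e * q i e' = 0) ->
  exists s k (a : 'I_k -> X -> K) (y : 'I_k -> E -> K),
    [/\ reg_on (over sigma) s /\ s e0 != 0,
        forall j, reg_on (tU sigma) (a j) /\ a j (proj e0) = 0,
        forall j, reg_on (over sigma) (y j)
      & forall e, over sigma e -> s e * \sum_i p i e0 * q i e = \sum_j a j (proj e) * y j e].
Proof.
move=> He0 rp rq rel.
have [m [u0 [_ cU]]] := coords_tU fanS X sigma; have [l [z cz]] := coords_over fanS E sigma.
pose rep (i : 'I_r) := reg_over_tact fanS (rp i).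
pose mk i := projT1 (cid (rep i)).
pose uu i : 'I_(mk i) -> M := projT1 (cid (projT2 (cid (rep i)))).
pose ff i : 'I_(mk i) -> E -> K := projT1 (cid (projT2 (cid (projT2 (cid (rep i)))))).
have [rf Ef] : (forall i j, reg_on (over sigma) (ff i j)) /\
   forall i t e, over sigma e -> p i (tact t e) = \sum_j character (uu i j) t * ff i j e.
  have H i := projT2 (cid (projT2 (cid (projT2 (cid (rep i)))))).
  by split=> i; have [] := H i.
pose fib := [set e : E | proj e = xorb torus_one].
have fibU e : fib e -> over sigma e by rewrite /fib /over /= => ->; apply: xorb_tU.
have [L [el [elfib [mu span]]]] := @spanning_points K E fib {i : 'I_r & 'I_(mk i)}
  (fun ij => ff (tag ij) (tagged ij)).
(* Multiplied by the character [v], the Laurent polynomials [t |-> p i (t el)] extend to functions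
   [a l i] on the chart that vanish off the open orbit. *)
have [v [pv pvu]] := positive_shift fanS sigma [seq uu (tag ij) (tagged ij) | ij <- enum {: {i : 'I_r & 'I_(mk i)}}].
have pvu' i j : positive_on (val sigma) (v + uu i j).
  by apply: pvu; apply/mapP; exists (Tagged (fun i => 'I_(mk i)) j); rewrite ?mem_enum.
pose a (l : 'I_L) (i : 'I_r) (x : X) := \sum_j ff i j (el l) * xchar sigma (v + uu i j) x.
have ra l' i : reg_on (tU sigma) (a l' i).
  apply: (reg_on_alg rX (S := [set h | reg_on (tU sigma) h])) => //.
  apply: alg_gen_sum => j _; apply: AlgMul; first exact: AlgCst.
  by apply: AlgGen; apply: reg_xchar; apply: positive_on_dual.
have aorb l' i t : a l' i (xorb t) = character v t * p i (tact t (el l')).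
  rewrite Ef; last exact/fibU/elfib.
  rewrite mulr_sumr; apply: eq_bigr => j _; rewrite xchar_xorb; last exact: positive_on_dual.
  by rewrite charD; ring.
have rel' l' e : over sigma e -> \sum_i a l' i (proj e) * q i e = 0.
  move=> He; have [orb|norb] := pselect (exists t, proj e = xorb t).
    have [t et] := orb; rewrite et.
    under eq_bigr do rewrite aorb -mulrA.
    rewrite -mulr_sumr rel ?mulr0 //; first exact/over_tact/fibU/elfib.
    by rewrite proj_tact elfib act_xorb torus_mul1 et.
  rewrite big1 // => i _; rewrite /a big1 ?mul0r // => j _.
  have [->|nz] := eqVneq (xchar sigma (v + uu i j) (proj e)) 0; first by rewrite mulr0.
  by case: norb; exact: (open_orbit fanS He (@pvu' i j) nz).
pose a' (k : nat) (i : 'I_r) : X -> K := if insub k is Some l' then a l' i else fun=> 0.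
have [k i|//|k e kL He|s [k [c [y [rs rc ry Eb Ea]]]]] := @flat_system K E X _ rE rX (proj_morph E)
    _ _ _ _ _ (tU_open X sigma) cU cz e0 He0 (@proj_flat _ _ _ _ _ E e0) L r a' q.
- by rewrite /a'; case: insub => // ; apply: (reg_on_cst rX).
- by rewrite /a' insubT; apply: rel'.
have Ea' l' j x : tU sigma x -> \sum_i a l' i x * c i j x = 0.
  by move=> Ux; rewrite -[RHS](Ea l' j x (ltn_ord l') Ux) /a' valK.
exists s, k, (fun j x => \sum_i p i e0 * c i j x), y; split=> //.
- move=> j; split.
    apply: (reg_on_alg rX (S := [set h | reg_on (tU sigma) h])) => //.
    apply: alg_gen_sum => i _; apply: AlgMul; first exact: AlgCst.
    by apply: AlgGen; apply: rc.
  (* The vanishing at [e0] is shown for every [e] in its place. Over the open orbit the finitely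
     many relations imply it by the choice of the points [el], and flatness carries it to [e0]. *)
  apply: (@zero_over_orbit sigma (fun e => \sum_i p i e * c i j (proj e))) => //.
    apply: (reg_on_alg rE (S := [set h | reg_on (over sigma) h])) => //.
    apply: alg_gen_sum => i _; apply: AlgMul; apply: AlgGen; first exact: rp.
    exact: (reg_proj (rc i j)).
  move=> e t et; pose e' := tact (torus_inv t) e.
  have e'fib : fib e'.
    by rewrite /fib /= /e' proj_tact et act_xorb torus_mulC torus_mulV.
  have ee' : e = tact t e' by rewrite /e' -tactM torus_mulV tact1.
  pose lam l' := \sum_j mu l' j * ff (tag j) (tagged j) e'.
  have Elam := span e' e'fib.
  apply: (mulfI (char_neq0 v t)); rewrite mulr0 et.
  transitivity (\sum_l' lam l' * \sum_i a l' i (xorb t) * c i j (xorb t)).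
    rewrite mulr_sumr; under [RHS]eq_bigr do rewrite mulr_sumr.
    rewrite exchange_big /=; apply: eq_bigr => i _.
    rewrite {1}ee' Ef; last exact: fibU.
    rewrite mulrA [RHS](_ : _ = (\sum_l' lam l' * a l' i (xorb t)) * c i j (xorb t)); last first.
      by rewrite mulr_suml; apply: eq_bigr => l' _; rewrite mulrA.
    congr (_ * _); rewrite mulr_sumr.
    transitivity (\sum_l' \sum_j character v t * (character (uu i j) t * (lam l' * ff i j (el l')))).
      rewrite exchange_big; apply: eq_bigr => j' _ /=.
      by rewrite -!mulr_sumr -(Elam (existT _ i j')).
    apply: eq_bigr => l' _; rewrite aorb Ef; last exact/fibU/elfib.
    by rewrite !mulr_sumr; apply: eq_bigr => j' _; ring.
  by rewrite big1 // => l' _; rewrite Ea' ?mulr0 //; apply: xorb_tU.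
move=> e He; rewrite mulr_sumr.
under [RHS]eq_bigr do rewrite mulr_suml.
rewrite exchange_big /=; apply: eq_bigr => i _.
by rewrite mulrCA Eb // mulr_sumr; apply: eq_bigr => j _; rewrite mulrA.
Qed.

End Reducedness.

Section ReducedFibre.
Variables (K : closedFieldType) (n : nat).
Hypothesis hK : [pchar K] =i pred0.
Local Notation N := 'rV[int]_n.
Local Notation M := 'cV[int]_n.
Local Notation T := (torus K n).
Variable Sigma : set (set N).
Hypothesis fanS : is_fan Sigma.
Variable X : toric_variety K Sigma.
Variable G : alg_group K.
Variable E : principal_bundle X G.
Implicit Types (sigma : Sigma) (t : T) (u w : M) (e : E) (g : G).
Local Notation xorb := (xorb fanS X).
Local Notation KG := (@coordinate_ring K G).
Let rE := ringed_total E.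
Local Notation over := (over (E := E)).

(** Write [r (e g) = \sum_i f i e * h i g]. As [\sum_i f i e0 * h i = 0], on the fibre product
    [r e'] equals the sum of the [(f i e - f i e0) * h i (d e e')]. This is a relation with
    separated variables in which only the term [r] is left when [e = e0] in the first factors, so
    [fibre_product_relation] yields the assertion. *)
Lemma reduced_fibre sigma e0 r : over sigma e0 -> reg_on (over sigma) r ->
  (forall e, proj e = proj e0 -> r e = 0) ->
  exists s k (a : 'I_k -> X -> K) (y : 'I_k -> E -> K),
    [/\ reg_on (over sigma) s /\ s e0 != 0,
        forall j, reg_on (tU sigma) (a j) /\ a j (proj e0) = 0,
        forall j, reg_on (over sigma) (y j)
      & forall e, over sigma e -> s e * r e = \sum_j a j (proj e) * y j e].
Proof.
move=> He0 rr r0; have [d [dP md]] := bundle_division E.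
have [m [f [h [rf Kh Er]]]] := reg_over_ract fanS rr.
have /choice[L HL] : forall i, exists L : seq ((E -> K) * (E -> K)),
    (forall j, reg_on (over sigma) (nth (0, 0) L j).1 /\ reg_on (over sigma) (nth (0, 0) L j).2) /\
    forall e e', over sigma e -> proj e = proj e' -> h i (d e e') = \sum_(x <- L) x.1 e * x.2 e'.
  move=> i; have [k [p [q [rp rq Epq]]]] := reg_division fanS sigma (Kh i) md.
  exists [seq (p j, q j) | j <- enum 'I_k]; split=> [j|e e' He He'].
    have [jk|jk] := ltnP j k.
      by rewrite (nth_map (Ordinal jk)) ?size_enum_ord //=.
    rewrite nth_default; last by rewrite size_map size_enum_ord.
    by split; apply: (reg_on_cst rE 0).
  by rewrite big_map big_enum Epq //; apply: eq_big.
pose z : (E -> K) * (E -> K) := (0, 0).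
pose LL := ((fun=> 1) : E -> K, r) :: flatten
  [seq [seq ((fun e => - 1 * (f i e + - f i e0) * x.1 e) : E -> K, x.2) | x <- L i] | i <- enum 'I_m].
have rLL j : reg_on (over sigma) (nth z LL j).1 /\ reg_on (over sigma) (nth z LL j).2.
  case: j => [|j]; first by split=> //; apply: (reg_on_cst rE).
  rewrite /LL /=; elim: (enum _) j => [|i I IH] j /=.
    by rewrite nth_nil; split; apply: (reg_on_cst rE 0).
  rewrite nth_cat size_map; case: ltnP => [jL|_]; last exact: IH.
  rewrite (nth_map z) //=; have [rL1 rL2] := (HL i).1 j; split=> //.
  do !apply: (reg_on_mul rE) => //; first exact: (reg_on_cst rE).
  by apply: (reg_on_add rE) => //; apply: (reg_on_cst rE).
have sumE (F : (E -> K) * (E -> K) -> K) : \sum_(i < size LL) F (nth z LL i) = F ((fun=> 1) : E -> K, r) +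
   \sum_i \sum_(x <- L i) F ((fun e => - 1 * (f i e + - f i e0) * x.1 e) : E -> K, x.2).
  rewrite -(big_mkord xpredT (fun i => F (nth z LL i))) -(big_nth z xpredT F).
  rewrite big_cons big_flatten big_map big_enum; congr (_ + _); apply: eq_big => // i _.
  by rewrite big_map.
have h0 g : \sum_i f i e0 * h i g = 0 by rewrite -Er // r0 // proj_ract.
have [i|i|e e' He He'|s [k [a [y [rs ra ry Ey]]]]] := fibre_product_relation hK fanS (r := size LL)
    (p := fun i => (nth z LL i).1) (q := fun i => (nth z LL i).2) He0.
- by case: (rLL i).
- by case: (rLL i).
- rewrite (sumE (fun x => x.1 e * x.2 e')) /= mul1r.
  have -> : r e' = \sum_i f i e * h i (d e e') by rewrite -Er // dP.
  rewrite -[RHS](h0 (d e e')) -big_split; apply: eq_bigr => i _ /=.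
  have -> : \sum_(x <- L i) (- 1 * (f i e + - f i e0) * x.1 e * x.2 e') =
      - 1 * (f i e + - f i e0) * h i (d e e').
    by rewrite (HL i).2 // mulr_sumr; apply: eq_bigr => x _; rewrite mulrA.
  by ring.
exists s, k, a, y; split=> // e He; rewrite -Ey //; congr (_ * _).
rewrite (sumE (fun x => x.1 e0 * x.2 e)) /= mul1r [X in _ + X]big1 ?addr0 // => i _.
by rewrite big1 // => x _; rewrite subrr mulr0 !mul0r.
Qed.

End ReducedFibre.

(** * Local triviality *)

Section TangentCoordinates.
Variables (K : closedFieldType) (P : Type).
Implicit Types (f g h : P -> K) (W S : set (P -> K)).

Lemma basis_modulo W (I : finType) (h : I -> P -> K) : fun_subspace W ->
  exists d (phi : 'I_d -> I),
    (forall c : 'I_d -> K, W (fun p => \sum_i c i * h (phi i) p) -> forall i, c i = 0) /\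
    forall j, exists c : 'I_d -> K, W (fun p => h j p - \sum_i c i * h (phi i) p).
Proof.
move=> [W0 WD WZ].
pose indep (A : {set I}) := forall c : I -> K,
  W (fun p => \sum_(j in A) c j * h j p) -> forall j, j \in A -> c j = 0.
pose D k := `[< exists2 A, indep A & #|A| = k >].
have D0 : exists k, D k.
  by exists 0%N; apply/asboolP; exists finset.set0; [move=> c _ j; rewrite inE|rewrite cards0].
have Db k : D k -> (k <= #|I|)%N.
  by move=> /asboolP[A _ <-]; apply: max_card.
have [k /asboolP[A iA cA] kmax] := ex_maxnP D0 Db.
have spn j : exists c : I -> K, W (fun p => h j p - \sum_(i in A) c i * h i p).
  have [jA|jA] := boolP (j \in A).
    exists (fun i => (i == j)%:R); rewrite (_ : (fun p => _) = 0) //; apply/funext => p.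
    rewrite (bigD1 j) //= eqxx mul1r big1 ?addr0 ?subrr // => i /andP[_ /negPf ->].
    by rewrite mul0r.
  apply: contrapT => nspn.
  have : (k < k)%N.
    rewrite -{2}cA; have := kmax #|j |: A|; rewrite cardsU1 jA cA /= add1n; apply.
    apply/asboolP; exists (j |: A)%SET; last by rewrite cardsU1 jA cA.
    move=> c Wc; have cj : c j = 0.
      apply: contrapT => cj; apply: nspn; exists (fun i => - (c i / c j)).
      have := WZ (c j)^-1 _ Wc; congr W; apply/funext => p; rewrite fun_mulE.
      rewrite (finset.big_setU1 _ jA) /= mulrDr mulKf; last exact/eqP.
      rewrite mulr_sumr -sumrN; congr (_ + _); apply: eq_bigr => i _.
      by rewrite mulNr opprK mulrA [c i / _]mulrC.
    have Wc' : W (fun p => \sum_(i in A) c i * h i p).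
      move: Wc; congr W; apply/funext => p.
      by rewrite (finset.big_setU1 _ jA) /= cj mul0r add0r.
    by move=> i; rewrite !inE => /orP[/eqP -> //|]; apply: iA.
  by rewrite ltnn.
exists #|A|, (fun i => enum_val i); split.
  move=> c Wc i; pose c' j := if j \in A =P true is ReflectT jA then c (enum_rank_in jA j) else 0.
  have c'E i' : c' (enum_val i') = c i'.
    by rewrite /c'; case: eqP => [jA|]; [rewrite enum_valK_in|case; apply: enum_valP].
  rewrite -c'E; apply: iA; last exact: enum_valP.
  move: Wc; congr W; apply/funext => p; rewrite [RHS]big_enum_val.
  by apply: eq_bigr => i' _; rewrite c'E.
move=> j; have [c Wc] := spn j; exists (fun i => c (enum_val i)).
by move: Wc; congr W; apply/funext => p; congr (_ - _); apply: big_enum_val.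
Qed.

Lemma mem_idpow2 (R : comPzRingType) (O n : set R) a b : O 1 -> n a -> n b -> idpow O n 2 (a * b).
Proof.
move=> O1 na nb; rewrite -[b]mulr1; apply: mem_idmul => //.
exact: mem_idmul.
Qed.

Variables (S : set (P -> K)) (q : P).
Let O := alg_gen S.
Let n := point_ideal O q.
Let sO : subring O := subring_alg_gen S.

Lemma point_ideal_ideal : ideal O n.
Proof.
have [O1 OB OM] := sO; split=> [f []//||f g [Of f0] [Og g0]|f g Of [Og g0]].
- by split=> //; apply: (AlgCst _ 0).
- by split; [apply: subringD|rewrite fun_addE f0 g0 addr0].
by split; [apply: OM|rewrite fun_mulE g0 mulr0].
Qed.

(** [del i b] is the coordinate at [x i] of the class of [b - b q] in the cotangent space. The
    product rule holds because [(f - f q) * (g - g q)] is in the square of the maximal ideal. *)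
Lemma dual_derivations d (x : 'I_d -> P -> K) : (forall i, n (x i)) ->
  (forall c : 'I_d -> K, idpow O n 2 (fun p => \sum_i c i * x i p) -> forall i, c i = 0) ->
  (forall b, n b -> exists c : 'I_d -> K, idpow O n 2 (fun p => b p - \sum_i c i * x i p)) ->
  exists del : 'I_d -> (P -> K) -> K, [/\ forall i c, del i (fun=> c) = 0,
    forall i f g, O f -> O g -> del i (f + g) = del i f + del i g,
    forall i f g, O f -> O g -> del i (f * g) = f q * del i g + g q * del i f
    & forall i k, del i (x k) = (i == k)%:R].
Proof.
move=> nx indep spn; have in2 := idpow_ideal 2 sO point_ideal_ideal.
have [_ n20 n2D n2M] := in2.
have [O1 OB OM] := sO.
pose rel b (c : 'I_d -> K) := idpow O n 2 (fun p => b p - b q - \sum_i c i * x i p).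
have ex b : O b -> exists c, rel b c.
  move=> Ob; have [|c Hc] := spn (fun p => b p - b q); last by exists c.
  by split; [apply: (OB _ (fun=> b q)) => //; apply: AlgCst|rewrite subrr].
have uniq b c c' : rel b c -> rel b c' -> c = c'.
  move=> Hc Hc'; apply/funext => i; apply/eqP; rewrite -subr_eq0; apply/eqP.
  apply: (indep (fun i => c i - c' i)); have := idealB sO in2 Hc' Hc.
  congr (idpow _ _ _); apply/funext => p; rewrite fun_addE -[(- _) p]/(- _).
  under [RHS]eq_bigr do rewrite mulrBl.
  by rewrite sumrB; ring.
pose del i b := if pselect (O b) is left Ob then projT1 (cid (ex b Ob)) i else 0.
have delE b c : O b -> rel b c -> forall i, del i b = c i.
  by move=> Ob Hc i; rewrite /del; case: pselect => // Ob'; case: cid => c' /= Hc'; rewrite (uniq b c' c).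
have delP b : O b -> rel b (fun i => del i b).
  by move=> Ob; have [c Hc] := ex b Ob; have -> : del^~ b = c by apply/funext => i; apply: delE.
exists del; split=> [i c|i f g Of Og|i f g Of Og|i k].
- apply: (@delE _ (fun=> 0)); first exact: AlgCst.
  rewrite /rel (_ : (fun p => _) = 0) //; apply/funext => p.
  by rewrite subrr big1 ?subr0 // => j _; rewrite mul0r.
- apply: (@delE _ (fun i => del i f + del i g)); first exact: subringD.
  have := n2D _ _ (delP f Of) (delP g Og); congr (idpow _ _ _); apply/funext => p.
  rewrite !fun_addE; under [in RHS]eq_bigr do rewrite mulrDl.
  by rewrite big_split /=; ring.
- apply: (@delE _ (fun i => f q * del i g + g q * del i f)); first exact: OM.
  pose C c : P -> K := fun=> c.
  have OC c : O (C c) by apply: AlgCst.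
  have nsub h : O h -> n (h - C (h q)).
    by move=> Oh; split; [apply: OB|rewrite fun_addE -[(- _) q]/(- _) subrr].
  have H1 := n2M (C (f q)) _ (OC _) (delP g Og).
  have H2 := n2M (C (g q)) _ (OC _) (delP f Of).
  have H3 := mem_idpow2 O1 (nsub f Of) (nsub g Og).
  have := n2D _ _ (n2D _ _ H1 H2) H3; congr (idpow _ _ _); apply/funext => p.
  rewrite !fun_addE !fun_mulE !fun_addE -[(- C (f q)) p]/(- f q) -[(- C (g q)) p]/(- g q) /C.
  have -> : \sum_i (f q * del i g + g q * del i f) * x i p =
      f q * (\sum_i del i g * x i p) + g q * (\sum_i del i f * x i p).
    by rewrite !mulr_sumr -big_split; apply: eq_bigr => j _ /=; ring.
  ring.
rewrite (@delE _ (fun i => (i == k)%:R)) //; first by case: (nx k).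
have [_ xk0] := nx k.
rewrite /rel (_ : (fun p => _) = 0) //; apply/funext => p.
rewrite xk0 subr0 (bigD1 k) //= eqxx mul1r big1 ?addr0 ?subrr // => i' /negPf ->.
by rewrite mul0r.
Qed.

Lemma alg_gen_det d (A : 'I_d -> 'I_d -> P -> K) : (forall i j, O (A i j)) ->
  O (fun p => \det (\matrix_(i, j) A i j p)).
Proof.
move=> OA; rewrite /determinant; apply: alg_gen_sum => s _; apply: AlgMul; first exact: AlgCst.
rewrite (_ : (fun p => _) = fun p => \prod_i A i (s i) p); first (apply: (alg_gen_prod _ (F := fun i => A i (s i))) => i _; exact: OA).

by apply/funext => p; apply: eq_bigr => i _; rewrite mxE.
Qed.

Lemma alg_gen_adj d (A : 'I_d -> 'I_d -> P -> K) i j : (forall i j, O (A i j)) ->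
  O (fun p => (\adj (\matrix_(i, j) A i j p)) i j).
Proof.
case: d A i j => [A []//|d A i j OA].
rewrite (_ : (fun p => _) = fun p => (-1) ^+ (j + i) *
   \det (\matrix_(a < d, b < d) A (lift j a) (lift i b) p)).
  by apply: AlgMul; [apply: AlgCst|apply: alg_gen_det].
apply/funext => p; rewrite mxE /cofactor; congr (_ * \det _).
by apply/matrixP => a b; rewrite !mxE.
Qed.

End TangentCoordinates.

(** * The equivariant section over the chart of a top-dimensional cone *)

Section Trivialization.
Variables (K : closedFieldType) (n : nat).
Hypothesis hK : [pchar K] =i pred0.
Local Notation N := 'rV[int]_n.
Local Notation M := 'cV[int]_n.
Local Notation T := (torus K n).
Variable Sigma : set (set N).
Hypothesis fanS : is_fan Sigma.
Variable X : toric_variety K Sigma.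
Variable sigma : Sigma.
Hypothesis htop : top_dimensional (val sigma).

Lemma top_pointed (u : M) : dual_cone (val sigma) u -> dual_cone (val sigma) (- u) -> u = 0.
Proof.
move=> du dNu; apply: pairing_extl => v; rewrite pairing0l.
have z c : val sigma c -> pairing u c = 0.
  by move=> sc; have := du c sc; have := dNu c sc; rewrite pairingNl; lia.
have [k k0 [a [b [sa sb E]]]] := htop v.
have : pairing u (v *+ k) = 0 by rewrite E pairingDr pairingNr !z // subr0.
rewrite pairingMn => /eqP; rewrite mulf_eq0 => /orP[|/eqP //].
by case: k k0 E.
Qed.

(** The dual cone of a top-dimensional cone contains no line, so sending all its nonzero elements to
    0 is compatible with sums. *)
Lemma fixed_point : exists x : X, tU sigma x /\
  forall u, dual_cone (val sigma) u -> xchar sigma u x = (u == 0)%:R.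
Proof.
have ax : @sg_axiom K n (val sigma) (fun u => (u == 0)%:R).
  split=> [|u v du dv|u nd]; first by rewrite eqxx.
    have [->|u0] := eqVneq u 0; first by rewrite add0r mul1r.
    rewrite mul0r; case: eqP => // /eqP; rewrite addr_eq0 => /eqP uv.
    by case/eqP: u0; apply: top_pointed => //; rewrite uv opprK.
  by case: eqP nd => // -> []; apply: dual_cone_0.
pose p : affine_toric K (val sigma) := exist _ _ ax.
exists (toric_chart X p); split; first by exists p.
by move=> u du; rewrite /xchar tchartK.
Qed.

Variable G : alg_group K.
Variable E : principal_bundle X G.
Implicit Types (t : T) (u w : M) (e : E) (g : G).
Local Notation xorb := (xorb fanS X).
Local Notation KG := (@coordinate_ring K G).
Let rX := ringed_toric X.
Let rE := ringed_total E.
Let rT := ringed_torus K n.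
Let rG := ringed_group G.
Let sE := ringed_sheaf rE.
Local Notation Z := (over (E := E) sigma).

Variable e0 : E.
Hypothesis He0 : Z e0.
Hypothesis e0fix : forall u, dual_cone (val sigma) u -> xchar sigma u (proj e0) = (u == 0)%:R.
Variable d : E -> E -> G.
Hypothesis dP : forall e e', proj e = proj e' -> ract e (d e e') = e'.
Hypothesis md : @morph_on _ (product E E) [set p | proj p.1 = proj p.2] G (fun p => d p.1 p.2).
Variables (l : nat) (z : 'I_l -> E -> K).
Hypothesis cz : coords Z z.

Lemma fixed_point_act t : toric_act t (proj e0) = proj e0.
Proof.
apply: (xchar_point (sigma := sigma)) => // [|u du]; first exact: tU_act.
rewrite xchar_act // e0fix //; case: eqP => [->|_]; last by rewrite mulr0.
by rewrite char0E mul1r.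
Qed.

Definition fibre_char t : G := d e0 (tact t e0).
Local Notation chi := fibre_char.

Lemma fibre_charP t : ract e0 (chi t) = tact t e0.
Proof. by apply: dP; rewrite proj_tact fixed_point_act. Qed.

Lemma fibre_charM s t : chi (torus_mul s t) = gmul (chi s) (chi t).
Proof.
apply: (@ract_inj _ _ _ _ _ E e0).
by rewrite fibre_charP ractM fibre_charP tactM -[tact t e0]fibre_charP tact_ract.
Qed.

Lemma fibre_char1 : chi torus_one = gone.
Proof. by apply: (@ract_inj _ _ _ _ _ E e0); rewrite fibre_charP tact1 ract1. Qed.

Lemma morph_fibre_char : @morph_on _ T setT G chi.
Proof.
have rTE := ringed_product (ringed_sheaf rT) sE.
have mt : @morph_on _ T setT E (fun t => tact t e0).
  have mp : @morph_on _ T setT (product T E) (fun t => (t, e0)).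
    apply: morph_on_pair => //; [exact: (ringed_sheaf rT)|exact: morph_on_id|exact: morph_cst].
  apply: (@morph_on_comp _ T setT (product T E) setT E _ (fun p => tact p.1 p.2) (ringed_sheaf rT) mp) => //.
  exact: (morph_onTW _ (ringed_sheaf rTE) (tact_morph E)).
have mp : @morph_on _ T setT (product E E) (fun t => (e0, tact t e0)).
  by apply: morph_on_pair => //; apply: morph_cst.
apply: (@morph_on_comp _ T setT (product E E) [set p | proj p.1 = proj p.2] G _
  (fun p => d p.1 p.2) (ringed_sheaf rT) mp) => // t _ /=.
by rewrite proj_tact fixed_point_act.
Qed.

Definition twisted_act t e : E := ract (tact t e) (ginv (chi t)).
Local Notation th := twisted_act.

Lemma twisted_fix t : th t e0 = e0.
Proof. by rewrite /th -fibre_charP -ractM gmulgV ract1. Qed.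

Lemma twisted_actM s t e : th (torus_mul s t) e = th s (th t e).
Proof. by rewrite /th fibre_charM ginvM tactM tact_ract -ractM. Qed.

Lemma twisted_act1 e : th torus_one e = e.
Proof. by rewrite /th fibre_char1 ginv1 ract1 tact1. Qed.

Lemma proj_twisted t e : proj (th t e) = toric_act t (proj e).
Proof. by rewrite /th proj_ract proj_tact. Qed.

Lemma over_twisted t e : Z e -> Z (th t e).
Proof. by move=> He; apply: over_ract; apply: over_tact. Qed.

Lemma morph_twisted : @morph_on _ (product T E) (setT `*` Z) E (fun p => th p.1 p.2).
Proof.
have sT := ringed_sheaf rT; have sG := ringed_sheaf rG.
have rTE := ringed_product sT sE; have sTE := ringed_sheaf rTE.
have rEG := ringed_product sE sG.
have m1 : @morph_on _ (product T E) (setT `*` Z) G (fun p => ginv (chi p.1)).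
  apply: morph_ginv => //.
  apply: (@morph_on_comp _ (product T E) _ T setT G fst chi) => //; first exact: morph_on_fst.
  exact: morph_fibre_char.
have m2 : @morph_on _ (product T E) (setT `*` Z) E (fun p => tact p.1 p.2).
  exact: (morph_onTW _ sTE (tact_morph E)).
have mp := morph_on_pair rTE sE sG m2 m1.
apply: (@morph_on_comp _ (product T E) _ (product E G) setT E _ (fun p => ract p.1 p.2) sTE mp) => //.
exact: (morph_onTW _ (ringed_sheaf rEG) (ract_morph E)).
Qed.

(** The abstract retraction concerns functions on a type; the points over the chart form the type
    [P], and [O] consists of the restrictions to it of the functions regular over the chart. *)
Let P : Type := set_type Z.
Implicit Type p : P.
Let overP p : Z (val p) := set_mem (valP p).
Let mkP e (He : Z e) : P := SigSub (mem_set He).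
Let pe0 : P := mkP He0.
Let fib g : P := mkP (over_ract g He0).
Let thP t p : P := mkP (over_twisted t (overP p)).
Let ractP p g : P := mkP (over_ract g (overP p)).
Let O := alg_gen (range (fun i => z i \o (val : P -> E))).
Let n1 := point_ideal KG gone.
Let m := point_ideal O pe0.
Let alpha u p := xchar sigma u (proj (val p)).
Let S := dual_cone (val sigma).
Let sO : subring O := subring_alg_gen _.
Let sKG : subring KG := subring_coordinate_ring G.

Let OI F : reg_on Z F -> O (F \o val).
Proof.
move=> rF; have [g Ag Eg] := coords_reg_alg cz rF.
have -> : F \o val = g \o (val : P -> E) by apply/funext => p; apply: Eg; apply: overP.
exact: alg_gen_postcomp.
Qed.

Let OE f : O f -> exists2 F, reg_on Z F & f = F \o val.
Proof. by move=> /alg_gen_precomp[F AF ->]; exists F => //; apply: coords_alg_reg cz AF. Qed.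

Let alphaO u : S u -> O (alpha u).
Proof. by move=> Su; apply: (OI (reg_proj (E := E) (reg_xchar Su))). Qed.

Let theta_rat r : O r -> exists k (u : 'I_k -> M) (f : 'I_k -> P -> K),
  (forall i, O (f i)) /\ forall t p, r (thP t p) = \sum_i character (u i) t * f i p.
Proof.
move=> /OE[F rF ->].
have [k [u [f [rf Ef]]]] := reg_over_rational fanS morph_twisted over_twisted rF.
by exists k, u, (fun i => f i \o val); split=> [i|t p]; [apply: OI|apply: Ef; apply: overP].
Qed.

Let theta_e0 t : thP t pe0 = pe0.
Proof. by apply: val_inj; apply: twisted_fix. Qed.

Let theta_one p : thP torus_one p = p.
Proof. by apply: val_inj; apply: twisted_act1. Qed.

Let theta_mul s t p : thP (torus_mul s t) p = thP s (thP t p).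
Proof. by apply: val_inj; apply: twisted_actM. Qed.

Let alphaD u w : S u -> S w -> alpha (u + w) = alpha u * alpha w.
Proof. by move=> Su Sw; apply/funext => p; rewrite fun_mulE; apply: xcharD. Qed.

Let alpha_theta u t p : S u -> alpha u (thP t p) = character u t * alpha u p.
Proof. by move=> Su; rewrite /alpha /= proj_twisted xchar_act //; apply: overP. Qed.

Let alpha_regular u s : S u -> O s -> s * alpha u = 0 -> s pe0 = 0.
Proof.
move=> Su /OE[F rF ->] E0; apply: (zero_over_orbit hK (fanS := fanS) rF He0) => e t Et.
have He : Z e by rewrite /over /= Et; apply: xorb_tU.
have := congr1 (fun f => f (mkP He)) E0; rewrite /= fun_mulE /alpha /= Et xchar_xorb // => /eqP.
by rewrite mulf_eq0 (negPf (char_neq0 _ _)) orbF => /eqP.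
Qed.

(* Restriction to the fibre of the fixed point, identified with G. *)
Let res (f : P -> K) g := f (fib g).

Let res1 f : res f gone = f pe0.
Proof. by congr f; apply: val_inj; rewrite /= ract1. Qed.

Let res_KG f : O f -> KG (res f).
Proof.
move=> /OE[F rF ->]; have [k [a [h [ra Kh Eh]]]] := reg_over_ract fanS rF.
rewrite (_ : res _ = fun g => \sum_i a i e0 * h i g); last by apply/funext => g; apply: Eh.
rewrite -coordinate_ring_alg; apply: alg_gen_sum => i _; apply: AlgMul; first exact: AlgCst.
exact: AlgGen.
Qed.

Let res_surj b : KG b -> exists2 f, O f & res f = b.
Proof.
move=> Kb; have [k [a [h [ra rh Eh]]]] := reg_division fanS sigma Kb md.
exists ((fun e => \sum_i a i e0 * h i e) \o val).
  apply: OI; apply: (reg_on_alg rE (S := [set h | reg_on Z h])) => //.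
  by apply: alg_gen_sum => i _; apply: AlgMul; [apply: AlgCst|apply: AlgGen; apply: rh].
apply/funext => g; rewrite /res /= -Eh //; last by rewrite proj_ract.
by congr b; apply: (@ract_inj _ _ _ _ _ E e0); rewrite dP // proj_ract.
Qed.

(** The functions in [m] that vanish to second order along the fibre: [m] modulo [W] is the
    cotangent space of the fibre at [e0]. *)
Let W : set (P -> K) := [set r | [/\ O r, r pe0 = 0 & idpow KG n1 2 (res r)]].

Let ideal_n1 : ideal KG n1.
Proof. by have := point_ideal_ideal KG (gone : G); rewrite coordinate_ring_alg. Qed.

Let in2 := idpow_ideal 2 sKG ideal_n1.

Let W_subspace : fun_subspace W.
Proof.
have [_ n20 n2D n2M] := in2; split.
- by split=> //; apply: (AlgCst _ 0).
- move=> f h [Of f0 nf] [Oh h0 nh]; split; first exact: subringD.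
    by rewrite fun_addE f0 h0 addr0.
  exact: n2D nf nh.
move=> c f [Of f0 nf]; split; first exact: (AlgMul (AlgCst _ c) Of).
  by rewrite fun_mulE f0 mulr0.
by apply: (n2M (fun=> c)) nf; apply: coordinate_ring_cst.
Qed.

Let W_mul f h : O f -> O h -> f pe0 = 0 -> h pe0 = 0 -> W (f * h).
Proof.
move=> Of Oh f0 h0; split; first exact: (AlgMul Of Oh).
  by rewrite fun_mulE f0 mul0r.
have K1 : KG 1 by case: sKG.
rewrite (_ : res _ = res f * res h) //.
by apply: (mem_idpow2 K1); (split; [apply: res_KG|rewrite res1]).
Qed.

Let W_lin (I : finType) (c : I -> K) (f : I -> P -> K) : (forall i, W (f i)) ->
  W (fun p => \sum_i c i * f i p).
Proof.
have [W0 WD WZ] := W_subspace; move=> Wf.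
rewrite (_ : (fun p => _) = \sum_i (fun=> c i) * f i); last by apply/funext => p; rewrite fct_sumE.
by elim/big_ind: _ => // i _; apply: WZ.
Qed.

Let homogeneous_generators : exists (I : finType) (h : I -> P -> K) (w : I -> M),
  (forall i, [/\ O (h i), h i pe0 = 0 & forall t p, h i (thP t p) = character (w i) t * h i p]) /\
  forall r, O r -> exists c : I -> K, W (fun p => r p - r pe0 - \sum_i c i * h i p).
Proof.
have [W0 WD WZ] := W_subspace.
have wd i := weight_decomposition hK theta_rat theta_one theta_mul (alg_gen_range (fun i => z i \o (val : P -> E)) i).
pose k i := projT1 (cid (wd i)).
pose u i : 'I_(k i) -> M := projT1 (cid (projT2 (cid (wd i)))).
pose f i : 'I_(k i) -> P -> K := projT1 (cid (projT2 (cid (projT2 (cid (wd i)))))).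
have H i : [/\ forall j, O (f i j), forall j t p, f i j (thP t p) = character (u i j) t * f i j p
    & forall p, z i (val p) = \sum_j f i j p] := projT2 (cid (projT2 (cid (projT2 (cid (wd i)))))).
(* The weight components of the coordinates. Subtracting their values at the fixed point keeps them
   weight vectors, because a component that is nonzero there has trivial character. *)
pose h (ij : {i : 'I_l & 'I_(k i)}) p := f (tag ij) (tagged ij) p - f (tag ij) (tagged ij) pe0.
exists {i : 'I_l & 'I_(k i)}, h, (fun ij => u (tag ij) (tagged ij)); split.
  move=> [i j]; rewrite /h /=; have [Of fw _] := H i; split=> [||t p].
  - have [_ OB _] := sO; apply: (OB _ (fun=> f i j pe0)) => //; exact: AlgCst.
  - by rewrite subrr.
  rewrite fw mulrBr; congr (_ - _); have := fw j t pe0; rewrite theta_e0 => fe.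
  by rewrite -fe.
move=> r; elim=> [_ [i _ <-]|c|f1 f2 Of1 [c1 H1] Of2 [c2 H2]|f1 f2 Of1 [c1 H1] Of2 [c2 H2]].
- exists (fun ij => (tag ij == i)%:R); rewrite (_ : (fun p => _) = 0) //; apply/funext => p /=.
  have [_ _ Ez] := H i; rewrite Ez -[e0]/(val pe0) Ez -sumrB.
  rewrite -(sig_big_dep xpredT (fun _ _ => true) (fun i' j => (i' == i)%:R * (f i' j p - f i' j pe0))) /=.
  rewrite [X in _ - X](bigD1 i) //= [X in _ - (_ + X)]big1 ?addr0; last first.
    by move=> i' /negPf ii'; rewrite big1 // => j _; rewrite ii' mul0r.
  by rewrite eqxx; under [X in _ - X]eq_bigr do rewrite mul1r; rewrite subrr.
- exists (fun=> 0); rewrite (_ : (fun p => _) = 0) //; apply/funext => p.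
  by rewrite subrr big1 ?subr0 // => ij _; rewrite mul0r.
- exists (fun ij => c1 ij + c2 ij); have := WD _ _ H1 H2; congr W; apply/funext => p.
  rewrite fun_addE; under [in RHS]eq_bigr do rewrite mulrDl.
  rewrite big_split /=.
  by move: (f1 p) (f1 pe0) (f2 p) (f2 pe0) (\sum_ij _) (\sum_ij _); clear=> *; ring.
exists (fun ij => f1 pe0 * c2 ij + f2 pe0 * c1 ij).
pose C c : P -> K := fun=> c.
have nsub h' : O h' -> O (h' - C (h' pe0)) /\ (h' - C (h' pe0)) pe0 = 0.
  move=> Oh; have [_ OB _] := sO; split; first by apply: OB => //; apply: AlgCst.
  by rewrite fun_addE -[(- _) _]/(- _) subrr.
have [O1 z1] := nsub f1 Of1; have [O2 z2] := nsub f2 Of2.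
have := WD _ _ (WD _ _ (WZ (f1 pe0) _ H2) (WZ (f2 pe0) _ H1)) (W_mul O1 O2 z1 z2).
congr W; apply/funext => p.
rewrite !fun_addE !fun_mulE !fun_addE -[(- C (f1 pe0)) p]/(- f1 pe0) -[(- C (f2 pe0)) p]/(- f2 pe0).
have -> : \sum_ij (f1 pe0 * c2 ij + f2 pe0 * c1 ij) * h ij p =
    f1 pe0 * (\sum_ij c2 ij * h ij p) + f2 pe0 * (\sum_ij c1 ij * h ij p).
  by rewrite !mulr_sumr -big_split; apply: eq_bigr => j _ /=; rewrite mulrDl !mulrA.
by move: (f1 p) (f1 pe0) (f2 p) (f2 pe0) (\sum_ij _) (\sum_ij _); clear=> *; ring.
Qed.

Let tangent_basis : exists dd (x : 'I_dd -> P -> K) (w : 'I_dd -> M),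
  [/\ forall i, [/\ O (x i), x i pe0 = 0 & forall t p, x i (thP t p) = character (w i) t * x i p],
      forall c : 'I_dd -> K, W (fun p => \sum_i c i * x i p) -> forall i, c i = 0
    & forall r, O r -> exists c : 'I_dd -> K, W (fun p => r p - r pe0 - \sum_i c i * x i p)].
Proof.
have [W0 WD WZ] := W_subspace.
have [I [h [w [hP span]]]] := homogeneous_generators.
have [dd [phi [indep spanx]]] := basis_modulo h W_subspace.
exists dd, (h \o phi), (w \o phi); split=> [i|//|r Or]; first exact: hP.
have [c Wc] := span r Or; have /choice[C WC] := spanx.
exists (fun i => \sum_j c j * C j i); have := WD _ _ Wc (W_lin c WC); congr W; apply/funext => p.
rewrite fun_addE /=; under [X in _ + X]eq_bigr do rewrite mulrBr mulr_sumr.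
rewrite sumrB addrA subrK exchange_big /=; congr (_ - _); apply: eq_bigr => i _.
by rewrite mulr_suml; apply: eq_bigr => j _; rewrite mulrA.
Qed.

Let ideal_m : ideal O m.
Proof. exact: point_ideal_ideal. Qed.
Let im2 := idpow_ideal 2 sO ideal_m.

Let lift_n2 b : idpow KG n1 2 b -> exists2 y, idpow O m 2 y & res y = b.
Proof.
have [m2O m20 m2D m2M] := im2; have [O1 OB OM] := sO.
pose Q : set (G -> K) := [set b | KG b /\ exists2 y, idpow O m 2 y & res y = b].
have iQ : ideal KG Q.
  split=> [f []//||f h [Kf [y Yf fE]] [Kh [y' Yh hE]]|f h Kf [Kh [y Yh hE]]].
  - by split; [apply: (@coordinate_ring_cst _ G 0)|exists 0].
  - by split; [exact: (coordinate_ringD Kf Kh)|exists (y + y'); [exact: (m2D _ _ Yf Yh)|rewrite -fE -hE]].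
  have [r Or rE'] := res_surj Kf; split; first exact: (coordinate_ringM Kf Kh).
  by exists (r * y); [exact: (m2M _ _ Or Yh)|rewrite -rE' -hE].
suff sub : idpow KG n1 2 `<=` Q by move=> /sub[].
apply: idmul_sub iQ _ => a a' na na'.
have {na'} [Ka' a'1] : n1 a'.
  have [_ _ _ nM] := ideal_n1.
  by apply: (idmul_sub ideal_n1 _ na') => f h nf Kh; rewrite mulrC; apply: nM.
have [Ka a1] := na.
have [f Of fE] := res_surj Ka; have [h Oh hE] := res_surj Ka'.
split; first exact: coordinate_ringM.
exists (f * h); last by rewrite -fE -hE.
by apply: mem_idpow2 => //; (split=> //; rewrite -res1 ?fE ?hE).
Qed.

(** Modulo [m^2] the function [v] may be taken to be an [F] that vanishes on the fibre. By
    reducedness [s F] is a sum of products [a j * Y j] with [a j] from the base and zero at the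
    fixed point; modulo [m^2] this gives [F] as the sum of the [Y j e0 / s e0 * a j]. *)
Let tangent_W (v : P -> K) : W v -> exists a, [/\ char_span S alpha a, a pe0 = 0 & idpow O m 2 (v - a)].
Proof.
move=> [Ow v0 /lift_n2[y Yy Ey]]; have [m2O m20 m2D m2M] := im2; have [O1 OB OM] := sO.
have Oy := m2O _ Yy.
have [F rF EF] := OE (OB _ _ Ow Oy).
have F0 e : proj e = proj e0 -> F e = 0.
  move=> Ee; rewrite -(dP (esym Ee)).
  have := congr1 (fun f => f (fib (d e0 e))) EF => /= <-.
  have := congr1 (fun f => f (d e0 e)) Ey; rewrite /res fun_addE -[(- y) _]/(- y _) => ->.
  by rewrite subrr.
have [s [k [a [Y [[rs s0] ra rY Es]]]]] := reduced_fibre hK fanS He0 rF F0.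
pose f q := \sum_j (Y j e0 / s e0) * a j q.
have rf : reg_on (tU sigma) f.
  apply: (reg_on_alg rX (S := [set h | reg_on (tU sigma) h])) => //.
  by apply: alg_gen_sum => j _; apply: AlgMul; [apply: AlgCst|apply: AlgGen; case: (ra j)].
have [r [c [u [du Ef]]]] := reg_tU fanS rf.
exists (fun p => f (proj (val p))); split.
- by exists r, c, u; split=> // p; rewrite Ef //; apply: overP.
- by rewrite /f big1 // => j _; have [_ /= ->] := ra j; rewrite mulr0.
pose C c : P -> K := fun=> c.
have nsub h : O h -> m (h - C (h pe0)).
  move=> Oh; split; first by apply: OB => //; apply: AlgCst.
  by rewrite fun_addE -[(- _) _]/(- _) subrr.
have Os : O (s \o val) by apply: OI.
have H1 : idpow O m 2 ((s \o val - C (s e0)) * (v - y)).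
  apply: mem_idpow2 => //; first exact: (nsub _ Os).
  by split; [apply: OB|rewrite EF /=; apply: F0].
have H2 j : idpow O m 2 ((a j \o @proj _ _ _ _ _ E \o val) * ((Y j \o val) - C (Y j e0))).
  have [raj a0] := ra j; apply: mem_idpow2 => //; last exact: (nsub _ (OI (rY j))).
  by split=> //; apply: OI; apply: reg_proj.
have H3 : idpow O m 2 (\sum_j (a j \o @proj _ _ _ _ _ E \o val) * ((Y j \o val) - C (Y j e0))).
  by elim/big_ind: _ => // j _; apply: H2.
have OC c' : O (C c') by apply: AlgCst.
have := m2D _ _ (m2M (C (s e0)^-1) _ (OC _) (m2D _ _ (m2M (C (-1)) _ (OC _) H1) H3)) Yy.
congr (idpow _ _ _); apply/funext => p.
rewrite !(fun_addE, fun_mulE) fct_sumE.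
under eq_bigr do rewrite fun_mulE fun_addE.
rewrite -[(- C (s e0)) p]/(- s e0) -![(- y) p]/(- y p) -[(- (fun p => _)) p]/(- f (proj (val p))) /C /=.
have Ewy : v p - y p = F (val p) by rewrite -[v p - y p]/((v - y) p) EF.
have Esp := Es _ (overP p).
have -> : v p = y p + F (val p) by rewrite -Ewy addrC subrK.
have -> : \sum_i a i (proj (val p)) * (Y i (val p) + (- C (Y i e0)) p) =
     s (val p) * F (val p) - s e0 * f (proj (val p)).
  rewrite Esp /f mulr_sumr -sumrB; apply: eq_bigr => i _.
  by rewrite -[(- C (Y i e0)) p]/(- Y i e0); field.
by rewrite /C; field.
Qed.

Let fibre_KG r p : O r -> KG (fun g => r (ractP p g)).
Proof.
move=> /OE[F rF ->]; have [k [a [h [ra Kh Eh]]]] := reg_over_ract fanS rF.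
rewrite (_ : (fun g => _) = fun g => \sum_i a i (val p) * h i g); last first.
  by apply/funext => g; apply: Eh; apply: overP.
rewrite -coordinate_ring_alg; apply: alg_gen_sum => i _; apply: AlgMul; first exact: AlgCst.
exact: AlgGen.
Qed.

Let ractP1 p : ractP p gone = p.
Proof. by apply: val_inj; rewrite /= ract1. Qed.

(** The derivations [D i] along the right action of the group are vertical, and the matrix [Mx] of
    the [D k (x i)] is the identity at [e0]. With its adjugate one forms [Eul], the sum of the
    [x j * adj j k * D k]. It multiplies every [x i] by the determinant [Delta], without inverting
    the latter. *)
Let retraction : exists s : (P -> K) -> P -> K,
  [/\ forall r, O r -> char_span S alpha (s r), forall a, char_span S alpha a -> s a = a,
      forall r r', O r -> O r' -> s (r + r') = s r + s r',
      forall r r', O r -> O r' -> s (r * r') = s r * s r'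
    & forall r t, O r -> s (r \o thP t) = s r \o thP t].
Proof.
have [dd [x [w [xP indep span]]]] := tangent_basis.
have Ox i : O (x i) by case: (xP i).
have xe0 i : x i pe0 = 0 by case: (xP i).
have := @dual_derivations K G KG gone dd (fun i => res (x i)); rewrite coordinate_ring_alg => dualP.
have [i|c H|b [Kb b1]|del [delC delD delM delx]] := dualP.
- by split; [apply: res_KG|rewrite res1].
- apply: indep; split=> //; first by apply: alg_gen_sum => i _; apply: AlgMul; [exact: AlgCst|exact: Ox].
  by rewrite big1 // => i _; rewrite xe0 mulr0.
- have [r Or rb] := res_surj Kb; have [c [_ _ Hc]] := span r Or; exists c.
  move: Hc; congr (idpow _ _ _); apply/funext => g; rewrite -rb /res.
  by rewrite -(res1 r) rb b1 subr0.
have delZ i c f : KG f -> del i ((fun=> c) * f) = c * del i f.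
  by move=> Kf; rewrite delM //; [rewrite delC mulr0 addr0|apply: coordinate_ring_cst].
have del_sum i k (c : 'I_k -> K) (h : 'I_k -> G -> K) : (forall j, KG (h j)) ->
    del i (fun g => \sum_j c j * h j g) = \sum_j c j * del i (h j).
  move=> Kh; rewrite (_ : (fun g => _) = \sum_j (fun=> c j) * h j); last first.
    by apply/funext => g; rewrite fct_sumE.
  suff : KG (\sum_j (fun=> c j) * h j) /\ del i (\sum_j (fun=> c j) * h j) = \sum_j c j * del i (h j) by case.
  elim: (index_enum _) => [|j L [IH1 IH2]].
    by rewrite !big_nil; split; [apply: (@coordinate_ring_cst _ G 0)|apply: delC].
  have Kj : KG ((fun=> c j) * h j) by apply: coordinate_ringM => //; apply: coordinate_ring_cst.
  rewrite !big_cons; split; first exact: coordinate_ringD.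
  by rewrite delD // IH2 delZ.
pose D i r p := del i (fun g => r (ractP p g)).
have DO i r : O r -> O (D i r).
  move=> /OE[F rF ->]; have [k [a [h [ra Kh Eh]]]] := reg_over_ract fanS rF.
  rewrite (_ : D i _ = (fun e => \sum_j del i (h j) * a j e) \o val).
    apply: OI; apply: (reg_on_alg rE (S := [set h | reg_on Z h])) => //.
    by apply: alg_gen_sum => j _; apply: AlgMul; [apply: AlgCst|apply: AlgGen; apply: ra].
  apply/funext => p; rewrite /D /= (_ : (fun g => _) = fun g => \sum_j a j (val p) * h j g).
    by rewrite del_sum //; apply: eq_bigr => j _; rewrite mulrC.
  by apply/funext => g; apply: Eh; apply: overP.
have DD i r r' : O r -> O r' -> D i (r + r') = D i r + D i r'.
  move=> Or Or'; apply/funext => p; rewrite fun_addE /D -delD; [|exact: fibre_KG..].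
  by congr (del i _).
have DM i r r' : O r -> O r' -> D i (r * r') = r * D i r' + r' * D i r.
  move=> Or Or'; apply/funext => p; rewrite fun_addE !fun_mulE /D.
  rewrite (_ : (fun g => _) = (fun g => r (ractP p g)) * (fun g => r' (ractP p g))) //.
  by rewrite delM ?ractP1 //; apply: fibre_KG.
have Dalpha i u : D i (alpha u) = 0.
  apply/funext => p; rewrite /D (_ : (fun g => _) = fun=> alpha u p) ?delC //.
  by apply/funext => g; rewrite /alpha /= proj_ract.
have Dx i k : D i (x k) pe0 = (i == k)%:R.
  rewrite -delx; congr (del i _); apply/funext => g; congr (x k _); exact: val_inj.
pose Mx p := \matrix_(k, i) D k (x i) p.
pose Delta p := \det (Mx p).
have ODelta : O Delta by apply: alg_gen_det => i j; apply: DO.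
have Oadj j k : O (fun p => (\adj (Mx p)) j k).
  by apply: (alg_gen_adj (A := fun k i => D k (x i))) => i i'; apply: DO.
pose Eul r p := \sum_j x j p * \sum_k (\adj (Mx p)) j k * D k r p.
have Xi : ideal O (idl O (range x)) by apply: (idl_ideal sO) => _ [i _ <-].
have [_ X0 XD XM] := Xi.
apply: (@equivariant_retraction K n hK P l (fun i => z i \o val) pe0 thP theta_rat theta_e0 theta_one
  theta_mul S alpha _ _ _ _ _ _ dd x w _ _ _ Eul Delta) => //.
- exact: dual_cone_0.
- by move=> *; apply: dual_coneD.
- by apply/funext => p; apply: xchar0.
- by move=> i t p; have [_ _ ->] := xP i.
- move=> r Or; rewrite (_ : Eul r = \sum_j (fun p => \sum_k (\adj (Mx p)) j k * D k r p) * x j).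
    elim/big_ind: _ => // j _; apply: XM.
      by apply: alg_gen_sum => k _; apply: AlgMul; [exact: Oadj|apply: DO].
    by apply: subset_idl; exists j.
  by apply/funext => p; rewrite fct_sumE; apply: eq_bigr => j _; rewrite fun_mulE mulrC.
- move=> r r' Or Or'; apply/funext => p; rewrite fun_addE -big_split; apply: eq_bigr => j _ /=.
  by rewrite -mulrDr -big_split; congr (_ * _); apply: eq_bigr => k _; rewrite DD // fun_addE mulrDr.
- move=> r r' Or Or'; apply/funext => p; rewrite fun_addE !fun_mulE !mulr_sumr -big_split.
  apply: eq_bigr => j _ /=; rewrite !mulr_sumr -big_split; apply: eq_bigr => k _ /=.
  rewrite DM // fun_addE !fun_mulE.
  by move: (x j p) (\adj _ j k) (r p) (D k r' p) (r' p) (D k r p); clear=> *; ring.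
- move=> i; apply/funext => p; rewrite fun_mulE /Eul.
  have E1 j : \sum_k (\adj (Mx p)) j k * D k (x i) p = (\det (Mx p))%:M j i.
    by rewrite -mul_adj_mx [RHS]mxE; apply: eq_bigr => k _; congr (_ * _); rewrite mxE.
  under eq_bigr do rewrite E1 mxE.
  by rewrite (bigD1 i) //= eqxx mulr1n big1 ?addr0 1?mulrC // => j /negPf ->; rewrite mulr0n mulr0.
- move=> u Su; apply/funext => p; rewrite /Eul big1 // => j _.
  by rewrite big1 ?mulr0 // => k _; rewrite Dalpha mulr0.
- rewrite /Delta (_ : Mx pe0 = 1%:M) ?det1 ?oner_neq0 //.
  by apply/matrixP => i j; rewrite !mxE Dx.
move=> r Or r0; have [c Wc] := span r Or; have [a [Aa a0 Ha]] := tangent_W Wc.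
  exists a; split=> //; exists (\sum_i (fun=> c i) * x i).
    by elim/big_ind: _ => // i _; apply: XM; [apply: AlgCst|apply: subset_idl; exists i].
  exists (r - (fun=> r pe0) - \sum_i (fun=> c i) * x i - a).
    move: Ha; congr (idpow _ _ _); congr (_ - _); apply/funext => p.
    by rewrite !fun_addE -[(- (fun=> r pe0)) p]/(- r pe0) -[(- \sum_i _) p]/(- (\sum_i _) p) fct_sumE.
  rewrite r0 (_ : (fun=> 0) = 0 :> (P -> K)) // subr0.
  by rewrite [RHS]addrC addrAC subrK.
Qed.

(** Applying the retraction and evaluating at a point over [x] is a character of the functions over
    the chart. It only depends on [x], since the retraction has values in functions from the base,
    and so it is a point [q x]; equivariance of the retraction gives that of [q]. *)
Lemma equivariant_local_section : exists q : X -> E, [/\ morph_on (tU sigma) q,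
    forall x, tU sigma x -> proj (q x) = x
  & forall t x, tU sigma x -> q (toric_act t x) = twisted_act t (q x)].
Proof.
have [s [sA sid sD sM stheta]] := retraction.
have Aproj a (p p' : P) : char_span S alpha a -> proj (val p) = proj (val p') -> a p = a p'.
  by move=> [k [c [u [_ Ea]]]] pp; rewrite !Ea /alpha pp.
have pt (x : X) : tU sigma x -> {p : P | proj (val p) = x}.
  move=> Ux; apply: cid; have [e ex] := @proj_surj _ _ _ _ _ E x.
  by have He : Z e by [rewrite /over /= ex]; exists (mkP He).
have zO F : alg_gen (range z) F -> O (F \o val) by apply: alg_gen_postcomp.
have ch p : alg_char (alg_gen (range z)) (fun F => s (F \o val) p).
  split=> [c|F F' AF AF'|F F' AF AF'].
  - rewrite sid //; exists 1%N, (fun=> c), (fun=> 0); split=> [_|p']; first exact: dual_cone_0.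
    by rewrite big_ord1 /alpha xchar0 mulr1.
  - by rewrite -fun_addE -sD //; apply: zO.
  by rewrite -fun_mulE -sM //; apply: zO.
have ch0 p F : alg_gen (range z) F -> (forall e, Z e -> F e = 0) -> s (F \o val) p = 0.
  move=> AF F0; have -> : F \o (val : P -> E) = fun=> 0.
    by apply/funext => p'; apply: F0; apply: overP.
  by have [sC _ _] := ch p; apply: (sC 0).
pose q x : E := if pselect (tU sigma x) is left Ux
  then sval (coords_point_of_char cz (ch (sval (pt x Ux))) (ch0 _)) else e0.
have qP (x : X) (p : P) : tU sigma x -> proj (val p) = x ->
    Z (q x) /\ forall F, reg_on Z F -> F (q x) = s (F \o val) p.
  move=> Ux px; rewrite /q; case: pselect => // Ux'; case: coords_point_of_char => e /= [He Ee].
  split=> // F rF; have [g Ag Eg] := coords_reg_alg cz rF.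
  have -> : F \o val = g \o (val : P -> E) by apply/funext => p'; apply: Eg; apply: overP.
  rewrite Eg // -Ee //; apply: Aproj; first by apply: sA; apply: zO.
  by rewrite px; case: (pt x Ux').
exists q; split.
- apply: (morph_on_coords rX rE cz) => [x Ux|i].
    by have [p px] := pt x Ux; have [] := qP x p Ux px.
  have [k [c [u [Su Ea]]]] := sA _ (zO _ (alg_gen_range z i)).
  apply: (@reg_on_ext _ X _ (fun x => \sum_j c j * xchar sigma (u j) x)).
    move=> x Ux; have [p px] := pt x Ux; have [_ H] := qP x p Ux px.
    rewrite /= H ?Ea; last exact: (coords_reg cz).
    by apply: eq_bigr => j _; rewrite /alpha px.
  apply: (reg_on_alg rX (S := [set h | reg_on (tU sigma) h])) => //.
  by apply: alg_gen_sum => j _; apply: AlgMul; [apply: AlgCst|apply: AlgGen; apply: reg_xchar; apply: Su].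
- move=> x Ux; have [p px] := pt x Ux; have [Zq H] := qP x p Ux px.
  apply: (xchar_point (sigma := sigma)) => // u du.
  have := H _ (reg_proj (E := E) (reg_xchar du)) => /= ->.
  rewrite sid; first by rewrite /= px.
  exists 1%N, (fun=> 1), (fun=> u); split=> // p'.
  by rewrite big_ord1 mul1r.
move=> t x Ux; have [p px] := pt x Ux; have [Zq H] := qP x p Ux px.
have ptx : proj (val (thP t p)) = toric_act t x by rewrite /= proj_twisted px.
have [Ztq Ht] := qP _ _ (tU_act t Ux) ptx.
apply: (coords_sep cz Ztq (over_twisted t Zq)) => f Af.
rewrite Ht; last exact: coords_alg_reg cz Af.
have [k [u [h [Oh Eh]]]] := theta_rat (zO _ Af).
have Oft : O (fun p => (f \o val) (thP t p)).
  rewrite (_ : (fun p => _) = fun p => \sum_i character (u i) t * h i p); last exact/funext.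
  by apply: alg_gen_sum => i _; apply: AlgMul; [exact: AlgCst|exact: Oh].
have [F rF EF] := OE Oft.
have -> : f (twisted_act t (q x)) = F (q x).
  by have := congr1 (fun h => h (mkP Zq)) EF.
by rewrite H // -EF -[s _ _]/((s (f \o val) \o thP t) p) -stheta //; apply: zO.
Qed.

End Trivialization.

(** * Weights and filtrations *)

Section Frames.
Variables (K : closedFieldType) (n : nat).
Hypothesis hK : [pchar K] =i pred0.
Local Notation N := 'rV[int]_n.
Local Notation M := 'cV[int]_n.
Local Notation T := (torus K n).
Variable Sigma : set (set N).
Hypothesis fanS : is_fan Sigma.
Variable X : toric_variety K Sigma.
Variable G : alg_group K.
Implicit Types (E : principal_bundle X G) (sigma : Sigma) (t : T) (u w : M) (g : G) (b : G -> K).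
Local Notation xorb := (xorb fanS X).
Local Notation KG := (@coordinate_ring K G).
Let rX := ringed_toric X.
Let rT := ringed_torus K n.
Let rG := ringed_group G.

Definition torus_hom (chi : T -> G) :=
  @morph_on _ T setT G chi /\ forall s t, chi (torus_mul s t) = gmul (chi s) (chi t).

Lemma torus_hom1 chi : torus_hom chi -> chi torus_one = gone.
Proof.
move=> [_ hM]; apply: (@gmulgI _ _ (chi torus_one)).
by rewrite -hM torus_mul1 gmulg1.
Qed.

(* An equivariant trivialization over a chart, with s(1) = e1. *)
Definition frame E (e1 : E) sigma (chi : T -> G) (s : X -> E) :=
  [/\ torus_hom chi, morph_on (tU sigma) s, forall x, tU sigma x -> proj (s x) = x,
      forall t x, tU sigma x -> s (toric_act t x) = ract (tact t (s x)) (ginv (chi t))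
    & s (xorb torus_one) = e1].

Lemma frame_exists E (e1 : E) sigma : top_dimensional (val sigma) -> proj e1 = xorb torus_one ->
  exists chi s, frame e1 sigma chi s.
Proof.
move=> htop pe1; have rE := ringed_total E.
have [x0 [Ux0 x0E]] := fixed_point X htop; have [e0 Ee0] := @proj_surj _ _ _ _ _ E x0.
have He0 : over sigma e0 by rewrite /over /= Ee0.
have e0fix u : dual_cone (val sigma) u -> xchar sigma u (proj e0) = (u == 0)%:R.
  by move=> du; rewrite Ee0 x0E.
have [d [dP md]] := bundle_division E; have [l [z cz]] := coords_over fanS E sigma.
have [q [mq pq tq]] := equivariant_local_section hK fanS He0 e0fix dP md cz.
have chiM := fibre_charM He0 e0fix dP.
have mchi := morph_fibre_char He0 e0fix md.
set chi := fibre_char _ _ in chiM mchi.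
have U1 : tU sigma (xorb torus_one) by apply: xorb_tU.
(* Translating the section by [g] on the right makes it pass through the given [e1]; the
   homomorphism is conjugated accordingly. *)
pose g := d e1 (q (xorb torus_one)).
have eg : ract e1 g = q (xorb torus_one) by rewrite dP // pq.
exists (fun t => gmul (gmul g (chi t)) (ginv g)), (fun x => ract (q x) (ginv g)); split.
- split=> [|s t]; last by rewrite chiM !gmulA gmulgVK.
  by do !apply: (morph_gmul rT); [apply: morph_cst|exact: mchi|apply: morph_cst].
- have sE := ringed_sheaf rE; have sG := ringed_sheaf rG.
  have mp := morph_on_pair rX sE sG mq (morph_cst (X := G) (tU sigma) (ginv g) rX).
  apply: (@morph_on_comp _ X _ (product E G) setT E _ (fun p => ract p.1 p.2) (ringed_sheaf rX) mp) => //.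
  exact: (morph_onTW _ (ringed_sheaf (ringed_product sE sG)) (ract_morph E)).
- by move=> x Ux; rewrite proj_ract pq.
- move=> t x Ux; rewrite tq // /twisted_act tact_ract -!ractM; congr (ract _ _).
  by rewrite !ginvM ginvK !gmulA gmulVg gmul1g.
by rewrite -eg ractV.
Qed.

Section Weights.
Variables (chi : T -> G).
Hypothesis hchi : torus_hom chi.

Definition weight_space u b := KG b /\ forall t g, b (gmul (ginv (chi t)) g) = character u t * b g.

Lemma weight_space_mul u t g b : weight_space u b -> b (gmul (chi t) g) = (character u t)^-1 * b g.
Proof.
move=> [_ H]; have := H t (gmul (chi t) g); rewrite gmulKg => ->.
by rewrite mulKf // char_neq0.
Qed.

Lemma weight_components b r (u : 'I_r -> M) (h : 'I_r -> G -> K) : (forall i, KG (h i)) ->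
  (forall t g, b (gmul (ginv (chi t)) g) = \sum_i character (u i) t * h i g) ->
  forall w, weight_space w (fun g => \sum_(i | u i == w) h i g).
Proof.
move=> Kh Eb w; have [_ chiM] := hchi; split.
  by rewrite -coordinate_ring_alg; apply: alg_gen_sum => i _; apply: AlgGen.
move=> s; pose F i g := h i (gmul (ginv (chi s)) g) - character (u i) s * h i g.
have W0 : fun_subspace [set f : G -> K | f = 0].
  by split=> //= [f f' -> ->|c f ->]; rewrite ?addr0 ?mulr0.
have H t : (fun g => \sum_i character (u i) t * F i g) = 0.
  apply/funext => g; rewrite /F; under eq_bigr do rewrite mulrBr mulrA -char_mul.
  rewrite sumrB -!Eb torus_mulC chiM ginvM -gmulA; exact: subrr.
have := weights_in_subspace hK W0 H w => /= /(congr1 (fun f => f _)) Ew g.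
apply/eqP; rewrite -subr_eq0 mulr_sumr -sumrB; apply/eqP.
rewrite -[RHS]/((0 : G -> K) g) -Ew; apply: eq_bigr => i /eqP uw.
by rewrite /F uw.
Qed.

Lemma weight_regroup b r (u : 'I_r -> M) (f : 'I_r -> G -> K) : (forall i, KG (f i)) ->
  (forall t g, b (gmul (ginv (chi t)) g) = \sum_i character (u i) t * f i g) ->
  exists r' (u' : 'I_r' -> M) (h : 'I_r' -> G -> K), [/\ forall i, weight_space (u' i) (h i),
      forall i, exists j, u' i = u j, forall g, b g = \sum_i h i g
    & forall t g, b (gmul (ginv (chi t)) g) = \sum_i character (u' i) t * h i g].
Proof.
move=> Kf Ef; pose ws := undup (codom u).
have sumE t g : \sum_i character (u i) t * f i g =
    \sum_(i < size ws) character (nth 0 ws i) t * \sum_(j | u j == nth 0 ws i) f j g.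
  under eq_bigr do rewrite mulrC.
  rewrite (sum_by_weight u (f^~ g) (fun w => character w t)) (big_nth 0) big_mkord.
  by apply: eq_bigr => i _; rewrite mulrC.
exists (size ws), (fun i => nth 0 ws i), (fun i g => \sum_(j | u j == nth 0 ws i) f j g).
split=> [i|i|g|t g].
- exact: weight_components.
- have : nth 0 ws i \in codom u by rewrite -mem_undup mem_nth.
  by move=> /codomP[j ->]; exists j.
- have := Ef torus_one g; rewrite torus_hom1 // ginv1 gmul1g => ->; rewrite sumE.
  by apply: eq_bigr => i _; rewrite char_one mul1r.
by rewrite Ef sumE.
Qed.

Lemma weight_sum b : KG b -> exists r (u : 'I_r -> M) (h : 'I_r -> G -> K),
  [/\ forall i, weight_space (u i) (h i), forall g, b g = \sum_i h i g
    & forall t g, b (gmul (ginv (chi t)) g) = \sum_i character (u i) t * h i g].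
Proof.
move=> Kb; have [mchi chiM] := hchi.
have [m [y cG]] := group_coords G.
have sT := ringed_sheaf rT; have sG := ringed_sheaf rG; have rTG := ringed_product sT sG.
have rF : @reg_on _ (product T G) (setT `*` setT) (fun p => b (gmul (ginv (chi p.1)) p.2)).
  have mF : @morph_on _ (product T G) (setT `*` setT) G (fun p => gmul (ginv (chi p.1)) p.2).
    apply: morph_gmul => //; last exact: morph_on_snd.
    apply: morph_ginv => //.
    by apply: (@morph_on_comp _ (product T G) _ T setT G fst chi (ringed_sheaf rTG)) => //; apply: morph_on_fst.
  exact: morph_on_group_reg mF Kb.
have [k' [u [f [Af Ef]]]] := reg_on_torus_prod rG cG rF.
have [||r [u' [h [wh _ Eb Eh]]]] := @weight_regroup b k' u f.
- by move=> i; rewrite (coordinate_ringE cG).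
- by move=> t g; rewrite -Ef.
by exists r, u', h.
Qed.

Lemma weight_direct r (u : 'I_r -> M) (h : 'I_r -> G -> K) : (forall i, weight_space (u i) (h i)) ->
  (forall g, \sum_i h i g = 0) -> forall w g, \sum_(i | u i == w) h i g = 0.
Proof.
move=> wh h0 w g.
have W0 : fun_subspace [set f : G -> K | f = 0].
  by split=> //= [f f' -> ->|c f ->]; rewrite ?addr0 ?mulr0.
have H t : (fun g => \sum_i character (u i) t * h i g) = 0.
  apply/funext => g'; rewrite -[RHS](h0 (gmul (ginv (chi t)) g')).
  by apply: eq_bigr => i _; have [_ ->] := wh i.
by have := weights_in_subspace hK W0 H w => /= /(congr1 (fun f => f g)).
Qed.

End Weights.

End Frames.

(** * The filtration attached to a bundle *)

Section Filtration.
Variables (K : closedFieldType) (n : nat).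
Hypothesis hK : [pchar K] =i pred0.
Local Notation N := 'rV[int]_n.
Local Notation M := 'cV[int]_n.
Local Notation T := (torus K n).
Variable Sigma : set (set N).
Hypothesis fanS : is_fan Sigma.
Variable X : toric_variety K Sigma.
Variable G : alg_group K.
Variables (E : principal_bundle X G) (e1 : E).
Hypothesis pe1 : proj e1 = xorb fanS X torus_one.
Implicit Types (sigma : Sigma) (t : T) (u w : M) (g : G) (b : G -> K) (e : E) (rho : ray_generators Sigma).
Local Notation xorb := (xorb fanS X).
Local Notation KG := (@coordinate_ring K G).
Let rX := ringed_toric X.
Let rE := ringed_total E.
Let rG := ringed_group G.
Let sX := ringed_sheaf rX.
Let sE := ringed_sheaf rE.
Let sG := ringed_sheaf rG.

Lemma ray_cone_axiom rho : Sigma [set val rho *+ k | k in [set: nat]].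
Proof. by have := set_valP rho => -[]. Qed.

Definition ray_cone rho : Sigma := fcone (ray_cone_axiom rho).

(* With [<=] instead of [=], one need not know that [rho] is primitive. *)
Definition bundle_filt rho (i : int) b := KG b /\ exists w F,
  [/\ pairing w (val rho) <= - i, reg_on (over (ray_cone rho)) F
    & forall t g, F (ract (tact t e1) g) = character w t * b g].

Variables (sigma : Sigma) (chi : T -> G) (s : X -> E).
Hypothesis fr : frame fanS e1 sigma chi s.

Lemma frame_orbit t : tact t e1 = ract (s (xorb t)) (chi t).
Proof.
have [_ _ _ st s1] := fr; rewrite xorb_one_act st ?s1; last exact: xorb_tU.
by rewrite ractVV.
Qed.

Lemma frame_coord : exists k : E -> G, [/\ morph_on (over sigma) k,
    forall e, over sigma e -> ract (s (proj e)) (k e) = e,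
    forall x g, tU sigma x -> k (ract (s x) g) = g,
    forall e g, over sigma e -> k (ract e g) = gmul (k e) g
  & forall t e, over sigma e -> k (tact t e) = gmul (chi t) (k e)].
Proof.
have [hchi ms ps st s1] := fr; have [d [dP md]] := bundle_division E.
pose k e := d (s (proj e)) e.
have kE e : over sigma e -> ract (s (proj e)) (k e) = e by move=> He; apply: dP; rewrite ps.
have inj e g h : ract e g = ract e h -> g = h by apply: (@ract_inj _ _ _ _ _ E e).
exists k; split=> //.
- have m1 : morph_on (over sigma) (s \o @proj _ _ _ _ _ E).
    apply: (@morph_on_comp _ E (over sigma) X (tU sigma) E _ s sE) => //.
    exact: morph_proj.
  have mp := morph_on_pair rE sE sE m1 (@morph_on_id _ E (over sigma)).
  apply: (@morph_on_comp _ E _ (product E E) [set p | proj p.1 = proj p.2] G _ (fun p => d p.1 p.2) sE mp) => //.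
  by move=> e He /=; rewrite ps.
- move=> x g Ux; have H : over sigma (ract (s x) g) by rewrite /over /= proj_ract ps.
  by have := kE _ H; rewrite proj_ract ps // => /inj.
- move=> e g He; have := kE _ (over_ract g He); rewrite proj_ract => H.
  by apply: (inj (s (proj e))); rewrite H ractM kE.
move=> t e He; have := kE _ (over_tact t He); rewrite proj_tact => H.
apply: (inj (s (toric_act t (proj e)))); rewrite H st // -ractM gmulKg.
by rewrite -tact_ract kE.
Qed.

Lemma pairing_small rho (i : int) : exists w, pairing w (val rho) <= i.
Proof.
have [rho0 _] := set_valP rho.
have [u u0] : exists u, pairing u (val rho) != 0.
  apply: contrapT => /forallNP H; case/eqP: rho0; apply: pairing_ext => u.
  by rewrite pairing0r; apply/eqP; apply: contrapT => /negP; exact: H.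
exists ((- `|i| * Num.sg (pairing u (val rho))) *: u); rewrite pairingZl -mulrA -normrEsg mulNr.
move: u0; rewrite -normr_gt0; move: `|pairing _ _| => c c0; nia.
Qed.

(** In a frame [t e1] is [s(t) chi(t)], so at [s(t) g] the function [F] is [t^w b(chi(t)^-1 g)]: a
    component [h] of [b] of weight [u] contributes [t^(w + u) h(g)]. Regularity over the chart of
    [rho] means that the [w + u] that occur are nonnegative on [rho]. *)
Lemma bundle_filtP rho (i : int) b : val sigma (val rho) -> bundle_filt rho i b <->
  exists r (u : 'I_r -> M) (h : 'I_r -> G -> K),
    (forall j, weight_space chi (u j) (h j) /\ i <= pairing (u j) (val rho)) /\
    forall g, b g = \sum_j h j g.
Proof.
move=> srho; have [hchi ms ps st s1] := fr.
set tau := ray_cone rho.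
have tsub : val tau `<=` val sigma.
  have [_ _ scS _ _] := fanS; have [[l lE] _] := scS _ (fcone_mem sigma).
  move=> _ [k _ <-]; move: srho; rewrite lE => srho.
  by elim: k => [|k IH]; [rewrite mulr0n; apply: cone0|rewrite mulrS; apply: coneD].
have [tUsub xcharE] := tU_sub X tsub.
have trho : val tau (val rho) by exists 1%N.
split=> [[Kb [w [F [wi rF EF]]]]|[r [u [h [Hh Eb]]]]].
  have [m [y cG]] := group_coords G; have rXG := ringed_product sX sG; have rEG := ringed_product sE sG.
  have rF' : @reg_on _ (product X G) (tU tau `*` setT) (fun p => F (ract (s p.1) p.2)).
    apply: (@morph_on_reg _ (product X G) _ E (over tau) (fun p => ract (s p.1) p.2) F (ringed_sheaf rXG)) => //.
      have m1 : @morph_on _ (product X G) (tU tau `*` setT) E (fun p => s p.1).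
        apply: (@morph_on_comp _ (product X G) _ X (tU sigma) E fst s (ringed_sheaf rXG)) => //.
          exact: morph_on_fst.
        by move=> [x g] /= [Ux _]; apply: tUsub.
      have mp := morph_on_pair rXG sE sG m1 (@morph_on_snd _ X G (tU tau `*` setT) rX rG).
      apply: (@morph_on_comp _ (product X G) _ (product E G) setT E _ (fun p => ract p.1 p.2) (ringed_sheaf rXG) mp) => //.
      exact: (morph_onTW _ (ringed_sheaf rEG) (ract_morph E)).
    by move=> [x g] /= [Ux _]; rewrite /over /= proj_ract ps //; apply: tUsub.
  have [k [u [f [du Af Ef]]]] := reg_on_chart_prod fanS rG cG rF'.
  have Kf j : KG (f j) by rewrite (coordinate_ringE cG).
  have [t g|r [u' [h [wh uh bh _]]]] := @weight_regroup _ _ hK _ chi hchi b k (fun j => u j - w) f Kf.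
    have := EF t (gmul (ginv (chi t)) g); rewrite frame_orbit -ractM gmulVKg.
    have := Ef (xorb t) g (xorb_tU fanS X tau t) Logic.I => /= -> Eb.
    apply: (mulfI (char_neq0 w t)); rewrite -Eb mulr_sumr; apply: eq_bigr => j _.
    by rewrite xchar_xorb // charB mulrA mulrCA mulfV ?char_neq0 // mulr1.
  exists r, u', h; split=> // j; split=> //; have [j' ->] := uh j.
  by rewrite pairingBl; have := du j' _ trho; lia.
have Kh j : KG (h j) by have [[]] := Hh j.
split.
  rewrite (_ : b = fun g => \sum_j h j g); last exact/funext.
  by rewrite -coordinate_ring_alg; apply: alg_gen_sum => j _; apply: AlgGen.
(* [w] is minus the weight that is smallest on [rho]. For the empty sum there is none, and any [w]
   that is small enough on [rho] will do. *)
have [w [wi wu]] : exists w, pairing w (val rho) <= - i /\ forall j, 0 <= pairing (w + u j) (val rho).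
  case: r u h Hh Eb Kh => [|r] u h Hh Eb Kh.
    by have [w wi] := pairing_small rho (- i); exists w; split=> // -[].
  have [j0 _ jmin] := arg_minP (fun j => pairing (u j) (val rho)) (erefl : xpredT (ord0 : 'I_r.+1)).
  exists (- u j0); split; first by rewrite pairingNl lerN2; case: (Hh j0).
  by move=> j; rewrite pairingDl pairingNl addrC subr_ge0; apply: jmin.
have dwu j : dual_cone (val tau) (w + u j).
  by move=> _ [k _ <-]; rewrite pairingMn mulr_ge0.
have [k [mk kE ks _ _]] := frame_coord.
have overs : over (E := E) tau `<=` over sigma by move=> e; apply: tUsub.
exists w, (fun e => \sum_j xchar tau (w + u j) (proj e) * h j (k e)); split=> //.
  apply: (reg_on_alg rE (S := [set f | reg_on (over tau) f])) => //.
  apply: alg_gen_sum => j _; apply: AlgMul; apply: AlgGen => /=.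
    exact: (reg_proj (E := E) (reg_xchar (dwu j))).
  by apply: (@morph_on_group_reg _ _ E (over tau) k) => //; apply: morph_on_sub overs mk.
move=> t g; rewrite frame_orbit -ractM Eb mulr_sumr; apply: eq_bigr => j _.
have Us : tU sigma (xorb t) by apply: xorb_tU.
rewrite ks // proj_ract ps // xchar_xorb // (weight_space_mul _ _ (proj1 (Hh j))) charD.
by rewrite mulrA mulfK ?char_neq0.
Qed.

End Filtration.

(** * Graded decompositions and their restriction to faces *)

Section SumOf.
Variables (K : closedFieldType) (n : nat).
Local Notation M := 'cV[int]_n.

Section Module.
Variables (V : lmodType K) (D : M -> set V).
Hypothesis sD : forall u, linear_subspace (D u).
Implicit Types P Q : set M.

Lemma sum_of_subspace P : linear_subspace (sum_of D P).
Proof.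
split; first by exists 0%N, (fun=> 0), (fun=> 0); split=> [[]//|]; rewrite big_ord0.
move=> k a b [r [u [d [Hd ->]]]] [r' [u' [d' [Hd' ->]]]].
exists (r + r')%N, (fun j => match fintype.split j with inl i => u i | inr i => u' i end),
  (fun j => match fintype.split j with inl i => k *: d i | inr i => d' i end); split.
  move=> j; case: (fintype.split j) => i; last exact: Hd'.
  split; first by case: (Hd i).
  by have [s0 sZ] := sD (u i); rewrite -[k *: _]addr0; apply: sZ => //; case: (Hd i).
rewrite big_split_ord scaler_sumr; congr (_ + _); apply: eq_bigr => i _.
  by rewrite (unsplitK (inl i)).
by rewrite (unsplitK (inr i)).
Qed.

Lemma subspace_sum (W : set V) (I : Type) (s : seq I) (R : pred I) (F : I -> V) : linear_subspace W ->
  (forall i, R i -> W (F i)) -> W (\sum_(i <- s | R i) F i).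
Proof.
move=> [W0 WZ] H; elim/big_ind: _ => // a b Wa Wb.
by rewrite -[a]scale1r; apply: WZ.
Qed.

Lemma sum_of1 P u d : P u -> D u d -> sum_of D P d.
Proof. by move=> Pu Du; exists 1%N, (fun=> u), (fun=> d); rewrite big_ord1. Qed.

Lemma sum_of_mono P Q : P `<=` Q -> sum_of D P `<=` sum_of D Q.
Proof. by move=> PQ _ [r [u [d [H ->]]]]; exists r, u, d; split=> // j; case: (H j) => /PQ. Qed.

Hypothesis directD : forall r (u : 'I_r -> M) (d : 'I_r -> V), injective u ->
  (forall j, D (u j) (d j)) -> \sum_j d j = 0 -> forall j, d j = 0.

Lemma direct_part (I : finType) (u : I -> M) (d : I -> V) (P : pred M) :
  (forall i, D (u i) (d i)) -> \sum_i d i = 0 -> \sum_(i | P (u i)) d i = 0.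
Proof.
move=> Dd d0; pose ws := undup (codom u).
have ui i : (index (u i) ws < size ws)%N by rewrite index_mem mem_undup codom_f.
pose p i : 'I_(size ws) := Ordinal (ui i).
have up i : nth 0 ws (p i) = u i by rewrite nth_index // mem_undup codom_f.
have nth_inj : injective (fun j : 'I_(size ws) => nth 0 ws j).
  by move=> j k /eqP; rewrite nth_uniq ?undup_uniq // => /eqP/val_inj.
have z := directD (u := fun j => nth 0 ws j) (d := fun j => \sum_(i | p i == j) d i) nth_inj.
rewrite (partition_big p (fun j => P (nth 0 ws j))) /=; last by move=> i Pi; rewrite nth_index // mem_undup codom_f.
apply: big1 => j Pj; rewrite (eq_bigl (fun i => p i == j)).
  apply: z => [k|]; last by rewrite -[RHS]d0 [RHS](partition_big p xpredT).
  by apply: subspace_sum => // i /eqP <-; rewrite up.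
by move=> i /=; case: eqP => [pj|]; rewrite ?andbF // andbT -up pj.
Qed.

(** The components whose weights agree with [u] on [kappa] are collected; this is how a
    decomposition for a top-dimensional cone induces one for each cone contained in it. *)
Definition coarsen (kappa : set 'rV[int]_n) (u : M) : set V := sum_of D [set v | perp kappa (v - u)].

End Module.

Lemma sum_of_mul (A : comAlgType K) (D : M -> set A) (P Q R : set M) a b :
  (forall u, linear_subspace (D u)) -> (forall u v a b, D u a -> D v b -> D (u + v) (a * b)) ->
  (forall u v, P u -> Q v -> R (u + v)) -> sum_of D P a -> sum_of D Q b -> sum_of D R (a * b).
Proof.
move=> sD mD PQR [r [u [d [Hd ->]]]] [r' [u' [d' [Hd' ->]]]].
rewrite mulr_suml; apply: subspace_sum => [|i _]; first exact: sum_of_subspace.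
rewrite mulr_sumr; apply: subspace_sum => [|j _]; first exact: sum_of_subspace.
have [Pu Du] := Hd i; have [Qu' Du'] := Hd' j.
by apply: (@sum_of1 _ _ _ (u i + u' j)); [apply: PQR|apply: mD].
Qed.

Variable Sigma : set (set 'rV[int]_n).
Hypothesis fanS : is_fan Sigma.
Hypothesis hmax : forall sigma, maximal_cone Sigma sigma -> top_dimensional sigma.

Lemma perp_top (sigma : set 'rV[int]_n) u : top_dimensional sigma -> perp sigma u -> u = 0.
Proof.
move=> htop pu; apply: pairing_extl => v; rewrite pairing0l.
have [k k0 [a [b [sa sb E]]]] := htop v.
have : pairing u (v *+ k) = 0 by rewrite E pairingDr pairingNr !pu // subr0.
rewrite pairingMn => /eqP; rewrite mulf_eq0 => /orP[|/eqP //].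
by case: k k0 E.
Qed.

Lemma compatible_face (B : sigma_filtered_algebra K Sigma) (sigma kappa : set 'rV[int]_n) D :
  top_dimensional sigma -> kappa `<=` sigma -> @compatible_decomposition K n Sigma B sigma D ->
  @compatible_decomposition K n Sigma B kappa (coarsen D kappa).
Proof.
move=> htop ks [[sD _] genD dirD filtD mulD].
have directD r (u : 'I_r -> M) (d : 'I_r -> B) : injective u ->
    (forall j, D (u j) (d j)) -> \sum_j d j = 0 -> forall j, d j = 0.
  move=> inj; apply: dirD => i j ij /(perp_top htop)/eqP; rewrite subr_eq0 => /eqP/inj e.
  by rewrite e eqxx in ij.
have perpD u v : perp kappa u -> perp kappa v -> perp kappa (u + v).
  by move=> pu pv c kc; rewrite pairingDl pu // pv // addr0.
have perpN u : perp kappa u -> perp kappa (- u).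
  by move=> pu c kc; rewrite pairingNl pu // oppr0.
have perp0 u : perp kappa (u - u) by move=> c _; rewrite subrr pairing0l.
have Dsub u : D u `<=` coarsen D kappa u by move=> d Du; apply: (sum_of1 (u := u)) => //; exact: perp0.
have sC u : linear_subspace (coarsen D kappa u) by apply: sum_of_subspace.
split.
- split=> // u v uv; rewrite /coarsen; congr sum_of; apply/seteqP; split=> w /= pw.
    by rewrite -(subrK u w) -addrA; apply: perpD.
  by rewrite -(subrK v w) -addrA; apply: perpD => //; rewrite -opprB; apply: perpN.
- apply/seteqP; split=> // b _; have : sum_of D setT b by rewrite genD.
  by move=> [r [u [d [H ->]]]]; exists r, u, d; split=> // j; split=> //; apply: Dsub; case: (H j).
- move=> r u d nperp Cd d0 j.
  have /choice[L HL] : forall i, exists L : {m : nat & (('I_m -> M) * ('I_m -> B))%type},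
      (forall l, perp kappa ((projT2 L).1 l - u i) /\ D ((projT2 L).1 l) ((projT2 L).2 l)) /\
      d i = \sum_l (projT2 L).2 l.
    by move=> i; have [m [v [e [H E]]]] := Cd i; exists (existT _ m (v, e)).
  pose I := {i : 'I_r & 'I_(projT1 (L i))}.
  pose v (x : I) := (projT2 (L (tag x))).1 (tagged x).
  pose e (x : I) := (projT2 (L (tag x))).2 (tagged x).
  have sumI (F : I -> B) : \sum_x F x = \sum_(i < r) \sum_(l < projT1 (L i)) F (existT (fun i => 'I_(projT1 (L i))) i l).
    rewrite (sig_big_dep xpredT (fun _ _ => true) (fun i l => F (existT (fun i => 'I_(projT1 (L i))) i l))).
    by apply: eq_bigr => -[].
  have De x : D (v x) (e x) by case: ((HL (tag x)).1 (tagged x)).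
  have e0 : \sum_x e x = 0 by rewrite sumI -[RHS]d0; apply: eq_bigr => i _; rewrite (HL i).2.
  rewrite -(direct_part sD directD (fun w => `[< perp kappa (w - u j) >]) De e0).
  rewrite big_mkcond sumI (bigD1 j) //= [X in _ + X]big1 ?addr0.
    rewrite (HL j).2; apply: eq_bigr => l _; case: asboolP => // -[].
    by case: ((HL j).1 l).
  move=> i ij; apply: big1 => l _; case: asboolP => // pv; case: (nperp i j ij).
  have [pv' _] := (HL i).1 l.
  rewrite -(subrK (v (existT (fun i => 'I_(projT1 (L i))) i l)) (u i)) -addrA; apply: perpD => //.
  by rewrite -opprB; apply: perpN.
- move=> rho i krho; rewrite filtD; last exact: ks.
  apply/seteqP; split=> b [r [u [d [H ->]]]].
    by exists r, u, d; split=> // j; have [? ?] := H j; split=> //; apply: Dsub.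
  apply: subspace_sum => [|j _]; first exact: sum_of_subspace.
  have [iu] := H j; apply: sum_of_mono => w /= pw.
  by rewrite -(subrK (u j) w) pairingDl pw // add0r.
move=> u v a b; apply: sum_of_mul => // w w' pw pw' /=.
by rewrite opprD addrACA; apply: perpD.
Qed.

Lemma compatible_of_top (B : sigma_filtered_algebra K Sigma) :
  (forall sigma, Sigma sigma -> top_dimensional sigma ->
     exists D, @compatible_decomposition K n Sigma B sigma D) -> compatible B.
Proof.
move=> H kappa Sk; have [sigma [Ss smax] ks] := fan_maximal fanS Sk.
have htop := hmax (conj Ss smax); have [D HD] := H sigma Ss htop.
by exists (coarsen D kappa); apply: compatible_face HD.
Qed.

End SumOf.

(** * The coordinate ring as an algebra *)

Section CoordinateAlgebra.
Variables (K : closedFieldType) (G : alg_group K).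
Local Notation KG := (@coordinate_ring K G).

Definition coordinate_algebra : Type := {f : G -> K | KG f}.
Local Notation R := coordinate_algebra.
HB.instance Definition _ := gen_eqMixin R.
HB.instance Definition _ := gen_choiceMixin R.

Lemma cring_ext (f h : R) : (forall g, sval f g = sval h g) -> f = h.
Proof. by case: f h => [f Kf] [h Kh] /= E; apply: eq_exist; apply/funext. Qed.

Let cst (c : K) : R := exist _ (fun=> c) (@coordinate_ring_cst K G c).
Let add (f h : R) : R := exist _ (sval f + sval h) (coordinate_ringD (svalP f) (svalP h)).
Let mul (f h : R) : R := exist _ (sval f * sval h) (coordinate_ringM (svalP f) (svalP h)).
Let opp (f : R) : R := mul (cst (-1)) f.
Let scale c (f : R) : R := mul (cst c) f.

Let addA : associative add. Proof. by move=> f h k; apply: cring_ext => g /=; rewrite !fun_addE addrA. Qed.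
Let addC : commutative add. Proof. by move=> f h; apply: cring_ext => g /=; rewrite !fun_addE addrC. Qed.
Let add0 : left_id (cst 0) add. Proof. by move=> f; apply: cring_ext => g /=; rewrite !fun_addE add0r. Qed.
Let addN : left_inverse (cst 0) opp add.
Proof. by move=> f; apply: cring_ext => g /=; rewrite !fun_addE fun_mulE mulN1r addNr. Qed.
HB.instance Definition _ := GRing.isZmodule.Build R addA addC add0 addN.

Let mulA : associative mul. Proof. by move=> f h k; apply: cring_ext => g /=; rewrite !fun_mulE mulrA. Qed.
Let mulC : commutative mul. Proof. by move=> f h; apply: cring_ext => g /=; rewrite !fun_mulE mulrC. Qed.
Let mul1 : left_id (cst 1) mul. Proof. by move=> f; apply: cring_ext => g /=; rewrite !fun_mulE mul1r. Qed.
Let mulD : left_distributive mul +%R.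
Proof. by move=> f h k; apply: cring_ext => g /=; rewrite !(fun_mulE, fun_addE) mulrDl. Qed.
Let one_neq0 : cst 1 != 0.
Proof. by apply/eqP => /(congr1 (fun f : R => sval f gone)) /= /eqP; rewrite oner_eq0. Qed.
HB.instance Definition _ := GRing.Zmodule_isComNzRing.Build R mulA mulC mul1 mulD one_neq0.

Let scaleA a b (f : R) : scale a (scale b f) = scale (a * b) f.
Proof. by apply: cring_ext => g /=; rewrite !fun_mulE mulrA. Qed.
Let scale1 : left_id 1 scale. Proof. by move=> f; apply: cring_ext => g /=; rewrite fun_mulE mul1r. Qed.
Let scaleDr : right_distributive scale +%R.
Proof. by move=> c f h; apply: cring_ext => g /=; rewrite !(fun_mulE, fun_addE) mulrDr. Qed.
Let scaleDl f : {morph scale^~ f : a b / a + b}.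
Proof. by move=> a b; apply: cring_ext => g /=; rewrite !(fun_mulE, fun_addE) mulrDl. Qed.
HB.instance Definition _ := GRing.Zmodule_isLmodule.Build K R scaleA scale1 scaleDr scaleDl.

Let scaleAl (k : K) (f h : R) : k *: (f * h) = (k *: f) * h.
Proof. by apply: cring_ext => g /=; rewrite !fun_mulE mulrA. Qed.
HB.instance Definition _ := GRing.Lmodule_isLalgebra.Build K R scaleAl.
HB.instance Definition _ := GRing.Lalgebra_isComAlgebra.Build K R.

Lemma cringD (f h : R) g : sval (f + h) g = sval f g + sval h g. Proof. by []. Qed.
Lemma cringM (f h : R) g : sval (f * h) g = sval f g * sval h g. Proof. by []. Qed.
Lemma cringZ k (f : R) g : sval (k *: f) g = k * sval f g. Proof. by []. Qed.
Lemma cring1 g : sval (1 : R) g = 1. Proof. by []. Qed.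
Lemma cring_sum (I : Type) (s : seq I) (P : pred I) (F : I -> R) g :
  sval (\sum_(i <- s | P i) F i) g = \sum_(i <- s | P i) sval (F i) g.
Proof. by elim/big_rec2: _ => // i x y _ <-; rewrite cringD. Qed.

Lemma cring_countable : countable_dimension R.
Proof.
have [m [y cy]] := group_coords G; have Ey := coordinate_ringE cy.
pose Y i : R := exist _ (y i) (eq_ind_r (fun S => S (y i)) (alg_gen_range y i) Ey).
pose mono (s : seq 'I_m) : R := \prod_(i <- s) Y i.
(* Monomials in the coordinates are sequences of indices, numbered by [pickle]; numbers that code no
   sequence are sent to 0. *)
pose e (k : nat) : R := if @choice.unpickle (seq 'I_m) k is Some s then mono s else 0.
have eE s : e (choice.pickle s) = mono s by rewrite /e choice.pickleK.
exists e.
have rep f : alg_gen (range y) f -> exists L : seq (K * seq 'I_m),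
    forall g, f g = sval (\sum_(x <- L) x.1 *: mono x.2) g.
  elim=> {f} [_ [i _ <-]|c|f f' _ [L HL] _ [L' HL']|f f' _ [L HL] _ [L' HL']].
  - by exists [:: (1, [:: i])] => g; rewrite big_seq1 scale1r /mono big_seq1.
  - by exists [:: (c, [::])] => g; rewrite big_seq1 /mono big_nil cringZ cring1 mulr1.
  - by exists (L ++ L') => g; rewrite big_cat cringD HL HL'.
  exists [seq (x.1 * x'.1, x.2 ++ x'.2) | x <- L, x' <- L'] => g.
  rewrite HL HL' -cringM mulr_suml big_allpairs_dep; congr (sval _ g); apply: eq_bigr => x _.
  rewrite mulr_sumr; apply: eq_bigr => x' _ /=.
  by rewrite -scalerAl -scalerAr scalerA /mono big_cat.
move=> v; have [L HL] : exists L : seq (K * seq 'I_m), v = \sum_(x <- L) x.1 *: mono x.2.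
  have [|L HL] := rep (sval v); first by rewrite -Ey; apply: svalP.
  by exists L; apply: cring_ext.
rewrite HL; pose N := (\max_(x <- L) (choice.pickle x.2).+1)%N.
exists N, (fun i : 'I_N => \sum_(x <- L | choice.pickle x.2 == i) x.1).
have lt x : x \in L -> (choice.pickle x.2 < N)%N by move=> xL; apply: (@leq_bigmax_seq _ L xpredT (fun x => (choice.pickle x.2).+1)).
under [RHS]eq_bigr do rewrite scaler_suml.
rewrite (exchange_big_dep xpredT) //= big_seq [RHS]big_seq; apply: eq_bigr => x xL.
rewrite (big_pred1 (Ordinal (lt x xL))); last by move=> i /=; apply/eqP/eqP => [E|-> //]; apply: val_inj; rewrite /= E.
by rewrite -[in LHS]eE.
Qed.

End CoordinateAlgebra.

(** * The filtered algebra of a bundle *)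

Section BundleAlgebra.
Variables (K : closedFieldType) (n : nat).
Hypothesis hK : [pchar K] =i pred0.
Local Notation N := 'rV[int]_n.
Local Notation M := 'cV[int]_n.
Local Notation T := (torus K n).
Variable Sigma : set (set N).
Hypothesis fanS : is_fan Sigma.
Hypothesis hmax : forall sigma, maximal_cone Sigma sigma -> top_dimensional sigma.
Variable X : toric_variety K Sigma.
Variable G : alg_group K.
Local Notation R := (coordinate_algebra G).
Local Notation KG := (@coordinate_ring K G).
Local Notation xorb := (xorb fanS X).
Implicit Types (rho : ray_generators Sigma).

Definition weight_part (chi : T -> G) (u : M) : set R := [set b | weight_space chi u (sval b)].

Lemma weight_part_subspace chi u : linear_subspace (weight_part chi u).
Proof.
split; first by split=> [|t g]; [apply: svalP|rewrite /= mulr0].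
move=> k a b [_ Ha] [_ Hb]; split=> [|t g]; first exact: svalP.
by rewrite !cringD !cringZ Ha Hb; ring.
Qed.

Lemma weight_part_mul chi u v (a b : R) : weight_part chi u a -> weight_part chi v b ->
  weight_part chi (u + v) (a * b).
Proof.
move=> [_ Ha] [_ Hb]; split=> [|t g]; first exact: svalP.
by rewrite !cringM Ha Hb charD; ring.
Qed.

Lemma sum_of_weight_part chi (P : set M) (b : R) : sum_of (weight_part chi) P b <->
  exists r (u : 'I_r -> M) (h : 'I_r -> G -> K),
    (forall j, weight_space chi (u j) (h j) /\ P (u j)) /\ forall g, sval b g = \sum_j h j g.
Proof.
split=> [[r [u [d [H ->]]]]|[r [u [h [H Eb]]]]].
  exists r, u, (fun j => sval (d j)); split=> [j|g]; first by case: (H j).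
  by rewrite cring_sum.
have Kh j : KG (h j) by have [[]] := H j.
exists r, u, (fun j => exist _ (h j) (Kh j)); split=> [j|]; first by case: (H j).
by apply: cring_ext => g; rewrite cring_sum Eb.
Qed.

Variables (E : principal_bundle X G) (e1 : E).
Hypothesis pe1 : proj e1 = xorb torus_one.

Definition balg_filt rho (i : int) : set R := [set b | bundle_filt e1 rho i (sval b)].

Lemma balg_filtE sigma chi s rho i : frame fanS e1 sigma chi s -> val sigma (val rho) ->
  balg_filt rho i = sum_of (weight_part chi) [set u | i <= pairing u (val rho)].
Proof.
move=> fr srho; apply/seteqP; split=> b; rewrite sum_of_weight_part.
  by move=> /(bundle_filtP hK fr _ _ srho).
by move=> H; apply/(bundle_filtP hK fr _ _ srho).
Qed.

(** Each law of the filtration concerns a single ray. It can thus be checked in a frame over a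
    maximal cone that contains the ray, where the filtration comes from a grading. *)
Lemma ray_frame rho : exists sigma chi s, frame fanS e1 sigma chi s /\ val sigma (val rho).
Proof.
have [sigma [Ss smax] rs] := fan_maximal fanS (ray_cone_axiom rho).
have [chi [s fr]] := frame_exists hK (sigma := fcone Ss) (hmax (conj Ss smax)) pe1.
by exists (fcone Ss), chi, s; split=> //; apply: rs; exists 1%N.
Qed.

Lemma balg_subspace rho i : linear_subspace (balg_filt rho i).
Proof.
have [sigma [chi [s [fr srho]]]] := ray_frame rho; rewrite (balg_filtE _ fr srho).
exact/sum_of_subspace/weight_part_subspace.
Qed.

Lemma balg_decr rho i : balg_filt rho (i + 1) `<=` balg_filt rho i.
Proof.
have [sigma [chi [s [fr srho]]]] := ray_frame rho; rewrite !(balg_filtE _ fr srho).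
by apply: sum_of_mono => u /=; lia.
Qed.

Lemma balg_full rho b : exists i, balg_filt rho i b.
Proof.
have [sigma [chi [s [fr srho]]]] := ray_frame rho; have [hchi _ _ _ _] := fr.
have [r [u [h [wh Eb _]]]] := weight_sum hK hchi (svalP b).
exists (- \sum_j `|pairing (u j) (val rho)|); rewrite (balg_filtE _ fr srho).
apply/sum_of_weight_part; exists r, u, h; split=> // j; split=> //=.
rewrite (bigD1 j) //= lerNl; apply: le_trans (_ : `|pairing (u j) (val rho)| <= _).
  by rewrite -normrN ler_norm.
by rewrite lerDl sumr_ge0.
Qed.

Lemma balg_mul rho i j a b : balg_filt rho i a -> balg_filt rho j b -> balg_filt rho (i + j) (a * b).
Proof.
have [sigma [chi [s [fr srho]]]] := ray_frame rho; rewrite !(balg_filtE _ fr srho).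
apply: sum_of_mul; [exact: weight_part_subspace|exact: weight_part_mul|].
by move=> u v /= iu jv; rewrite pairingDl lerD.
Qed.

Definition balg_falg : sigma_filtered_algebra K Sigma :=
  SigmaFilteredAlgebra (cring_countable G) balg_subspace balg_decr balg_full balg_mul.

Lemma balg_decomposition sigma chi s : top_dimensional (val sigma) -> frame fanS e1 sigma chi s ->
  @compatible_decomposition K n Sigma balg_falg (val sigma) (weight_part chi).
Proof.
move=> htop fr; have [hchi _ _ _ _] := fr; split.
- split=> [u|u v /(perp_top htop)/eqP]; first exact: weight_part_subspace.
  by rewrite subr_eq0 => /eqP ->.
- apply/seteqP; split=> // b _; apply/sum_of_weight_part.
  have [r [u [h [wh Eb _]]]] := weight_sum hK hchi (svalP b).
  by exists r, u, h.
- move=> r u d nperp wd d0 j; apply: cring_ext => g.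
  have := weight_direct hK (u := u) (h := fun j => sval (d j)) wd _ (u j) g.
  rewrite (big_pred1 j) => [-> // g'|i]; first by rewrite -cring_sum d0.
  rewrite /=; have [->|ij] := eqVneq i j; first by rewrite eqxx.
  by apply/eqP => uij; case: (nperp i j ij); rewrite uij subrr => c _; apply: pairing0l.
- by move=> rho i srho; apply: (balg_filtE _ fr srho).
exact: weight_part_mul.
Qed.

Lemma balg_compatible : compatible balg_falg.
Proof.
apply: compatible_of_top => // sigma Ss htop.
have [chi [s fr]] := frame_exists hK (sigma := fcone Ss) htop pe1.
by exists (weight_part chi); apply: (balg_decomposition (sigma := fcone Ss) htop fr).
Qed.

Definition balg_act g (b : R) : R := exist _ _ (coordinate_ring_rmul g (svalP b)).

Lemma balg_act_alg g : alg_map (balg_act g : balg_falg -> balg_falg).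
Proof. by split=> [k a b|]; [apply: cring_ext|split=> [|a b]; apply: cring_ext]. Qed.

Lemma balg_translation : exists phi : balg_falg -> G -> K,
    [/\ forall k a b x, phi (k *: a + b) x = k * phi a x + phi b x,
        forall x, phi 1 x = 1,
        forall a b x, phi (a * b) x = phi a x * phi b x,
        set_bij setT KG phi
      & forall g b x, phi (balg_act g b) x = phi b (gmul x g)].
Proof.
exists (fun b : R => sval b); split=> //.
split=> [b _|b b' _ _ bb'|b Kb]; [exact: svalP|by apply: cring_ext => g; rewrite bb'|].
by exists (exist _ b Kb).
Qed.

Lemma balg_torus sigma : Sigma sigma -> top_dimensional sigma ->
  exists tau : torus K n -> balg_falg -> balg_falg, compatible_action sigma tau /\
    forall t g b, tau t (balg_act g b) = balg_act g (tau t b).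
Proof.
move=> Ss htop; have [chi [s fr]] := frame_exists hK (sigma := fcone Ss) htop pe1.
have [hchi _ _ _ _] := fr; have [_ chiM] := hchi.
exists (fun t b => exist _ _ (coordinate_ring_lmul (ginv (chi t)) (svalP b))); split.
  split.
  - by move=> b; apply: cring_ext => g /=; rewrite torus_hom1 // ginv1 gmul1g.
  - by move=> t t' b; apply: cring_ext => g /=; rewrite chiM ginvM gmulA.
  - by move=> t; split=> [k a b|]; [apply: cring_ext|split=> [|a b]; apply: cring_ext].
  rewrite (_ : (fun u => _) = weight_part chi); first exact: (balg_decomposition (sigma := fcone Ss) htop fr).
  apply/funext => u; apply/seteqP; split=> b.
    by move=> H; split=> [|t g]; [apply: svalP|have := congr1 (fun f : R => sval f g) (H t)].
  by move=> [_ H] t; apply: cring_ext => g; apply: H.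
by move=> t g b; apply: cring_ext => h /=; rewrite gmulA.
Qed.

Definition balg : calg Sigma G.
Proof.
refine (@CalgObject K n Sigma G balg_falg balg_compatible balg_act _ _ balg_act_alg balg_translation balg_torus).
- by move=> b; apply: cring_ext => g /=; rewrite gmulg1.
- by move=> g h b; apply: cring_ext => x /=; rewrite gmulA.
Defined.

End BundleAlgebra.

(** * The functor *)

Section Transitions.
Variables (K : closedFieldType) (n : nat).
Hypothesis hK : [pchar K] =i pred0.
Local Notation N := 'rV[int]_n.
Local Notation M := 'cV[int]_n.
Local Notation T := (torus K n).
Variable Sigma : set (set N).
Hypothesis fanS : is_fan Sigma.
Hypothesis hmax : forall sigma, maximal_cone Sigma sigma -> top_dimensional sigma.
Variable X : toric_variety K Sigma.
Variable G : alg_group K.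
Implicit Types (sigma : Sigma) (t : T) (u w : M) (g : G) (b : G -> K) (E : principal_bundle X G).
Local Notation xorb := (xorb fanS X).
Local Notation KG := (@coordinate_ring K G).
Let rX := ringed_toric X.
Let sX := ringed_sheaf rX.
Let rG := ringed_group G.
Let sG := ringed_sheaf rG.

(** The right-hand side of [bundle_filtP], now for any homomorphism: the filtration along [rho]
    defined by the torus action [b |-> b (chi(t)^-1 g)]. *)
Definition weight_filt (chi : T -> G) (rho : N) (i : int) b :=
  exists r (u : 'I_r -> M) (h : 'I_r -> G -> K),
    (forall j, weight_space chi (u j) (h j) /\ i <= pairing (u j) rho) /\ forall g, b g = \sum_j h j g.

(** Comparing two expansions of [b] along a ray [rho], directness of the decomposition kills the
    components whose weight is smaller than [u] on [rho]. By [dual_cone_rays] the other weights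
    differ from [u] by elements of the dual cone. *)
Lemma weight_support sigma chi u b : torus_hom chi -> KG b ->
  (forall rho, ray_generators Sigma rho -> val sigma rho -> weight_filt chi rho (pairing u rho) b) ->
  exists r (v : 'I_r -> M) (h : 'I_r -> G -> K),
    (forall j, weight_space chi (v j) (h j) /\ dual_cone (val sigma) (v j - u)) /\
    forall g, b g = \sum_j h j g.
Proof.
move=> hchi Kb filt; have [r [v [h [wh Eb _]]]] := weight_sum hK hchi Kb.
have zero w : ~ dual_cone (val sigma) (w - u) -> forall g, \sum_(k | v k == w) h k g = 0.
  move=> nd g; have [rho [rrho [srho lt]]] : exists rho, ray_generators Sigma rho /\
      val sigma rho /\ pairing w rho < pairing u rho.
    apply: contrapT => /forallNP H; apply: nd; apply: (dual_cone_rays fanS (fcone_mem sigma)) => rho rr sr.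
    rewrite pairingBl subr_ge0 leNgt; apply/negP => lt; exact: (H rho).
  have [r' [v' [h' [wh' Eb']]]] := filt rho rrho srho.
  pose vv j := match fintype.split j with inl i => v i | inr i => v' i end.
  pose hh j (g : G) := match fintype.split j with inl i => h i g | inr i => - h' i g end.
  have whh j : weight_space chi (vv j) (hh j).
    rewrite /vv /hh; case: (fintype.split j) => i; first exact: wh.
    have [[Kh Hh] _] := wh' i; split=> [|t g']; last by rewrite Hh mulrN.
    by have := coordinate_ringM (coordinate_ring_cst G (-1)) Kh; congr KG; apply/funext => g'; rewrite fun_mulE mulN1r.
  have hh0 g' : \sum_j hh j g' = 0.
    rewrite big_split_ord /=.
    rewrite (eq_bigr (fun i => h i g')) => [|i _]; last by rewrite /hh (unsplitK (inl i)).
    rewrite [X in _ + X](eq_bigr (fun i => - h' i g')) => [|i _]; last by rewrite /hh (unsplitK (inr i)).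
    by rewrite sumrN -Eb -Eb' subrr.
  rewrite -[RHS](weight_direct hK whh hh0 w g) big_split_ord /= [X in _ = _ + X]big1 ?addr0.
    apply: eq_big => [k|k _]; first by rewrite /vv (unsplitK (inl k)).
    by rewrite /hh (unsplitK (inl k)).
  move=> k; rewrite /vv (unsplitK (inr k)) => /eqP vw.
  by have [_] := wh' k; rewrite vw leNgt lt.
pose ws := [seq w <- undup (codom v) | `[< dual_cone (val sigma) (w - u) >]].
exists (size ws), (fun i => nth 0 ws i), (fun i g => \sum_(k | v k == nth 0 ws i) h k g); split=> [j|g].
  have : nth 0 ws j \in ws by rewrite mem_nth.
  rewrite mem_filter => /andP[/asboolP dw _]; split=> //.
  split=> [|t g]; last by rewrite mulr_sumr; apply: eq_bigr => k /eqP <-; have [_ ->] := wh k.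
  by rewrite -coordinate_ring_alg; apply: alg_gen_sum => k _; apply: AlgGen; have [] := wh k.
have := sum_by_weight v (h^~ g) (fun=> 1).
rewrite (eq_bigr (fun k => h k g)) => [|k _]; last by rewrite mulr1.
rewrite -Eb => ->; rewrite -(big_mkord xpredT (fun i => \sum_(k | v k == nth 0 ws i) h k g)).
rewrite -(big_nth 0 xpredT (fun w => \sum_(k | v k == w) h k g)) big_filter [RHS]big_mkcond.
apply: eq_bigr => w _; rewrite mulr1; case: asboolP => // nd; exact: zero.
Qed.

(** If [b] has weight [u] for [chi], then [b (chi(t) c chi'(t)^-1)] is [t^-u] times a combination of
    the [t^v], where [v] runs over the weights for [chi'] in the translate of [b] by [c]. By
    [weight_support] these [v - u] are in the dual cone. This extends the inverse of the map in
    question. *)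
Lemma transition_extends sigma chi chi' c : torus_hom chi -> torus_hom chi' ->
  (forall rho i b, ray_generators Sigma rho -> val sigma rho -> KG b ->
     weight_filt chi rho i b -> weight_filt chi' rho i (fun g => b (gmul c g))) ->
  exists gbar : X -> G, morph_on (tU sigma) gbar /\
    forall t, gbar (xorb t) = gmul (gmul (chi' t) (ginv c)) (ginv (chi t)).
Proof.
move=> hchi hchi' filt.
have [b Kb|gbar [mg Eg]] := torus_to_group_extend hK (fanS := fanS) (X := X) (sigma := sigma)
    (gamma := fun t => gmul (gmul (chi t) c) (ginv (chi' t))).
  have [r [u [h [wh Eb _]]]] := weight_sum hK hchi Kb.
  have /choice[F HF] : forall j, exists F : X -> K, reg_on (tU sigma) F /\
      forall t, F (xorb t) = h j (gmul (gmul (chi t) c) (ginv (chi' t))).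
    move=> j; have Kh : KG (h j) by have [] := wh j.
    have [rho rr sr|r' [v [h' [wh' Eb']]]] := weight_support (sigma := sigma) (u := u j) hchi'
        (coordinate_ring_lmul c Kh).
      apply: filt => //; exists 1%N, (fun=> u j), (fun=> h j).
      by split=> // g; rewrite big_ord1.
    exists (fun x => \sum_k h' k gone * xchar sigma (v k - u j) x); split.
      apply: (reg_on_alg rX (S := [set f | reg_on (tU sigma) f])) => //.
      apply: alg_gen_sum => k _; apply: AlgMul; first exact: AlgCst.
      by apply: AlgGen; apply: reg_xchar; have [] := wh' k.
    move=> t; rewrite -gmulA (weight_space_mul _ _ (wh j)) Eb' mulr_sumr; apply: eq_bigr => k _.
    have [[_ wk] dk] := wh' k; rewrite xchar_xorb // charB.
    have := wk t gone; rewrite gmulg1 => ->; ring.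
  exists (fun x => \sum_j F j x); split=> [|t].
    apply: (reg_on_alg rX (S := [set f | reg_on (tU sigma) f])) => //.
    by apply: alg_gen_sum => j _; apply: AlgGen; case: (HF j).
  by rewrite Eb; apply: eq_bigr => j _; case: (HF j).
exists (fun x => ginv (gbar x)); split; first exact: morph_ginv.
by move=> t; rewrite Eg !ginvM ginvK gmulA.
Qed.

Lemma top_cover (x : X) : exists sigma, top_dimensional (val sigma) /\ tU sigma x.
Proof.
have [tau Ux] := toric_cover x; have [sigma [Ss smax] ts] := fan_maximal fanS (fcone_mem tau).
exists (fcone Ss); split; first exact: (hmax (conj Ss smax)).
by have [sub _] := @tU_sub K n Sigma X (fcone Ss) tau ts; apply: sub.
Qed.

Lemma orbit_point E (e1 e : E) t : proj e1 = xorb torus_one -> proj e = xorb t ->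
  exists g, e = ract (tact t e1) g.
Proof.
move=> pe1 pe; have [d [dP _]] := bundle_division E; exists (d (tact t e1) e).
by rewrite dP // proj_tact pe1 pe act_xorb torus_mul1.
Qed.

Lemma morph_eq_over E E' sigma (f f' : E -> E') : morph_on (over sigma) f -> morph_on (over sigma) f' ->
  (forall e, over sigma e -> over sigma (f e)) -> (forall e, over sigma e -> over sigma (f' e)) ->
  (forall e t, proj e = xorb t -> f e = f' e) -> forall e, over sigma e -> f e = f' e.
Proof.
move=> mf mf' of1 of2 eq e He; have [l [z cz]] := coords_over fanS E' sigma.
have rE := ringed_total E; have rE' := ringed_total E'.
apply: (coords_sep cz (of1 e He) (of2 e He)) => h Ah.
have rh := coords_alg_reg rE' cz Ah.
rewrite -[h (f e)]/((h \o f) e) -[h (f' e)]/((h \o f') e).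
apply: (eq_over_orbit hK (fanS := fanS) (sigma := sigma)) => //.
- exact: (morph_on_alg rE cz).
- exact: (morph_on_alg rE cz).
by move=> e' t Et; rewrite /= (eq e' t).
Qed.

(** Over the open orbit every point is [t e1 g], so equivariance determines the map there;
    [eq_over_orbit] carries the equality to the whole bundle. *)
Lemma bundle_map_ext E E' (e1 : E) (f f' : E -> E') : proj e1 = xorb torus_one ->
  bundle_map f -> bundle_map f' -> f e1 = f' e1 -> f = f'.
Proof.
move=> pe1 [mf pf gf tf] [mf' pf' gf' tf'] eq; apply/funext => e.
have sE := ringed_sheaf (ringed_total E).
have [sigma [_ Ue]] := top_cover (proj e).
apply: (morph_eq_over (sigma := sigma)) => //; [exact: morph_onTW..|by move=> ?; rewrite /over /= pf
  |by move=> ?; rewrite /over /= pf'|].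
by move=> e' t /(orbit_point pe1)[g ->]; rewrite gf gf' tf tf' eq.
Qed.

Section LocalMap.
Variables (E E' : principal_bundle X G) (sigma : Sigma) (s : X -> E') (k : E -> G) (gbar : X -> G).
Hypotheses (ms : morph_on (tU sigma) s) (mk : morph_on (over sigma) k) (mg : morph_on (tU sigma) gbar).

Lemma morph_local_map : morph_on (over sigma) (fun e => ract (s (proj e)) (gmul (gbar (proj e)) (k e))).
Proof.
have rE := ringed_total E; have rE' := ringed_total E'.
have sE := ringed_sheaf rE; have sE' := ringed_sheaf rE'.
have mp : morph_on (over sigma) (@proj _ _ _ _ _ E) by apply: morph_proj.
have m1 : morph_on (over sigma) (fun e : E => s (proj e)).
  exact: (@morph_on_comp _ E (over sigma) X (tU sigma) E' _ s sE mp).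
have m2 : morph_on (over sigma) (fun e : E => gbar (proj e)).
  exact: (@morph_on_comp _ E (over sigma) X (tU sigma) G _ gbar sE mp).
have m3 := morph_on_pair rE sE' sG m1 (morph_gmul rE m2 mk).
apply: (@morph_on_comp _ E _ (product E' G) setT E' _ (fun p => ract p.1 p.2) sE m3) => //.
exact: (morph_onTW _ (ringed_sheaf (ringed_product sE' sG)) (ract_morph E')).
Qed.

End LocalMap.

Lemma morph_of_top_cover E (Y : space K) (f : E -> Y) :
  (forall sigma, top_dimensional (val sigma) -> morph_on (over sigma) f) -> is_morphism f.
Proof.
move=> H; have sE := ringed_sheaf (ringed_total E); apply/(morph_onT _ sE).
apply: (morph_on_local sE) => e _; have [sigma [htop Ue]] := top_cover (proj e).
exists (over sigma); split=> //; first exact: over_open.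
by apply: morph_on_sub (H sigma htop) => e' [].
Qed.

Lemma base_point E : exists e1 : E, proj e1 = xorb torus_one.
Proof. exact: proj_surj. Qed.

(** Bijectivity holds on each fibre, as both are torsors. With a local section [s] the inverse maps
    [e] to [s(x)] times the quotient of [e] by [f (s x)], which is a morphism. *)
Lemma bundle_map_inverse E E' (f : E -> E') : bundle_map f ->
  exists f' : E' -> E, [/\ bundle_map f', cancel f f' & cancel f' f].
Proof.
move=> [mf pf gf tf]; have [d [dP _]] := bundle_division E; have [d' [dP' md']] := bundle_division E'.
have inj : injective f.
  move=> e e2 ee; have pe : proj e = proj e2 by rewrite -pf ee pf.
  have : ract (f e) (d e e2) = ract (f e) gone by rewrite -gf dP // ract1 ee.
  by move=> /(@ract_inj _ _ _ _ _ E' _) dd; rewrite -(dP _ _ pe) dd ract1.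
have surj e' : exists e, f e = e'.
  have [e pe] := @proj_surj _ _ _ _ _ E (proj e'); exists (ract e (d' (f e) e')).
  by rewrite gf dP' // pf.
have /choice[f' f'K] := surj.
have fK : cancel f f' by move=> e; apply: inj; rewrite f'K.
have pf' e : proj (f' e) = proj e by rewrite -[in RHS](f'K e) pf.
exists f'; split=> //; split=> //.
- apply: morph_of_top_cover => sigma htop; have [e1 pe1] := base_point E.
  have [chi [s [_ ms ps _ _]]] := frame_exists hK htop pe1.
  have rE' := ringed_total E'; have sE' := ringed_sheaf rE'; have sE := ringed_sheaf (ringed_total E).
  have mp : morph_on (over sigma) (@proj _ _ _ _ _ E') by apply: morph_proj.
  have m1 : morph_on (over sigma) (fun e : E' => f (s (proj e))).
    apply: (@morph_on_comp _ E' (over sigma) X (tU sigma) E' _ (f \o s) sE' mp) => //.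
    by apply: (@morph_on_comp _ X (tU sigma) E setT E' s f sX ms) => //; apply: morph_onTW.
  have mk : morph_on (over sigma) (fun e : E' => d' (f (s (proj e))) e).
    apply: (@morph_on_comp _ E' _ (product E' E') [set p | proj p.1 = proj p.2] G
      (fun e => (f (s (proj e)), e)) (fun p => d' p.1 p.2) sE' _ _ md').
      exact: (morph_on_pair rE' sE' sE' m1 (@morph_on_id _ E' _)).
    by move=> e He /=; rewrite pf ps.
  have mc := morph_cst (X := G) (tU sigma) gone rX.
  apply: morph_on_ext (morph_local_map ms mk mc) => e He /=.
  by apply: inj; rewrite f'K gf gmul1g dP' // pf ps.
- by move=> e g; apply: inj; rewrite gf !f'K.
by move=> t e; apply: inj; rewrite tf !f'K.
Qed.

End Transitions.

(** * Fully faithful and essentially surjective functors *)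

Section FullFaithful.
Variables (C D : category) (F : functor C D).
Hypothesis faithful : forall a b (f g : hom a b), fmap F f = fmap F g -> f = g.
Hypothesis full : forall a b (h : hom (F a) (F b)), exists f : hom a b, fmap F f = h.
Hypothesis ess : forall d : D, exists (c : C) (u : hom (F c) d) (v : hom d (F c)),
  comp u v = idm d /\ comp v u = idm (F c).

Lemma equivalence_of_full_faithful : equivalent_categories C D.
Proof.
pose G0 d : C := projT1 (cid (ess d)).
pose u d : hom (F (G0 d)) d := projT1 (cid (projT2 (cid (ess d)))).
pose v d : hom d (F (G0 d)) := projT1 (cid (projT2 (cid (projT2 (cid (ess d)))))).
have uv d : comp (u d) (v d) = idm d by case: (projT2 (cid (projT2 (cid (projT2 (cid (ess d))))))).
have vu d : comp (v d) (u d) = idm _ by case: (projT2 (cid (projT2 (cid (projT2 (cid (ess d))))))).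
pose lift a b (h : hom (F a) (F b)) : hom a b := projT1 (cid (full h)).
have liftK a b (h : hom (F a) (F b)) : fmap F (lift a b h) = h := projT2 (cid (full h)).
pose G1 d d' (f : hom d d') : hom (G0 d) (G0 d') := lift _ _ (comp (v d') (comp f (u d))).
have G1id d : G1 d d (idm d) = idm (G0 d).
  by apply: faithful; rewrite liftK comp_idl vu fmap_id.
have G1comp a b c (g : hom b c) (f : hom a b) : G1 _ _ (comp g f) = comp (G1 _ _ g) (G1 _ _ f).
  apply: faithful; rewrite fmap_comp !liftK -!comp_assoc; congr (comp _ (comp _ _)).
  by rewrite (comp_assoc (u b)) uv comp_idl.
pose G := Functor G1id G1comp.
exists F, G; split.
  exists (fun a => lift (G0 (F a)) a (u (F a))), (fun a => lift a (G0 (F a)) (v (F a))); split.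
  - by move=> a; apply: faithful; rewrite fmap_comp !liftK uv fmap_id.
  - by move=> a; apply: faithful; rewrite fmap_comp !liftK vu fmap_id.
  by move=> a b f; apply: faithful; rewrite /= !(fmap_comp F) !liftK comp_assoc uv comp_idl.
exists u, v; split=> // a b f /=.
by rewrite liftK comp_assoc uv comp_idl.
Qed.

End FullFaithful.

Lemma sig_ext (A : Type) (P : A -> Prop) (a b : {x | P x}) : sval a = sval b -> a = b.
Proof. by case: a b => [a Pa] [b Pb] /= E; apply: eq_exist. Qed.

(** * The functor is fully faithful *)

Section BundleFunctor.
Variables (K : closedFieldType) (n : nat).
Hypothesis hK : [pchar K] =i pred0.
Local Notation N := 'rV[int]_n.
Local Notation M := 'cV[int]_n.
Local Notation T := (torus K n).
Variable Sigma : set (set N).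
Hypothesis fanS : is_fan Sigma.
Hypothesis hmax : forall sigma, maximal_cone Sigma sigma -> top_dimensional sigma.
Variable X : toric_variety K Sigma.
Variable G : alg_group K.
Implicit Types (sigma : Sigma) (t : T) (g : G) (E : principal_bundle X G).
Local Notation R := (coordinate_algebra G).
Local Notation KG := (@coordinate_ring K G).
Local Notation xorb := (xorb fanS X).
Local Notation balg := (balg hK hmax).

Definition ltrans g (b : R) : R := exist _ _ (coordinate_ring_lmul g (svalP b)).

(** A function [F] that witnesses the degree of [b] pulls back along [f] to a witness for its left
    translate, with the same character [w]. *)
Lemma ltrans_filtered E E' (e1 : E) (e1' : E') (pe1 : proj e1 = xorb torus_one)
    (pe1' : proj e1' = xorb torus_one) (f : E' -> E) g : bundle_map f -> f e1' = ract e1 g ->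
  filtered_map (ltrans g : balg pe1 -> balg pe1').
Proof.
move=> [mf pf gf tf] fe1; split.
  by split=> [k a b|]; [apply: cring_ext|split=> [|a b]; apply: cring_ext].
move=> rho i b [Kb [w [F [wi rF EF]]]]; split; first exact: svalP.
have sE' := ringed_sheaf (ringed_total E').
exists w, (F \o f); split=> // [|t h].
  apply: (@morph_on_reg _ E' _ E (over (ray_cone rho)) f F sE') => //; first exact: morph_onTW.
  by move=> e; rewrite /over /= pf.
by rewrite /= gf tf fe1 tact_ract -ractM EF.
Qed.

(** The points [e1] and [e1'] identify the fibres over the unit with the group, and [f] with left
    translation by [g]; functions are carried along by the inverse translation. *)
Lemma ltrans_calg E E' (e1 : E) (e1' : E') (pe1 : proj e1 = xorb torus_one)
    (pe1' : proj e1' = xorb torus_one) (f : E -> E') g : bundle_map f -> f e1 = ract e1' g ->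
  calg_map (ltrans (ginv g) : balg pe1 -> balg pe1').
Proof.
move=> bf fe1; have [f' [bf' fK f'K]] := bundle_map_inverse hK fanS hmax bf.
have [_ _ gf' _] := bf'; split.
- apply: (ltrans_filtered pe1 pe1' bf').
  by rewrite -[e1'](ractV e1' g) -fe1 gf' fK.
- by move=> h a; apply: cring_ext => x /=; rewrite gmulA.
exists (ltrans g); split.
- exact: (ltrans_filtered pe1' pe1 bf).
- by move=> b; apply: cring_ext => x /=; rewrite gmulKg.
by move=> b; apply: cring_ext => x /=; rewrite gmulVKg.
Qed.

(** Since [phi] commutes with the group it is a left translation, by some [c]. Read in two frames,
    the map sought is multiplication by [chi'(t) c^-1 chi(t)^-1], which extends over the chart
    because [phi] respects the filtrations. The local maps agree over the open orbit, hence glue. *)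
Lemma bundle_map_of_calg E E' (e1 : E) (e1' : E') (pe1 : proj e1 = xorb torus_one)
    (pe1' : proj e1' = xorb torus_one) (phi : balg pe1 -> balg pe1') : calg_map phi ->
  exists (f : E -> E') g, [/\ bundle_map f, f e1 = ract e1' g & forall b, phi b = ltrans (ginv g) b].
Proof.
move=> [[[lin [phi1 phiM]] filt] equiv _].
pose ph (b : G -> K) : G -> K := if pselect (KG b) is left Kb then sval (phi (exist _ b Kb)) else 0.
have phE (b : R) : ph (sval b) = sval (phi b).
  by rewrite /ph; case: pselect => [Kb|[]]; [congr (sval (phi _)); apply: cring_ext|apply: svalP].
have phE' b (Kb : KG b) : ph b = sval (phi (exist _ b Kb)) by rewrite -phE.
have phiD (a b : R) : phi (a + b) = phi a + phi b by have := lin 1 a b; rewrite !scale1r.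
have phi0 : phi 0 = 0 by have := lin (-1) 0 0; rewrite !scaleN1r !addNr.
have phiZ k (a : R) : phi (k *: a) = k *: phi a by have := lin k a 0; rewrite phi0 !addr0.
have [c|a b Ka Kb|a b Ka Kb|b h Kb|c Ec] := @coordinate_ring_endo K G ph.
- rewrite (_ : (fun=> c) = sval (c *: (1 : R))); last by apply/funext => g; rewrite cringZ cring1 mulr1.
  by rewrite phE phiZ phi1.
- by rewrite -[a + b]/(sval ((exist _ a Ka : R) + (exist _ b Kb : R))) phE phiD !phE'.
- by rewrite -[a * b]/(sval ((exist _ a Ka : R) * (exist _ b Kb : R))) phE phiM !phE'.
- by rewrite -[X in ph X]/(sval (balg_act h (exist _ b Kb : R))) phE (equiv h) phE'.
have phic (b : R) : phi b = ltrans c b by apply: cring_ext => g; rewrite -phE Ec //; apply: svalP.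
have loc sigma : exists F : E -> E', top_dimensional (val sigma) -> [/\ morph_on (over sigma) F,
    forall e, over sigma e -> proj (F e) = proj e,
    forall e g, over sigma e -> F (ract e g) = ract (F e) g
    & forall t g, F (ract (tact t e1) g) = ract (tact t e1') (gmul (ginv c) g)].
  have [htop|ntop] := pselect (top_dimensional (val sigma)); last by exists (fun=> e1').
  have [chi [s fr]] := frame_exists hK htop pe1; have [chi' [s' fr']] := frame_exists hK htop pe1'.
  have [hchi ms ps _ _] := fr; have [hchi' ms' ps' _ _] := fr'.
  have [rho i b rr sr Kb wf|gbar [mg Eg]] := @transition_extends _ _ hK _ fanS X G sigma chi chi' c hchi hchi'.
    pose rh : ray_generators Sigma := SigSub (mem_set rr).
    have sr' : val sigma (val rh) by [].
    have fb : balg_filt e1 rh i (exist _ b Kb) by apply/(bundle_filtP hK fr i b sr').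
    by have := filt rh i _ fb; rewrite phic => /(bundle_filtP hK fr' i _ sr').
  have [k [mk kE ks kg kt]] := frame_coord fr.
  exists (fun e => ract (s' (proj e)) (gmul (gbar (proj e)) (k e))) => _; split.
  - exact: (morph_local_map ms' mk mg).
  - by move=> e He; rewrite proj_ract ps'.
  - by move=> e g He; rewrite proj_ract kg // gmulA ractM.
  move=> t g; rewrite proj_ract proj_tact pe1 act_xorb torus_mul1 (frame_orbit fr) (frame_orbit fr').
  have Ut : tU sigma (xorb t) by apply: xorb_tU.
  by rewrite -ractM ks // Eg -!ractM !gmulA gmulgVK.
have /choice[F HF] := loc.
pose sg (e : E) : Sigma := projT1 (cid (top_cover fanS hmax (proj e))).
have sgP e : top_dimensional (val (sg e)) /\ over (sg e) e := projT2 (cid (top_cover fanS hmax (proj e))).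
pose f e := F (sg e) e.
have fE sigma e : top_dimensional (val sigma) -> over sigma e -> f e = F sigma e.
  move=> htop He; have [htop' He'] := sgP e.
  have [m1 p1 _ E1] := HF _ htop; have [m2 p2 _ E2] := HF _ htop'.
  have sub (e' : E) : over (coneI fanS (sg e) sigma) e' -> over (sg e) e' /\ over sigma e'.
    by rewrite /over /= -tU_inter.
  have Hk : over (coneI fanS (sg e) sigma) e by rewrite /over /= -tU_inter.
  apply: (morph_eq_over hK (fanS := fanS) (sigma := coneI fanS (sg e) sigma) (f := F (sg e)) (f' := F sigma)) => //.
  - by apply: morph_on_sub m2 => e' /sub[].
  - by apply: morph_on_sub m1 => e' /sub[].
  - by move=> e' He1; rewrite /over /= p2 //; case: (sub e' He1).
  - by move=> e' He1; rewrite /over /= p1 //; case: (sub e' He1).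
  by move=> e' t /(orbit_point pe1)[g ->]; rewrite E1 E2.
have pf e : proj (f e) = proj e by have [htop He] := sgP e; have [_ p _ _] := HF _ htop; apply: p.
have forb t g : f (ract (tact t e1) g) = ract (tact t e1') (gmul (ginv c) g).
  by have [htop _] := sgP (ract (tact t e1) g); have [_ _ _ H] := HF _ htop; exact: H.
have mf : is_morphism f.
  apply: (morph_of_top_cover fanS hmax) => sigma htop; have [m _ _ _] := HF _ htop.
  by apply: morph_on_ext m => e He; rewrite (fE sigma).
have rE := ringed_total E; have rE' := ringed_total E'; have sE := ringed_sheaf rE; have sE' := ringed_sheaf rE'.
have mt (B : principal_bundle X G) t : @morph_on _ B setT B (tact t).
  have rB := ringed_total B; have sB := ringed_sheaf rB; have rT := ringed_torus K n.
  have mp := morph_on_pair rB (ringed_sheaf rT) sB (morph_cst (X := T) setT t rB) (@morph_on_id _ B setT).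
  apply: (@morph_on_comp _ B setT (product T B) setT B _ (fun p => tact p.1 p.2) sB mp) => //.
  exact: (morph_onTW _ (ringed_sheaf (ringed_product (ringed_sheaf rT) sB)) (tact_morph B)).
exists f, (ginv c); split.
- split=> //.
    move=> e g; have [htop He] := sgP e; have [_ _ gF _] := HF _ htop.
    by rewrite (fE (sg e) (ract e g)) ?gF //; apply: over_ract.
  move=> t e; have [htop He] := sgP e.
  have mfT : morph_on setT f by apply/morph_onT.
  apply: (morph_eq_over hK (fanS := fanS) (sigma := sg e) (f := f \o tact t) (f' := tact t \o f)) => //.
  - apply: (@morph_on_sub _ E setT) => //; exact: (@morph_on_comp _ E setT E setT E' _ f sE (mt E t)).
  - apply: (@morph_on_sub _ E setT) => //; exact: (@morph_on_comp _ E setT E' setT E' f _ sE mfT).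
  - by move=> e' He'; rewrite /over /= pf; apply: over_tact.
  - by move=> e' He'; apply: over_tact; rewrite /over /= pf.
  by move=> e' t' /(orbit_point pe1)[g ->]; rewrite /= tact_ract -tactM !forb tact_ract -tactM.
- by have := forb torus_one gone; rewrite !tact1 ract1 gmulg1.
by move=> b; rewrite ginvK phic.
Qed.

(** The algebra of a bundle requires a point over the unit of the torus, chosen once for each
    bundle; [base_shift] records how a bundle map moves the chosen points. *)
Definition base E : E := projT1 (cid (base_point fanS E)).
Lemma baseP E : proj (base E) = xorb torus_one. Proof. exact: projT2 (cid (base_point fanS E)). Qed.

Lemma base_shift_ex E E' (f : bundle_hom E E') : exists g, sval f (base E) = ract (base E') g.
Proof.
have [_ pf _ _] := svalP f.
have [|g Eg] := @orbit_point _ _ _ fanS _ _ E' (base E') (sval f (base E)) torus_one (baseP E').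
  by rewrite pf baseP.
by exists g; rewrite Eg tact1.
Qed.

Definition base_shift E E' (f : bundle_hom E E') : G := projT1 (cid (base_shift_ex f)).

Lemma base_shiftP E E' (f : bundle_hom E E') : sval f (base E) = ract (base E') (base_shift f).
Proof. exact: projT2 (cid (base_shift_ex f)). Qed.

Lemma base_shift_eq E E' (f : bundle_hom E E') g : sval f (base E) = ract (base E') g -> base_shift f = g.
Proof. by rewrite base_shiftP; apply: ract_inj. Qed.

Definition bundle_fmap E E' (f : bundle_hom E E') : calg_hom (balg (baseP E)) (balg (baseP E')) :=
  exist _ _ (ltrans_calg (baseP E) (baseP E') (svalP f) (base_shiftP f)).

Lemma bundle_fmap_id E : bundle_fmap (bundle_id E) = calg_id (balg (baseP E)).
Proof.
apply: eq_exist; apply/funext => b; apply: cring_ext => g /=.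
by rewrite (@base_shift_eq _ _ (bundle_id E) gone) ?ginv1 ?gmul1g //= ract1.
Qed.

Lemma bundle_fmap_comp E E' E'' (f' : bundle_hom E' E'') (f : bundle_hom E E') :
  bundle_fmap (bundle_comp f' f) = calg_comp (bundle_fmap f') (bundle_fmap f).
Proof.
apply: eq_exist; apply/funext => b; apply: cring_ext => g /=.
rewrite (@base_shift_eq _ _ (bundle_comp f' f) (gmul (base_shift f') (base_shift f))).
  by rewrite ginvM gmulA.
by rewrite /= base_shiftP; have [_ _ -> _] := svalP f'; rewrite base_shiftP ractM.
Qed.

Definition bundle_functor : functor (Pbun X G) (Calg Sigma G) :=
  @Functor (Pbun X G) (Calg Sigma G) (fun E => balg (baseP E)) bundle_fmap bundle_fmap_id bundle_fmap_comp.

Lemma bundle_functor_faithful (E E' : Pbun X G) (f f' : hom E E') :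
  fmap bundle_functor f = fmap bundle_functor f' -> f = f'.
Proof.
move=> eq; apply: sig_ext; apply: (bundle_map_ext hK (fanS := fanS) hmax (baseP E) (svalP f) (svalP f')).
rewrite !base_shiftP; congr ract; rewrite -[base_shift f]ginvK -[base_shift f']ginvK; congr ginv.
apply: coordinate_ring_sep => b Kb.
have := congr1 (fun h : calg_hom (balg (baseP E)) (balg (baseP E')) => sval (sval h (exist _ b Kb)) gone) eq.
by rewrite /= !gmulg1.
Qed.

Lemma bundle_functor_full (E E' : Pbun X G) (h : hom (bundle_functor E) (bundle_functor E')) :
  exists f : hom E E', fmap bundle_functor f = h.
Proof.
have [f [g [bf fe Eh]]] := bundle_map_of_calg (svalP h).
exists (exist _ f bf); apply: sig_ext; apply/funext => b.
rewrite Eh; congr (ltrans (ginv _) b).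
by apply: (@base_shift_eq _ _ (exist _ f bf)).
Qed.

End BundleFunctor.

(** * Gluing bundles *)

Section GluingTools.
Variable K : closedFieldType.

Lemma alg_gen_slice1 (P Q : Type) m l (y : 'I_m -> P -> K) (z : 'I_l -> Q -> K) H q :
  alg_gen (range (pair_fun y z)) H -> alg_gen (range y) (fun p => H (p, q)).
Proof.
apply: (@alg_gen_comp K P (P * Q)%type (fun p => (p, q))) => _ [i _ <-].
rewrite /pair_fun; case: (fintype.split i) => j; first exact: alg_gen_range.
exact: (AlgCst _ (z j q)).
Qed.

Lemma alg_gen_slice2 (P Q : Type) m l (y : 'I_m -> P -> K) (z : 'I_l -> Q -> K) H p :
  alg_gen (range (pair_fun y z)) H -> alg_gen (range z) (fun q => H (p, q)).
Proof.
apply: (@alg_gen_comp K Q (P * Q)%type (fun q => (p, q))) => _ [i _ <-].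
rewrite /pair_fun; case: (fintype.split i) => j; last exact: alg_gen_range.
exact: (AlgCst _ (y j p)).
Qed.

(** On each of the finitely many affine pieces a function regular off the zeros of [h] is a
    polynomial over a power of [h]; the largest exponent serves for all pieces. *)
Lemma reg_extend (X : space K) (Q : set X) h f r (W : 'I_r -> set X) : ringed X ->
  (forall i, open (W i)) -> (forall p, Q p -> exists i, W i p) ->
  (forall i, exists l (z : 'I_l -> X -> K), coords (Q `&` W i) z) ->
  reg_on Q h -> reg_on (Q `&` [set p | h p != 0]) f ->
  exists N F, reg_on Q F /\ forall p, Q p -> h p != 0 -> F p = h p ^+ N * f p.
Proof.
move=> rX oW cov cW rh rf.
have /choice[Ng H] : forall i, exists Ng : nat * (X -> K), reg_on (Q `&` W i) Ng.2 /\
    forall p, Q p -> W i p -> h p != 0 -> h p ^+ Ng.1 * f p = Ng.2 p.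
  move=> i; have [l [z cz]] := cW i.
  have [a Aa Ea] := coords_reg_alg cz (reg_on_sub (@subIsetl _ Q (W i)) rh).
  have c2 := coords_principal rX cz Aa.
  have [|g Ag Eg] := coords_reg_alg (f := f) c2.
    by apply: reg_on_sub rf => p [[Qp Wp] /= ap]; split=> //=; rewrite Ea.
  have [N [g' [Ag' Eg']]] := alg_gen_snoc_inv Aa Ag.
  exists (N, g'); split; first exact: coords_alg_reg cz Ag'.
  move=> p Qp Wp hp; have QW : (Q `&` W i) p by [].
  have ap : a p != 0 by rewrite -Ea.
  by rewrite Eg //= Eg' // Ea // mulrC divfK // expf_neq0.
pose N := (\max_i (Ng i).1)%N.
(* One more factor than needed to clear denominators makes the local extensions vanish with [h], so
   that they agree with the value 0 chosen there. *)
exists N.+1, (fun p => if h p == 0 then 0 else h p ^+ N.+1 * f p); split; last first.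
  by move=> p _ /negPf ->.
apply: (reg_on_local (ringed_sheaf rX)) => p Qp; have [i Wp] := cov p Qp.
exists (W i); split=> //; have [rg Eg] := H i.
apply: (@reg_on_ext _ X _ (fun p => h p ^+ (N - (Ng i).1).+1 * (Ng i).2 p)).
  move=> q [Qq Wq]; case: eqP => [->|/eqP hq]; first by rewrite exprS !mul0r.
  by rewrite -Eg // mulrA -exprD addSn subnK // (leq_bigmax i).
apply: (reg_on_mul rX) => //.
apply: (reg_on_alg rX (S := [set h | reg_on (Q `&` W i) h])) => //.
by apply: alg_gen_exp; apply: AlgGen; apply: reg_on_sub rh => q [].
Qed.

End GluingTools.

(** * The bundle glued from a family of homomorphisms *)

Section GluedBundle.
Variables (K : closedFieldType) (n : nat).
Hypothesis hK : [pchar K] =i pred0.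
Local Notation N := 'rV[int]_n.
Local Notation M := 'cV[int]_n.
Local Notation T := (torus K n).
Variable Sigma : set (set N).
Hypothesis fanS : is_fan Sigma.
Hypothesis hmax : forall sigma, maximal_cone Sigma sigma -> top_dimensional sigma.
Variable X : toric_variety K Sigma.
Variable G : alg_group K.
Implicit Types (sigma kappa : Sigma) (t : T) (u : M) (g h : G) (b : G -> K) (x : X).
Local Notation KG := (@coordinate_ring K G).
Local Notation xorb := (xorb fanS X).
Let rX := ringed_toric X.
Let rT := ringed_torus K n.
Let rG := ringed_group G.
Let sX := ringed_sheaf rX.
Let sT := ringed_sheaf rT.
Let sG := ringed_sheaf rG.
Let rXG : ringed (product X G) := ringed_product sX sG.
Local Notation top sigma := (top_dimensional (val sigma)).

Lemma toric_act1 x : toric_act torus_one x = x.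
Proof.
have [sigma [p _ <-]] := toric_cover x; rewrite toric_chart_act; congr (toric_chart X _).
by apply: sg_point_inj; apply/funext => u /=; rewrite mul1r.
Qed.

Lemma toric_actM t t' x : toric_act (torus_mul t t') x = toric_act t (toric_act t' x).
Proof.
have [sigma [p _ <-]] := toric_cover x; rewrite !toric_chart_act; congr (toric_chart X _).
by apply: sg_point_inj; apply/funext => u /=; rewrite mulrA.
Qed.

Variable chi : Sigma -> T -> G.
Hypothesis chi_hom : forall sigma, top sigma -> torus_hom (chi sigma).
Hypothesis chi_filt : forall sigma sigma' rho i b, top sigma -> top sigma' -> ray_generators Sigma rho ->
  val sigma rho -> val sigma' rho -> KG b ->
  weight_filt (chi sigma) rho i b -> weight_filt (chi sigma') rho i b.

(** [transition_extends] with [c = 1] on the intersection of the two cones, whose rays are common to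
    both, so that [chi_filt] applies. Other pairs of cones get a constant map. *)
Lemma glue_exists : exists gamma : Sigma -> Sigma -> X -> G, forall sigma sigma', top sigma -> top sigma' ->
  morph_on (tU (coneI fanS sigma sigma')) (gamma sigma sigma') /\
  forall t, gamma sigma sigma' (xorb t) = gmul (chi sigma' t) (ginv (chi sigma t)).
Proof.
have H (ss : Sigma * Sigma) : exists f : X -> G, top ss.1 -> top ss.2 ->
    morph_on (tU (coneI fanS ss.1 ss.2)) f /\ forall t, f (xorb t) = gmul (chi ss.2 t) (ginv (chi ss.1 t)).
  case: (pselect (top ss.1)) => t1; last by exists (fun=> gone).
  case: (pselect (top ss.2)) => t2; last by exists (fun=> gone).
  have [rho i b rr [s1 s2] Kb wf|f [mf Ef]] := @transition_extends _ _ hK _ fanS X G (coneI fanS ss.1 ss.2)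
      (chi ss.1) (chi ss.2) gone (chi_hom t1) (chi_hom t2).
    have := chi_filt t1 t2 rr s1 s2 Kb wf.
    by congr weight_filt; apply/funext => g; rewrite gmul1g.
  by exists f => _ _; split=> // t; rewrite Ef ginv1 gmulg1.
have /choice[f Hf] := H; exists (fun s s' => f (s, s')) => s s' t1 t2; exact: (Hf (s, s')).
Qed.

Let gamma := projT1 (cid glue_exists).
Let gammaP sigma sigma' : top sigma -> top sigma' ->
  morph_on (tU (coneI fanS sigma sigma')) (gamma sigma sigma') /\
  forall t, gamma sigma sigma' (xorb t) = gmul (chi sigma' t) (ginv (chi sigma t)).
Proof. exact: projT2 (cid glue_exists) sigma sigma'. Qed.

Let gamma_id sigma x : top sigma -> tU sigma x -> gamma sigma sigma x = gone.
Proof.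
move=> ts Ux; have [mg Eg] := gammaP ts ts.
have Uc : tU (coneI fanS sigma sigma) x by rewrite -tU_inter.
apply: (morph_to_group_unique hK (fanS := fanS) mg (morph_cst (X := G) _ gone rX) _ Uc) => t.
by rewrite Eg gmulgV.
Qed.

Let gamma_comp s1 s2 s3 x : top s1 -> top s2 -> top s3 -> tU s1 x -> tU s2 x -> tU s3 x ->
  gmul (gamma s2 s3 x) (gamma s1 s2 x) = gamma s1 s3 x.
Proof.
move=> t1 t2 t3 U1 U2 U3.
have [m12 E12] := gammaP t1 t2; have [m23 E23] := gammaP t2 t3; have [m13 E13] := gammaP t1 t3.
pose c := coneI fanS (coneI fanS s1 s2) s3.
have cE y : tU c y -> [/\ tU s1 y, tU s2 y & tU s3 y] by rewrite -!tU_inter => -[[]].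
have Uc : tU c x by rewrite -!tU_inter.
apply: (morph_to_group_unique hK (fanS := fanS) (sigma := c) (f := fun x => gmul (gamma s2 s3 x) (gamma s1 s2 x))) => //.
- apply: morph_gmul => //; [apply: morph_on_sub m23|apply: morph_on_sub m12] => y /cE[? ? ?];
  by rewrite -tU_inter.
- by apply: morph_on_sub m13 => y /cE[? ? ?]; rewrite -tU_inter.
by move=> t /=; rewrite E12 E23 E13 gmulA gmulgVK.
Qed.

Let morph_toric_act sigma t : morph_on (tU sigma) (fun x : X => toric_act t x).
Proof.
have mp := morph_on_pair rX sT sX (morph_cst (X := T) (tU sigma) t rX) (@morph_on_id _ X (tU sigma)).
by apply: (@morph_on_comp _ X (tU sigma) (product T X) (setT `*` tU sigma) X _ (fun p => toric_act p.1 p.2) sX mp _ (morph_act fanS sigma)).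
Qed.

Let gamma_act s1 s2 t x : top s1 -> top s2 -> tU s1 x -> tU s2 x ->
  gamma s1 s2 (toric_act t x) = gmul (gmul (chi s2 t) (gamma s1 s2 x)) (ginv (chi s1 t)).
Proof.
move=> t1 t2 U1 U2; have [m12 E12] := gammaP t1 t2.
have [_ h1] := chi_hom t1; have [_ h2] := chi_hom t2.
have Uc : tU (coneI fanS s1 s2) x by rewrite -tU_inter.
have m1 : morph_on (tU (coneI fanS s1 s2)) (fun x => gamma s1 s2 (toric_act t x)).
  apply: (@morph_on_comp _ X _ X (tU (coneI fanS s1 s2)) G _ (gamma s1 s2) sX (@morph_toric_act _ t)) => //.
  by move=> y; apply: tU_act.
have m2 : morph_on (tU (coneI fanS s1 s2)) (fun x => gmul (gmul (chi s2 t) (gamma s1 s2 x)) (ginv (chi s1 t))).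
  by do !apply: (morph_gmul rX); [apply: morph_cst| |apply: morph_cst].
apply: (morph_to_group_unique hK (fanS := fanS) m1 m2 _ Uc) => t'.
by rewrite act_xorb !E12 h1 h2 ginvM !gmulA.
Qed.

Let jj x : Sigma := projT1 (cid (top_cover fanS hmax x)).
Let jjP x : top (jj x) /\ tU (jj x) x := projT2 (cid (top_cover fanS hmax x)).

(* As a set, the total space is X * G, read over x in the chart of the cone
   [jj x]; [kk sigma] and [mk sigma] translate to and from the chart of sigma. *)
Let P : Type := (X * G)%type.
Let cc sigma x : G := gamma sigma (jj x) x.
Let kk sigma (p : P) : G := gmul (ginv (cc sigma p.1)) p.2.
Let mk sigma x g : P := (x, gmul (cc sigma x) g).

Let kk_mk s1 s2 x g : top s1 -> top s2 -> tU s1 x -> tU s2 x -> kk s2 (mk s1 x g) = gmul (gamma s1 s2 x) g.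
Proof.
move=> t1 t2 U1 U2; have [tj Uj] := jjP x.
by rewrite /kk /mk /cc /= -(gamma_comp t1 t2 tj) // -gmulA gmulKg.
Qed.

Let mk_kk sigma (p : P) : mk sigma p.1 (kk sigma p) = p.
Proof. by case: p => x h; rewrite /mk /kk /= gmulVKg. Qed.

Let kk_trans s1 s2 (p : P) : top s1 -> top s2 -> tU s1 p.1 -> tU s2 p.1 ->
  kk s2 p = gmul (gamma s1 s2 p.1) (kk s1 p).
Proof. by move=> t1 t2 U1 U2; rewrite -{1}(mk_kk s1 p) kk_mk. Qed.

Let kk_mkid sigma x g : top sigma -> tU sigma x -> kk sigma (mk sigma x g) = g.
Proof. by move=> ts Ux; rewrite kk_mk // gamma_id // gmul1g. Qed.

Let ov kappa : set P := [set p : P | tU kappa p.1].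

(** A chart is given by a cone [kappa], over which it lies, and a top-dimensional cone containing
    [kappa], which supplies the fibre coordinate. Allowing smaller [kappa] makes overlaps of charts
    into charts, as [directed] requires. *)
Definition glued_charts : set (set P * set (P -> K)) := [set c | exists kappa sigma,
  [/\ top sigma, val kappa `<=` val sigma & c = (ov kappa,
    [set f | exists2 u, dual_cone (val kappa) u & f = fun p : P => xchar kappa u p.1] `|`
    [set f | exists2 b, KG b & f = b \o kk sigma])]].

Let chart_in kappa sigma : top sigma -> val kappa `<=` val sigma -> glued_charts (ov kappa,
    [set f | exists2 u, dual_cone (val kappa) u & f = fun p : P => xchar kappa u p.1] `|`
    [set f | exists2 b, KG b & f = b \o kk sigma]).
Proof. by move=> ts ks; exists kappa, sigma. Qed.

Let gamma_reg kappa s1 s2 b : top s1 -> top s2 -> val kappa `<=` val s1 -> val kappa `<=` val s2 -> KG b ->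
  reg_on (tU kappa) (b \o gamma s1 s2).
Proof.
move=> t1 t2 k1 k2 Kb; have [m12 _] := gammaP t1 t2.
apply: morph_on_group_reg Kb => //; apply: morph_on_sub m12 => x Ux; rewrite -tU_inter.
by split; [apply: (tU_sub X k1).1|apply: (tU_sub X k2).1].
Qed.

Let glued_directed : directed glued_charts.
Proof.
split=> [p|D S D' S' p [k1 [s1 [t1 ks1 [-> ->]]]] [k2 [s2 [t2 ks2 [-> ->]]]] D1 D2].
  have [tj Uj] := jjP p.1; have C := @chart_in (jj p.1) (jj p.1) tj (fun _ H => H).
  exact: (ex_intro _ _ (ex_intro _ _ (conj C Uj))).
pose k := coneI fanS k1 k2.
have kk1 : val k `<=` val k1 by move=> v [].
have kk2 : val k `<=` val k2 by move=> v [].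
have ks1' : val k `<=` val s1 by move=> v /kk1/ks1.
have ks2' : val k `<=` val s2 by move=> v /kk2/ks2.
have C := chart_in t1 ks1'.
refine (ex_intro _ _ (ex_intro _ _ (And5 C _ _ _ _))).
- by rewrite /ov /= -tU_inter.
- by move=> q; rewrite /ov /= -tU_inter.
- move=> f [[u du ->]|[b Kb ->]]; last by exists (b \o kk s1) => //; apply: AlgGen; right; exists b.
  exists (fun p => xchar k u p.1) => [|q Dq]; last by rewrite (tU_sub X kk1).2.
  by apply: AlgGen; left; exists u => // v /kk1; apply: du.
move=> f [[u du ->]|[b Kb ->]].
  exists (fun p => xchar k u p.1) => [|q Dq]; last by rewrite (tU_sub X kk2).2.
  by apply: AlgGen; left; exists u => // v /kk2; apply: du.
have [r [a [a' [Ka Ka' Eb]]]] := coordinate_ring_comul Kb.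
have /choice[F HF] : forall i, exists F : X -> K, (forall q, ov k q -> a i (gamma s1 s2 q.1) = F q.1) /\
    alg_gen ([set f | exists2 u, dual_cone (val k) u & f = fun p : P => xchar k u p.1] `|`
             [set f | exists2 b, KG b & f = b \o kk s1]) (fun p => F p.1).
  move=> i; have [m [c [u [du EF]]]] := reg_tU fanS (gamma_reg t1 t2 ks1' ks2' (Ka i)).
  exists (fun x => \sum_j c j * xchar k (u j) x); split; first by move=> q Dq; apply: EF.
  apply: alg_gen_sum => j _; apply: AlgMul; first exact: AlgCst.
  by apply: AlgGen; left; exists (u j).
exists (fun p => \sum_i F i p.1 * a' i (kk s1 p)) => [|q Dq].
  apply: alg_gen_sum => i _; apply: AlgMul; first by case: (HF i).
  by apply: AlgGen; right; exists (a' i).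
have [U1 U2] : tU s1 q.1 /\ tU s2 q.1 by split; [apply: (tU_sub X ks1').1|apply: (tU_sub X ks2').1].
by rewrite /= (kk_trans t1 t2 U1 U2) Eb; apply: eq_bigr => i _; rewrite -(HF i).1.
Qed.

Definition glued : space K := gen_space glued_charts.
Local Notation E := glued.
Let rE : ringed E := gen_ringed glued_directed.
Let sE := ringed_sheaf rE.

Let cone_top kappa : exists sigma, top sigma /\ val kappa `<=` val sigma.
Proof.
have [sigma [Ss smax] ks] := fan_maximal fanS (fcone_mem kappa).
by exists (fcone Ss); split=> //; exact: (hmax (conj Ss smax)).
Qed.

Let ov_open kappa : @open E (ov kappa).
Proof.
have [sigma [ts ks]] := cone_top kappa.
have := gen_basic_open (chart_in ts ks) (AlgCst _ 1); congr open.
by apply/seteqP; split=> [p []//|p Hp]; split=> //=; apply: oner_neq0.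
Qed.

Let gen_reg D S f : glued_charts (D, S) -> alg_gen S f -> @reg_on _ E D f.
Proof.
move=> C Af p Dp; exists D, f; split=> //.
  by have [k [s [_ _ [-> _]]]] := C; apply: ov_open.
move=> q Dq; exists D, S, f, (fun=> 1); split=> //; [exact: AlgCst|by split=> //; apply: oner_neq0|].
by move=> *; rewrite divr1.
Qed.

Let morph_fst kappa : @morph_on _ E (ov kappa) X fst.
Proof.
have [sigma [ts ks]] := cone_top kappa; have [m [u [du cU]]] := coords_tU fanS X kappa.
apply: (morph_on_coords rE rX cU) => // i; apply: gen_reg (chart_in ts ks) _.
by apply: AlgGen; left; exists (u i).
Qed.

Let morph_kk kappa sigma : top sigma -> val kappa `<=` val sigma -> @morph_on _ E (ov kappa) G (kk sigma).
Proof.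
move=> ts ks; apply: (morph_on_group rE) => b Kb; apply: gen_reg (chart_in ts ks) _.
by apply: AlgGen; right; exists b.
Qed.

Let morph_mk sigma (Y : space K) (Z : set Y) (f : Y -> X) (a : Y -> G) : top sigma -> ringed Y ->
  morph_on Z f -> (forall y, Z y -> tU sigma (f y)) -> morph_on Z a ->
  @morph_on _ Y Z E (fun y => mk sigma (f y) (a y)).
Proof.
move=> ts rY mf Zf ma; apply: (morph_on_gen glued_directed rY) => D S p [k [s [ts' ks [-> ->]]]] Zp Dp.
have sY := ringed_sheaf rY.
have [W [oW Wp HW]] := (mf _ (tU_open X k)).1 p Zp Dp.
have ZW y : Z y -> W y -> tU k (f y) by move=> Zy Wy; apply: HW.
exists W; split=> // h [[u du ->]|[b Kb ->]].
  apply: (@morph_on_reg _ Y _ X (tU k) f (xchar k u) sY); first by apply: morph_on_sub mf => y [].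
    by move=> y [Zy Wy]; apply: ZW.
  exact: reg_xchar.
have [mg _] := gammaP ts ts'.
have Us y : Z y -> W y -> tU s (f y) by move=> Zy Wy; apply: (tU_sub X ks).1; apply: ZW.
apply: (@reg_on_ext _ Y _ (fun y => b (gmul (gamma sigma s (f y)) (a y)))).
  by move=> y [Zy Wy] /=; rewrite kk_mk //; [apply: Zf|apply: Us].
have m2 : morph_on (Z `&` W) (fun y => gmul (gamma sigma s (f y)) (a y)).
  apply: morph_gmul => //; last by apply: morph_on_sub ma => y [].
  apply: (@morph_on_comp _ Y _ X (tU (coneI fanS sigma s)) G f (gamma sigma s) sY) => //.
    by apply: morph_on_sub mf => y [].
  by move=> y [Zy Wy]; rewrite -tU_inter; split; [apply: Zf|apply: Us].
exact: morph_on_group_reg rY m2 Kb.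
Qed.

Let glued_coords kappa sigma : top sigma -> val kappa `<=` val sigma ->
  forall (V : set X) m (y : 'I_m -> X -> K), V `<=` tU kappa -> coords V y ->
  forall l (z : 'I_l -> G -> K), coords setT z ->
  @coords _ E [set p | V p.1] _ (fun i => pair_fun y z i \o (fun p : P => (p.1, kk sigma p))).
Proof.
move=> ts ks V m y VU cy l z cz; have cXG := coords_prod rX rG cy cz.
have Vs x : V x -> tU sigma x by move=> Vx; apply: (tU_sub X ks).1; apply: VU.
have mf : @morph_on _ E [set p | V p.1] (product X G) (fun p : P => (p.1, kk sigma p)).
  apply: (morph_on_pair rE sX sG).
    by apply: morph_on_sub (@morph_fst kappa) => p; apply: VU.
  by apply: morph_on_sub (morph_kk ts ks) => p; apply: VU.
apply: (coords_transport (T := E) rXG rE cXG mf) => //.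
- by move=> [x g] [/= Vx _]; exists (mk sigma x g) => //=; rewrite kk_mkid //; apply: Vs.
- by move=> p q _ _ [e1 e2]; rewrite -(mk_kk sigma p) -(mk_kk sigma q) e1 e2.
apply: (transport_inverse (X := product X G) (T := E) (g := fun p => mk sigma p.1 p.2) rXG (Z := V `*` setT)) => //.
- by move=> p _; exact: (mk_kk sigma p).
apply: (@morph_mk sigma (product X G) _ fst snd) => //; [exact: morph_on_fst|by move=> p [/= /Vs]|exact: morph_on_snd].
Qed.

Let coords_ov kappa : exists l (z : 'I_l -> P -> K), @coords _ E (ov kappa) _ z.
Proof.
have [sigma [ts ks]] := cone_top kappa; have [m [u [du cU]]] := coords_tU fanS X kappa.
have [l [z cz]] := group_coords G.
exact: (ex_intro _ _ (ex_intro _ _ (glued_coords ts ks (fun _ H => H) cU cz))).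
Qed.

Let m_proj : @morph_on _ E setT X fst.
Proof.
apply: (morph_on_local sE) => p _; have [tj Uj] := jjP p.1.
exists (ov (jj p.1)); split=> //.
by apply: morph_on_sub (@morph_fst (jj p.1)) => q [].
Qed.

Let preim_open (V : set X) : open V -> @open E [set p | V p.1].
Proof.
move=> oV; apply: open_local => p Vp; have [W [oW Wp HW]] := (m_proj oV).1 p Logic.I Vp.
by exists W; split=> // q; apply: HW.
Qed.

(** Two points with distinct projections are separated by the base, which is a variety. Two distinct
    points over the same [x] lie in one affine chart, where some function takes different values at
    them. *)
Let glued_closed : @closed (product E E) [set p | p.1 = p.2].
Proof.
have rEE := ringed_product sE sE; have sEE := ringed_sheaf rEE; have rXX := ringed_product sX sX.
rewrite -openC; apply: (@open_local (product E E)) => -[p q] /= npq.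
have [pq1|npq1] := eqVneq p.1 q.1; last first.
  have [_ _ clX] := toric_is_variety X.
  have m2 : @morph_on _ (product E E) setT (product X X) (fun r => (r.1.1, r.2.1)).
    apply: (morph_on_pair rEE sX sX).
      by apply: (@morph_on_comp _ (product E E) setT E setT X fst fst sEE) => //; apply: morph_on_fst.
    by apply: (@morph_on_comp _ (product E E) setT E setT X snd fst sEE) => //; apply: morph_on_snd.
  have oC : @open (product X X) (~` [set r | r.1 = r.2]) by rewrite openC.
  have [|W [oW Wp HW]] := (m2 _ oC).1 (p, q) Logic.I; first exact/eqP.
  by exists W; split=> // r Wr /= e; apply: (HW r Logic.I Wr) => /=; rewrite e.
have [tj Uj] := jjP p.1; have [l [z cz]] := coords_ov (jj p.1).
have Up : ov (jj p.1) p by []. have Uq : ov (jj p.1) q by rewrite /ov /= -pq1.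
have [f [Af fpq]] : exists f, alg_gen (range z) f /\ f p != f q.
  apply: contrapT => /forallNP H; apply: npq; apply: (coords_sep cz Up Uq) => f Af.
  by apply/eqP; apply: contrapT => /negP nf; apply: (H f).
pose D : set (product E E) := ov (jj p.1) `*` ov (jj p.1).
have oD : open D by apply: product_open; apply: ov_open.
have rf := coords_alg_reg rE cz Af.
pose F (r : product E E) : K := f r.1 + - 1 * f r.2.
have rF : reg_on D F.
  apply: (reg_on_add rEE); last apply: (reg_on_mul rEE (reg_on_cst rEE _)).
    apply: (@morph_on_reg _ (product E E) _ E (ov (jj p.1)) fst f sEE) => //; first exact: morph_on_fst.
    by move=> r [].
  apply: (@morph_on_reg _ (product E E) _ E (ov (jj p.1)) snd f sEE) => //; first exact: morph_on_snd.
  by move=> r [].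
exists (D `&` [set r | F r != 0]); split.
- exact: (regular_open_nz rEE oD (reg_on_regular sEE oD rF)).
- by split=> //=; rewrite /F /= mulN1r subr_eq0.
by move=> [r1 r2] [_ /= nz] e; case/eqP: nz; rewrite /F /= e mulN1r subrr.
Qed.

Let glued_variety : variety E.
Proof.
have [finS _ _ _ _] := fanS.
have /finite_seqP[L SL] := finS.
have LS i : Sigma (tnth (in_tuple L) i) by rewrite SL /=; apply: mem_tnth.
apply: (@coords_variety _ E (size L) (fun i => ov (fcone (LS i))) rE) => [i|p|].
- by split; [apply: ov_open|apply: coords_ov].
- have [tj Uj] := jjP p.1; have inL s : Sigma s -> s \in L by rewrite SL.
  have := inL _ (fcone_mem (jj p.1)).
  rewrite -index_mem => iL; exists (Ordinal iL).
  rewrite /ov /= (_ : fcone _ = jj p.1) //; apply: val_inj => /=.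
  by rewrite (tnth_nth (val (jj p.1))) /= nth_index // -index_mem.
exact: glued_closed.
Qed.

(** Locally the total space is a product with the group, where functions separate. Finitely many
    points [pt l] of the group detect all linear relations, so the functions [B i (x, g)] are the
    sums of the [B i (x, pt l) * lam l g]. The given relation, evaluated at [g = pt l], is the
    required relation on the base. *)
Let glued_flat : @flat_morphism K E X fst.
Proof.
move=> e0 r a b _ rb near0.
have [ts U0] := jjP e0.1; set sigma := jj e0.1 in ts U0.
have [m [u [_ cU]]] := coords_tU fanS X sigma; have [l [z cz]] := group_coords G.
have cE := glued_coords ts (fun _ H => H) (fun _ H => H) cU cz.
set y := (fun i : 'I_m => xchar sigma (u i)) in cU cE.
have [db [be [Adb db0 Abe Ebe]]] := coords_common_denominator cE (F := b) (p := e0) U0 rb.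
have [hh [Ahh hh0 Ehh]] := coords_near cE (p := e0) U0 near0.
have [Db ADb EDb] := alg_gen_precomp Adb; have [H AH EH] := alg_gen_precomp Ahh.
have /choice[B HB] : forall i, exists B, alg_gen (range (pair_fun y z)) B /\ be i = B \o (fun p : P => (p.1, kk sigma p)).
  by move=> i; have [B AB EB] := alg_gen_precomp (Abe i); exists B.
have sep i : exists L : {k : nat & (('I_k -> X -> K) * ('I_k -> G -> K))%type},
    [/\ forall j, alg_gen (range y) ((projT2 L).1 j), forall j, alg_gen (range z) ((projT2 L).2 j)
      & forall x g, B i (x, g) = \sum_j (projT2 L).1 j x * (projT2 L).2 j g].
  by have [AB _] := HB i; have [k [f [h [Af Ah E]]]] := alg_gen_pair_sum AB; exists (existT _ k (f, h)).
have {sep} /choice[L HL] := sep.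
pose eta x g := H (x, g) * Db (x, g).
pose hI (ij : {i : 'I_r & 'I_(projT1 (L i))}) := (projT2 (L (tag ij))).2 (tagged ij).
(* The points are taken where [eta] is nonzero at the base point of [e0]: then the given relation,
   and the expression of the [b i] with denominator [db], are valid at [(x, pt l)] for all [x] near
   that point. *)
have [q [pt [ptA [mu Emu]]]] := spanning_points [set g | eta e0.1 g != 0] hI.
pose lam l' g := \sum_ij mu l' ij * hI ij g.
have KGz f : alg_gen (range z) f -> KG f by rewrite (coordinate_ringE cz).
have Klam l' : KG (lam l').
  rewrite -coordinate_ring_alg; apply: alg_gen_sum => ij _; apply: AlgMul; first exact: AlgCst.
  by apply: AlgGen; apply: KGz; have [_ Ah _] := HL (tag ij); apply: Ah.
have regk f : KG f -> @reg_on _ E (ov sigma) (f \o kk sigma).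
  by move=> Kf; apply: morph_on_group_reg rE (morph_kk ts (fun _ H => H)) Kf.
have rdb := coords_alg_reg rE cE Adb.
have oV : @open E (ov sigma `&` [set p | db p != 0]).
  by apply: (regular_open_nz rE (@ov_open sigma)); apply: (reg_on_regular sE) => //; apply: ov_open.
exists q, (fun i l' x => B i (x, pt l')), (fun l' p => lam l' (kk sigma p) * (db p)^-1); split.
- move=> i j; exists (tU sigma); split=> //; first exact: tU_open.
  apply: (reg_on_regular sX); first exact: tU_open.
  by have [AB _] := HB i; apply: coords_alg_reg cU (alg_gen_slice1 (pt j) AB).
- move=> j; exists (ov sigma `&` [set p | db p != 0]); split=> //.
  apply: (reg_on_regular sE) => //; apply: (reg_on_mul rE); last exact: reg_on_inv.
  by apply: reg_on_sub (regk _ (Klam j)) => p [].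
- move=> i; pose eta0 p := eta e0.1 (kk sigma p).
  have reta0 : @reg_on _ E (ov sigma) eta0.
    by apply: (reg_on_mul rE); apply: (regk (fun g => _ (e0.1, g))); apply: KGz; apply: alg_gen_slice2; eassumption.
  have oeta : @open E (ov sigma `&` [set p | eta0 p != 0]).
    by apply: (regular_open_nz rE (@ov_open sigma)); apply: (reg_on_regular sE) => //; apply: ov_open.
  have e0eta : (ov sigma `&` [set p | eta0 p != 0]) e0.
    split=> //=; rewrite /eta0 /eta mulf_neq0 //; [by move: hh0; rewrite EH|by move: db0; rewrite EDb].
  apply: filterS2 (open_nbhs_nbhs (conj oeta e0eta)) (open_nbhs_nbhs (conj oV (conj U0 db0))).
  move=> p [Up etap] [_ dbp]; apply: (mulfI dbp); rewrite Ebe //.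
  have [_ EB] := HB i; rewrite EB /=; have [_ _ EL] := HL i.
  transitivity (\sum_l' B i (p.1, pt l') * lam l' (kk sigma p)).
    under [RHS]eq_bigr do rewrite EL mulr_suml.
    rewrite EL exchange_big /=; apply: eq_bigr => j _.
    have := Emu (kk sigma p) etap (existT (fun i => 'I_(projT1 (L i))) i j); rewrite {1}/hI /= => ->.
    by rewrite mulr_sumr; apply: eq_bigr => l' _; rewrite /hI /= /lam; ring.
  by rewrite mulr_sumr; apply: eq_bigr => l' _; field.
move=> j; pose etaj x := eta x (pt j).
have retaj : reg_on (tU sigma) etaj.
  exact: (reg_on_mul rX (coords_alg_reg rX cU (alg_gen_slice1 (pt j) AH))
    (coords_alg_reg rX cU (alg_gen_slice1 (pt j) ADb))).
have oj : open (tU sigma `&` [set x | etaj x != 0]).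
  by apply: (regular_open_nz rX (@tU_open _ _ _ X sigma)); apply: (reg_on_regular sX) => //; apply: tU_open.
apply: filterS (open_nbhs_nbhs (conj oj (conj U0 (ptA j)))) => x [Ux nz].
pose p := mk sigma x (pt j); have kp : kk sigma p = pt j by rewrite kk_mkid.
have [Hnz Dnz] : H (x, pt j) != 0 /\ Db (x, pt j) != 0 by move: nz; rewrite /= mulf_eq0 negb_or => /andP[].
have hp : hh p != 0 by rewrite EH /= kp.
have dp : db p != 0 by rewrite EDb /= kp.
transitivity (db p * \sum_i a i p.1 * b i p); last by rewrite Ehh ?mulr0.
rewrite mulr_sumr; apply: eq_bigr => i _.
have [_ EB] := HB i; have := Ebe i p Ux dp; rewrite EB /= kp => <-.
by rewrite mulrCA.
Qed.

(** [V] is covered by principal open sets, each inside one chart, over which the total space is a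
    product. The fibre coordinates there extend over [V] after multiplication by a power of [h i].
    Together with the coordinates of the base these extensions satisfy the hypotheses of
    [coords_glue]. *)
Let glued_affine : @affine_morphism K E X fst.
Proof.
move=> V oV aff; have [m [y cy]] := affine_coords rX aff; have [l [z cz]] := group_coords G.
pose ovV : set E := [set p | V p.1].
pose S : set (X -> K) := [set h | alg_gen (range y) h /\ exists2 sigma, top sigma &
  forall q, V q -> h q != 0 -> tU sigma q].
have [q []//|q Vq|r [h [k [Sh Ak E1]]]] := @coords_partition _ _ _ _ y S cy.
  have [tj Uj] := jjP q; have [h [Ah hq Hh]] := coords_base cy (@tU_open _ _ _ X (jj q)) Vq Uj.
  by exists h => //; split=> //; exists (jj q).
have Ah i : alg_gen (range y) (h i) by case: (Sh i).
have /choice[sg Hsg] : forall i, exists sigma, top sigma /\ forall q, V q -> h i q != 0 -> tU sigma q.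
  by move=> i; have [_ [s ts Hs]] := Sh i; exists s.
pose Vi i := V `&` [set x | h i x != 0].
have oVi i : open (Vi i) by apply: (coords_alg_open rX oV cy).
have cVi i := coords_principal rX cy (Ah i).
have VU i : Vi i `<=` tU (sg i) by move=> x [Vx hx]; apply: (Hsg i).2.
have cE i := glued_coords (Hsg i).1 (fun _ H => H) (VU i) (cVi i) cz.
have regp f : alg_gen (range y) f -> @reg_on _ E ovV (fun p => f p.1).
  move=> Af; apply: (@morph_on_reg _ E ovV X V fst f sE) => //; last exact: coords_alg_reg cy Af.
  by apply: morph_on_sub m_proj.
have regext i j : exists NF : nat * (E -> K), reg_on ovV NF.2 /\
    forall p, ovV p -> h i p.1 != 0 -> NF.2 p = h i p.1 ^+ NF.1 * z j (kk (sg i) p).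
  have [|p Vp|i'|||N [F [rF EF]]] := @reg_extend K E ovV (fun p => h i p.1) (z j \o kk (sg i)) r
      (fun i => [set p | Vi i p.1]) rE.
  - by move=> i'; apply: preim_open.
  - apply: contrapT => /forallNP H.
    have := E1 p.1 Vp; rewrite big1 => [/esym/eqP|i' _]; first by rewrite oner_eq0.
    by apply/eqP; rewrite mulf_eq0; apply/orP; right; apply: contrapT => /negP nz; apply: (H i').
  - rewrite (_ : ovV `&` _ = [set p | Vi i' p.1]); first exact: (ex_intro _ _ (ex_intro _ _ (cE i'))).
    by apply/seteqP; split=> [p []//|p [Vp hp]].
  - exact: regp.
  - apply: morph_on_group_reg rE (morph_on_sub _ (morph_kk (Hsg i).1 (fun _ H => H))) _.
      by move=> p [Vp hp]; apply: (Hsg i).2.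
    by rewrite (coordinate_ringE cz); apply: alg_gen_range.
  by exists (N, F).
have /choice[NF HNF] : forall ij : 'I_r * 'I_l, exists NF : nat * (E -> K), reg_on ovV NF.2 /\
    forall p, ovV p -> h ij.1 p.1 != 0 -> NF.2 p = h ij.1 p.1 ^+ NF.1 * z ij.2 (kk (sg ij.1) p).
  by move=> [i j]; apply: regext.
pose wI (x : 'I_m + 'I_r * 'I_l) : E -> K :=
  match x with inl j => fun p => y j p.1 | inr ij => (NF ij).2 end.
pose w (k : 'I_#|{: 'I_m + 'I_r * 'I_l}|) := wI (enum_val k).
have wx (c : _ + _) : alg_gen (range w) (wI c) by apply: AlgGen; exists (enum_rank c); rewrite // /w enum_rankK.
have wy f : alg_gen (range y) f -> alg_gen (range w) (fun p => f p.1).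
  move=> Af; apply: (alg_gen_sub _ (alg_gen_postcomp (fst : E -> X) Af)) => _ [j _ <-].
  exact: (wx (inl j)).
apply: (@coords_affine _ E ovV _ w rE).
apply: (@coords_glue _ E ovV _ w r (fun i p => h i p.1) (fun i p => k i p.1) rE).
- move=> i; rewrite /w; case: (enum_val i) => [j|ij] /=; last by case: (HNF ij).
  exact/regp/alg_gen_range.
- by move=> i; apply: wy.
- by move=> i; apply: wy.
- by move=> p Vp; apply: E1.
move=> i; refine (ex_intro _ _ (ex_intro _ _ (conj (cE i) _))).
move=> j; rewrite /pair_fun /=; case: (fintype.split j) => j' /=.
  rewrite /snoc_fun; case: (unlift ord_max j') => [j''|].
    by exists 0%N, (fun p => y j'' p.1); split=> [|p _ _]; [apply: (wx (inl j''))|rewrite divr1].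
  by exists 1%N, (fun=> 1); split=> [|p _ _]; [apply: AlgCst|rewrite expr1 mul1r].
have [_ EF] := HNF (i, j'); exists (NF (i, j')).1, (NF (i, j')).2.
split=> [|p Vp hp]; first exact: (wx (inr (i, j'))).
by rewrite EF //= mulrC mulKf // expf_neq0.
Qed.

Let over_local (Y : space K) (Z : set Y) (Y' : space K) (F : Y -> Y') (f : Y -> E) : ringed Y ->
  morph_on Z f -> (forall sigma, top sigma -> morph_on (Z `&` [set y | ov sigma (f y)]) F) -> morph_on Z F.
Proof.
move=> rY mf H; apply: (morph_on_local (ringed_sheaf rY)) => y Zy.
have [tj Uj] := jjP (f y).1; have [W [oW Wy HW]] := (mf _ (@ov_open (jj (f y).1))).1 y Zy Uj.
by exists W; split=> //; apply: morph_on_sub (H _ tj) => y' [Zy' Wy']; split=> //; apply: HW.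
Qed.

Definition glued_ract (p : P) g : P := (p.1, gmul p.2 g).

Let kk_ract sigma (p : P) g : kk sigma (glued_ract p g) = gmul (kk sigma p) g.
Proof. by rewrite /kk /= gmulA. Qed.

Let rEG : ringed (product E G) := ringed_product sE sG.
Let rEE : ringed (product E E) := ringed_product sE sE.
Let rTE : ringed (product T E) := ringed_product sT sE.

Let glued_ract_morph : @is_morphism K (product E G) E (fun p => glued_ract p.1 p.2).
Proof.
have sEG := ringed_sheaf rEG; apply/(morph_onT _ sEG).
apply: (@over_local (product E G) setT E _ fst rEG); first exact: morph_on_fst.
move=> sigma ts; set Z := (X in morph_on X _).
have m1 : @morph_on _ (product E G) Z E fst by apply: morph_on_fst.
have m2 : @morph_on _ (product E G) Z G snd by apply: morph_on_snd.
have mf : @morph_on _ (product E G) Z X (fun p => p.1.1).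
  by apply: (@morph_on_comp _ (product E G) Z E setT X fst fst sEG m1).
have mk1 : @morph_on _ (product E G) Z G (fun p => kk sigma p.1).
  apply: (@morph_on_comp _ (product E G) Z E (ov sigma) G fst (kk sigma) sEG m1) => //; first by move=> p [].
  exact: (morph_kk ts (fun _ H => H)).
apply: morph_on_ext (morph_mk ts rEG mf _ (morph_gmul rEG mk1 m2)); last by move=> p [].
by move=> p _; rewrite -[RHS](mk_kk sigma) kk_ract.
Qed.

(** The formula is written in the chart picked by [jj]; by [kk_tact] it is the same in every chart
    of a top-dimensional cone. *)
Definition glued_tact t (p : P) : P :=
  mk (jj p.1) (toric_act t p.1) (gmul (chi (jj p.1) t) (kk (jj p.1) p)).

Let kk_tact sigma t (p : P) : top sigma -> tU sigma p.1 ->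
  kk sigma (glued_tact t p) = gmul (chi sigma t) (kk sigma p).
Proof.
move=> ts Up; have [tj Uj] := jjP p.1.
rewrite /glued_tact kk_mk //; [|exact: tU_act..].
by rewrite gamma_act // (kk_trans tj ts Uj Up) gmulA gmulgVK gmulA.
Qed.

Let kk_inj sigma (p q : P) : p.1 = q.1 -> kk sigma p = kk sigma q -> p = q.
Proof. by move=> e1 e2; rewrite -(mk_kk sigma p) -(mk_kk sigma q) e1 e2. Qed.

Let glued_tact_morph : @is_morphism K (product T E) E (fun p => glued_tact p.1 p.2).
Proof.
have sTE := ringed_sheaf rTE; apply/(morph_onT _ sTE).
apply: (@over_local (product T E) setT E _ snd rTE); first exact: morph_on_snd.
move=> sigma ts; set Z := (X in morph_on X _).
have m1 : @morph_on _ (product T E) Z T fst by apply: morph_on_fst.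
have m2 : @morph_on _ (product T E) Z E snd by apply: morph_on_snd.
have mf : @morph_on _ (product T E) Z X (fun p => p.2.1).
  by apply: (@morph_on_comp _ (product T E) Z E setT X snd fst sTE m2).
have mtf : @morph_on _ (product T E) Z X (fun p => toric_act p.1 p.2.1).
  have mp := morph_on_pair rTE sT sX m1 mf.
  apply: (@morph_on_comp _ (product T E) Z (product T X) (setT `*` tU sigma) X _
    (fun p => toric_act p.1 p.2) sTE mp); last exact: morph_act.
  by move=> p [].
have mk1 : @morph_on _ (product T E) Z G (fun p => kk sigma p.2).
  apply: (@morph_on_comp _ (product T E) Z E (ov sigma) G snd (kk sigma) sTE m2) => //; first by move=> p [].
  exact: (morph_kk ts (fun _ H => H)).
have mc : @morph_on _ (product T E) Z G (fun p => chi sigma p.1).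
  by apply: (@morph_on_comp _ (product T E) Z T setT G fst (chi sigma) sTE m1) => //; case: (chi_hom ts).
apply: morph_on_ext (morph_mk ts rTE mtf _ (morph_gmul rTE mc mk1)); last by move=> p [_ Up]; apply: tU_act.
by move=> p [_ Up]; rewrite -[RHS](mk_kk sigma) kk_tact.
Qed.

Let glued_torsor : @is_iso_onto K (product E G) (product E E)
    [set p | p.1.1 = p.2.1] (fun p => (p.1, glued_ract p.1 p.2)).
Proof.
have sEG := ringed_sheaf rEG; have sEE := ringed_sheaf rEE.
have mF : @is_morphism K (product E G) (product E E) (fun p => (p.1, glued_ract p.1 p.2)).
  apply/(morph_onT _ sEG); apply: (morph_on_pair rEG sE sE); first exact: morph_on_fst.
  exact/(morph_onT _ sEG)/glued_ract_morph.
split=> //.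
  split=> [p _|p q _ _ pq|[p q] /= pq] //.
    have e1 : p.1 = q.1 := congr1 (fun r : P * P => r.1) pq.
    have := congr1 (fun r : P * P => r.2.2) pq; rewrite /= e1 => /gmulgI e2.
    by rewrite (surjective_pairing p) (surjective_pairing q) e1 e2.
  exists (p, gmul (ginv p.2) q.2) => //=.
  by rewrite /glued_ract gmulVKg pq -surjective_pairing.
pose D := [set p : product E E | p.1.1 = p.2.1].
have sD : is_sheaf (subspace_of (product E E) D) by apply: sub_sheaf.
(* The transition functions act on the left and cancel in [g^-1 h], so the division map can be
   computed in the fibre coordinates of any chart. *)
have md : @morph_on _ (product E E) D G (fun p => gmul (ginv p.1.2) p.2.2).
  apply: (@over_local (product E E) D G _ fst rEE); first exact: morph_on_fst.
  move=> sigma ts; set Z := (X in morph_on X _).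
  have m1 : @morph_on _ (product E E) Z G (fun p => kk sigma p.1).
    apply: (@morph_on_comp _ (product E E) Z E (ov sigma) G fst (kk sigma) sEE) => //; first exact: morph_on_fst.
      by move=> p [].
    exact: (morph_kk ts (fun _ H => H)).
  have m2 : @morph_on _ (product E E) Z G (fun p => kk sigma p.2).
    apply: (@morph_on_comp _ (product E E) Z E (ov sigma) G snd (kk sigma) sEE) => //; first exact: morph_on_snd.
      by move=> p [Dp Up]; rewrite /ov /= -Dp.
    exact: (morph_kk ts (fun _ H => H)).
  apply: morph_on_ext (morph_gmul rEE (morph_ginv rEE m1) m2) => p [Dp _].
  by rewrite /kk -Dp ginvM ginvK gmulA gmulgK.
exists (fun p => ((val p).1, gmul (ginv (val p).1.2) (val p).2.2)); split; last first.
  move=> p /=; have := valP p; rewrite in_setE /= => Dp.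
  rewrite /glued_ract /= gmulVKg Dp -surjective_pairing; exact/esym/surjective_pairing.
apply/(morph_onT _ sD).
have mp := morph_on_pair rEE sE sG (@morph_on_fst _ E E D rE rE) md.
have vD (p : subspace_of (product E E) D) : setT p -> D (val p) by have := valP p; rewrite in_setE.
exact (@morph_on_comp _ _ _ _ _ _ _ _ sD (@morph_on_val _ (product E E) D setT) vD mp).
Qed.

Lemma glued_bundle_exists : exists (B : principal_bundle X G) (e1 : B), proj e1 = xorb torus_one /\
  forall sigma, top sigma -> exists s, frame fanS e1 sigma (chi sigma) s.
Proof.
have top_tact t (p q : P) : p.1 = toric_act t q.1 -> kk (jj q.1) p = gmul (chi (jj q.1) t) (kk (jj q.1) q) ->
    glued_tact t q = p.
  move=> e1 e2; have [tj Uj] := jjP q.1; apply: (@kk_inj (jj q.1)) => //.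
  by rewrite kk_tact.
have mfst : @is_morphism K E X fst by apply/(morph_onT _ sE).
have surj x : exists p : E, p.1 = x by exists (x, gone).
have r1 (p : P) : glued_ract p gone = p by rewrite /glued_ract gmulg1 -surjective_pairing.
have rM (p : P) g h : glued_ract p (gmul g h) = glued_ract (glued_ract p g) h by rewrite /glued_ract gmulA.
have t1 (p : P) : glued_tact torus_one p = p.
  have [tj Uj] := jjP p.1; apply: top_tact; first by rewrite toric_act1.
  by rewrite torus_hom1 ?gmul1g //; apply: chi_hom.
have tM s t (p : P) : glued_tact (torus_mul s t) p = glued_tact s (glued_tact t p).
  have [tj Uj] := jjP p.1; apply: top_tact; first by rewrite toric_actM.
  have [_ hM] := chi_hom tj.
  by rewrite !kk_tact //; [rewrite hM gmulA|apply: tU_act].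
have pt t (p : P) : (glued_tact t p).1 = toric_act t p.1 by [].
have tr t (p : P) g : glued_tact t (glued_ract p g) = glued_ract (glued_tact t p) g.
  have [tj Uj] := jjP p.1; apply: top_tact => //.
  by rewrite !kk_ract kk_tact // gmulA.
pose B := @PrincipalBundle K n Sigma X G E glued_variety fst glued_ract glued_tact mfst surj
  glued_flat glued_affine glued_ract_morph r1 rM (fun _ _ => erefl) glued_torsor glued_tact_morph
  t1 tM pt tr.
exists B, (xorb torus_one, gone); split=> // sigma ts.
exists (fun x => mk sigma x gone); split=> //.
- exact: chi_hom.
- apply: (morph_mk ts rX (@morph_on_id _ X _)) => //.
  exact: morph_cst.
- move=> t x Ux; apply: (@kk_inj sigma) => //.
  have Utx := tU_act t Ux; rewrite kk_mkid // [ract _ _]/(glued_ract _ _) kk_ract kk_tact //.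
  by rewrite kk_mkid // gmulg1 gmulgV.
have [tj Uj] := jjP (xorb torus_one).
have [_ Eg] := gammaP ts tj; rewrite /mk /cc Eg gmulg1.
by rewrite !torus_hom1 ?ginv1 ?gmul1g //; apply: chi_hom.
Qed.

End GluedBundle.

(** * Essential surjectivity *)

Section EssentialSurjectivity.
Variables (K : closedFieldType) (n : nat).
Hypothesis hK : [pchar K] =i pred0.
Local Notation N := 'rV[int]_n.
Local Notation M := 'cV[int]_n.
Local Notation T := (torus K n).
Variable Sigma : set (set N).
Hypothesis fanS : is_fan Sigma.
Hypothesis hmax : forall sigma, maximal_cone Sigma sigma -> top_dimensional sigma.
Variable X : toric_variety K Sigma.
Variable G : alg_group K.
Local Notation KG := (@coordinate_ring K G).
Local Notation R := (coordinate_algebra G).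

Lemma calg_iso (A B : calg Sigma G) (f : A -> B) : calg_map f ->
  exists (u : calg_hom A B) (v : calg_hom B A), calg_comp u v = calg_id B /\ calg_comp v u = calg_id A.
Proof.
move=> cf; have [ff gf [h [fh fK hK']]] := cf.
have ch : calg_map h.
  split=> //; last by exists f.
  by move=> g b; rewrite -[b in LHS]hK' -gf fK.
exists (exist _ f cf), (exist _ h ch); split; apply: eq_exist; apply/funext => b /=; [exact: hK'|exact: fK].
Qed.

Variable B : calg Sigma G.
Variable phi : B -> G -> K.
Hypothesis phi_lin : forall k a b x, phi (k *: a + b) x = k * phi a x + phi b x.
Hypothesis phi1 : forall x, phi 1 x = 1.
Hypothesis phiM : forall a b x, phi (a * b) x = phi a x * phi b x.
Hypothesis phi_bij : set_bij setT KG phi.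
Hypothesis phi_act : forall g b x, phi (gact g b) x = phi b (gmul x g).

Let phi_KG b : KG (phi b). Proof. by case: phi_bij => H _ _; apply: H. Qed.
Let phi_inj : injective phi.
Proof. by case: phi_bij => _ H _ a b E; apply: H => //; rewrite in_setE. Qed.
Let phi_surj f : KG f -> exists b, phi b = f.
Proof. by case: phi_bij => _ _ H /H[b _ <-]; exists b. Qed.
Let phi0 x : phi 0 x = 0.
Proof. by have := phi_lin (-1) 0 0 x; rewrite scaleN1r oppr0 addr0 mulN1r addNr. Qed.
Let phiD a b x : phi (a + b) x = phi a x + phi b x.
Proof. by have := phi_lin 1 a b x; rewrite scale1r mul1r. Qed.
Let phiZ k a x : phi (k *: a) x = k * phi a x.
Proof. by have := phi_lin k a 0 x; rewrite !addr0 phi0 addr0. Qed.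
Let phi_sum r (d : 'I_r -> B) x : phi (\sum_j d j) x = \sum_j phi (d j) x.
Proof. by elim/big_rec2: _ => // i y b _ <-; rewrite phiD. Qed.

Let psi_ex (f : R) : exists b, phi b = sval f := phi_surj (svalP f).
Let psi f : B := projT1 (cid (psi_ex f)).
Let psiK f : phi (psi f) = sval f := projT2 (cid (psi_ex f)).

(** The torus action commutes with right translations, so [t] acts as left translation by some
    [c t]. Since [c] reverses products, its inverse is the homomorphism. It is regular because, by
    the weight decomposition, the functions on it are combinations of characters. *)
Lemma calg_torus_hom sigma : Sigma sigma -> top_dimensional sigma -> exists chi : T -> G,
  torus_hom chi /\ forall (rho : ray_generators Sigma) i b, sigma (val rho) ->
    filt rho i b <-> weight_filt chi (val rho) i (phi b).
Proof.
move=> Ss htop; have [tau [[tau1 tauM tau_alg dec] tauG]] := @calg_torus _ _ _ _ B _ Ss htop.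
have [[sD _] genD _ filtD _] := dec.
have tauD t a b : tau t (a + b) = tau t a + tau t b.
  by have [lin _] := tau_alg t; have := lin 1 a b; rewrite !scale1r.
have tauZ t k a : tau t (k *: a) = k *: tau t a.
  have [lin _] := tau_alg t; have := lin k a 0; rewrite !addr0 => ->.
  by have := lin (-1) 0 0; rewrite !scaleN1r !addNr => ->; rewrite addr0.
have tau_1 t : tau t 1 = 1 by have [_ []] := tau_alg t.
have tau_M t a b : tau t (a * b) = tau t a * tau t b by have [_ []] := tau_alg t.
have /choice[c Ec] : forall t, exists c, forall b, phi (tau t b) = fun g => phi b (gmul c g).
  move=> t; pose ph (f : G -> K) : G -> K := if pselect (KG f) is left Kf then phi (tau t (psi (exist _ f Kf))) else 0.
  have phE b : ph (phi b) = phi (tau t b).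
    rewrite /ph; case: pselect => [Kb|[]]; last exact: phi_KG.
    by congr (phi (tau t _)); apply: phi_inj; rewrite psiK.
  have [k|f h Kf Kh|f h Kf Kh|f h Kf|c Ec] := @coordinate_ring_endo K G ph.
  - rewrite (_ : (fun=> k) = phi (k *: 1)); last by apply/funext => x; rewrite phiZ phi1 mulr1.
    by rewrite phE tauZ tau_1.
  - have [[a <-] [b <-]] := (phi_surj Kf, phi_surj Kh).
    rewrite (_ : phi a + phi b = phi (a + b)); last by apply/funext => x; rewrite phiD.
    by rewrite !phE tauD; apply/funext => x; rewrite phiD.
  - have [[a <-] [b <-]] := (phi_surj Kf, phi_surj Kh).
    rewrite (_ : phi a * phi b = phi (a * b)); last by apply/funext => x; rewrite phiM.
    by rewrite !phE tau_M; apply/funext => x; rewrite phiM.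
  - have [a <-] := phi_surj Kf.
    rewrite (_ : (fun g => phi a (gmul g h)) = phi (gact h a)); last by apply/funext => x; rewrite phi_act.
    by rewrite !phE tauG; apply/funext => x; rewrite phi_act.
  by exists c => b; rewrite -phE Ec //; apply: phi_KG.
have cM s t : c (torus_mul s t) = gmul (c t) (c s).
  apply: coordinate_ring_sep => f /phi_surj[b <-].
  have := congr1 (fun f => f gone) (Ec (torus_mul s t) b); rewrite tauM !Ec /= !gmulg1 => <-.
  by [].
have weightD u b : (forall t, tau t b = character u t *: b) <-> weight_space (fun t => ginv (c t)) u (phi b).
  split=> [H|[_ H] t].
    split=> // t g; rewrite ginvK -[LHS]/((fun g => phi b (gmul (c t) g)) g) -Ec H phiZ.
    by [].
  by apply: phi_inj; apply/funext => g; rewrite Ec phiZ -H ginvK.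
exists (fun t => ginv (c t)); split.
  split=> [|s t]; last by rewrite cM ginvM.
  have rT := ringed_torus K n; apply: morph_ginv => //; apply: (morph_on_group rT) => f /phi_surj[b <-].
  have : sum_of (fun u => [set b | forall t, tau t b = character u t *: b]) setT b by rewrite genD.
  move=> [r [u [d [Hd Eb]]]].
  apply: (@reg_on_ext _ T _ (fun t => \sum_j phi (d j) gone * character (u j) t)).
    move=> t _ /=; rewrite Eb phi_sum; apply: eq_bigr => j _.
    have [_ Hj] := Hd j; have := congr1 (fun f => f gone) (Ec t (d j)); rewrite Hj gmulg1 => <-.
    by rewrite phiZ mulrC.
  apply: (reg_on_alg rT (S := [set h | reg_on setT h])) => //.
  apply: alg_gen_sum => j _; apply: AlgMul; first exact: AlgCst.
  by apply: AlgGen; apply: reg_character.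
move=> rho i b srho; rewrite filtD //; split=> [[r [u [d [Hd ->]]]]|[r [u [h [Hh Eb]]]]].
  exists r, u, (fun j => phi (d j)); split=> [j|g]; last exact: phi_sum.
  by have [iu Hj] := Hd j; split=> //; apply/weightD.
have /choice[d Hd] : forall j, exists d, phi d = h j by move=> j; have [[Kh _] _] := Hh j; apply: phi_surj.
exists r, u, d; split=> [j|]; last by apply: phi_inj; apply/funext => g; rewrite Eb phi_sum; apply: eq_bigr => j _; rewrite Hd.
by have [wh iu] := Hh j; split=> //; apply/weightD; rewrite Hd.
Qed.

Lemma bundle_of_calg : exists (E : principal_bundle X G) (u : calg_hom (balg hK hmax (baseP fanS E)) B)
    (v : calg_hom B (balg hK hmax (baseP fanS E))),
  calg_comp u v = calg_id B /\ calg_comp v u = calg_id _.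
Proof.
have /choice[chi Hchi] : forall sigma : Sigma, exists chi : T -> G, top_dimensional (val sigma) ->
    torus_hom chi /\ forall (rho : ray_generators Sigma) i b, val sigma (val rho) ->
      filt rho i b <-> weight_filt chi (val rho) i (phi b).
  move=> sigma; have [htop|] := pselect (top_dimensional (val sigma)); last by exists (fun=> gone).
  by have [chi H] := calg_torus_hom (fcone_mem sigma) htop; exists chi.
have [sigma htop|s1 s2 rho i f t1 t2 rr sr1 sr2 Kf|E [e1 [pe1 fr]]] := glued_bundle_exists hK fanS hmax X (chi := chi).
- by case: (Hchi sigma htop).
- have [b <-] := phi_surj Kf; pose rh : ray_generators Sigma := SigSub (mem_set rr).
  have [_ H1] := Hchi _ t1; have [_ H2] := Hchi _ t2.
  by move=> /(H1 rh i b sr1) /(H2 rh i b sr2).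
exists E.
have filtE (rho : ray_generators Sigma) i (f : R) : balg_filt e1 rho i f <-> filt rho i (psi f).
  have [sigma [Ss smax] rs] := fan_maximal fanS (ray_cone_axiom rho).
  have htop := hmax (conj Ss smax); have srho : sigma (val rho) by apply: rs; exists 1%N.
  have [s fs] := fr (fcone Ss) htop; have [_ H] := Hchi (fcone Ss) htop.
  rewrite (H rho i (psi f) srho) psiK; exact: (bundle_filtP hK fs i _ srho).
have psiE f b : psi f = b <-> sval f = phi b.
  by split=> [<-|E0]; [rewrite psiK|apply: phi_inj; rewrite psiK].
have cpsi : calg_map (psi : balg hK hmax pe1 -> B).
  split.
  - split=> [|rho i f Hf]; last exact/filtE.
    split=> [k a b|]; first by apply/psiE/funext => x; rewrite phi_lin !psiK.
    by split=> [|a b]; apply/psiE/funext => x; rewrite ?phi1 ?phiM ?psiK.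
  - by move=> g f; apply/psiE/funext => x; rewrite phi_act psiK.
  exists (fun b => exist _ (phi b) (phi_KG b)); split.
  - split=> [|rho i b Hb]; last first.
      by apply/filtE; rewrite (_ : psi _ = b) //; apply/psiE.
    by split=> [k a b|]; [apply: cring_ext => x; apply: phi_lin|split=> [|a b]; apply: cring_ext => x; rewrite /= ?phi1 ?phiM].
  - by move=> f; apply: cring_ext => x /=; rewrite psiK.
  by move=> b; apply/psiE.
(* The glued bundle comes with its own point [e1], while the functor uses the chosen one. The
   identity map, read from one point to the other, provides the left translation between the two
   algebras. *)
have [g Eg] := orbit_point (e := base fanS E) pe1 (baseP fanS E).
rewrite tact1 in Eg.
have cl := ltrans_calg hK hmax (baseP fanS E) pe1 (f := @id E) (bundle_map_id E) Eg.
exact: calg_iso (calg_map_comp cpsi cl).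
Qed.

End EssentialSurjectivity.

Theorem theorem6p6 (K : closedFieldType) (hK : [pchar K]%R =i pred0)
  (n : nat) (Sigma : set (set 'rV[int]_n)) (hSigma : is_fan Sigma)
  (hmax : forall sigma, maximal_cone Sigma sigma -> top_dimensional sigma)
  (X : toric_variety K Sigma) (G : alg_group K) (hG : reductive G) :
  equivalent_categories (Pbun X G) (Calg Sigma G).
Proof.
apply: (equivalence_of_full_faithful (F := bundle_functor hK hSigma hmax X G)).
- by move=> E E' f f'; apply: bundle_functor_faithful.
- by move=> E E' h; apply: bundle_functor_full.
move=> B; have [phi [lin one mul bij act]] := gact_translation B.
exact: (bundle_of_calg hK hSigma hmax X lin one mul bij act).
Qed.
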